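(* Assume the setting of the context, with constant background coefficients $\epsilon_0>0$, $\mu_0>0$, $\sigma_0\ge 0$. (i) If $T<2\sqrt{\mu_0\epsilon_0}\,\mathrm{dist}(D,B)$, then $\displaystyle\lim_{\tau\to\infty}e^{\tau T}I(\tau)=0$. (ii) Suppose that $f$ satisfies: there exists $\gamma\in\mathbb R$ with $\liminf_{\tau\to\infty}\tau^\gamma|\tilde f(\tau)|>0$. Assume that $\partial D$ is $C^2$ and that one of the conditions (B.I), (B.II), (B.III) of the context is satisfied. Then $$\lim_{\tau\to\infty}e^{\tau T}I(\tau)=\begin{cases}-\infty,&\text{if }T>2\sqrt{\mu_0\epsilon_0}\,\mathrm{dist}(D,B)\text{ and (A.I) is satisfied},\\ \infty,&\text{if }T>2\sqrt{\mu_0\epsilon_0}\,\mathrm{dist}(D,B)\text{ and (A.II) is satisfied}.\end{cases}$$ Moreover, if one of (A.I) or (A.II) is satisfied, then for all $T>2\sqrt{\mu_0\epsilon_0}\,\mathrm{dist}(D,B)$, $$\lim_{\tau\to\infty}\frac1\tau\log|I(\tau)|=-2\sqrt{\mu_0\epsilon_0}\,\mathrm{dist}(D,B).$$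
   Context: Coefficients: $\epsilon_0>0$, $\mu_0>0$, $\sigma_0\ge0$ are constants. $\epsilon,\mu,\sigma$ are real-valued essentially bounded functions on $\mathbb R^3$ such that $\epsilon,\mu$ have strictly positive essential infimum and $\sigma\ge 0$ a.e. $D\subset\mathbb R^3$ is a nonempty bounded open set with $\mathbb R^3\setminus\overline D$ connected, and $\epsilon=\epsilon_0$, $\mu=\mu_0$, $\sigma=\sigma_0$ a.e. on $\mathbb R^3\setminus D$. Put $\epsilon_r=\epsilon/\epsilon_0$, $\mu_r=\mu/\mu_0$. Source: $B$ is the open ball with center $p$ and radius $\eta>0$, with $\overline B\cap\overline D=\emptyset$; $\boldsymbol a\in\mathbb R^3$ is a constant unit vector; $0<T<\infty$; $f\in H^1(0,T)$ is real-valued with $f(0)=0$; $\boldsymbol J(x,t)=f(t)\chi_B(x)\boldsymbol a$, where $\chi_B$ is the characteristic function of $B$. $\mathrm{dist}(D,B)=\inf_{x\in D,y\in B}|x-y|$. Fields: $(\boldsymbol E,\boldsymbol H)$ is the solution on $\mathbb R^3\times\,]0,T[$ of $$\epsilon\,\partial_t\boldsymbol E-\nabla\times\boldsymbol H=-\sigma\boldsymbol E+\boldsymbol J,\quad \mu\,\partial_t\boldsymbol H+\nabla\times\boldsymbol E=\boldsymbol 0,\quad \boldsymbol E|_{t=0}=\boldsymbol H|_{t=0}=\boldsymbol 0,$$ and $(\boldsymbol E_0,\boldsymbol H_0)$ is the solution of the same system with $(\epsilon,\mu,\sigma)$ replaced by $(\epsilon_0,\mu_0,\sigma_0)$ (same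 $\boldsymbol J$). Solutions are understood in the class $C^1([0,T];L^2(\mathbb R^3)^3)\cap C([0,T];H(\mathrm{curl};\mathbb R^3))$ for each of the two fields. For $\tau>0$: $\boldsymbol W_e=\int_0^Te^{-\tau t}\boldsymbol E(\cdot,t)\,dt$, $\boldsymbol V_e=\int_0^Te^{-\tau t}\boldsymbol E_0(\cdot,t)\,dt$, $\tilde f(\tau)=\int_0^Te^{-\tau t}f(t)\,dt$, $\boldsymbol f(x,\tau)=\tilde f(\tau)\chi_B(x)\boldsymbol a$, and the indicator function is $I(\tau)=\int_{\mathbb R^3}\boldsymbol f\cdot(\boldsymbol W_e-\boldsymbol V_e)\,dx$. Jump conditions: (A.I) there is a constant $C_1>0$ with $\left(1-\frac1{\epsilon_r(x)}\right)+(1-\mu_r(x))\ge C_1$ for a.e. $x\in D$. (A.II) there is a constant $C_2>0$ with $(1-\epsilon_r(x))+\left(1-\frac1{\mu_r(x)}\right)\ge C_2$ for a.e. $x\in D$. Geometric conditions (for $\partial D$ of class $C^2$): $\boldsymbol\nu_q$ is the unit outer normal to $\partial D$ at $q\in\partial D$. $S(p,\partial D)=\{x\in\mathbb R^3: |x-p|=\mathrm{dist}(\{p\},\partial D)\}$. The first reflector from $p$ is the set $\partial D\cap S(p,\partial D)$. At a point $q$ of the first reflector, $\boldsymbol\nu_q$ is also the inner unit normal of the sphere $S(p,\partial D)$, and both surfaces have the same tangent plane there; $\boldsymbol S_q(\partial D)$ and $\boldsymbol S_q(S(p,\partial D))$ denote the shape operators at $q$ of $\partial D$ and of $S(p,\partial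 D)$, both with respect to $\boldsymbol\nu_q$, acting on the common tangent space. $K_{\partial D}(q)$ is the Gauss curvature of $\partial D$ at $q$. (B.I) The first reflector from $p$ is finite and $K_{\partial D}(q)>0$ at each of its points $q$. (B.II) The first reflector from $p$ is finite and $\det(\boldsymbol S_q(S(p,\partial D))-\boldsymbol S_q(\partial D))>0$ at each of its points $q$. (B.III) There is a point $q$ in the first reflector from $p$ with $\boldsymbol a\times\boldsymbol\nu_q\ne\boldsymbol 0$. *)

(* Defs.v *)
From HB Require Import structures.
From mathcomp Require Import all_boot all_order all_algebra.
From mathcomp Require Import all_classical all_reals all_analysis.

Set Implicit Arguments.
Unset Strict Implicit.
Unset Printing Implicit Defensive.

Import Order.TTheory GRing.Theory Num.Theory.
Import numFieldNormedType.Exports.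

Local Open Scope classical_set_scope.
Local Open Scope ring_scope.

(* The canonical norm `|x| of 'rV[R]_n is the max norm, so the Euclidean norm
   is defined here; the two induce the same topology. *)
Definition dotv (R : realType) n (u v : 'rV[R]_n) : R := (u *m v^T) 0 0.
Definition enorm (R : realType) n (u : 'rV[R]_n) : R := Num.sqrt (dotv u u).
Definition eball (R : realType) n (p : 'rV[R]_n) (r : R) : set 'rV[R]_n :=
  [set x | enorm (x - p) < r].

(* Indices of 'I_3 are added modulo 3 (also in curl). *)
Definition crossv (R : realType) (u v : 'rV[R]_3) : 'rV[R]_3 :=
  \row_i (u 0 (i + 1) * v 0 (i + 2) - u 0 (i + 2) * v 0 (i + 1)).

Definition setdist (R : realType) n (A B : set 'rV[R]_n) : R :=
  inf [set enorm (x - y) | x in A & y in B].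

Definition bdry (R : realType) n (D : set 'rV[R]_n) : set 'rV[R]_n :=
  closure D `\` interior D.

Definition rV_display : measure_display. Proof. exact: default_measure_display. Qed.

Section measurable_rV.
Context (R : realType) (n : nat).

Let coors : 'I_n -> 'rV[R]_n -> R := fun i x => x 0 i.

Let rV_set0 : g_sigma_preimage coors set0.
Proof. exact: sigma_algebra0. Qed.

Let rV_setC A : g_sigma_preimage coors A -> g_sigma_preimage coors (~` A).
Proof. exact: sigma_algebraC. Qed.

Let rV_bigcup (F : _^nat) : (forall i, g_sigma_preimage coors (F i)) ->
  g_sigma_preimage coors (\bigcup_i (F i)).
Proof. exact: sigma_algebra_bigcup. Qed.

HB.instance Definition _ := @isMeasurable.Build rV_display
  'rV[R]_n (g_sigma_preimage coors) rV_set0 rV_setC rV_bigcup.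

End measurable_rV.

Definition vec3 (R : realType) (x : R * R * R) : 'rV[R]_3 :=
  \row_(i < 3) [:: x.1.1; x.1.2; x.2]`_i.

Lemma measurable_vec3 (R : realType) : measurable_fun setT (@vec3 R).
Proof.
apply: (@measurability _ _ _ _ _ _
  (\big[setU/set0]_(i < 3) preimage_set_system setT
     (fun x : 'rV[R]_3 => x 0 i) measurable)) => //.
move=> _ [A + <-]; rewrite -bigcup_seq => -[i _ [B mB <-]].
rewrite !setTI -comp_preimage.
suff mi : measurable_fun setT ((fun x : 'rV[R]_3 => x 0 i) \o @vec3 R).
  by rewrite -[X in measurable X]setTI; exact: mi.
suff : forall k, measurable_fun setT (fun y : R * R * R =>
  [:: y.1.1; y.1.2; y.2]`_k).
  by move=> /(_ i); apply: eq_measurable_fun => y _ /=; rewrite mxE.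
move=> [|[|[|k]]] /=.
- exact: measurableT_comp.
- exact: measurableT_comp.
- exact: measurable_snd.
- by rewrite nth_nil; exact: measurable_cst.
Qed.

Section leb3.
Context (R : realType).
Local Open Scope ereal_scope.

Let leb := @lebesgue_measure R.

Definition leb3 : set 'rV[R]_3 -> \bar R :=
  pushforward ((leb \x leb) \x leb) (@vec3 R).

Let leb30 : leb3 set0 = 0.
Proof. by rewrite /leb3 /pushforward preimage_set0 measure0. Qed.

Let leb3_ge0 A : 0 <= leb3 A.
Proof. by rewrite /leb3 /pushforward; exact: measure_ge0. Qed.

Let leb3_sigma_additive : semi_sigma_additive leb3.
Proof.
move=> F mF tF mUF; rewrite /leb3 /pushforward preimage_bigcup.
apply: measure_semi_sigma_additive.
- by move=> n; rewrite -[X in measurable X]setTI; exact: measurable_vec3.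
- apply/trivIsetP => /= i j _ _ ij; rewrite -preimage_setI.
  by move/trivIsetP : tF => /(_ _ _ _ _ ij) ->//; rewrite preimage_set0.
- by rewrite -preimage_bigcup -[X in measurable X]setTI; exact: measurable_vec3.
Qed.

HB.instance Definition _ := isMeasure.Build _ _ _ leb3
  leb30 leb3_ge0 leb3_sigma_additive.

End leb3.
Arguments leb3 {R}.

Definition partial (R : realType) n (i : 'I_n) (g : 'rV[R]_n -> R) :
    'rV[R]_n -> R :=
  fun x => 'D_(delta_mx 0 i) g x.

Fixpoint Ck (R : realType) n (k : nat) (g : 'rV[R]_n -> R) : Prop :=
  match k with
  | 0 => continuous g
  | k'.+1 => continuous g /\
      forall i, (forall x, derivable g x (delta_mx 0 i)) /\ Ck k' (partial i g)
  end.

Definition test_field (R : realType) (phi : 'rV[R]_3 -> 'rV[R]_3) : Prop :=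
  (forall k i, Ck k (fun x => phi x 0 i)) /\
  compact (closure [set x | phi x != 0]).

Definition curl (R : realType) (phi : 'rV[R]_3 -> 'rV[R]_3)
    (x : 'rV[R]_3) : 'rV[R]_3 :=
  \row_i (partial (i + 1) (fun y => phi y 0 (i + 2)) x
          - partial (i + 2) (fun y => phi y 0 (i + 1)) x).

Definition L2field (R : realType) (u : 'rV[R]_3 -> 'rV[R]_3) : Prop :=
  forall i, (fun x => u x 0 i) \in Lfun leb3 2%:E.

Definition L2norm (R : realType) (u : 'rV[R]_3 -> 'rV[R]_3) : \bar R :=
  Lnorm leb3 2%:E (fun x => (enorm (u x))%:E).

(* u and c are square integrable and c is the distributional curl of u, i.e.
   u belongs to H(curl; R^3). *)
Definition weak_curl (R : realType) (u c : 'rV[R]_3 -> 'rV[R]_3) : Prop :=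
  [/\ L2field u, L2field c &
      forall phi, test_field phi ->
        \int[leb3]_x dotv (u x) (curl phi x) =
        \int[leb3]_x dotv (c x) (phi x)].

(* Below, a field u : R -> 'rV[R]_3 -> 'rV[R]_3 is a family of representatives
   u t of elements of L^2(R^3)^3; only the values t in [0, T] matter. *)

Definition L2_C0 (R : realType) (T : R)
    (u : R -> 'rV[R]_3 -> 'rV[R]_3) : Prop :=
  forall t, t \in `[0, T] ->
    L2field (u t) /\
    L2norm (fun x => u s x - u t x) @[s --> within `[0, T] (nbhs t)] --> 0%E.

Definition L2_C1 (R : realType) (T : R)
    (u u' : R -> 'rV[R]_3 -> 'rV[R]_3) : Prop :=
  [/\ L2_C0 T u, L2_C0 T u' &
      forall t, t \in `[0, T] ->
        L2norm (fun x => (s - t)^-1 *: (u s x - u t x) - u' t x)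
          @[s --> within `[0, T] t^'] --> 0%E].

Definition Hcurl_C0 (R : realType) (T : R)
    (u c : R -> 'rV[R]_3 -> 'rV[R]_3) : Prop :=
  [/\ L2_C0 T u, L2_C0 T c & forall t, t \in `[0, T] -> weak_curl (u t) (c t)].

(* Every element of C([0, T]; L^2) has a representative which is measurable in
   (t, x); fixing such a representative lets the L^2-valued integral over
   [0, T] be computed pointwise in x (see laplaceT). *)
Definition jointly_measurable (R : realType) (T : R)
    (u : R -> 'rV[R]_3 -> 'rV[R]_3) : Prop :=
  forall i, measurable_fun (`[0, T]%classic `*` setT)
    (fun tx : R * 'rV[R]_3 => u tx.1 tx.2 0 i).

Definition maxwell_solution (R : realType) (T : R)
    (eps mu sigma : 'rV[R]_3 -> R) (J E H : R -> 'rV[R]_3 -> 'rV[R]_3) : Prop :=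
  jointly_measurable T E /\ jointly_measurable T H /\
  exists E' H' cE cH : R -> 'rV[R]_3 -> 'rV[R]_3,
    [/\ L2_C1 T E E', L2_C1 T H H', Hcurl_C0 T E cE, Hcurl_C0 T H cH &
    [/\ forall t, t \in `]0, T[ -> {ae leb3, forall x,
          eps x *: E' t x - cH t x = - (sigma x *: E t x) + J t x},
        forall t, t \in `]0, T[ -> {ae leb3, forall x,
          mu x *: H' t x + cE t x = 0},
        {ae leb3, forall x, E 0 x = 0} &
        {ae leb3, forall x, H 0 x = 0}]].

Definition L2_interval (R : realType) (T : R) (f : R -> R) : Prop :=
  measurable_fun `]0, T[%classic f /\
  lebesgue_measure.-integrable `]0, T[%classic (fun t => ((f t) ^+ 2)%:E).

Definition test_function (R : realType) (T : R) (phi : R -> R) : Prop :=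
  (forall n t, derivable (derive1n n phi) t 1) /\
  exists a b, [/\ 0 < a, b < T & forall t, t \notin `[a, b] -> phi t = 0].

(* f is the continuous representative on [0, T] of an element of H^1(0, T). *)
Definition H1_interval (R : realType) (T : R) (f : R -> R) : Prop :=
  [/\ {within `[0, T]%classic, continuous f}, L2_interval T f &
      exists2 g, L2_interval T g &
        forall phi, test_function T phi ->
          \int[lebesgue_measure]_(t in `]0, T[) (f t * derive1 phi t) =
          - \int[lebesgue_measure]_(t in `]0, T[) (g t * phi t)].

Definition source (R : realType) (f : R -> R) (B : set 'rV[R]_3)
    (a : 'rV[R]_3) : R -> 'rV[R]_3 -> 'rV[R]_3 :=
  fun t x => (f t * \1_B x) *: a.

Definition laplace (R : realType) (T : R) (f : R -> R) (tau : R) : R :=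
  \int[lebesgue_measure]_(t in `[0, T]) (expR (- tau * t) * f t).

Definition laplaceT (R : realType) (T : R)
    (u : R -> 'rV[R]_3 -> 'rV[R]_3) (tau : R) (x : 'rV[R]_3) : 'rV[R]_3 :=
  \row_i laplace T (fun t => u t x 0 i) tau.

Definition indicator_fun (R : realType) (T : R) (f : R -> R)
    (B : set 'rV[R]_3) (a : 'rV[R]_3) (E E0 : R -> 'rV[R]_3 -> 'rV[R]_3)
    (tau : R) : R :=
  \int[leb3]_x dotv ((laplace T f tau * \1_B x) *: a)
                    (laplaceT T E tau x - laplaceT T E0 tau x).

Definition jumpI (R : realType) (eps0 mu0 : R) (eps mu : 'rV[R]_3 -> R)
    (D : set 'rV[R]_3) : Prop :=
  exists2 C, 0 < C & {ae leb3, forall x, D x ->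
    C <= (1 - 1 / (eps x / eps0)) + (1 - mu x / mu0)}.

Definition jumpII (R : realType) (eps0 mu0 : R) (eps mu : 'rV[R]_3 -> R)
    (D : set 'rV[R]_3) : Prop :=
  exists2 C, 0 < C & {ae leb3, forall x, D x ->
    C <= (1 - eps x / eps0) + (1 - 1 / (mu x / mu0))}.

(* After a rotation or reflection Q of the axes, D coincides in a ball around
   q with the strict subgraph of a C^2 function g; rho is the corresponding
   local defining function: D = {rho < 0} near q. *)
Definition local_defining (R : realType) (D : set 'rV[R]_3) (q : 'rV[R]_3)
    (rho : 'rV[R]_3 -> R) : Prop :=
  exists (r : R) (Q : 'M[R]_3) (g : 'rV[R]_2 -> R),
    [/\ 0 < r, Q *m Q^T = 1%:M, Ck 2 g,
        rho = (fun x => let y : 'rV[R]_(2 + 1) := x *m Q in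
                        rsubmx y 0 0 - g (lsubmx y)) &
        D `&` eball q r = [set x | rho x < 0] `&` eball q r].

Definition C2_boundary (R : realType) (D : set 'rV[R]_3) : Prop :=
  forall q, bdry D q -> exists rho, local_defining D q rho.

Definition grad (R : realType) n (rho : 'rV[R]_n -> R) (x : 'rV[R]_n) :
    'rV[R]_n :=
  \row_i partial i rho x.

Definition normalize (R : realType) n (v : 'rV[R]_n) : 'rV[R]_n :=
  (enorm v)^-1 *: v.

(* C^1 extension, to a neighborhood of q in R^3, of the unit outer normal field
   of the boundary of D. Its values on the boundary near q, hence also its
   derivatives at q in tangential directions, do not depend on the local
   defining function that is chosen. *)
Definition outer_normal_near (R : realType) (D : set 'rV[R]_3) (q : 'rV[R]_3) :
    'rV[R]_3 -> 'rV[R]_3 :=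
  fun x => normalize (grad (xget (fun=> 0) (local_defining D q)) x).

Definition outer_normal (R : realType) (D : set 'rV[R]_3) (q : 'rV[R]_3) :
    'rV[R]_3 :=
  outer_normal_near D q q.

(* Shape operator v |-> - dN(v) of a surface with unit normal field N (extended
   to a neighborhood of q), as a matrix acting on row vectors on the right.
   Only its action on the tangent plane at q is meaningful. *)
Definition shape_operator (R : realType) (N : 'rV[R]_3 -> 'rV[R]_3)
    (q : 'rV[R]_3) : 'M[R]_3 :=
  - 'J N q.

Definition tangent_basis (R : realType) (nu : 'rV[R]_3) : 'M[R]_(2, 3) :=
  xget 0 [set b : 'M[R]_(2, 3) | b *m b^T = 1%:M /\ b *m nu^T = 0].

(* Determinant of the compression of A to the plane orthogonal to nu; it does
   not depend on the orthonormal basis of the plane that is chosen. *)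
Definition tangent_det (R : realType) (nu : 'rV[R]_3) (A : 'M[R]_3) : R :=
  \det (tangent_basis nu *m A *m (tangent_basis nu)^T).

Definition shape_bdry (R : realType) (D : set 'rV[R]_3) (q : 'rV[R]_3) :
    'M[R]_3 :=
  shape_operator (outer_normal_near D q) q.

Definition gauss_curvature (R : realType) (D : set 'rV[R]_3) (q : 'rV[R]_3) :
    R :=
  tangent_det (outer_normal D q) (shape_bdry D q).

Definition refl_sphere (R : realType) (p : 'rV[R]_3) (D : set 'rV[R]_3) :
    set 'rV[R]_3 :=
  [set x | enorm (x - p) = setdist [set p] (bdry D)].

(* x |-> normalize (p - x) restricts to the inner unit normal field of every
   sphere centered at p. *)
Definition shape_sphere (R : realType) (p q : 'rV[R]_3) : 'M[R]_3 :=
  shape_operator (fun x => normalize (p - x)) q.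

Definition first_reflector (R : realType) (p : 'rV[R]_3) (D : set 'rV[R]_3) :
    set 'rV[R]_3 :=
  bdry D `&` refl_sphere p D.

Definition geomI (R : realType) (p : 'rV[R]_3) (D : set 'rV[R]_3) : Prop :=
  finite_set (first_reflector p D) /\
  forall q, first_reflector p D q -> 0 < gauss_curvature D q.

Definition geomII (R : realType) (p : 'rV[R]_3) (D : set 'rV[R]_3) : Prop :=
  finite_set (first_reflector p D) /\
  forall q, first_reflector p D q ->
    0 < tangent_det (outer_normal D q) (shape_sphere p q - shape_bdry D q).

Definition geomIII (R : realType) (p a : 'rV[R]_3) (D : set 'rV[R]_3) : Prop :=
  exists2 q, first_reflector p D q & crossv a (outer_normal D q) != 0.

(* Main.v *)
(* At a frequency tau > 0 the Laplace transforms (We, Wh) of (E, H) solve, up to terms of size e^{-tau T},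
   the stationary system curl We = - tau mu Wh, curl Wh = (tau eps + sigma) We - F. The constant background
   system with the same source F has the explicit decaying solution (V, Vh) built from the radial solution u of
   - Laplacian u + k^2 u = 1_B, where k^2 = mu0 tau (tau eps0 + sigma0). Symmetry of the weak curl turns
   int F.(We - V) into quadratic integrals over D. Energy estimates bound it by C tau int_D (|V|^2 + |Vh|^2);
   completing squares bounds it from below, with the sign given by the jump condition, by
   int_D (tau A1 - C) |V|^2 + tau A2 |Vh|^2 with A1 / eps0 + A2 / mu0 bounded below on D.
   On D the fields decay like e^{-k (|x - p| - eta)}, which yields the exponential rate. The leading part of the
   integrand is proportional to the squared sine of the angle between a and x - p, so it degenerates only in a
   cone of opening O(1/k) around the line p + R a. That cone contributes at most C k^-3 e^{-2kd}, d being the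
   distance from p to D, whereas the integral of e^{-2k|x-p|} over D exceeds every multiple of k^-3 e^{-2kd}: near a
   nearest point of the C^2 boundary, D contains arbitrarily many disjoint cubes of side c/k at distance at most
   d + C/k from p. *)

(* The Laplace transform of (E0, H0) also solves its system only up to a term of size e^{-tau T}. So
   [I] is split into two pairings with the explicit field, one for (E, H) and one for (E0, H0); the
   second is the same estimate for an empty obstacle. Its bound tau^{-2} e^{-tau T}, with tau^{-2}
   coming from the size of the incident field, is small enough for e^{tau T} I to tend to 0 below
   the threshold. The solutions lie only in H(curl), where the curl is known through smooth test
   fields, so pairing two of them requires mollification. The incident potential is only C^1 across
   the sphere bounding B and is written with powers of 1/|x - p|, so its curls are verified by
   integration by parts along almost every line parallel to an axis. The jump condition controls one
   combination of the two contrasts and not each of them; this combination is the leading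
   coefficient because eps0 |V|^2 and mu0 |Vh|^2 agree to leading order in tau. The conductivity is
   of lower order and is absorbed by C. *)
From HB Require Import structures.
Require Import Defs.
From mathcomp Require Import all_boot all_order all_algebra.
From mathcomp Require Import all_classical all_reals all_analysis.
From mathcomp Require Import ess_sup_inf measurable_realfun.
From mathcomp Require Import ring lra.
Set SsrOldRewriteGoalsOrder.
Set Implicit Arguments.
Unset Strict Implicit.
Unset Printing Implicit Defensive.
Import Order.TTheory GRing.Theory Num.Theory.
Import numFieldNormedType.Exports.
Local Open Scope classical_set_scope.
Local Open Scope ring_scope.

(** * Lebesgue measure and square-integrable fields on R^3 *)

Section leb3_theory.
Context {R : realType}.
Notation leb := (@lebesgue_measure R).
Notation leb3 := (@leb3 R).

Lemma measurable_coord n (i : 'I_n) : measurable_fun setT (fun x : 'rV[R]_n => x 0 i).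
Proof.
move=> _ B mB; rewrite setTI; apply: sub_sigma_algebra.
rewrite -bigcup_seq; exists i; first exact: mem_index_enum.
by exists B => //; rewrite setTI.
Qed.

Definition box (A : 'I_3 -> set R) : set 'rV[R]_3 := [set x | forall i, A i (x 0 i)].

Lemma forall_I3 (P : 'I_3 -> Prop) : P 0 -> P 1 -> P 2 -> forall i, P i.
Proof.
move=> P0 P1 P2 [[|[|[|//]]] h].
- by rewrite (_ : Ordinal h = 0)//; exact: val_inj.
- by rewrite (_ : Ordinal h = 1)//; exact: val_inj.
- by rewrite (_ : Ordinal h = 2)//; exact: val_inj.
Qed.

Lemma measurable_box A : (forall i, measurable (A i)) -> measurable (box A).
Proof.
move=> mA; rewrite (_ : box A = \bigcap_(i in setT) ((fun x : 'rV[R]_3 => x 0 i) @^-1` A i)).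
  apply: fin_bigcap_measurable => // i _; rewrite -[X in measurable X]setTI.
  exact: measurable_coord.
by apply/seteqP; split=> x => [h i _|h i]; exact: h.
Qed.

Lemma leb3_box A : (forall i, measurable (A i)) ->
  leb3 (box A) = (leb (A 0%R) * leb (A 1%R) * leb (A 2%R))%E.
Proof.
move=> mA; rewrite /leb3 /pushforward.
rewrite (_ : _ @^-1` _ = (A 0 `*` A 1) `*` A 2).
  rewrite product_measure1E; [|by apply: measurableX; exact: mA|exact: mA].
  by congr (_ * _)%E; apply: product_measure1E; exact: mA.
apply/seteqP; split=> [[[x y] z] /= h|[[x y] z] /= [[h0 h1] h2]].
  by have := h 0; have := h 1; have := h 2; rewrite !mxE/=.
by apply: (@forall_I3 (fun i => A i (vec3 (x, y, z) 0 i))); rewrite mxE.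
Qed.

Definition cube (n : nat) := box (fun=> `]-n%:R, n%:R]%classic).

Lemma measurable_cube n : measurable (cube n).
Proof. by apply: measurable_box => i; exact: measurable_itv. Qed.

Lemma leb3_cube_lty n : (leb3 (cube n) < +oo)%E.
Proof.
rewrite leb3_box//.
rewrite /= !lebesgue_measure_itv/=; case: ifPn => _; last by rewrite !mul0e.
by rewrite -!EFinD -!EFinM ltry.
Qed.

Lemma bigcup_cube : \bigcup_n cube n = setT.
Proof.
apply/seteqP; split=> // x _.
exists (Num.trunc (\sum_i `|x 0 i|)).+1 => // i.
have : `|x 0 i| < (Num.trunc (\sum_i `|x 0 i|)).+1%:R.
  apply: le_lt_trans (truncnS_gt _); rewrite (bigD1 i)//= lerDl.
  exact: sumr_ge0.
by rewrite /= in_itv/= ltr_norml => /andP[-> /ltW].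
Qed.

Let leb3_sigma_finite : sigma_finite setT leb3.
Proof.
exists cube; first by rewrite bigcup_cube.
by move=> n; split; [exact: measurable_cube|exact: leb3_cube_lty].
Qed.

HB.instance Definition _ := Measure_isSigmaFinite.Build _ _ _ leb3 leb3_sigma_finite.

End leb3_theory.

(** * Real-valued integrals and square-integrable functions *)

Section generic_integral.
Context d (T : measurableType d) (R : realType) (mu : {measure set T -> \bar R}).
Implicit Types f g h : T -> R.
Notation intg f := (mu.-integrable setT (EFin \o f)).

Lemma intg_measurable f : intg f -> measurable_fun setT f.
Proof. by move=> /measurable_int /measurable_EFinP. Qed.

Lemma intg_le g f : measurable_fun setT f -> intg g ->
  (forall x, `|f x| <= g x) -> intg f.
Proof.
move=> mf ig fg; apply: le_integrable ig => //; first exact/measurable_EFinP.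
by move=> x _ /=; rewrite lee_fin (le_trans (fg x))// ler_norm.
Qed.

Lemma intgD f g : intg f -> intg g -> intg (fun x => f x + g x).
Proof.
move=> If Ig; rewrite (_ : EFin \o _ = (EFin \o f) \+ (EFin \o g))//.
exact: integrableD.
Qed.

Lemma intgZ (k : R) f : intg f -> intg (fun x => k * f x).
Proof.
by move=> If; rewrite (_ : EFin \o _ = (fun x => k%:E * (EFin \o f) x)%E)//;
  exact: integrableZl.
Qed.

Lemma intgN f : intg f -> intg (fun x => - f x).
Proof.
by move=> /(@intgZ (-1)); apply: eq_integrable => // x _ /=; rewrite mulN1r.
Qed.

Lemma intgB f g : intg f -> intg g -> intg (fun x => f x - g x).
Proof. by move=> If Ig; apply: intgD => //; exact: intgN. Qed.

Lemma intg0 : intg (fun=> 0).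
Proof. exact: integrable0. Qed.

Lemma intg_sum (I : Type) (s : seq I) (F : I -> T -> R) :
  (forall i, intg (F i)) -> intg (fun x => \sum_(i <- s) F i x).
Proof.
move=> IF; elim: s => [|i s ih].
  by under eq_fun do rewrite big_nil; exact: intg0.
by under eq_fun do rewrite big_cons; exact: intgD.
Qed.

Lemma Rintegral_sum (I : Type) (s : seq I) (F : I -> T -> R) :
  (forall i, intg (F i)) ->
  \int[mu]_x (\sum_(i <- s) F i x) = \sum_(i <- s) \int[mu]_x (F i x).
Proof.
move=> IF; elim: s => [|i s ih].
  rewrite big_nil; under eq_Rintegral do rewrite big_nil.
  by rewrite /Rintegral integral0_eq.
rewrite big_cons -ih -RintegralD//; last exact: intg_sum.
by apply: eq_Rintegral => x _; rewrite big_cons.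
Qed.

Lemma intg_bounded_mul f h M : intg f -> measurable_fun setT h ->
  (forall x, `|h x| <= M) -> intg (fun x => h x * f x).
Proof.
move=> If mh hM; apply: (@intg_le (fun x => M * `|f x|)).
- by apply: measurable_funM => //; exact: intg_measurable.
- by apply: intgZ; exact: integrable_norm.
- by move=> x; rewrite normrM ler_wpM2r.
Qed.

Lemma Rintegral_ae_eq f g : measurable_fun setT f -> measurable_fun setT g ->
  {ae mu, forall x, f x = g x} -> \int[mu]_x f x = \int[mu]_x g x.
Proof.
move=> mf mg fg; congr fine; apply: ae_eq_integral => //.
- exact/measurable_EFinP.
- exact/measurable_EFinP.
- by apply: filterS fg => x ->.
Qed.

Lemma intg_ae_eq f g : measurable_fun setT g ->
  {ae mu, forall x, f x = g x} -> intg f -> intg g.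
Proof.
move=> mg fg If; apply/integrableP; split; first exact/measurable_EFinP.
have /integrableP[mf] := If; rewrite (_ : integral mu _ _ = \int[mu]_x `|(EFin \o g) x|)%E//.
apply: ge0_ae_eq_integral => //.
- exact: measurableT_comp.
- by apply: measurableT_comp => //; exact/measurable_EFinP.
- by apply: filterS fg => x /= ->.
Qed.

(** Replacing g by max(f, g), which equals g almost everywhere, turns the inequality into one that
    holds everywhere. *)
Lemma le_Rintegral_ae f g : intg f -> intg g ->
  {ae mu, forall x, f x <= g x} -> \int[mu]_x f x <= \int[mu]_x g x.
Proof.
move=> If Ig fg; have mf := intg_measurable If; have mg := intg_measurable Ig.
have mM : measurable_fun setT (fun x => Num.max (f x) (g x)).
  exact: measurable_maxr.
have h : {ae mu, forall x, g x = Num.max (f x) (g x)}.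
  by apply: filterS fg => x fg; apply/esym/max_idPr.
rewrite (Rintegral_ae_eq mg mM h); apply: le_Rintegral => //.
  exact: intg_ae_eq h Ig.
by move=> x _; rewrite le_max lexx.
Qed.

Definition sqint f := measurable_fun setT f /\ intg (fun x => f x ^+ 2).

Lemma sqint_mul f g : sqint f -> sqint g -> intg (fun x => f x * g x).
Proof.
move=> [mf If] [mg Ig]; apply: (@intg_le (fun x => f x ^+ 2 + g x ^+ 2)).
- exact: measurable_funM.
- exact: intgD.
- by move=> x; rewrite ler_norml; apply/andP; split; nra.
Qed.

Lemma sqintD f g : sqint f -> sqint g -> sqint (fun x => f x + g x).
Proof.
move=> [mf If] [mg Ig]; split; first exact: measurable_funD.
apply: (@intg_le (fun x => 2 * f x ^+ 2 + 2 * g x ^+ 2)).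
- by apply: measurable_funX; exact: measurable_funD.
- by apply: intgD; exact: intgZ.
- move=> x; rewrite ger0_norm ?sqr_ge0//.
  by have := sqr_ge0 (f x - g x); rewrite sqrrB sqrrD; lra.
Qed.

Lemma sqint_bounded_mul f h M : sqint f -> measurable_fun setT h ->
  (forall x, `|h x| <= M) -> sqint (fun x => h x * f x).
Proof.
move=> [mf If] mh hM; split; first exact: measurable_funM.
apply: (@intg_le (fun x => M ^+ 2 * f x ^+ 2)).
- by apply: measurable_funX; exact: measurable_funM.
- exact: intgZ.
- move=> x; rewrite ger0_norm ?sqr_ge0// exprMn ler_wpM2r ?sqr_ge0//.
  rewrite -(real_normK (num_real (h x))) ler_pXn2r// ?nnegrE//.
  by rewrite (le_trans _ (hM x)).
Qed.

Lemma sqintZ k f : sqint f -> sqint (fun x => k * f x).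
Proof. by move=> h; apply: (@sqint_bounded_mul _ _ `|k|). Qed.

Lemma sqint0 : sqint (fun=> 0).
Proof. by split => //; under eq_fun do rewrite expr0n/=; exact: intg0. Qed.

Lemma sqint_le f g : measurable_fun setT f -> sqint g ->
  (forall x, `|f x| <= `|g x|) -> sqint f.
Proof.
move=> mf [mg Ig] fg; split => //; apply: intg_le Ig _; first exact: measurable_funX.
move=> x; rewrite ger0_norm ?sqr_ge0//.
by rewrite -(real_normK (num_real (f x))) -(real_normK (num_real (g x))) ler_pXn2r// ?nnegrE.
Qed.

Lemma Lfun2P f : (f \in Lfun mu 2%:E) <-> sqint f.
Proof.
split => [h|[mf If]].
  split; last exact: Lfun2_integrable_sqr.
  by move: h; rewrite inE => /andP[]; rewrite inE.
rewrite inE; apply/andP; split; first by rewrite inE.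
rewrite inE /finite_norm /= unlock.
rewrite poweR_lty//.
under eq_integral do rewrite /= powR_mulrn// -normrX.
by have /integrableP[] := If.
Qed.

End generic_integral.

Lemma integral_off_null d (T : measurableType d) (R : realType)
    (mu : {measure set T -> \bar R}) (N : set T) (h : T -> \bar R) :
  measurable N -> mu N = 0%E -> measurable_fun setT h ->
  {ae mu, forall t, ~ N t -> h t = 0%E} -> (\int[mu]_t h t = 0)%E.
Proof.
move=> mN N0 mh h0; rewrite (ae_eq_integral (cst 0%E))//; first by rewrite integral0.
have hc : {ae mu, forall t, ~ N t} by exists N; split => // t /= /contrapT.
by apply: filterS2 h0 hc => t h1 tc _ /=; exact: h1.
Qed.

(** * Fubini's theorem on R^3 in coordinates *)

Section leb3_integral.
Context {R : realType}.
Notation leb := (@lebesgue_measure R).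
Notation mR := (measurableTypeR R).
Notation leb3 := (@leb3 R).
Notation intg f := (leb3.-integrable setT (EFin \o f)).
Local Open Scope ereal_scope.

(** A named copy of the planar product measure, so that it can carry a sigma-finite structure and
    Fubini's theorem can be applied a second time. *)
Definition leb2 : set (mR * mR)%type -> \bar R := @product_measure1 _ _ _ _ R leb leb.
HB.instance Definition _ := Measure.copy leb2 (@product_measure1 _ _ _ _ R leb leb).
Let leb2_sf : sigma_finite setT leb2.
Proof.
pose F (n : nat) := (`](-n%:R)%R, (n%:R)%R]%classic : set mR) `*` (`](-n%:R)%R, (n%:R)%R]%classic : set mR).
exists F.
  apply/esym/seteqP; split => // -[x y] _; pose n := (Num.trunc (`|x| + `|y|)%R).+1.
  have xyn : (`|x| + `|y| < n%:R)%R by exact: truncnS_gt.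
  have [hx hy] : (`|x| < n%:R)%R /\ (`|y| < n%:R)%R.
    by split; apply: le_lt_trans xyn; rewrite ?lerDl ?lerDr.
  exists n => //; move: hx hy; rewrite !ltr_norml => /andP[a b] /andP[c e].
  by split; rewrite /= in_itv/= ?a ?c ltW.
move=> n; split; first by apply: measurableX; exact: measurable_itv.
rewrite /F /leb2 product_measure1E; [|exact: measurable_itv..].
rewrite /= !lebesgue_measure_itv/=; case: ifPn => _; last by rewrite mul0e.
by rewrite -!EFinD -!EFinM ltry.
Qed.
HB.instance Definition _ := Measure_isSigmaFinite.Build _ _ _ leb2 leb2_sf.
Definition prodleb2 : {sigma_finite_measure set (mR * mR)%type -> \bar R} := leb2.
Definition prodleb3 : {measure set (mR * mR * mR)%type -> \bar R} := @product_measure1 _ _ _ _ R prodleb2 leb.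
Lemma measurable_vec3R : measurable_fun setT (@vec3 R : (mR * mR * mR)%type -> 'rV[R]_3).
Proof. move=> _ B mB; exact: (@measurable_vec3 R measurableT B mB). Qed.

Lemma ge0_integral_leb3 (f : 'rV[R]_3 -> \bar R) : measurable_fun setT f ->
  (forall x, 0 <= f x) ->
  \int[leb3]_x f x = \int[prodleb3]_y f (vec3 y).
Proof.
move=> mf f0.
by have := @ge0_integral_pushforward _ _ _ _ _ _ measurable_vec3R prodleb3
  setT f measurableT mf (fun x _ => f0 x).
Qed.

Lemma integrable_leb3 (f : 'rV[R]_3 -> \bar R) : leb3.-integrable setT f ->
  prodleb3.-integrable setT (f \o @vec3 R).
Proof.
move=> /integrableP[mf fo]; apply/integrableP; split.
  by apply: measurableT_comp => //; exact: measurable_vec3R.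
move: fo; rewrite ge0_integral_leb3//; exact: measurableT_comp.
Qed.

Lemma integral_leb3 (f : 'rV[R]_3 -> \bar R) : leb3.-integrable setT f ->
  \int[leb3]_x f x = \int[prodleb3]_y f (vec3 y).
Proof.
move=> If.
have := @integral_pushforward _ _ _ _ _ _ measurable_vec3R prodleb3
  setT f (measurable_int _ If).
by rewrite preimage_setT; apply => //; exact: integrable_leb3.
Qed.

Lemma integral_leb3_prod (g : 'I_3 -> mR -> R) :
  (forall i, measurable_fun setT (g i)) -> (forall i t, (0 <= g i t)%R) ->
  \int[leb3]_x (g 0%R (x 0%R 0%R) * g 1%R (x 0%R 1%R) * g 2%R (x 0%R 2%R))%:E =
  \int[leb]_t (g 0%R t)%:E * \int[leb]_t (g 1%R t)%:E * \int[leb]_t (g 2%R t)%:E.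
Proof.
move=> mg g0.
have mgE i : measurable_fun setT (EFin \o g i) by exact/measurable_EFinP.
rewrite ge0_integral_leb3; last 2 first.
- apply/measurable_EFinP; apply: measurable_funM; first apply: measurable_funM.
  + exact: (measurableT_comp (mg _) (@measurable_coord _ _ _)).
  + exact: (measurableT_comp (mg _) (@measurable_coord _ _ _)).
  + exact: (measurableT_comp (mg _) (@measurable_coord _ _ _)).
- by move=> x; rewrite lee_fin !mulr_ge0.
under eq_integral do rewrite !mxE/=.
rewrite (@fubini_tonelli1 _ _ _ _ R prodleb2 leb)/=; last 2 first.
- apply/measurable_EFinP; apply: measurable_funM; first apply: measurable_funM.
  + by apply: (measurableT_comp (mg _)); exact: measurableT_comp.
  + by apply: (measurableT_comp (mg _)); exact: measurableT_comp.
  + exact: (measurableT_comp (mg _)).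
- by move=> x; rewrite lee_fin !mulr_ge0.
rewrite /fubini_F/=.
under eq_integral => x _.
  under eq_integral do rewrite EFinM.
  rewrite ge0_integralZl; [|by []|exact: mgE|by move=> y _; rewrite lee_fin|by rewrite lee_fin mulr_ge0].
  over.
rewrite ge0_integralZr//; last 3 first.
- apply/measurable_EFinP; apply: measurable_funM.
  + exact: (measurableT_comp (mg _)).
  + exact: (measurableT_comp (mg _)).
- by move=> x _; rewrite lee_fin mulr_ge0.
- by apply: integral_ge0 => t _; rewrite lee_fin.
congr (_ * _).
rewrite (@fubini_tonelli1 _ _ _ _ R leb leb)/=; last 2 first.
- apply/measurable_EFinP; apply: measurable_funM.
  + exact: (measurableT_comp (mg _)).
  + exact: (measurableT_comp (mg _)).
- by move=> x; rewrite lee_fin mulr_ge0.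
rewrite /fubini_F/=.
under eq_integral => x _.
  under eq_integral do rewrite EFinM.
  rewrite ge0_integralZl; [|by []|exact: mgE|by move=> y _; rewrite lee_fin|by rewrite lee_fin].
  over.
rewrite ge0_integralZr//.
- exact: mgE.
- by move=> x _; rewrite lee_fin.
- by apply: integral_ge0 => t _; rewrite lee_fin.
Qed.

Definition upd (i : 'I_3) (t : R) (x : 'rV[R]_3) : 'rV[R]_3 :=
  \row_j (if j == i then t else x 0%R j).

Lemma row3_eq (x y : 'rV[R]_3) : x 0%R 0%R = y 0%R 0%R ->
  x 0%R 1%R = y 0%R 1%R -> x 0%R 2%R = y 0%R 2%R -> x = y.
Proof.
move=> h0 h1 h2; apply/rowP.
exact: (@forall_I3 (fun i => x 0%R i = y 0%R i)).
Qed.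

Let integral_off1 (h : mR -> \bar R) c : measurable_fun setT h ->
  {ae leb, forall t, ~ (t = c) -> h t = 0} -> \int[leb]_t h t = 0.
Proof.
move=> mh h0; apply: (@integral_off_null _ _ _ leb [set c]) => //.
exact: lebesgue_measure_set1.
Qed.

(** Fubini with the direction i innermost. The lines on which coordinate i + 1 equals c fill a
    hyperplane of measure zero, so nothing is asked on them. This is what allows a singular point to
    be avoided later. *)
Lemma integral_leb3_lines0 (F : 'rV[R]_3 -> R) (i : 'I_3) (c : R) : intg F ->
  (forall x : 'rV[R]_3, x ord0 (i + 1)%R <> c -> \int[leb]_t (F (upd i t x))%:E = 0) ->
  \int[leb3]_x (F x)%:E = 0.
Proof.
move=> /[dup] If /integrable_leb3 IG; rewrite integral_leb3//.
move: i; apply: forall_I3 => /= h.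
- rewrite -integral21_prod_meas1//; apply: (@integral_off1 _ c).
    exact: (measurable_fubini_G IG).
  have := ae_integrable2 IG; apply: filterS => z Iz _.
  rewrite /fubini_G/= -(integral21_prod_meas1 Iz).
  apply: (@integral_off1 _ c); first exact: (measurable_fubini_G Iz).
  apply: nearW => y yc; rewrite /fubini_G/=.
  rewrite -[RHS](h (vec3 (0, y, z))%R); last by rewrite mxE.
  apply: eq_integral => x _; congr (F _)%:E.
  by apply: row3_eq; rewrite !mxE.
- rewrite -integral21_prod_meas1//; apply: (@integral_off1 _ c).
    exact: (measurable_fubini_G IG).
  have := ae_integrable2 IG; apply: filterS => z Iz zc.
  rewrite /fubini_G/= -(integral12_prod_meas1 Iz).
  rewrite integral0_eq// => x _; rewrite /fubini_F/=.
  rewrite -[RHS](h (vec3 (x, 0, z))%R); last by rewrite mxE.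
  apply: eq_integral => y _; congr (F _)%:E.
  by apply: row3_eq; rewrite !mxE.
- rewrite -integral12_prod_meas1//.
  rewrite -(integral12_prod_meas1 (integrable_fubini_F IG)).
  apply: (@integral_off1 _ c).
    exact: (measurable_fubini_F (integrable_fubini_F IG)).
  apply: nearW => x xc; rewrite /fubini_F/=; rewrite integral0_eq// => y _.
  rewrite -[RHS](h (vec3 (x, y, 0))%R); last by rewrite mxE.
  apply: eq_integral => z _; congr (F _)%:E.
  by apply: row3_eq; rewrite !mxE.
Qed.

End leb3_integral.

Section open_measurable.
Context {R : realType} (n : nat).
Implicit Types U : set 'rV[R]_n.

(** The sigma-algebra is generated by the coordinates and not by the topology; the link is that an
    open set is the countable union of the boxes with rational corners contained in it. *)
Lemma open_measurable_rV U : open U -> measurable U.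
Proof.
move=> oU.
pose qbox (ab : 'rV[rat]_n * 'rV[rat]_n) : set 'rV[R]_n :=
  [set x | forall i, ratr (ab.1 0 i) < x 0 i < ratr (ab.2 0 i)].
have -> : U = \bigcup_(ab in [set ab | qbox ab `<=` U]) qbox ab.
  apply/seteqP; split => [x Ux|x [ab /= h] /h//].
  have /nbhs_ballP[e /= e0 eU] := open_nbhs_nbhs (conj oU Ux).
  have ha i : exists q : rat, ratr q \in `]x 0 i - e, x 0 i[.
    by apply: rat_in_itvoo; rewrite ltrBlDr ltrDl.
  have hb i : exists q : rat, ratr q \in `]x 0 i, x 0 i + e[.
    by apply: rat_in_itvoo; rewrite ltrDl.
  exists (\row_i xchoose (ha i), \row_i xchoose (hb i)).
    move=> y /= hy; apply: eU; split=> // i j; rewrite ord1 /ball/= distrC.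
    have := xchooseP (ha j); have := xchooseP (hb j); have := hy j.
    rewrite !mxE !in_itv/= ltr_norml.
    move=> /andP[y1 y2] /andP[_ b2] /andP[a1 _]; apply/andP; split; lra.
  move=> i /=; have := xchooseP (ha i); have := xchooseP (hb i).
  by rewrite !mxE !in_itv/= => /andP[-> _] /andP[_ ->].
rewrite bigcup_mkcond; apply: countable_bigcupT_measurable => [|ab].
  exact: countableP.
case: ifPn => // _; rewrite (_ : qbox ab = \bigcap_(i in setT)
  ((fun x : 'rV[R]_n => x 0 i) @^-1` `]ratr (ab.1 0 i), ratr (ab.2 0 i)[%classic)).
  apply: fin_bigcap_measurable => // i _; rewrite -[X in measurable X]setTI.
  by apply: measurable_coord => //; exact: measurable_itv.
by apply/seteqP; split=> x => [h i _|h i]; have := h i; rewrite /= in_itv/= => h1; apply: h1.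
Qed.

Lemma continuous_measurable_rV (f : 'rV[R]_n -> R) :
  continuous f -> measurable_fun setT f.
Proof.
move=> cf; apply: (measurability _ (RGenOpens.measurableE R)) => _ [_ [a [b ->] <-]].
rewrite setTI; apply: open_measurable_rV.
by apply: open_comp => [x _|]; [exact: cf|exact: interval_open].
Qed.

End open_measurable.

Section dot.
Context {R : realType}.
Implicit Types u v w : 'rV[R]_3.

Lemma sum3E (F : 'I_3 -> R) : \sum_i F i = F 0 + F 1 + F 2.
Proof.
rewrite !big_ord_recl big_ord0 addr0 addrA; congr (F _ + F _ + F _);
  exact: val_inj.
Qed.

Lemma dotvE u v : dotv u v = \sum_i u 0 i * v 0 i.
Proof. by rewrite /dotv mxE; apply: eq_bigr => i _; rewrite mxE. Qed.

Lemma dotvC u v : dotv u v = dotv v u.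
Proof. by rewrite !dotvE; apply: eq_bigr => i _; rewrite mulrC. Qed.

Lemma dotvDl u v w : dotv (u + v) w = dotv u w + dotv v w.
Proof. by rewrite /dotv mulmxDl mxE. Qed.

Lemma dotvZl k u v : dotv (k *: u) v = k * dotv u v.
Proof. by rewrite /dotv -scalemxAl mxE. Qed.

Lemma dotvNl u v : dotv (- u) v = - dotv u v.
Proof. by rewrite -scaleN1r dotvZl mulN1r. Qed.

Lemma dotvBl u v w : dotv (u - v) w = dotv u w - dotv v w.
Proof. by rewrite dotvDl dotvNl. Qed.

Lemma dotvDr u v w : dotv w (u + v) = dotv w u + dotv w v.
Proof. by rewrite dotvC dotvDl !(dotvC w). Qed.

Lemma dotvZr k u v : dotv v (k *: u) = k * dotv v u.
Proof. by rewrite dotvC dotvZl dotvC. Qed.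

Lemma dotvNr u v : dotv v (- u) = - dotv v u.
Proof. by rewrite dotvC dotvNl dotvC. Qed.

Lemma dotvBr u v w : dotv w (u - v) = dotv w u - dotv w v.
Proof. by rewrite dotvDr dotvNr. Qed.

Lemma dotvv_ge0 u : 0 <= dotv u u.
Proof. by rewrite dotvE sumr_ge0// => i _; rewrite -expr2 sqr_ge0. Qed.

Lemma dotv0l u : dotv 0 u = 0.
Proof. by rewrite -(scale0r 0) dotvZl mul0r. Qed.

Lemma dotv_CS u v : dotv u v ^+ 2 <= dotv u u * dotv v v.
Proof.
have [v0|v0] := eqVneq (dotv v v) 0.
  have : dotv u v = 0; last by move=> ->; rewrite v0 mulr0 expr0n.
  rewrite dotvE big1// => i _; move: v0.
  rewrite dotvE => /eqP; rewrite psumr_eq0; last by move=> j _; rewrite -expr2 sqr_ge0.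
  by move=> /allP/(_ i); rewrite mem_index_enum mulf_eq0 orbb => /(_ isT)/eqP ->; rewrite mulr0.
have v1 : 0 < dotv v v by rewrite lt_neqAle eq_sym v0 dotvv_ge0.
have := dotvv_ge0 (dotv v v *: u - dotv u v *: v).
rewrite dotvBl !dotvBr !dotvZl !dotvZr (dotvC v u) => h.
by rewrite -(ler_pM2l v1); nra.
Qed.

Lemma enorm_ge0 u : 0 <= enorm u. Proof. exact: sqrtr_ge0. Qed.

Lemma enorm_sqr u : enorm u ^+ 2 = dotv u u.
Proof. by rewrite sqr_sqrtr ?dotvv_ge0. Qed.

Lemma dotv_le_enorm u v : `|dotv u v| <= enorm u * enorm v.
Proof.
rewrite -(ler_pXn2r (n := 2))// ?nnegrE ?mulr_ge0 ?enorm_ge0//.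
by rewrite exprMn !enorm_sqr real_normK ?num_real// dotv_CS.
Qed.

Lemma enormD u v : enorm (u + v) <= enorm u + enorm v.
Proof.
rewrite -(ler_pXn2r (n := 2))// ?nnegrE ?addr_ge0 ?enorm_ge0//.
rewrite sqrrD !enorm_sqr dotvDl !dotvDr (dotvC v u).
by have := le_trans (ler_norm _) (dotv_le_enorm u v); lra.
Qed.

Lemma enormZ k u : enorm (k *: u) = `|k| * enorm u.
Proof.
by rewrite /enorm dotvZl dotvZr mulrA -expr2 sqrtrM ?sqr_ge0// sqrtr_sqr.
Qed.

Lemma enormN u : enorm (- u) = enorm u.
Proof. by rewrite -scaleN1r enormZ normrN1 mul1r. Qed.

Lemma coord_le_enorm u i : `|u 0 i| <= enorm u.
Proof.
rewrite -(ler_pXn2r (n := 2))// ?nnegrE ?enorm_ge0// enorm_sqr dotvE.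
rewrite (bigD1 i)//= real_normK ?num_real// expr2 lerDl.
by rewrite sumr_ge0// => j _; rewrite -expr2 sqr_ge0.
Qed.

Lemma enorm_eq0 u : enorm u = 0 -> u = 0.
Proof.
move=> h; apply/rowP => i; rewrite mxE; apply/eqP.
by have := coord_le_enorm u i; rewrite h normr_le0.
Qed.

End dot.

(** * The inner product and norm of square-integrable fields *)

Section vector_L2.
Context {R : realType}.
Notation leb3 := (@leb3 R).
Notation intg f := (leb3.-integrable setT (EFin \o f)).
Implicit Types u v w : 'rV[R]_3 -> 'rV[R]_3.

Lemma L2fieldP u : L2field u <-> forall i, sqint leb3 (fun x => u x 0 i).
Proof. by split=> h i; apply/Lfun2P; exact: h. Qed.

Definition ip u v : R := \int[leb3]_x dotv (u x) (v x).

Lemma L2field_dotv u v : L2field u -> L2field v -> intg (fun x => dotv (u x) (v x)).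
Proof.
move=> /L2fieldP hu /L2fieldP hv; under eq_fun do rewrite dotvE.
by apply: intg_sum => i; exact: sqint_mul.
Qed.

Lemma L2fieldD u v : L2field u -> L2field v -> L2field (fun x => u x + v x).
Proof.
move=> /L2fieldP hu /L2fieldP hv; apply/L2fieldP => i.
by under eq_fun do rewrite mxE; exact: sqintD.
Qed.

Lemma L2field_mul (h : 'rV[R]_3 -> R) M u : L2field u -> measurable_fun setT h ->
  (forall x, `|h x| <= M) -> L2field (fun x => h x *: u x).
Proof.
move=> /L2fieldP hu mh hM; apply/L2fieldP => i.
by under eq_fun do rewrite mxE; exact: sqint_bounded_mul hM.
Qed.

Lemma L2fieldZ k u : L2field u -> L2field (fun x => k *: u x).
Proof. by move=> hu; apply: (@L2field_mul _ `|k|). Qed.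

Lemma L2fieldN u : L2field u -> L2field (fun x => - u x).
Proof. by move=> /(@L2fieldZ (-1)); under eq_fun do rewrite scaleN1r. Qed.

Lemma L2fieldB u v : L2field u -> L2field v -> L2field (fun x => u x - v x).
Proof. by move=> hu hv; apply: L2fieldD => //; exact: L2fieldN. Qed.

Lemma ipC u v : ip u v = ip v u.
Proof. by apply: eq_Rintegral => x _; rewrite dotvC. Qed.

Lemma ipDl u v w : L2field u -> L2field v -> L2field w ->
  ip (fun x => u x + v x) w = ip u w + ip v w.
Proof.
move=> hu hv hw; rewrite /ip -RintegralD//; [|exact: L2field_dotv..].
by apply: eq_Rintegral => x _; rewrite dotvDl.
Qed.

Lemma ipZl k u v : L2field u -> L2field v ->
  ip (fun x => k *: u x) v = k * ip u v.
Proof.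
move=> hu hv; rewrite /ip -RintegralZl//; last exact: L2field_dotv.
by apply: eq_Rintegral => x _; rewrite dotvZl.
Qed.

Lemma ipNl u v : L2field u -> L2field v -> ip (fun x => - u x) v = - ip u v.
Proof.
move=> hu hv; rewrite -mulN1r -ipZl//.
by under [in RHS]eq_fun do rewrite scaleN1r.
Qed.

Lemma ipBl u v w : L2field u -> L2field v -> L2field w ->
  ip (fun x => u x - v x) w = ip u w - ip v w.
Proof. by move=> hu hv hw; rewrite ipDl ?ipNl//; exact: L2fieldN. Qed.

Lemma ipDr u v w : L2field u -> L2field v -> L2field w ->
  ip w (fun x => u x + v x) = ip w u + ip w v.
Proof. by move=> hu hv hw; rewrite ipC ipDl// !(ipC w). Qed.

Lemma ipZr k u v : L2field u -> L2field v ->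
  ip v (fun x => k *: u x) = k * ip v u.
Proof. by move=> hu hv; rewrite ipC ipZl// ipC. Qed.

Lemma ipBr u v w : L2field u -> L2field v -> L2field w ->
  ip w (fun x => u x - v x) = ip w u - ip w v.
Proof. by move=> hu hv hw; rewrite ipC ipBl// !(ipC w). Qed.

Lemma ipvv_ge0 u : 0 <= ip u u.
Proof. by apply: Rintegral_ge0 => x _; exact: dotvv_ge0. Qed.

Definition nrm u := Num.sqrt (ip u u).

Lemma nrm_ge0 u : 0 <= nrm u. Proof. exact: sqrtr_ge0. Qed.

Lemma nrm_sqr u : nrm u ^+ 2 = ip u u.
Proof. by rewrite sqr_sqrtr ?ipvv_ge0. Qed.

Lemma ip_CS u v : L2field u -> L2field v -> `|ip u v| <= nrm u * nrm v.
Proof.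
move=> hu hv.
rewrite -(ler_pXn2r (n := 2))// ?nnegrE ?mulr_ge0 ?nrm_ge0//.
rewrite exprMn !nrm_sqr real_normK ?num_real//.
have H s t : 0 <= s ^+ 2 * ip u u - (s * t *+ 2) * ip u v + t ^+ 2 * ip v v.
  have := ipvv_ge0 (fun x => s *: u x - t *: v x).
  rewrite ipBl; [|exact: L2fieldZ|exact: L2fieldZ|by apply: L2fieldB; exact: L2fieldZ].
  have hsu : L2field (fun x => s *: u x) by exact: L2fieldZ.
  have htv : L2field (fun x => t *: v x) by exact: L2fieldZ.
  rewrite !ipBr// !ipZl// !ipZr//.
  by rewrite (ipC v u) => h; rewrite (le_trans h)// le_eqVlt; apply/orP; left; apply/eqP; ring.
have u0 := ipvv_ge0 u; have v0 := ipvv_ge0 v.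
have [vv|vv] := eqVneq (ip v v) 0.
  rewrite vv mulr0; rewrite leNgt; apply/negP => uv.
  (* When <v, v> = 0, the quadratic form at these values of s and t equals -<u, v>^2, which
     contradicts its nonnegativity unless <u, v> = 0. *)
  have := H (ip u v) ((ip u u + 1) / 2).
  rewrite vv mulr0 addr0 => h.
  have : ip u v ^+ 2 * (ip u u - (ip u u + 1)) < 0.
    by rewrite opprD addNKr mulrN1 oppr_lt0.
  by rewrite ltNge => /negP; apply; apply: le_trans h _; rewrite le_eqVlt; apply/orP; left; apply/eqP; field.
have v1 : 0 < ip v v by rewrite lt_neqAle eq_sym vv v0.
have := H (ip v v) (ip u v) => h.
by rewrite -(ler_pM2l v1); nra.
Qed.

Lemma nrmD u v : L2field u -> L2field v -> nrm (fun x => u x + v x) <= nrm u + nrm v.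
Proof.
move=> hu hv.
rewrite -(ler_pXn2r (n := 2))// ?nnegrE ?addr_ge0 ?nrm_ge0//.
rewrite sqrrD !nrm_sqr ipDl//; last exact: L2fieldD.
rewrite !ipDr// (ipC v u).
by have := le_trans (ler_norm _) (ip_CS hu hv); lra.
Qed.

Lemma nrmZ k u : L2field u -> nrm (fun x => k *: u x) = `|k| * nrm u.
Proof.
move=> hu; rewrite /nrm ipZl//; last exact: L2fieldZ.
by rewrite ipC ipZl// mulrA -expr2 sqrtrM ?sqr_ge0// sqrtr_sqr.
Qed.

Lemma L2normE u : L2field u -> L2norm u = (nrm u)%:E.
Proof.
move=> hu; rewrite /L2norm unlock /nrm /ip /Rintegral.
under eq_integral do rewrite /= powR_mulrn// -normrX enorm_sqr ger0_norm ?dotvv_ge0//.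
have /fineK <- := integrable_fin_num measurableT (L2field_dotv hu hu).
by rewrite poweR_EFin powR12_sqrt// Rintegral_ge0// => x _; exact: dotvv_ge0.
Qed.

End vector_L2.

(** * Smooth step functions *)

Section smooth1.
Context {R : realType}.
Implicit Types (f g : R -> R) (P : {poly R}).

Lemma is_derive_conv f (x v d d' : R) : is_derive x v f d -> d = d' -> is_derive x v f d'.
Proof. by move=> h <-. Qed.

Lemma near_is_derive f g (x d : R) :
  (\near x, f x = g x) -> is_derive x 1 f d -> is_derive x 1 g d.
Proof. exact: near_eq_is_derive. Qed.

(** Level 0 imposes nothing, not even continuity, so that every closure property is a plain
    induction; continuity is recovered from level 1 in [smoothn1_continuous]. *)
Fixpoint smoothn (n : nat) (f : R -> R) : Prop :=
  if n is n'.+1 then (forall x : R, derivable f x 1) /\ smoothn n' (f^`())%classic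
  else True.

Lemma smoothn_step n f g : (forall x : R, is_derive x 1 f (g x)) -> smoothn n g ->
  smoothn n.+1 f.
Proof.
move=> fg sg; split; first by move=> x; have [] := fg x.
rewrite (_ : (f^`())%classic = g)//; apply/funext => x.
by rewrite derive1E; have [_ ->] := fg x.
Qed.

Lemma smoothn_is_derive n f (x : R) : smoothn n.+1 f -> is_derive x 1 f ((f^`())%classic x).
Proof. by move=> [df _]; rewrite derive1E; exact/derivableP. Qed.

Lemma smoothnW n f : smoothn n.+1 f -> smoothn n f.
Proof. by elim: n f => // n ih f [df sf]; split => //; exact: ih. Qed.

Lemma smoothnD n f g : smoothn n f -> smoothn n g -> smoothn n (fun x => f x + g x).
Proof.
elim: n f g => // n ih f g sf sg.
apply: (@smoothn_step _ _ (fun x => (f^`())%classic x + (g^`())%classic x)).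
  move=> x; have := smoothn_is_derive x sf; have := smoothn_is_derive x sg.
  by move=> hg hf; exact: is_deriveD.
by apply: ih; [exact: sf.2|exact: sg.2].
Qed.

Lemma smoothnM n f g : smoothn n f -> smoothn n g -> smoothn n (fun x => f x * g x).
Proof.
elim: n f g => // n ih f g sf sg.
apply: (@smoothn_step _ _ (fun x => f x * (g^`())%classic x + g x * (f^`())%classic x)).
  move=> x; have := smoothn_is_derive x sf; have := smoothn_is_derive x sg.
  by move=> hg hf; exact: is_deriveM.
apply: smoothnD; apply: ih; [exact: smoothnW|exact: sg.2|exact: smoothnW|exact: sf.2].
Qed.

Lemma smoothn_cst n (c : R) : smoothn n (fun=> c).
Proof.
by elim: n c => // n ih c; apply: (@smoothn_step _ _ (fun=> 0)).
Qed.

Lemma smoothnV n f : (forall x, f x != 0) -> smoothn n f -> smoothn n (fun x => (f x)^-1).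
Proof.
move=> f0; elim: n => // n ih sf.
apply: (@smoothn_step _ _ (fun x => - 1 * ((f x)^-1 * (f x)^-1) * (f^`())%classic x)).
  move=> x; have h := smoothn_is_derive x sf.
  apply: (is_derive_conv (is_deriveV (f0 x) h)).
  by rewrite /GRing.scale/= mulN1r expr2 invfM.
have sfV := ih (smoothnW sf).
by apply: smoothnM; [apply: smoothnM; [exact: smoothn_cst|exact: smoothnM]|exact: sf.2].
Qed.

Lemma is_derive_affine (a c x : R) : is_derive x 1 (fun x => a * x + c) a.
Proof.
apply: (is_derive_conv (is_deriveD (is_deriveZ a (is_derive_id x 1)) (is_derive_cst c x 1))).
by rewrite addr0 /GRing.scale/= mulr1.
Qed.

Lemma smoothn_affine n f (a c : R) : smoothn n f -> smoothn n (fun x => f (a * x + c)).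
Proof.
elim: n f => // n ih f sf.
apply: (@smoothn_step _ _ (fun x => a * (f^`())%classic (a * x + c))).
  move=> x; have h := smoothn_is_derive (a * x + c) sf.
  have := @is_derive1_comp _ f (fun x => a * x + c) x _ _ h (is_derive_affine a c x).
  by rewrite mulrC.
by apply: smoothnM; [exact: smoothn_cst|apply: ih; exact: sf.2].
Qed.

(** The family P(1/x) e^{-1/x}, extended by 0, is closed under differentiation, with P replaced by
    X^2 (P - P'). Smoothness of every order then follows from one induction over all P. *)
Definition gexp P (x : R) : R := if x <= 0 then 0 else P.[x^-1] * expR (- x^-1).

Lemma pow_le_expR n (s : R) : 0 <= s -> s ^+ n <= n%:R ^+ n * expR s.
Proof.
move=> s0; case: n => [|n]; first by rewrite !expr0 mul1r; rewrite -expR0 ler_expR.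
have n0 : (0 < n.+1%:R :> R) by [].
rewrite [in expR _](_ : s = n.+1%:R * (s / n.+1%:R)); last by rewrite mulrC divfK ?gt_eqF.
rewrite expRM_natl -exprMn ler_pXn2r ?nnegrE ?mulr_ge0 ?expR_ge0//.
rewrite -ler_pdivrMl// mulrC.
by rewrite (le_trans _ (expR_ge1Dx _))// lerDr.
Qed.

Lemma horner_le_expR P : exists C, 0 <= C /\ forall s, 0 <= s -> `|P.[s]| <= C * expR s.
Proof.
exists (\sum_(i < size P) `|P`_i| * i%:R ^+ i); split.
  by apply: sumr_ge0 => i _; rewrite mulr_ge0// exprn_ge0.
move=> s s0; rewrite horner_coef (le_trans (ler_norm_sum _ _ _))// mulr_suml.
apply: ler_sum => i _; rewrite normrM -mulrA ler_wpM2l// ger0_norm ?exprn_ge0//.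
exact: pow_le_expR.
Qed.

(** The exponential dominates X^2 P at the point 1/x. The quadratic bound makes the difference
    quotient at 0 tend to 0. *)
Lemma gexp_bound P : exists C, 0 <= C /\ forall x, `|gexp P x| <= C * x ^+ 2.
Proof.
have [C [C0 hC]] := horner_le_expR ('X^2 * P); exists C; split => // x.
rewrite /gexp; case: ifPn => [_|]; first by rewrite normr0 mulr_ge0 ?sqr_ge0.
rewrite -ltNge => x0; rewrite normrM (ger0_norm (expR_ge0 _)) expRN.
rewrite ler_pdivrMr ?expR_gt0// -mulrA (mulrC (x ^+ 2)) mulrA.
rewrite -ler_pdivrMr ?exprn_gt0//.
have := hC x^-1; rewrite invr_ge0 (ltW x0) => /(_ isT).
have xV0 : 0 <= x^-1 by rewrite invr_ge0 ltW.
by rewrite hornerM hornerXn normrM ger0_norm ?exprn_ge0// exprVn mulrC.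
Qed.

Lemma is_derive_gexp P (x : R) : is_derive x 1 (gexp P) (gexp ('X^2 * (P - P^`())) x).
Proof.
have [x0|x0|x0] := ltgtP x 0.
- rewrite {2}/gexp (ltW x0).
  apply: (@near_is_derive (cst 0)).
    near=> y; rewrite /gexp ifT//; near: y.
    by apply: filterS (lt_nbhsl x0) => y /ltW.
- rewrite {2}/gexp leNgt x0/=.
  apply: (@near_is_derive (fun y => P.[y^-1] * expR (- y^-1))).
    by apply: filterS (lt_nbhsr x0) => y y0; rewrite /gexp leNgt y0.
  have xn0 : x != 0 by rewrite gt_eqF.
  have hV : is_derive x 1 (fun y : R => y^-1) (- x ^- 2).
    apply: (is_derive_conv (is_deriveV xn0 (is_derive_id x 1))).
    by rewrite /GRing.scale/= mulr1.
  have hP : is_derive x 1 (fun y => P.[y^-1]) ((P^`()).[x^-1] * - x ^- 2).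
    exact: (@is_derive1_comp _ (horner P) (fun y => y^-1)).
  have hE : is_derive x 1 (fun y => expR (- y^-1)) (expR (- x^-1) * x ^- 2).
    apply: (@is_derive1_comp _ (@expR R) (fun y => - y^-1)).
    by have := is_deriveN hV; rewrite opprK.
  apply: (is_derive_conv (is_deriveM hP hE)).
  rewrite /GRing.scale/= hornerM hornerXn hornerD hornerN exprVn.
  ring.
- rewrite x0; have [C [C0 hC]] := gexp_bound P.
  have H : (fun h : R => h^-1 *: ((gexp P \o shift 0) (h *: 1) - gexp P 0)) @ 0^' --> (0 : R).
    apply/cvgr0Pnorm_le => e e0; near=> h.
    rewrite /= addr0 [X in _ - X]/gexp lexx subr0 {1}/GRing.scale/= normrM.
    have h0 : h != 0 by near: h; exact: nbhs_dnbhs_neq.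
    rewrite normfV ler_pdivrMl ?normr_gt0// (le_trans (hC _))//.
    rewrite [h *: 1]/GRing.scale/= mulr1 -(real_normK (num_real h)).
    have : `|h| <= e / (C + 1) by near: h; apply: dnbhs0_le; rewrite divr_gt0// ltr_wpDl.
    rewrite ler_pdivlMr ?ltr_wpDl// => he.
    have hh := normr_ge0 h; rewrite expr2 mulrCA ler_wpM2l//; nra.
  have -> : gexp ('X^2 * (P - P^`())) 0 = 0 by rewrite /gexp lexx.
  apply: DeriveDef; first by apply/cvg_ex; exists 0.
  exact: cvg_lim H.
Unshelve. all: by end_near.
Qed.

Lemma gexp_smooth n P : smoothn n (gexp P).
Proof.
elim: n P => // n ih P.
by apply: (smoothn_step (is_derive_gexp P)); exact: ih.
Qed.

Let G := gexp 1.

Let G_gt0 t : 0 < t -> 0 < G t.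
Proof. by move=> t0; rewrite /G /gexp leNgt t0/= hornerC mul1r expR_gt0. Qed.

Let G_ge0 t : 0 <= G t.
Proof.
have [t0|/G_gt0/ltW//] := leP t 0.
by rewrite /G /gexp t0.
Qed.

Let G_le0 t : t <= 0 -> G t = 0.
Proof. by rewrite /G /gexp => ->. Qed.

Let dG t : 0 <= (G^`())%classic t.
Proof.
rewrite derive1E; have [_ ->] := is_derive_gexp 1 t.
rewrite /gexp; case: ifPn => // _; rewrite derivC subr0 mulr1 hornerXn.
by rewrite mulr_ge0 ?sqr_ge0 ?expR_ge0.
Qed.

Definition sstep (t : R) : R := G t / (G t + G (1 - t)).

Let den_gt0 t : 0 < G t + G (1 - t).
Proof.
have [t0|t0] := ltP 0 t; first by rewrite ltr_wpDr ?G_gt0 ?G_ge0.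
by rewrite ltr_wpDl ?G_ge0// G_gt0//; lra.
Qed.

Lemma sstep_smooth n : smoothn n sstep.
Proof.
apply: smoothnM; first exact: gexp_smooth.
apply: smoothnV => [x|]; first by rewrite gt_eqF.
apply: smoothnD; first exact: gexp_smooth.
have := @smoothn_affine n G (-1) 1 (gexp_smooth n 1).
by under eq_fun do rewrite mulN1r addrC.
Qed.

Lemma sstep_le0 t : t <= 0 -> sstep t = 0.
Proof. by move=> t0; rewrite /sstep G_le0// mul0r. Qed.

Lemma sstep_ge1 t : 1 <= t -> sstep t = 1.
Proof.
move=> t0; rewrite /sstep (_ : G (1 - t) = 0) ?addr0 ?divff//.
  by rewrite gt_eqF// G_gt0//; lra.
by rewrite G_le0//; lra.
Qed.

Lemma sstep_ge0 t : 0 <= sstep t.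
Proof. by rewrite divr_ge0 ?G_ge0// ltW. Qed.

Lemma sstep_le1 t : sstep t <= 1.
Proof. by rewrite ler_pdivrMr// mul1r lerDl. Qed.

(** The mollifier profile is taken to be a derivative: its integrals are then exact differences of
    values of [sstep], and its mass is 1 without a normalising constant. *)
Definition sbump : R -> R := (sstep^`())%classic.

Lemma is_derive_sstep (t : R) : is_derive t 1 sstep (sbump t).
Proof. exact: (smoothn_is_derive t (sstep_smooth 1)). Qed.

Lemma sbump_smooth n : smoothn n sbump.
Proof. exact: (sstep_smooth n.+1).2. Qed.

Lemma smoothn1_continuous f : smoothn 1 f -> continuous f.
Proof.
by move=> [df _] x; apply/differentiable_continuous/derivable1_diffP.
Qed.

Lemma sbump_out t : t < 0 \/ 1 < t -> sbump t = 0.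
Proof.
suff : is_derive t 1 sstep 0 -> sbump t = 0.
  move=> h [t0|t1]; apply: h.
    apply: (@near_is_derive (cst 0)).
    by apply: filterS (lt_nbhsl t0) => y /ltW/sstep_le0.
  apply: (@near_is_derive (cst 1)).
  by apply: filterS (lt_nbhsr t1) => y /ltW/sstep_ge1.
by move=> [_ h]; rewrite /sbump derive1E.
Qed.

(** By the quotient rule the numerator is G'(t) G(1 - t) + G(t) G'(1 - t), and each factor is
    nonnegative. *)
Lemma sbump_ge0 t : 0 <= sbump t.
Proof.
have hG := smoothn_is_derive t (gexp_smooth 1 1).
have h1 : is_derive t 1 (fun t => 1 - t) (-1 : R).
  rewrite (_ : (fun t => 1 - t) = (fun t => -1 * t + 1)); first exact: is_derive_affine.
  by apply/funext => s; rewrite mulN1r addrC.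
have hG1 : is_derive t 1 (fun t => G (1 - t)) (- (G^`())%classic (1 - t)).
  have hG' := smoothn_is_derive (1 - t) (gexp_smooth 1 1).
  by apply: (is_derive_conv (@is_derive1_comp _ G (fun t => 1 - t) t _ _ hG' h1)); rewrite mulrN1.
have dn0 : G t + G (1 - t) != 0 by rewrite gt_eqF.
have := is_deriveM hG (@is_deriveV _ (fun t => G t + G (1 - t)) t _ 1 dn0 (is_deriveD hG hG1)).
move=> h; have [_ E] := (h : is_derive t 1 sstep _); rewrite /sbump derive1E E.
rewrite /GRing.scale/=.
have -> : forall a b c e : R, c != 0 -> a * (- c ^- 2 * e) + c^-1 * b = (b * c - a * e) / c ^+ 2.
  by move=> a b c e c0; field.
- rewrite divr_ge0 ?sqr_ge0// -/G.
  move: (dG t) (dG (1 - t)) (G_ge0 t) (G_ge0 (1 - t)).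
  move: ((G^`())%classic t) ((G^`())%classic (1 - t)) (G t) (G (1 - t)) => x y z w x0 y0 z0 w0.
  by rewrite (_ : _ - _ = x * w + z * y); [rewrite addr_ge0 ?mulr_ge0|ring].
- by [].
Qed.

(** The sign e covers both t - x and x - t, since the kernels are integrated in either variable. *)
Lemma integral_sbump (n : nat) (x a b e : R) : e * e = 1 -> a < b ->
  (\int[lebesgue_measure]_(t in `]a, b]) (n%:R * sbump (n%:R * (e * (t - x))))%:E =
   (e * (sstep (n%:R * (e * (b - x))) - sstep (n%:R * (e * (a - x)))))%:E)%E.
Proof.
move=> ee ab.
have fE (g : R -> R) : (fun t => g (n%:R * (e * (t - x)))) =
    (fun t => g ((n%:R * e) * t + n%:R * e * - x)).
  by apply/funext => t; congr g; ring.
have hd (t : R) : is_derive t 1 (fun t => e * sstep (n%:R * (e * (t - x)))) (n%:R * sbump (n%:R * (e * (t - x)))).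
  rewrite (_ : (fun t => _) = (fun t => e * sstep ((n%:R * e) * t + n%:R * e * - x))); last first.
    by apply/funext => u; congr (e * sstep _); ring.
  apply: (is_derive_conv (is_deriveZ e (@is_derive1_comp _ sstep _ t _ _ (is_derive_sstep _) (is_derive_affine _ _ t)))).
  rewrite /GRing.scale/= (_ : n%:R * e * t + _ = n%:R * (e * (t - x))); last by ring.
  by set S := sbump _; transitivity ((e * e) * (n%:R * S)); [ring|rewrite ee mul1r].
have cF : continuous (fun t => e * sstep (n%:R * (e * (t - x)))).
  by move=> t; apply/differentiable_continuous/derivable1_diffP; have [] := hd t.
have cf : continuous (fun t => n%:R * sbump (n%:R * (e * (t - x)))).
  apply: smoothn1_continuous; apply: smoothnM; first exact: smoothn_cst.
  by rewrite fE; apply: smoothn_affine; exact: sbump_smooth.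
rewrite integral_itv_obnd_cbnd; last first.
  apply/measurable_EFinP; apply: measurable_funTS; exact: continuous_measurable_fun.
rewrite (@continuous_FTC2 _ _ (fun t => e * sstep (n%:R * (e * (t - x)))))//.
- by rewrite -EFinB -mulrBr.
- exact: continuous_subspaceT.
- by split => [t _||]; [have [] := hd t|apply: cvg_at_right_filter; exact: cF|apply: cvg_at_left_filter; exact: cF].
- by move=> t _; rewrite derive1E; have [_ ->] := hd t.
Qed.

Lemma integral_sbumpT (n : nat) (x e : R) : (0 < n)%N -> e = 1 \/ e = -1 ->
  (\int[lebesgue_measure]_t (n%:R * sbump (n%:R * (e * (t - x))))%:E = 1)%E.
Proof.
move=> n0 he; have n1 : 1 <= n%:R :> R by rewrite ler1n.
have -> : (\int[lebesgue_measure]_t (n%:R * sbump (n%:R * (e * (t - x))))%:E =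
    \int[lebesgue_measure]_(t in `](x - 2)%R, (x + 2)%R])
      (n%:R * sbump (n%:R * (e * (t - x))))%:E)%E.
  rewrite [RHS]integral_mkcond; apply: eq_integral => t _.
  rewrite patchE; case: ifPn => //; rewrite notin_setE /= in_itv/= => /negP.
  rewrite negb_and -!leNgt -ltNge => ht; rewrite sbump_out ?mulr0//.
  have {ht} : t - x <= -2 \/ 2 < t - x by case/orP: ht => h; [left|right]; lra.
  by case: he => ->; case => h; [left|right|right|left]; nra.
rewrite integral_sbump; last 2 first.
- by case: he => ->; lra.
- lra.
congr EFin; case: he => ->.
  by rewrite sstep_ge1; [rewrite sstep_le0; [ring|nra]|nra].
by rewrite sstep_le0; [rewrite sstep_ge1; [ring|nra]|nra].
Qed.

End smooth1.

Global Opaque sstep sbump.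

(** * Mollification and symmetry of the weak curl *)

Section Rfubini.
Context d1 d2 (T1 : measurableType d1) (T2 : measurableType d2) (R : realType).
Variables (m1 : {sigma_finite_measure set T1 -> \bar R})
          (m2 : {sigma_finite_measure set T2 -> \bar R}).
Variable F : T1 * T2 -> R.
Hypothesis iF : (m1 \x m2)%E.-integrable setT (EFin \o F).

Lemma Rfubini1 : Rintegral (m1 \x m2)%E setT F =
  \int[m1]_x (\int[m2]_y (F (x, y))).
Proof.
rewrite /Rintegral -(integral12_prod_meas1 iF); congr fine.
apply: ae_eq_integral => //.
- exact: measurable_fubini_F iF.
- apply/measurable_EFinP; apply: (measurableT_comp (fine_measurable measurableT)).
  exact: measurable_fubini_F iF.
- have := ae_integrable1 iF; apply: filterS => x ix _.
  by rewrite fineK//; exact: integrable_fin_num.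
Qed.

Lemma Rfubini2 : Rintegral (m1 \x m2)%E setT F =
  \int[m2]_y (\int[m1]_x (F (x, y))).
Proof.
rewrite /Rintegral -(integral21_prod_meas1 iF); congr fine.
apply: ae_eq_integral => //.
- exact: measurable_fubini_G iF.
- apply/measurable_EFinP; apply: (measurableT_comp (fine_measurable measurableT)).
  exact: measurable_fubini_G iF.
- have := ae_integrable2 iF; apply: filterS => x ix _.
  by rewrite fineK//; exact: integrable_fin_num.
Qed.

Lemma intg_fubini1 : m1.-integrable setT (EFin \o (fun x => \int[m2]_y (F (x, y)))).
Proof.
have /integrableP[m h] := integrable_fubini_F iF.
apply: (@intg_ae_eq _ _ _ m1 (fun x => fine (fubini_F m2 (EFin \o F) x))).
- by apply: (measurableT_comp (fine_measurable measurableT)); exact: measurable_fubini_F iF.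
- exact: nearW.
- apply/integrableP; split.
    by apply/measurable_EFinP; apply: (measurableT_comp (fine_measurable measurableT)).
  apply: le_lt_trans h; apply: ge0_le_integral => //.
  + by apply: measurableT_comp => //; apply/measurable_EFinP; exact: (measurableT_comp (fine_measurable measurableT)).
  + exact: measurableT_comp.
  + by move=> x _ /=; case: (fubini_F _ _ _) => //= ; rewrite normr0 leey.
Qed.

End Rfubini.

(** * Schur's test for integral kernels *)

Section schur.
Context {R : realType}.
Notation rV3 := 'rV[R]_3.
Notation leb3 := (@leb3 R).
Notation leb := (@lebesgue_measure R).
Notation intg f := (leb3.-integrable setT (EFin \o f)).
Notation L2 f := (sqint leb3 f).
Implicit Types (K : rV3 * rV3 -> R) (p q : rV3 -> R).

(** Pointwise |p q| <= l p^2 + q^2 / l; each square is then integrated against K, first in the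
    variable on which it does not depend. The free parameter l takes the place of a product of
    norms. *)
Lemma schur_bound K c p q (l : R) : measurable_fun setT K -> (forall z, 0 <= K z) ->
  (forall x, \int[leb3]_y (K (x, y))%:E <= c%:E)%E ->
  (forall y, \int[leb3]_x (K (x, y))%:E <= c%:E)%E ->
  0 < l -> L2 p -> L2 q ->
  (\int[leb3]_x \int[leb3]_y `|(K (x, y) * p x * q y)%:E| <=
   (c * (l * \int[leb3]_x (p x ^+ 2) + l^-1 * \int[leb3]_x (q x ^+ 2)))%:E)%E.
Proof.
move=> mK K0 Kx Ky l0 [mp ip] [mq iq].
have mp1 : measurable_fun setT (fun z : rV3 * rV3 => p z.1) by exact: measurableT_comp.
have mq2 : measurable_fun setT (fun z : rV3 * rV3 => q z.2) by exact: measurableT_comp.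
have mKp : measurable_fun setT (fun z : rV3 * rV3 => (K z * (l * p z.1 ^+ 2))%:E).
  by apply/measurable_EFinP; apply: measurable_funM => //; apply: measurable_funM => //; exact: measurable_funX.
have mKq : measurable_fun setT (fun z : rV3 * rV3 => (K z * (l^-1 * q z.2 ^+ 2))%:E).
  by apply/measurable_EFinP; apply: measurable_funM => //; apply: measurable_funM => //; exact: measurable_funX.
have mKpq : measurable_fun setT (fun z : rV3 * rV3 => `|(K z * p z.1 * q z.2)%:E|%E).
  apply: measurableT_comp => //; apply/measurable_EFinP.
  by apply: measurable_funM => //; exact: measurable_funM.
have c0 : 0 <= c.
  by rewrite -lee_fin; apply: le_trans (Kx 0); apply: integral_ge0 => y _; rewrite lee_fin.
have lV : 0 < l^-1 by rewrite invr_gt0.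
have Kp0 z : (0 <= (K z * (l * p z.1 ^+ 2))%:E)%E.
  by rewrite lee_fin mulr_ge0// mulr_ge0 ?sqr_ge0// ltW.
have Kq0 z : (0 <= (K z * (l^-1 * q z.2 ^+ 2))%:E)%E.
  by rewrite lee_fin mulr_ge0// mulr_ge0 ?sqr_ge0// ltW.
rewrite -(fubini_tonelli1 (fun z : rV3 * rV3 => `|(K z * p z.1 * q z.2)%:E|%E))//.
apply: (@le_trans _ _ (\int[leb3 \x leb3]_z ((K z * (l * p z.1 ^+ 2))%:E + (K z * (l^-1 * q z.2 ^+ 2))%:E))%E).
  apply: ge0_le_integral => //.
  - exact: emeasurable_funD.
  - move=> [x y] _ /=; rewrite lee_fin -mulrDr -mulrA normrM ger0_norm//.
    rewrite ler_wpM2l// normrM.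
    have := mulr_ge0 (ltW lV) (sqr_ge0 (l * `|p x| - `|q y|)).
    rewrite sqrrB !exprMn !real_normK ?num_real//.
    have h1 : l^-1 * (l * l) = l by rewrite mulrA mulVf ?mul1r// gt_eqF.
    have h2 : l^-1 * (l * `|p x| * `|q y|) = `|p x| * `|q y| by field; rewrite gt_eqF.
    rewrite mulrDr mulrBr mulrA (expr2 l) h1 mulrnAr h2 mulr2n => h3.
    have h4 : 0 <= `|p x| * `|q y| by rewrite mulr_ge0.
    by lra.
rewrite ge0_integralD// fubini_tonelli1// fubini_tonelli2// mulrDr EFinD.
have Hp (g : rV3 -> R) (r : R) : 0 <= r -> intg g -> (forall x, 0 <= g x) ->
    (\int[leb3]_x ((c * (r * g x))%:E) = (c * (r * \int[leb3]_x g x))%:E)%E.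
  move=> r0 ig g0; rewrite !mulrA.
  under eq_integral do rewrite mulrA EFinM.
  by rewrite integralZl// EFinM /Rintegral fineK//; exact: integrable_fin_num.
apply: leeD.
  rewrite -Hp//; [|exact: ltW|by move=> x; rewrite sqr_ge0].
  apply: ge0_le_integral => //.
  + by move=> x _; apply: integral_ge0 => y _; exact: Kp0.
  + exact: measurable_fun_fubini_tonelli_F.
  + apply/measurable_EFinP; apply: measurable_funM => //; apply: measurable_funM => //.
    exact: measurable_funX.
  + move=> x _; rewrite /fubini_F/=; under eq_integral do rewrite EFinM.
    rewrite ge0_integralZr//; last 3 first.
    * by apply/measurable_EFinP; exact: (measurableT_comp mK).
    * by move=> y _; rewrite lee_fin.
    * by rewrite lee_fin mulr_ge0 ?sqr_ge0// ltW.
    by rewrite [leRHS]EFinM lee_wpmul2r// lee_fin mulr_ge0 ?sqr_ge0// ltW.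
rewrite -Hp//; [|exact: ltW|by move=> x; rewrite sqr_ge0].
apply: ge0_le_integral => //.
+ by move=> x _; apply: integral_ge0 => y _; exact: Kq0.
+ exact: measurable_fun_fubini_tonelli_G.
+ apply/measurable_EFinP; apply: measurable_funM => //; apply: measurable_funM => //.
  exact: measurable_funX.
+ move=> y _; rewrite /fubini_G/=; under eq_integral do rewrite EFinM.
  rewrite ge0_integralZr//; last 3 first.
  * by apply/measurable_EFinP; exact: (measurableT_comp mK).
  * by move=> x _; rewrite lee_fin.
  * by rewrite lee_fin mulr_ge0 ?sqr_ge0// ltW.
  by rewrite [leRHS]EFinM lee_wpmul2r// lee_fin mulr_ge0 ?sqr_ge0// ltW.
Qed.

Lemma schur_integrable K c p q : measurable_fun setT K -> (forall z, 0 <= K z) ->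
  (forall x, \int[leb3]_y (K (x, y))%:E <= c%:E)%E ->
  (forall y, \int[leb3]_x (K (x, y))%:E <= c%:E)%E ->
  L2 p -> L2 q ->
  (leb3 \x leb3)%E.-integrable setT (EFin \o (fun z => K z * p z.1 * q z.2)).
Proof.
move=> mK K0 Kx Ky hp hq; apply/integrable12ltyP.
  apply/measurable_EFinP; apply: measurable_funM.
    by apply: measurable_funM => //; apply: (measurableT_comp hp.1).
  exact: (measurableT_comp hq.1).
by apply: le_lt_trans (schur_bound mK K0 Kx Ky ltr01 hp hq) _; rewrite ltry.
Qed.

Definition dbl K p q : R := Rintegral (leb3 \x leb3)%E setT (fun z => K z * p z.1 * q z.2).

Lemma dbl_bound K c p q (l : R) : measurable_fun setT K -> (forall z, 0 <= K z) ->
  (forall x, \int[leb3]_y (K (x, y))%:E <= c%:E)%E ->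
  (forall y, \int[leb3]_x (K (x, y))%:E <= c%:E)%E ->
  0 < l -> L2 p -> L2 q ->
  `|dbl K p q| <= c * (l * \int[leb3]_x (p x ^+ 2) + l^-1 * \int[leb3]_x (q x ^+ 2)).
Proof.
move=> mK K0 Kx Ky l0 hp hq.
have h := schur_integrable mK K0 Kx Ky hp hq.
have [mh _] := integrableP _ _ _ h.
rewrite -lee_fin EFin_normr_Rintegral//.
apply: le_trans (le_abse_integral _ _ _) _ => //.
have mh' : measurable_fun setT (fun z : rV3 * rV3 => `|(K z * p z.1 * q z.2)%:E|%E).
  exact: measurableT_comp.
rewrite (fubini_tonelli1 (fun z : rV3 * rV3 => `|(K z * p z.1 * q z.2)%:E|%E) mh').
  exact: (schur_bound mK K0 Kx Ky l0 hp hq).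
by move=> z; exact: abse_ge0.
Qed.

End schur.

Lemma I3E : ((((0 + 1)%R : 'I_3) = 1%R) * (((0 + 2)%R : 'I_3) = 2%R) * (((1 + 1)%R : 'I_3) = 2%R) * (((1 + 2)%R : 'I_3) = 0%R) * (((2 + 1)%R : 'I_3) = 0%R) * (((2 + 2)%R : 'I_3) = 1%R))%type.
Proof. by do !split; exact: val_inj. Qed.

Lemma I3ne : ((((0%R : 'I_3) == 1%R) = false) * (((0%R : 'I_3) == 2%R) = false) * (((1%R : 'I_3) == 0%R) = false) * (((1%R : 'I_3) == 2%R) = false) * (((2%R : 'I_3) == 0%R) = false) * (((2%R : 'I_3) == 1%R) = false))%type.
Proof. by []. Qed.

(** * Functions of product form and their use as test fields *)

Section prodf.
Context {R : realType}.
Notation rV3 := 'rV[R]_3.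
Implicit Types h : 'I_3 -> R -> R.

Lemma prod3E (F : 'I_3 -> R) : \prod_i F i = F 0 * F 1 * F 2.
Proof.
rewrite !big_ord_recl big_ord0 mulr1 mulrA; congr (F _ * F _ * F _);
  exact: val_inj.
Qed.

Definition prodf h (x : rV3) : R := h 0 (x 0 0) * h 1 (x 0 1) * h 2 (x 0 2).

Lemma updE (i : 'I_3) (t : R) (x : rV3) : x + t *: delta_mx 0 i = upd i (x 0 i + t) x.
Proof.
by apply/rowP => j; rewrite !mxE eqxx/=; case: eqP => [->|_]; rewrite ?mulr1 ?mulr0 ?addr0.
Qed.

Lemma is_derive_line (f : rV3 -> R) (x : rV3) i (F : R -> R) (d : R) :
  (forall t, f (upd i t x) = F t) -> is_derive (x 0 i) 1 F d ->
  is_derive x (delta_mx 0 i) f d.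
Proof.
move=> fF [dF dE].
have E : (fun h : R => h^-1 *: ((f \o shift x) (h *: delta_mx 0 i) - f x)) =
    (fun h : R => h^-1 *: ((F \o shift (x 0 i)) (h *: 1) - F (x 0 i))).
  apply/funext => h /=; rewrite [h *: delta_mx 0 i + x]addrC updE fF.
  have {2}-> : x = upd i (x 0 i) x.
    by apply/rowP => j; rewrite !mxE; case: eqP => [->|].
  by rewrite fF [h *: 1 + _]addrC /GRing.scale/= mulr1.
by apply: DeriveDef; [rewrite /derivable E|rewrite /derive E].
Qed.

(** Differentiating in direction l changes only the factor l, so partial derivatives stay in product
    form and all orders follow by induction. *)
Definition dh h (l : 'I_3) : 'I_3 -> R -> R :=
  fun j => if j == l then (h j)^`()%classic else h j.

Lemma prodf_derive h l x : (forall i, smoothn 1 (h i)) ->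
  is_derive x (delta_mx 0 l) (prodf h) (prodf (dh h l) x).
Proof.
move=> sh.
pose c := \prod_(j | j != l) h j (x 0 j).
have E (g : R -> R) t : prodf (fun j => if j == l then g else h j) (upd l t x) = c * g t.
  rewrite /c; move: l {c}; apply: forall_I3; rewrite /prodf !mxE/=
    big_mkcond/= prod3E/=; ring.
apply: (@is_derive_line _ _ _ (fun t => c * h l t)).
  move=> t; rewrite -E; congr prodf; apply/funext => j; by case: eqP => [->|].
have -> : prodf (dh h l) x = c * (h l)^`()%classic (x 0 l).
  rewrite -E; have -> : upd l (x 0 l) x = x.
    by apply/rowP => j; rewrite !mxE; case: eqP => [->|].
  by congr prodf; apply/funext => j; rewrite /dh; case: eqP => [->|].
exact: (is_deriveZ c (smoothn_is_derive (x 0 l) (sh l))).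
Qed.

Lemma coord_cont (i : 'I_3) : continuous (fun x : rV3 => x 0 i).
Proof. exact: coord_continuous. Qed.

Lemma prodf_continuous h : (forall i, continuous (h i)) -> continuous (prodf h).
Proof.
move=> ch.
have c i : continuous (fun x : rV3 => h i (x 0 i)).
  by move=> x; exact: (@continuous_comp _ _ _ (fun x : rV3 => x 0 i) (h i) x (@coord_cont i x) (ch i _)).
move=> x; apply: (@continuousM _ _ (fun x : rV3 => h 0 (x 0 0) * h 1 (x 0 1)) (fun x : rV3 => h 2 (x 0 2)) x).
  exact: (@continuousM _ _ (fun x : rV3 => h 0 (x 0 0)) (fun x : rV3 => h 1 (x 0 1)) x (c 0 x) (c 1 x)).
exact: c.
Qed.

Lemma prodf_Ck k h : (forall i n, smoothn n (h i)) -> Ck k (prodf h).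
Proof.
elim: k h => [|k ih] h sh /=.
  by apply: prodf_continuous => i; exact: smoothn1_continuous.
split; first by apply: prodf_continuous => i; exact: smoothn1_continuous.
move=> i; split.
  by move=> x; have [] := prodf_derive i x (fun j => sh j 1).
have -> : partial i (prodf h) = prodf (dh h i).
  by apply/funext => x; have [_ E] := prodf_derive i x (fun j => sh j 1); exact: E.
by apply: ih => j n; rewrite /dh; case: eqP => _ //; exact: (sh j n.+1).2.
Qed.

Lemma Ck_mulr k (c : R) f : Ck k f -> Ck k (fun x : rV3 => f x * c).
Proof.
elim: k f => [|k ih] f /=.
  by move=> cf x; exact: (@continuousM _ _ f (cst c) x (cf x) (@cst_continuous _ _ c x)).
move=> [cf df]; split; first by move=> x; exact: (@continuousM _ _ f (cst c) x (cf x) (@cst_continuous _ _ c x)).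
move=> i; have [dfi Cfi] := df i; split.
  by move=> x; apply: derivableM => //; exact: dfi.
have -> : partial i (fun x => f x * c) = (fun x => partial i f x * c).
  by apply/funext => x; rewrite /partial deriveMr// /GRing.scale/= mulrC.
exact: ih.
Qed.

Lemma test_prodf h j M : (forall i n, smoothn n (h i)) ->
  (forall i t, M < `|t| -> h i t = 0) ->
  test_field (fun x => prodf h x *: delta_mx 0 j).
Proof.
move=> sh hM; split.
  move=> k i; under eq_fun do rewrite !mxE.
  by apply: Ck_mulr; exact: prodf_Ck.
have cbox : compact [set v : rV3 | forall i, `[- M, M]%classic (v 0 i)].
  by apply: (@rV_compact _ _ (fun=> `[- M, M]%classic)) => i; exact: segment_compact.
apply: (subclosed_compact (@closed_closure _ _) cbox).
have /closure_id -> : closed [set v : rV3 | forall i, `[- M, M]%classic (v 0 i)].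
  by apply: compact_closed => //; exact: norm_hausdorff.
apply: closure_subset => x /= /eqP x0 i; rewrite in_itv/= -ler_norml leNgt.
apply/negP => xi; apply: x0.
suff -> : prodf h x = 0 by rewrite scale0r.
move: i xi; apply: forall_I3 => /(hM _) h0; rewrite /prodf h0; ring.
Qed.

Lemma dotv_curl_prodf h j x w : (forall i, smoothn 1 (h i)) ->
  dotv w (curl (fun x => prodf h x *: delta_mx 0 j) x) =
  w 0 (j + 1) * prodf (dh h (j + 2)) x - w 0 (j + 2) * prodf (dh h (j + 1)) x.
Proof.
move=> sh.
have P l i : partial l (fun y => (prodf h y *: delta_mx 0 j : rV3) 0 i) x =
    (i == j)%:R * prodf (dh h l) x.
  have [dP eP] := prodf_derive l x sh.
  rewrite /partial; under eq_fun do rewrite !mxE eqxx/=.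
  by rewrite deriveMr// eP.
rewrite dotvE sum3E !mxE !P.
move: j {P}; apply: forall_I3; rewrite /=;
  rewrite ?I3E /= ?I3ne; ring.
Qed.

End prodf.

Section kernels.
Context {R : realType}.
Notation rV3 := 'rV[R]_3.
Notation mR := (measurableTypeR R).
Notation leb3 := (@leb3 R).
Notation leb := (@lebesgue_measure R).
Notation intg f := (leb3.-integrable setT (EFin \o f)).
Notation L2 f := (sqint leb3 f).
Implicit Types (k : 'I_3 -> R -> R) (p q : rV3 -> R) (K : rV3 * rV3 -> R).

Definition kern k (z : rV3 * rV3) : R := prodf k (z.1 - z.2).

Lemma measurable_kern k : (forall i, measurable_fun setT (k i)) ->
  measurable_fun setT (kern k).
Proof.
move=> mk.
have c i : measurable_fun setT (fun z : rV3 * rV3 => k i ((z.1 - z.2) 0 i)).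
  apply: (measurableT_comp (mk i)).
  under eq_fun do rewrite !mxE.
  apply: measurable_funB; apply: (measurableT_comp (@measurable_coord R 3 i));
    [exact: measurable_fst|exact: measurable_snd].
by apply: measurable_funM => //; apply: measurable_funM.
Qed.

Lemma kern_int2 k x : (forall i, measurable_fun setT (k i)) ->
  (forall i t, 0 <= k i t) ->
  (\int[leb3]_y (kern k (x, y))%:E =
   (\int[leb]_t (k 0%R (x 0%R 0%R - t)%R)%:E) * (\int[leb]_t (k 1%R (x 0%R 1%R - t)%R)%:E)
   * (\int[leb]_t (k 2%R (x 0%R 2%R - t)%R)%:E))%E.
Proof.
move=> mk k0; rewrite -(@integral_leb3_prod R (fun i t => k i (x 0 i - t)))//.
  by apply: eq_integral => y _; rewrite /kern/prodf !mxE.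
move=> i; apply: (measurableT_comp (mk i)).
exact: (measurable_funB (measurable_cst _) (@measurable_id _ R setT)).
Qed.

Lemma kern_int1 k y : (forall i, measurable_fun setT (k i)) ->
  (forall i t, 0 <= k i t) ->
  (\int[leb3]_x (kern k (x, y))%:E =
   (\int[leb]_t (k 0%R (t - y 0%R 0%R)%R)%:E) * (\int[leb]_t (k 1%R (t - y 0%R 1%R)%R)%:E)
   * (\int[leb]_t (k 2%R (t - y 0%R 2%R)%R)%:E))%E.
Proof.
move=> mk k0; rewrite -(@integral_leb3_prod R (fun i t => k i (t - y 0 i)))//.
  by apply: eq_integral => x _; rewrite /kern/prodf !mxE.
move=> i; apply: (measurableT_comp (mk i)).
exact: (measurable_funB (@measurable_id _ R setT) (measurable_cst _)).
Qed.

(** A kernel concentrated near the diagonal with both marginals equal to 8. It dominates, up to a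
    constant, every mollifier and its first derivatives, which makes Fubini's theorem available with
    square-integrable factors. *)
Definition nearK : rV3 * rV3 -> R := kern (fun _ t => \1_(`[-1, 1]%classic) t).

Lemma measurable_nearK : measurable_fun setT nearK.
Proof. by apply: measurable_kern => i; apply: measurable_indic; exact: measurable_itv. Qed.

Lemma nearK_ge0 z : 0 <= nearK z.
Proof. by rewrite /nearK/kern/prodf !mulr_ge0. Qed.

Let indic_itv1 (a : R) (e : bool) :
  (\int[leb]_t (\1_(`[-1, 1]%classic) ((if e then a - t else t - a) : R) : R)%:E = 2%:E)%E.
Proof.
have -> : (fun t : R => (\1_(`[-1, 1]%classic) ((if e then a - t else t - a) : R) : R)%:E) =
    EFin \o (\1_(`[a - 1, a + 1]%classic)).
  apply/funext => t /=; congr (_%:E); rewrite !indicE; congr (nat_of_bool _)%:R.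
  by apply/idP/idP; rewrite !inE/= !in_itv/=; case: e => /andP[h1 h2]; apply/andP; split; lra.
rewrite integral_indic// ?setIT.
apply: (etrans (lebesgue_measure_itv _)); rewrite /= lte_fin ifT; last by lra.
by rewrite -EFinB; congr EFin; lra.
Qed.

Lemma nearK_int2 x : (\int[leb3]_y (nearK (x, y))%:E = 8%:E)%E.
Proof.
rewrite kern_int2//.
  rewrite !(indic_itv1 _ true) -!EFinM; congr EFin; lra.
by move=> i; apply: measurable_indic; exact: measurable_itv.
Qed.

Lemma nearK_int1 y : (\int[leb3]_x (nearK (x, y))%:E = 8%:E)%E.
Proof.
rewrite kern_int1//.
  rewrite !(indic_itv1 _ false) -!EFinM; congr EFin; lra.
by move=> i; apply: measurable_indic; exact: measurable_itv.
Qed.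

Definition nkern K := measurable_fun setT K /\ exists2 C, 0 <= C & forall z, `|K z| <= C * nearK z.

Lemma nkern_intg K p q : nkern K -> L2 p -> L2 q ->
  (leb3 \x leb3)%E.-integrable setT (EFin \o (fun z => K z * p z.1 * q z.2)).
Proof.
move=> [mK [C C0 hC]] hp hq.
have h : (leb3 \x leb3)%E.-integrable setT (EFin \o (fun z => nearK z * p z.1 * q z.2)).
  apply: (@schur_integrable _ _ 8) => //; [exact: measurable_nearK|exact: nearK_ge0|..].
    by move=> x; rewrite nearK_int2.
  by move=> x; rewrite nearK_int1.
have := intgZ C (integrable_norm h).
apply: le_integrable => //.
- apply/measurable_EFinP; apply: measurable_funM.
    by apply: measurable_funM => //; apply: (measurableT_comp hp.1).
  exact: (measurableT_comp hq.1).
- move=> z _; rewrite /= lee_fin [leRHS]ger0_norm ?mulr_ge0//.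
  rewrite (normrM (K z * p z.1)) (normrM (K z)) (normrM (nearK z * p z.1)) (normrM (nearK z)).
  apply: le_trans (ler_wpM2r (normr_ge0 (q z.2)) (ler_wpM2r (normr_ge0 (p z.1)) (hC z))) _.
  by rewrite (ger0_norm (nearK_ge0 z)) -(mulrA C) -(mulrA C).
Qed.

Lemma cont_supp_bounded (g : R -> R) : continuous g ->
  (forall t, 1 < `|t| -> g t = 0) ->
  exists2 C, 0 <= C & forall t, `|g t| <= C * \1_(`[-1, 1]%classic) t.
Proof.
move=> cg g0.
have [c _ hc] : exists2 c, c \in `[-1 : R, 1] & forall t, t \in `[-1, 1] -> `|g t| <= `|g c|.
  apply: (@EVT_max _ (fun t => `|g t|)); first by lra.
  by apply: continuous_subspaceT => t; exact: (continuous_comp (cg t) (@norm_continuous _ _ _)).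
exists `|g c| => // t; rewrite indicE.
have [t1|t1] := leP `|t| 1.
  by rewrite mem_set/= ?in_itv/= -?ler_norml// mulr1 hc// in_itv/= -ler_norml.
by rewrite g0// normr0 mulr_ge0.
Qed.

Lemma nkern_kern k : (forall i, continuous (k i)) ->
  (forall i t, 1 < `|t| -> k i t = 0) -> nkern (kern k).
Proof.
move=> ck k0; split.
  by apply: measurable_kern => i; exact: continuous_measurable_fun.
have h i := cont_supp_bounded (ck i) (@k0 i).
have [C0 ? h0] := h 0; have [C1 ? h1] := h 1; have [C2 ? h2] := h 2.
exists (C0 * C1 * C2); first by rewrite !mulr_ge0.
move=> z; rewrite /nearK /kern /prodf !normrM.
rewrite [leRHS](_ : _ = (C0 * \1_(`[-1, 1]%classic) ((z.1 - z.2) 0 0)) *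
  (C1 * \1_(`[-1, 1]%classic) ((z.1 - z.2) 0 1)) *
  (C2 * \1_(`[-1, 1]%classic) ((z.1 - z.2) 0 2))); last by ring.
by rewrite !ler_pM ?mulr_ge0.
Qed.

Lemma dblD K p q1 q2 c : nkern K -> L2 p -> L2 q1 -> L2 q2 ->
  dbl K p (fun x => q1 x + c * q2 x) = dbl K p q1 + c * dbl K p q2.
Proof.
move=> hK hp h1 h2; rewrite /dbl -RintegralZl//; last exact: nkern_intg.
rewrite -RintegralD//; [|exact: nkern_intg|by apply: intgZ; exact: nkern_intg].
by apply: eq_Rintegral => z _; ring.
Qed.

(** The scale n + 1 keeps the mass equal to 1 also at index 0. The profile lives on [0, 1], so the
    mollifier is one-sided: [rho n (x, y)] vanishes unless 0 <= x_i - y_i <= 1/(n + 1) for each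
    i. *)
Definition rho1 (n : nat) : 'I_3 -> R -> R := fun _ t => n.+1%:R * sbump (n.+1%:R * t).
Definition rho n := kern (rho1 n).
Definition drho n l := kern (dh (rho1 n) l).

Lemma rho1_smooth n i m : smoothn m (rho1 n i).
Proof.
apply: smoothnM; first exact: smoothn_cst.
rewrite (_ : (fun t => _) = (fun t => sbump (n.+1%:R * t + 0))).
  by apply: smoothn_affine; exact: sbump_smooth.
by apply/funext => t; rewrite addr0.
Qed.

Lemma rho1_supp n i t : 1 < `|t| -> rho1 n i t = 0.
Proof.
move=> t1; rewrite /rho1 sbump_out ?mulr0//.
have n1 : 1 <= n.+1%:R :> R by rewrite ler1n.
by move: t1; rewrite ltr_normr => /orP[h|h]; [right|left]; nra.
Qed.

Lemma supp_derive (g : R -> R) t : (forall t, 1 < `|t| -> g t = 0) -> 1 < `|t| ->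
  (g^`())%classic t = 0.
Proof.
move=> g0 t1; rewrite derive1E (@near_eq_derive _ _ _ _ (cst 0)) ?derive_cst//.
suff : \forall s \near t, 1 < `|s| by apply: filterS => s /g0.
by apply: (cvgr_gt _ (@norm_continuous _ _ t)).
Qed.

Lemma nkern_rho n : nkern (rho n).
Proof.
apply: nkern_kern; last exact: rho1_supp.
by move=> i; apply: smoothn1_continuous; exact: rho1_smooth.
Qed.

Lemma nkern_drho n l : nkern (drho n l).
Proof.
apply: nkern_kern => i.
  rewrite /dh; case: ifP => _; apply: smoothn1_continuous; last exact: rho1_smooth.
  exact: (rho1_smooth n i 2).2.
move=> t t1; rewrite /dh; case: ifP => _; last exact: rho1_supp.
by apply: supp_derive t1; exact: rho1_supp.
Qed.

Lemma rho_ge0 n z : 0 <= rho n z.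
Proof. by rewrite /rho/kern/prodf !mulr_ge0 ?sbump_ge0. Qed.

Let mrho1 n i : measurable_fun setT (rho1 n i).
Proof.
apply: continuous_measurable_fun; apply: smoothn1_continuous; exact: rho1_smooth.
Qed.

Let rho1_ge0 n i t : 0 <= rho1 n i t.
Proof. by rewrite mulr_ge0 ?sbump_ge0. Qed.

Lemma rho_int2 n x : (\int[leb3]_y (rho n (x, y))%:E = 1)%E.
Proof.
have h (c : R) i : (\int[leb]_t (rho1 n i (c - t)%R)%:E = 1)%E.
  rewrite -[RHS](@integral_sbumpT _ n.+1 c (-1)); [|by []|by right].
  apply: eq_integral => t _; rewrite /rho1; congr (_ * sbump (_ * _))%:E.
  by rewrite mulN1r opprB.
rewrite /rho (kern_int2 _ (mrho1 n) (@rho1_ge0 n)) -[RHS]mul1e -[X in _ = (X * _)%E]mul1e.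
by congr (_ * _ * _)%E; exact: h.
Qed.

Lemma rho_int1 n y : (\int[leb3]_x (rho n (x, y))%:E = 1)%E.
Proof.
have h (c : R) i : (\int[leb]_t (rho1 n i (t - c)%R)%:E = 1)%E.
  rewrite -[RHS](@integral_sbumpT _ n.+1 c 1); [|by []|by left].
  apply: eq_integral => t _; rewrite /rho1; congr (_ * sbump (_ * _))%:E.
  by rewrite mul1r.
rewrite /rho (kern_int1 _ (mrho1 n) (@rho1_ge0 n)) -[RHS]mul1e -[X in _ = (X * _)%E]mul1e.
by congr (_ * _ * _)%E; exact: h.
Qed.

Lemma rho_bound n p q l : 0 < l -> L2 p -> L2 q ->
  `|dbl (rho n) p q| <= l * \int[leb3]_x (p x ^+ 2) + l^-1 * \int[leb3]_x (q x ^+ 2).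
Proof.
move=> l0 hp hq; rewrite -[leRHS]mul1r; apply: dbl_bound => //.
- by have [] := nkern_rho n.
- exact: rho_ge0.
- by move=> x; rewrite rho_int2.
- by move=> x; rewrite rho_int1.
Qed.

(** The mollification of a box is explicit. Because the mollifier is one-sided, the half-open boxes
    are those whose indicators are recovered at every point in the limit. *)
Lemma rho_box n (al be : 'I_3 -> R) x : (forall i, al i < be i) ->
  (\int[leb3]_y (rho n (x, y) * \1_(box (fun i => `]al i, be i]%classic)) y)%:E =
  (prodf (fun i t => sstep (n.+1%:R * (t - al i)) - sstep (n.+1%:R * (t - be i))) x)%:E)%E.
Proof.
move=> ab.
pose g i (t : mR) := rho1 n i (x 0 i - t) * \1_(`]al i, be i]%classic) t.
have h i : (\int[leb]_t (g i t)%:E = (sstep (n.+1%:R * (x 0%R i - al i)) - sstep (n.+1%:R * (x 0%R i - be i)))%:E)%E.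
  transitivity (\int[leb]_(t in `]al i, be i]) (n.+1%:R * sbump (n.+1%:R * (-1 * (t - x 0%R i))))%R%:E)%E.
    rewrite [RHS]integral_mkcond; apply: eq_integral => t _.
    rewrite patchE /g indicE /rho1 mulN1r opprB.
    by case: ifP => _; [rewrite mulr1|rewrite mulr0].
  rewrite integral_sbump//; last by rewrite mulrNN mulr1.
  congr EFin; rewrite !mulN1r !opprB; ring.
have := @integral_leb3_prod R g; rewrite !h -!EFinM => <-.
- apply: eq_integral => y _; congr EFin.
  rewrite /rho/kern/prodf/g !mxE !indicE.
  set B := (_ \in box _); have -> : (B%:R : R) = ((y 0 0 \in `]al 0, be 0]%classic) : nat)%:R *
     ((y 0 1 \in `]al 1, be 1]%classic) : nat)%:R * ((y 0 2 \in `]al 2, be 2]%classic) : nat)%:R.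
    rewrite -!natrM !mulnb; congr (_%:R); congr nat_of_bool.
    apply/idP/idP; rewrite inE /box/=.
      move=> hb; apply/andP; split; [apply/andP; split|]; apply/mem_set; exact: hb.
    by move=> /andP[/andP[]] /set_mem h0 /set_mem h1 /set_mem h2; exact: forall_I3.
  have aux (a b c d e f : R) : a * b * c * (d * e * f) = a * d * (b * e) * (c * f) by ring.
  exact: aux.
- move=> i; apply: measurable_funM.
    apply: (measurableT_comp (mrho1 n i)).
    exact: (measurable_funB (measurable_cst _) (@measurable_id _ R setT)).
  by apply: measurable_indic; exact: measurable_itv.
- by move=> i t; rewrite mulr_ge0.
Qed.

End kernels.

(** * Weak convergence of the mollification, by approximation from boxes *)

Section good.
Context {R : realType}.
Notation rV3 := 'rV[R]_3.
Notation leb3 := (@leb3 R).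
Notation leb := (@lebesgue_measure R).
Notation intg f := (leb3.-integrable setT (EFin \o f)).
Notation L2 f := (sqint leb3 f).
Implicit Types (p q g : rV3 -> R).

(** Convergence is only asked after pairing with a fixed p. This weak form is enough for Green's
    formula and is stable under linear combinations and dominated limits, so it extends from boxes
    to all square-integrable functions. *)
Definition mollifies q := L2 q /\ forall p, L2 p ->
  (fun n => dbl (rho n) p q) @ \oo --> \int[leb3]_x (p x * q x).

Lemma mollifies_lin q1 q2 c : mollifies q1 -> mollifies q2 ->
  mollifies (fun x => q1 x + c * q2 x).
Proof.
move=> [L1 h1] [L2' h2]; split; first by apply: sqintD => //; exact: sqintZ.
move=> p hp; under eq_fun => n do rewrite (dblD _ (nkern_rho n))//.
rewrite (_ : \int[leb3]_x _ = \int[leb3]_x (p x * q1 x) + c * \int[leb3]_x (p x * q2 x)).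
  by apply: cvgD; [exact: h1|apply: cvgMr; exact: h2].
rewrite -RintegralZl//; last exact: sqint_mul.
rewrite -RintegralD//; [|exact: sqint_mul|by apply: intgZ; exact: sqint_mul].
by apply: eq_Rintegral => x _; ring.
Qed.

Lemma mollifies0 : mollifies (fun=> 0).
Proof.
split; first exact: sqint0.
move=> p hp; rewrite (_ : \int[leb3]_x _ = 0); last first.
  by rewrite /Rintegral integral0_eq// => x _; rewrite mulr0.
rewrite (_ : (fun n => _) = fun=> 0); first exact: cvg_cst.
apply/funext => n; rewrite /dbl /Rintegral integral0_eq// => z _; by rewrite mulr0.
Qed.

Lemma mollifies_sum (I : Type) (s : seq I) (F : I -> rV3 -> R) (c : I -> R) :
  (forall i, mollifies (F i)) -> mollifies (fun x => \sum_(i <- s) c i * F i x).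
Proof.
move=> hF; elim: s => [|i s ih].
  by under eq_fun do rewrite big_nil; exact: mollifies0.
under eq_fun do rewrite big_cons addrC.
exact: mollifies_lin.
Qed.

Lemma Rint_mul_le p q l : 0 < l -> L2 p -> L2 q ->
  `|\int[leb3]_x (p x * q x)| <= l * \int[leb3]_x (p x ^+ 2) + l^-1 * \int[leb3]_x (q x ^+ 2).
Proof.
move=> l0 hp hq; have lV : 0 < l^-1 by rewrite invr_gt0.
rewrite -!RintegralZl//; [|exact: hq.2|exact: hp.2].
rewrite -RintegralD//; [|apply: intgZ; exact: hp.2|apply: intgZ; exact: hq.2].
apply: le_trans (le_normr_Rintegral _ _) _ => //; first exact: sqint_mul.
apply: le_Rintegral => //.
- by apply: integrable_norm; exact: sqint_mul.
- by apply: intgD; apply: intgZ; [exact: hp.2|exact: hq.2].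
- move=> x _; rewrite normrM.
  have := mulr_ge0 (ltW lV) (sqr_ge0 (l * `|p x| - `|q x|)).
  rewrite sqrrB !exprMn !real_normK ?num_real//.
  have h1 : l^-1 * (l * l) = l by rewrite mulrA mulVf ?mul1r// gt_eqF.
  have h2 : l^-1 * (l * `|p x| * `|q x|) = `|p x| * `|q x| by field; rewrite gt_eqF.
  rewrite mulrDr mulrBr mulrA (expr2 l) h1 mulrnAr h2 mulr2n => h3.
  have h4 : 0 <= `|p x| * `|q x| by rewrite mulr_ge0.
  by lra.
Qed.

(** Dominated convergence gives q_j -> q in L^2, and Schur's test controls the mollified pairing
    with q - q_j uniformly in n, so the two limits can be exchanged. *)
Lemma mollifies_dominated (q_ : nat -> rV3 -> R) q g : (forall j, mollifies (q_ j)) -> L2 g ->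
  (forall j x, `|q_ j x| <= g x) -> (forall x, q_ ^~ x @ \oo --> q x) -> mollifies q.
Proof.
move=> hq_ hg qg qq.
have mq : measurable_fun setT q.
  by apply: (measurable_fun_cvg (fun j => (hq_ j).1.1)) => x _; exact: qq.
have qg' x : `|q x| <= g x.
  have h : (fun n => `|q_ n x|) @ \oo --> `|q x| by exact: cvg_norm (qq x).
  rewrite -(cvg_lim _ h)//; apply: limr_le; first exact: cvgP h.
  by apply: nearW => j; exact: qg.
have hq : L2 q by apply: (sqint_le mq hg) => x; exact: le_trans (qg' x) (ler_norm _).
split => // p hp.
pose e j := \int[leb3]_x ((q x - q_ j x) ^+ 2).
have hd j : L2 (fun x => q x + -1 * q_ j x).
  by apply: sqintD => //; apply: sqintZ; exact: (hq_ j).1.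
have eE j : e j = \int[leb3]_x ((q x + -1 * q_ j x) ^+ 2).
  by apply: eq_Rintegral => x _; rewrite mulN1r.
have e0 : e @ \oo --> 0.
  have [] := @dominated_convergence _ _ _ leb3 setT measurableT
    (fun j x => ((q x - q_ j x) ^+ 2)%:E) (cst 0%E) (fun x => (4 * g x ^+ 2)%:E).
  - move=> j; apply/measurable_EFinP; apply: measurable_funX.
    by apply: measurable_funB => //; exact: (hq_ j).1.1.
  - exact: measurable_cst.
  - apply: nearW => x _; apply/fine_cvgP; split; first exact: nearW.
    rewrite [X in _ --> X](_ : _ = (q x - q x) ^+ 2); last by rewrite subrr expr0n.
    rewrite /comp/= (_ : (fun j => _) = (fun j => (q x - q_ j x) * (q x - q_ j x))); last first.
      by apply/funext => j; rewrite expr2.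
    by rewrite expr2; apply: cvgM; (apply: cvgB; [exact: cvg_cst|exact: qq]).
  - by apply: intgZ; exact: hg.2.
  - apply: nearW => x j _; rewrite /= lee_fin ger0_norm ?sqr_ge0//.
    have := qg j x; have := qg' x; rewrite !ler_norml => /andP[a b] /andP[c d].
    by nra.
  move=> _ _; rewrite integral0_eq// => /fine_cvgP[_]; exact.
set I0 := \int[leb3]_x _.
set P := \int[leb3]_x (p x ^+ 2).
have P0 : 0 <= P by apply: Rintegral_ge0 => x _; rewrite sqr_ge0.
apply/cvgrPdist_le => eps eps0.
(* First l makes the part containing p small; then j is chosen so that the part containing q - q_j,
   divided by this l, is small as well. *)
pose l := eps / (4 * (P + 1)).
have l0 : 0 < l by rewrite divr_gt0// mulr_gt0// ltr_wpDl.
have lP : l * P <= eps / 4.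
  rewrite /l mulrAC ler_pdivrMr ?mulr_gt0 ?ltr_wpDl//.
  by rewrite mulrA divfK// ler_wpM2l ?(ltW eps0)// lerDl.
have [j hj] : exists j, l^-1 * e j <= eps / 8.
  have : \forall j \near \oo, `|0 - e j| <= l * (eps / 8).
    by move/cvgrPdist_le : e0; apply; rewrite mulr_gt0// divr_gt0.
  move=> [j _ /(_ j (leqnn j))]; rewrite sub0r normrN => h; exists j.
  by rewrite ler_pdivrMl//; exact: le_trans (ler_norm _) h.
have [_ /(_ p hp) /cvgrPdist_le /(_ (eps / 4))] := hq_ j.
move=> /(_ (divr_gt0 eps0 (ltr0n _ 4))); apply: filterS => n hn.
have E1 : dbl (rho n) p q = dbl (rho n) p (q_ j) + dbl (rho n) p (fun x => q x + -1 * q_ j x).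
  by rewrite (dblD _ (nkern_rho n))//; [ring|exact: (hq_ j).1].
have E2 : I0 = \int[leb3]_x (p x * q_ j x) + \int[leb3]_x (p x * (q x + -1 * q_ j x)).
  rewrite -RintegralD//; [|exact: sqint_mul (hq_ j).1|exact: sqint_mul (hd j)].
  by apply: eq_Rintegral => x _; ring.
have B1 := rho_bound n l0 hp (hd j).
have B2 := Rint_mul_le l0 hp (hd j).
rewrite -eE -/P in B1 B2.
move: hn B1 B2; rewrite E1 E2 !ler_norml => /andP[? ?] /andP[? ?] /andP[? ?].
by apply/andP; split; lra.
Qed.

Lemma sqint_indic (A : set rV3) : measurable A -> (leb3 A < +oo)%E -> L2 (\1_A).
Proof.
move=> mA fA; split; first exact: measurable_indic.
apply/integrableP; split.
  by apply/measurable_EFinP; apply: measurable_funX; exact: measurable_indic.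
rewrite (_ : integral _ _ _ = leb3 A)//.
rewrite -[in RHS](setIT A) -(integral_indic leb3 measurableT mA).
by apply: eq_integral => x _; rewrite /= indicE; case: (_ \in _); rewrite ?expr1n ?expr0n ?normr1 ?normr0.
Qed.

Lemma leb3_box_lty (al be : 'I_3 -> R) : (leb3 (box (fun i => `]al i, be i]%classic)) < +oo)%E.
Proof.
rewrite leb3_box; last by move=> i; exact: measurable_itv.
have h i : (0 <= leb `]al i, be i]%classic < +oo)%E.
  rewrite measure_ge0/= lebesgue_measure_itv/=; case: ifP => _; last by rewrite ltry.
  by rewrite -EFinB ltry.
have /andP[a0 b0] := h 0; have /andP[a1 b1] := h 1; have /andP[a2 b2] := h 2.
by rewrite !lte_mul_pinfty// ?mule_ge0// ge0_fin_numE ?mule_ge0// lte_mul_pinfty// ge0_fin_numE.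
Qed.

Let fac (al be : R) (n : nat) (t : R) := sstep (n.+1%:R * (t - al)) - sstep (n.+1%:R * (t - be)).

Let fac_cvg al be t : al < be ->
  fac al be ^~ t @ \oo --> (\1_(`]al, be]%classic) t : R).
Proof.
move=> ab.
have H c : (fun n => sstep (n.+1%:R * (t - c))) @ \oo --> ((c < t)%R%:R : R).
  have [ct|ct] := ltP c t; last first.
    rewrite (_ : (fun n => _) = fun=> 0); first exact: cvg_cst.
    by apply/funext => n; rewrite sstep_le0// mulr_ge0_le0// subr_le0.
  apply/cvgrPdist_le => e e0; near=> n.
  rewrite sstep_ge1 ?subrr ?normr0 ?(ltW e0)//.
  rewrite -ler_pdivrMr ?subr_gt0// div1r.
  apply: (@le_trans _ _ n%:R); last by rewrite ler_nat.
  by near: n; exact: nbhs_infty_ger.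
suff -> : (\1_(`]al, be]%classic) t : R) = (al < t)%R%:R - (be < t)%R%:R.
  exact: (cvgB (H al) (H be)).
rewrite indicE; have [h1|h1] := ltP al t; have [h2|h2] := ltP be t.
- rewrite memNset ?subrr//= in_itv/= h1/=; apply/negP; rewrite -ltNge//.
- by rewrite mem_set ?subr0//= in_itv/= h1.
- by have := le_lt_trans h1 ab; rewrite ltNge (ltW h2).
- by rewrite memNset ?subrr//= in_itv/= ltNge h1.
Unshelve. all: by end_near. Qed.

Let fac_bound al be n t : al < be -> `|fac al be n t| <= \1_(`]al, (be + 1)%R]%classic) t.
Proof.
move=> ab; rewrite /fac indicE.
have n1 : 1 <= n.+1%:R :> R by rewrite ler1n.
have [h1|h1] := leP t al.
  have h2 : t <= be by rewrite (le_trans h1)// ltW.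
  by rewrite !sstep_le0 ?subrr ?normr0// mulr_ge0_le0// subr_le0.
have [h2|h2] := leP t (be + 1).
  rewrite mem_set/= ?in_itv/= ?h1 ?h2//.
  have := sstep_ge0 (n.+1%:R * (t - al)); have := sstep_ge0 (n.+1%:R * (t - be)).
  have := sstep_le1 (n.+1%:R * (t - al)); have := sstep_le1 (n.+1%:R * (t - be)).
  by rewrite ler_norml => *; apply/andP; split; lra.
rewrite !sstep_ge1 ?subrr ?normr0//; nra.
Qed.

Lemma box_indic (A : 'I_3 -> set R) (x : rV3) :
  \1_(box A) x = \1_(A 0) (x 0 0) * \1_(A 1) (x 0 1) * \1_(A 2) (x 0 2) :> R.
Proof.
rewrite !indicE -!natrM !mulnb; congr (_%:R); congr nat_of_bool.
apply/idP/idP; rewrite inE /box/=.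
  by move=> hb; apply/andP; split; [apply/andP; split|]; apply/mem_set; exact: hb.
by move=> /andP[/andP[]] /set_mem h0 /set_mem h1 /set_mem h2; exact: (@forall_I3 (fun i => A i (x 0 i))).
Qed.

Lemma mollifies_box (al be : 'I_3 -> R) : (forall i, al i < be i) ->
  mollifies (\1_(box (fun i => `]al i, be i]%classic))).
Proof.
move=> ab; set B := box _.
have mB : measurable B by apply: measurable_box => i; exact: measurable_itv.
have L2B : L2 \1_B by apply: sqint_indic => //; exact: leb3_box_lty.
split => // p hp.
pose Phi n := prodf (fun i => fac (al i) (be i) n).
have E n : dbl (rho n) p \1_B = \int[leb3]_x (p x * Phi n x).
  rewrite /dbl Rfubini1; last exact: nkern_intg (nkern_rho n) hp L2B.
  apply: eq_Rintegral => x _ /=.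
  rewrite /Rintegral (_ : (\int[leb3]_y _ = \int[leb3]_y ((p x)%:E * (rho n (x, y) * \1_B y)%:E))%E); last first.
    by apply: eq_integral => y _; rewrite -EFinM; congr EFin; ring.
  have I1 := rho_box n x ab; rewrite -/B in I1.
  rewrite integralZl//; first by rewrite I1.
  apply/integrableP; split.
    apply/measurable_EFinP; apply: measurable_funM; last exact: measurable_indic.
    by apply: (measurableT_comp (nkern_rho n).1).
  rewrite (eq_integral (fun y => (rho n (x, y) * \1_B y)%:E)); first by rewrite I1 ltry.
  by move=> y _; rewrite gee0_abs// lee_fin mulr_ge0// rho_ge0.
rewrite (_ : (fun n => _) = (fun n => \int[leb3]_x (p x * Phi n x))); last by apply/funext.
(* The smooth steps have width 1/(n + 1) <= 1, so this larger box contains the supports for all n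
   and supplies the dominating function. *)
pose BB := box (fun i => `]al i, (be i + 1)%R]%classic).
have mBB : measurable BB by apply: measurable_box => i; exact: measurable_itv.
have L2BB : L2 \1_BB by apply: sqint_indic => //; exact: leb3_box_lty.
have Labs : L2 (fun x => `|p x|).
  split; first by apply: measurableT_comp => //; exact: hp.1.
  by have [_] := hp; apply: eq_integrable => // x _; rewrite /= real_normK ?num_real.
have := @dominated_convergence _ _ _ leb3 setT measurableT
    (fun n x => (p x * Phi n x)%:E) (fun x => (p x * \1_B x)%:E) (fun x => (`|p x| * \1_BB x)%:E).
case.
- move=> n; apply/measurable_EFinP; apply: measurable_funM; first exact: hp.1.
  apply: continuous_measurable_rV; apply: prodf_continuous => i.
  apply: smoothn1_continuous; rewrite /fac.
  have hs (c : R) : smoothn 1 (fun t => sstep (n.+1%:R * (t - c))).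
    rewrite (_ : (fun t => _) = (fun t => sstep (n.+1%:R * t + - n.+1%:R * c))).
      by apply: smoothn_affine; exact: sstep_smooth.
    by apply/funext => t; congr sstep; ring.
  have := smoothnD (hs (al i)) (smoothnM (smoothn_cst 1 (-1)) (hs (be i))).
  by under eq_fun do rewrite mulN1r.
- by apply/measurable_EFinP; apply: measurable_funM; [exact: hp.1|exact: measurable_indic].
- apply: nearW => x _; apply/fine_cvgP; split; first exact: nearW.
  apply: cvgMr; rewrite box_indic.
  by apply: cvgM; first apply: cvgM; exact: fac_cvg.
- exact: sqint_mul.
- apply: nearW => x n _; rewrite /= lee_fin normrM ler_wpM2l// box_indic /Phi /prodf !normrM.
  by rewrite !ler_pM ?mulr_ge0 ?fac_bound.
move=> I1 _ C1; rewrite /Rintegral.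
apply: fine_cvg; rewrite fineK//; exact: integrable_fin_num.
Qed.

(** Cutting by cubes keeps the indicators square integrable, so that the whole space is good, as a
    Dynkin system requires. The generating pi-system is that of products of open half-lines. *)
Let goodset (A : set rV3) := measurable A /\ forall m, mollifies (\1_(A `&` cube m)).

Let cubeE m : cube m = box (fun i : 'I_3 => `](- m%:R), m%:R]%classic) :> set rV3.
Proof. by []. Qed.

Let cube_lty A m : measurable A -> (leb3 (A `&` cube m) < +oo)%E.
Proof.
move=> mA; apply: le_lt_trans (leb3_cube_lty m); apply: le_measure.
- by rewrite inE; apply: measurableI => //; exact: measurable_cube.
- by rewrite inE; exact: measurable_cube.
- by move=> x [].
Qed.

Let dynkin_goodset : dynkin goodset.
Proof.
have gT : goodset setT.
  split => // m; rewrite setTI cubeE.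
  case: m => [|m]; last by apply: mollifies_box => i; rewrite (@lt_trans _ _ 0) ?oppr_lt0 ?ltr0n.
  rewrite (_ : \1_(box _) = fun=> 0); first exact: mollifies0.
  apply/funext => x; rewrite indicE memNset// => /(_ 0).
  by rewrite /= in_itv/= oppr0 => /andP[h1 h2]; have := lt_le_trans h1 h2; rewrite ltxx.
split => //.
- move=> A [mA hA]; split; first exact: measurableC.
  move=> m; rewrite (_ : \1_(_ `&` _) = fun x => \1_(setT `&` cube m) x + -1 * \1_(A `&` cube m) x).
    exact: (mollifies_lin (-1) (gT.2 m) (hA m)).
  apply/funext => x; rewrite !indicE !in_setI in_setT in_setC /=.
  by case: (x \in A); case: (x \in cube m); rewrite /= ?mulr0 ?addr0 ?mulr1 ?subrr.
- move=> F tF hF; split; first by apply: bigcupT_measurable => n; exact: (hF n).1.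
  move=> m; have mF n := (hF n).1.
  (* Partial sums of indicators of disjoint sets are at most 1, so they are dominated by the
     indicator of the cube. *)
  apply: (@mollifies_dominated (fun j x => \sum_(i < j) 1 * \1_(F i `&` cube m) x)
     _ (\1_(setT `&` cube m))).
  + by move=> j; apply: (@mollifies_sum _ _ (fun i : 'I_j => \1_(F i `&` cube m))) => i; exact: (hF i).2.
  + exact: (gT.2 m).1.
  + move=> j x; rewrite ger0_norm; last by apply: sumr_ge0 => i _; rewrite mul1r.
    under eq_bigr do rewrite mul1r indicE in_setI.
    rewrite indicE in_setI in_setT/=.
    have [xm|xm] := boolP (x \in cube m); last by rewrite big1// => i _; rewrite andbF.
    under eq_bigr do rewrite andbT.
    have [[i Fi]|ni] := pselect (exists i : 'I_j, F i x).
      rewrite (bigD1 i)//= mem_set// big1 ?addr0// => i' ii'; rewrite memNset// => Fi'.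
      have /trivIsetP/(_ i i' I I) := tF; rewrite eq_sym => /(_ ii')/seteqP[/(_ x) h _].
      exact: h.
    by rewrite big1// => i _; rewrite memNset// => Fi; apply: ni; exists i.
  + move=> x; have [[i _ Fi]|ni] := pselect ((\bigcup_i F i) x); last first.
      rewrite indicE memNset; last by move=> [].
      rewrite (_ : (fun n => _) = fun=> 0); first exact: cvg_cst.
      apply/funext => n; rewrite big1// => i _; rewrite indicE memNset ?mulr0// => -[Fi _].
      by apply: ni; exists i.
    apply: cvg_near_cst; near=> n.
    have ni : (i < n)%N by near: n; exact: nbhs_infty_gt.
    rewrite (bigD1 (Ordinal ni))//= mul1r big1 ?addr0.
      rewrite !indicE !in_setI (@mem_set _ (F i) x)// (@mem_set _ (\bigcup_i F i) x)//.
      by exists i.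
    move=> i' ii'; rewrite mul1r indicE memNset// => -[Fi' _].
    have /trivIsetP/(_ i i' I I) := tF; rewrite eq_sym.
    move=> /(_ ii')/seteqP[/(_ x) h _]; exact: h.
Unshelve. all: by end_near. Qed.

Let rays : set (set rV3) := [set A | exists a : 'I_3 -> R, A = box (fun i => `]a i, +oo[%classic)].

Let setI_closed_rays : setI_closed rays.
Proof.
move=> _ _ [a ->] [b ->]; exists (fun i => Num.max (a i) (b i)).
apply/seteqP; split => x /=.
  by move=> [h1 h2] i; have := h1 i; have := h2 i; rewrite /= !in_itv/= !andbT gt_max => -> ->.
by move=> h; split=> i; have := h i; rewrite /= !in_itv/= !andbT gt_max => /andP[].
Qed.

Let rays_good : rays `<=` goodset.
Proof.
move=> _ [a ->]; split; first by apply: measurable_box => i; exact: measurable_itv.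
move=> m; rewrite (_ : _ `&` _ = box (fun i => `]Num.max (a i) (- m%:R), m%:R]%classic)); last first.
  apply/seteqP; split => x.
    move=> [h1 h2] i; have := h1 i; have := h2 i.
    by rewrite /= !in_itv/= andbT gt_max => /andP[-> ->] ->.
  move=> h; split=> i; have := h i; rewrite /= !in_itv/= gt_max => /andP[/andP[h1 h2] h3].
    by rewrite h1.
  by rewrite h2.
have [h|/existsNP[i /negP]] := pselect (forall i, Num.max (a i) (- m%:R) < m%:R); first exact: mollifies_box.
rewrite -leNgt => hi; rewrite (_ : \1_(box _) = fun=> 0); first exact: mollifies0.
apply/funext => x; rewrite indicE memNset// => /(_ i).
by rewrite /= in_itv/= => /andP[h1 h2]; have := lt_le_trans h1 (le_trans h2 hi); rewrite ltxx.
Qed.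

(** A half-space in one coordinate is the countable union of products of rays whose other sides are
    ]-n, +oo[. *)
Let measurable_rays (A : set rV3) : measurable A -> <<s rays >> A.
Proof.
move=> mA; apply: (@smallest_sub _ (sigma_algebra setT)) mA.
  exact: smallest_sigma_algebra.
move=> B; rewrite -bigcup_seq => -[i _ [C mC <-]]; rewrite setTI.
pose T' := g_sigma_algebraType rays.
have : measurable_fun (setT : set T') (fun x : T' => (x : rV3) 0 i).
  apply: (measurability _ (RGenOInfty.measurableE R)) => _ [_ [r ->] <-].
  rewrite setTI (_ : _ @^-1` _ = \bigcup_n (box (fun j => if j == i then `]r, +oo[%classic else `](- n%:R), +oo[%classic))).
    apply: bigcupT_measurable => n; apply: sub_sigma_algebra.
    exists (fun j => if j == i then r else - n%:R).
    by congr box; apply/funext => j; case: ifP.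
  apply/seteqP; split => x.
    rewrite /= in_itv/= andbT => rx.
    exists (Num.trunc (\sum_j `|x 0 j|)).+1 => // j; case: eqP => [->|_].
      by rewrite /= in_itv/= rx.
    rewrite /= in_itv/= andbT.
    have : `|x 0 j| < (Num.trunc (\sum_j `|x 0 j|)).+1%:R.
      apply: le_lt_trans (truncnS_gt _); rewrite (bigD1 j)//= lerDl.
      exact: sumr_ge0.
    by rewrite ltr_norml => /andP[].
  by move=> [n _ /(_ i)]; rewrite eqxx.
by move=> /(_ measurableT C mC); rewrite setTI.
Qed.

Lemma mollifies_indic (A : set rV3) m : measurable A -> mollifies (\1_(A `&` cube m)).
Proof.
move=> /measurable_rays mA; suff : goodset A by move=> [].
have H := setI_closed_g_dynkin_g_sigma_algebra setI_closed_rays.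
by move: mA; rewrite -H; apply: smallest_sub => //; exact: dynkin_goodset.
Qed.

Import HBNNSimple.

Lemma mollifies_nnsfun (f : {nnsfun rV3 >-> R}) m : mollifies (fun x => f x * \1_(cube m) x).
Proof.
have -> : (fun x => f x * \1_(cube m) x) = (fun x =>
    \sum_(y <- finmap.enum_fset (fset_set (range f))) y * \1_((f @^-1` [set y]) `&` cube m) x).
  apply/funext => x; rewrite fimfunE fsbig_finite//= mulr_suml.
  apply: eq_bigr => y _; rewrite -mulrA; congr (_ * _).
  by rewrite !indicE in_setI -natrM mulnb.
by apply: mollifies_sum => y; apply: mollifies_indic; exact: measurable_sfunP.
Qed.

Lemma mollifies_ge0 q : L2 q -> (forall x, 0 <= q x) -> mollifies q.
Proof.
move=> hq q0.
have mq : measurable_fun setT (EFin \o q) by apply/measurable_EFinP; exact: hq.1.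
pose f := nnsfun_approx measurableT mq.
have fq n x : f n x <= q x.
  rewrite -lee_fin /f nnsfun_approxE; apply: (@le_approx _ _ _ setT (EFin \o q)) => // y _.
  by rewrite lee_fin.
apply: (@mollifies_dominated (fun j x => f j x * \1_(cube j) x) _ q) => //.
- by move=> j; exact: mollifies_nnsfun.
- move=> j x; rewrite ger0_norm ?mulr_ge0//; apply: le_trans (fq j x).
  by rewrite ler_piMr// indicE lern1 leq_b1.
- move=> x; rewrite -[X in _ --> X]mulr1; apply: cvgM.
    have := @cvg_nnsfun_approx _ _ _ setT measurableT _ mq (fun y _ => q0 y) x I.
    by move=> /fine_cvgP[_].
  apply: cvg_near_cst.
  have : (\bigcup_n cube n) x by rewrite bigcup_cube.
  move=> [N _ xN]; near=> n; rewrite indicE mem_set// => i.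
  have := xN i; rewrite /= !in_itv/= => /andP[h1 h2].
  have Nn : N%:R <= n%:R :> R by rewrite ler_nat; near: n; exact: nbhs_infty_ge.
  by rewrite (le_lt_trans _ h1) ?lerN2// (le_trans h2).
Unshelve. all: by end_near. Qed.

Theorem mollifies_sqint q : L2 q -> mollifies q.
Proof.
move=> hq; have mq := hq.1.
have h1 : mollifies (fun x => Num.max (q x) 0).
  apply: mollifies_ge0; last by move=> x; rewrite le_max lexx orbT.
  apply: sqint_le hq _; first exact: measurable_maxr.
  by move=> x; rewrite ger0_norm ?le_max ?lexx ?orbT// ge_max ler_norm normr_ge0.
have h2 : mollifies (fun x => Num.max (- q x) 0).
  apply: mollifies_ge0; last by move=> x; rewrite le_max lexx orbT.
  apply: sqint_le hq _; first by apply: measurable_maxr => //; exact: measurableT_comp.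
  by move=> x; rewrite ger0_norm ?le_max ?lexx ?orbT// ge_max -normrN ler_norm normr_ge0.
have := mollifies_lin (-1) h1 h2.
rewrite (_ : (fun x => _ + _) = q)//; apply/funext => x.
by rewrite /Num.max; case: ltP => h; case: ltP => h'; lra.
Qed.

End good.

(** * Green's formula for two fields with a weak curl *)

Section Green.
Context {R : realType}.
Notation rV3 := 'rV[R]_3.
Notation leb3 := (@leb3 R).
Implicit Types u v : rV3 -> rV3.

Let dl n l u v (a b : 'I_3) : R := dbl (drho n l) (fun x => u x 0 a) (fun x => v x 0 b).

(** With c = -y and s = 1 this gives x |-> rho(x, y), with c = x and s = -1 it gives y |-> rho(x,
    y): the mollifier as a test function of either variable. *)
Let dtest (k : 'I_3 -> R -> R) (c : rV3) (s : R) := fun i t => k i (s * t + c 0 i).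

Let test_kern n j (c : rV3) (s : R) : s = 1 \/ s = -1 ->
  test_field (fun x => prodf (dtest (rho1 n) c s) x *: delta_mx 0 j).
Proof.
move=> hs; apply: (@test_prodf _ _ _ (1 + \sum_i `|c 0 i|)).
  by move=> i m; apply: smoothn_affine; exact: rho1_smooth.
move=> i t ht; apply: rho1_supp.
have hc : `|c 0 i| <= \sum_i `|c 0 i| by rewrite (bigD1 i)//= lerDl sumr_ge0.
have := lerB_normD (s * t) (c 0 i); rewrite normrM (_ : `|s| = 1) ?mul1r; last first.
  by case: hs => ->; rewrite ?normrN normr1.
by move=> h; apply: lt_le_trans h; lra.
Qed.

Let dh_dtest n l (c : rV3) (s : R) x :
  prodf (dh (dtest (rho1 n) c s) l) x = s * prodf (fun i t => dh (rho1 n) l i (s * t + c 0 i)) x.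
Proof.
have D i t : ((dtest (rho1 n) c s i)^`())%classic t = s * ((rho1 n i)^`())%classic (s * t + c 0 i).
  have h := smoothn_is_derive (s * t + c 0 i) (rho1_smooth n i 1).
  have := @is_derive1_comp _ (rho1 n i) (fun t => s * t + c 0 i) t _ _ h (is_derive_affine s (c 0 i) t).
  by move=> [_ E]; rewrite derive1E [RHS]mulrC -E.
have E i t : dh (dtest (rho1 n) c s) l i t = (if i == l then s else 1) * dh (rho1 n) l i (s * t + c 0 i).
  by rewrite /dh; case: eqP => _; [exact: D|rewrite mul1r].
move: (dtest (rho1 n) c s) E {D} => g E.
rewrite /prodf !E; move: (dh _ _ 0 _) (dh _ _ 1 _) (dh _ _ 2 _) => u v w.
by move: l {E}; apply: forall_I3 => /=; ring.
Qed.

Let nearK_le1 (z : rV3 * rV3) : nearK z <= 1.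
Proof.
have h t : \1_(`[-1, 1]%classic) (t : R) <= 1 :> R by rewrite indicE lern1 leq_b1.
by rewrite /nearK /kern /prodf !mulr_ile1 ?mulr_ge0.
Qed.

Lemma nkern_section1 K (p : rV3 -> R) (y : rV3) : nkern K -> sqint leb3 p ->
  leb3.-integrable setT (EFin \o (fun x => K (x, y) * p x)).
Proof.
move=> [mK [C C0 hC]] hp.
have mn : measurable_fun setT (fun x : rV3 => nearK (x, y)) by exact: (measurableT_comp (@measurable_nearK R)).
apply: (@intg_le _ _ _ _ (fun x => C * (nearK (x, y) + p x ^+ 2))).
- by apply: measurable_funM; [exact: (measurableT_comp mK)|exact: hp.1].
- apply: intgZ; apply: intgD; last exact: hp.2.
  apply/integrableP; split; first exact/measurable_EFinP.
  rewrite (eq_integral (fun x => (nearK (x, y))%:E)); first by rewrite nearK_int1 ltry.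
  by move=> x _; rewrite gee0_abs// lee_fin nearK_ge0.
- move=> x; rewrite normrM; have h := hC (x, y).
  have n0 := nearK_ge0 (x, y); have n1 := nearK_le1 (x, y).
  rewrite -(real_normK (num_real (p x))); have q0 := normr_ge0 (p x).
  apply: (le_trans (ler_wpM2r q0 h)); rewrite -mulrA ler_wpM2l//.
  by have := sqr_ge0 (`|p x| - 1); rewrite sqrrB expr1n mulr1; nra.
Qed.

Lemma nkern_section2 K (p : rV3 -> R) (y : rV3) : nkern K -> sqint leb3 p ->
  leb3.-integrable setT (EFin \o (fun x => K (y, x) * p x)).
Proof.
move=> [mK [C C0 hC]] hp.
have mn : measurable_fun setT (fun x : rV3 => nearK (y, x)) by exact: (measurableT_comp (@measurable_nearK R)).
apply: (@intg_le _ _ _ _ (fun x => C * (nearK (y, x) + p x ^+ 2))).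
- by apply: measurable_funM; [exact: (measurableT_comp mK)|exact: hp.1].
- apply: intgZ; apply: intgD; last exact: hp.2.
  apply/integrableP; split; first exact/measurable_EFinP.
  rewrite (eq_integral (fun x => (nearK (y, x))%:E)); first by rewrite nearK_int2 ltry.
  by move=> x _; rewrite gee0_abs// lee_fin nearK_ge0.
- move=> x; rewrite normrM; have h := hC (y, x).
  have n0 := nearK_ge0 (y, x); have n1 := nearK_le1 (y, x).
  rewrite -(real_normK (num_real (p x))); have q0 := normr_ge0 (p x).
  apply: (le_trans (ler_wpM2r q0 h)); rewrite -mulrA ler_wpM2l//.
  by have := sqr_ge0 (`|p x| - 1); rewrite sqrrB expr1n mulr1; nra.
Qed.

(** For each y the weak curl of u is tested with x |-> rho(x, y) e_j; the result is multiplied by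
    v_j(y) and integrated in y. [green_y] does the same with the roles of the variables
    exchanged. *)
Lemma green_x n j u cu v : weak_curl u cu -> L2field v ->
  dbl (rho n) (fun x => cu x 0 j) (fun x => v x 0 j) =
  dl n (j + 2) u v (j + 1) j - dl n (j + 1) u v (j + 2) j.
Proof.
move=> [hu hcu H] hv; move: (hu) (hcu) (hv) => /L2fieldP Lu /L2fieldP Lcu /L2fieldP Lv.
have I0 := nkern_intg (nkern_rho n) (Lcu j) (Lv j).
have I1 := nkern_intg (nkern_drho n (j + 2)) (Lu (j + 1)) (Lv j).
have I2 := nkern_intg (nkern_drho n (j + 1)) (Lu (j + 2)) (Lv j).
rewrite /dl /dbl -RintegralB//.
rewrite Rfubini2// [RHS]Rfubini2; last exact: intgB I1 I2.
apply: eq_Rintegral => y _ /=.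
have Hy := H _ (test_kern n j (- y) (or_introl erefl : 1 = 1 \/ 1 = -1)).
have E1 x : prodf (dtest (rho1 n) (- y) 1) x = rho n (x, y).
  by rewrite /rho /kern /prodf /dtest !mxE !mul1r.
have E2 l x : prodf (dh (dtest (rho1 n) (- y) 1) l) x = drho n l (x, y).
  by rewrite dh_dtest mul1r /drho /kern /prodf !mxE !mul1r.
have {Hy} Hy : \int[leb3]_x (drho n (j + 2) (x, y) * u x 0 (j + 1) - drho n (j + 1) (x, y) * u x 0 (j + 2)) =
    \int[leb3]_x (rho n (x, y) * cu x 0 j).
  rewrite -[LHS](_ : \int[leb3]_x dotv (u x) (curl (fun x => prodf (dtest (rho1 n) (- y) 1) x *: delta_mx 0 j) x) = _).
    rewrite Hy; apply: eq_Rintegral => x _.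
    rewrite dotvZr E1; congr (_ * _); rewrite dotvE (bigD1 j)//= big1 ?addr0.
      by rewrite mxE !eqxx mulr1.
    by move=> i ij; rewrite mxE (negbTE ij) andbF mulr0.
  apply: eq_Rintegral => x _; rewrite dotv_curl_prodf; last by move=> i; apply: smoothn_affine; exact: rho1_smooth.
  by rewrite !E2 mulrC [X in _ - X]mulrC.
rewrite RintegralZr//; last exact: nkern_section1 (nkern_rho n) (Lcu j).
rewrite -Hy -RintegralZr//.
  by apply: eq_Rintegral => x _; rewrite mulrBl.
by apply: intgB; apply: nkern_section1 => //; exact: nkern_drho.
Qed.

Lemma green_y n j u v cv : weak_curl v cv -> L2field u ->
  dbl (rho n) (fun x => u x 0 j) (fun x => cv x 0 j) =
  dl n (j + 1) u v j (j + 2) - dl n (j + 2) u v j (j + 1).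
Proof.
move=> [hv hcv H] hu; move: (hu) (hcv) (hv) => /L2fieldP Lu /L2fieldP Lcv /L2fieldP Lv.
have I0 := nkern_intg (nkern_rho n) (Lu j) (Lcv j).
have I1 := nkern_intg (nkern_drho n (j + 2)) (Lu j) (Lv (j + 1)).
have I2 := nkern_intg (nkern_drho n (j + 1)) (Lu j) (Lv (j + 2)).
rewrite /dl /dbl -RintegralB//.
rewrite Rfubini1// [RHS]Rfubini1; last exact: intgB I2 I1.
apply: eq_Rintegral => x _ /=.
have Hx := H _ (test_kern n j x (or_intror erefl : -1 = 1 \/ -1 = -1)).
have E1 y : prodf (dtest (rho1 n) x (-1)) y = rho n (x, y).
  by rewrite /rho /kern /prodf /dtest !mxE !mulN1r ![- _ + _]addrC.
have E2 l y : prodf (dh (dtest (rho1 n) x (-1)) l) y = - drho n l (x, y).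
  by rewrite dh_dtest mulN1r /drho /kern /prodf !mxE !mulN1r ![- _ + _]addrC.
have {Hx} Hx : \int[leb3]_y (drho n (j + 1) (x, y) * v y 0 (j + 2) - drho n (j + 2) (x, y) * v y 0 (j + 1)) =
    \int[leb3]_y (rho n (x, y) * cv y 0 j).
  rewrite -[LHS](_ : \int[leb3]_y dotv (v y) (curl (fun y => prodf (dtest (rho1 n) x (-1)) y *: delta_mx 0 j) y) = _).
    rewrite Hx; apply: eq_Rintegral => y _.
    rewrite dotvZr E1; congr (_ * _); rewrite dotvE (bigD1 j)//= big1 ?addr0.
      by rewrite mxE !eqxx mulr1.
    by move=> i ij; rewrite mxE (negbTE ij) andbF mulr0.
  apply: eq_Rintegral => y _; rewrite dotv_curl_prodf; last by move=> i; apply: smoothn_affine; exact: rho1_smooth.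
  by rewrite !E2 !mulrN opprK addrC mulrC [X in _ - X]mulrC.
rewrite -[LHS](_ : \int[leb3]_y (rho n (x, y) * cv y 0 j * u x 0 j) = _); last first.
  by apply: eq_Rintegral => y _; rewrite mulrAC.
rewrite RintegralZr//; last exact: nkern_section2 (nkern_rho n) (Lcv j).
rewrite -Hx -RintegralZr//.
  apply: eq_Rintegral => y _; rewrite mulrBl; congr (_ - _); exact: mulrAC.
by apply: intgB; apply: nkern_section2 => //; exact: nkern_drho.
Qed.

(** The kernel depends on x - y, so its derivatives in x and in y are opposite. At each fixed n both
    sides therefore reduce to the same sum of pairings with [drho], and mollification lets n tend to
    infinity. *)
Theorem weak_curl_symmetric u cu v cv : weak_curl u cu -> weak_curl v cv ->
  ip cu v = ip u cv.
Proof.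
move=> hcu hcv.
have [hu hcu2 _] := hcu; have [hv hcv2 _] := hcv.
move: (hu) (hcu2) (hcv2) (hv) => /L2fieldP Lu /L2fieldP Lcu /L2fieldP Lcv /L2fieldP Lv.
have ipE (a b : rV3 -> rV3) : L2field a -> L2field b ->
    ip a b = \sum_i \int[leb3]_x (a x 0 i * b x 0 i).
  move=> /L2fieldP La /L2fieldP Lb; rewrite /ip.
  under eq_Rintegral do rewrite dotvE.
  by rewrite Rintegral_sum// => i; exact: sqint_mul.
rewrite !ipE//.
have C1 : (fun n => \sum_i dbl (rho n) (fun x => cu x 0 i) (fun x => v x 0 i)) @ \oo -->
    \sum_i \int[leb3]_x (cu x 0 i * v x 0 i).
  rewrite sum3E; under eq_fun do rewrite sum3E.
  by apply: cvgD; first apply: cvgD; apply: (mollifies_sqint (Lv _)).2.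
have C2 : (fun n => \sum_i dbl (rho n) (fun x => u x 0 i) (fun x => cv x 0 i)) @ \oo -->
    \sum_i \int[leb3]_x (u x 0 i * cv x 0 i).
  rewrite sum3E; under eq_fun do rewrite sum3E.
  by apply: cvgD; first apply: cvgD; apply: (mollifies_sqint (Lcv _)).2.
have E : (fun n => \sum_i dbl (rho n) (fun x => cu x 0 i) (fun x => v x 0 i)) =
    (fun n => \sum_i dbl (rho n) (fun x => u x 0 i) (fun x => cv x 0 i)).
  apply/funext => n; under eq_bigr do rewrite (green_x _ _ hcu)//.
  under [RHS]eq_bigr do rewrite (green_y _ _ hcv)//.
  rewrite !sum3E !I3E; ring.
by rewrite E in C1; exact: (cvg_unique _ C1 C2).
Qed.

End Green.

(** * Laplace transform of the Maxwell system *)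

Section Rintegral_junk.
Context d (T : measurableType d) (R : realType) (mu : {measure set T -> \bar R}).
Implicit Types f : T -> R.

(* Rintegral of a measurable nonintegrable function is the junk value 0. *)
Lemma Rintegral_nonintegrable f : measurable_fun setT f ->
  ~ mu.-integrable setT (EFin \o f) -> \int[mu]_x f x = 0.
Proof.
move=> mf nf; have mF : measurable_fun setT (EFin \o f) by exact/measurable_EFinP.
rewrite /Rintegral integralE.
set a := (\int[mu]_x _^\+ x)%E; set b := (\int[mu]_x _^\- x)%E.
have a0 : (0 <= a)%E by apply: integral_ge0 => x _; exact: funepos_ge0.
have b0 : (0 <= b)%E by apply: integral_ge0 => x _; exact: funeneg_ge0.
have ab : (a + b = +oo)%E.
  apply: contrapT => h; apply: nf; apply/integrableP; split => //.
  rewrite (_ : (fun x => `|(EFin \o f) x|)%E = ((EFin \o f)^\+ \+ (EFin \o f)^\-)%E); last first.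
    exact: (fune_abse (EFin \o f)).
  rewrite ge0_integralD//; first by rewrite ltey; exact/eqP.
  - exact: measurable_funepos.
  - exact: measurable_funeneg.
by case: a b a0 b0 ab => [a||] [b||].
Qed.

(** Without integrability both sides take the default value 0 (for c <> 0). This spares an
    exceptional null set when a time integral is known to converge only for almost every x. *)
Lemma RintegralZl_measurable f c : measurable_fun setT f ->
  \int[mu]_x (c * f x) = c * \int[mu]_x f x.
Proof.
move=> mf; have [hf|hf] := pselect (mu.-integrable setT (EFin \o f)).
  exact: RintegralZl.
have [->|c0] := eqVneq c 0.
  by rewrite mul0r; under eq_Rintegral do rewrite mul0r; rewrite /Rintegral integral0.
rewrite [X in _ * X]Rintegral_nonintegrable// mulr0 Rintegral_nonintegrable//; first exact: measurable_funM.
move=> h; apply: hf; have := intgZ c^-1 h.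
by under [X in EFin \o X]eq_fun do rewrite mulKf//.
Qed.

End Rintegral_junk.

Section test_fields.
Context {R : realType}.
Notation rV3 := 'rV[R]_3.
Notation leb3 := (@leb3 R).

Lemma cont_compact_bounded (g : rV3 -> R) (K : set rV3) : compact K -> continuous g ->
  (forall x, ~ K x -> g x = 0) -> exists2 M, 0 <= M & forall x, `|g x| <= M.
Proof.
move=> cK cg g0.
have [[x0 Kx0]|K0] := pselect (K !=set0); last first.
  by exists 0 => // x; rewrite g0 ?normr0// => Kx; apply: K0; exists x.
have [c Kc hc] := @EVT_max_rV R 3 (fun x => `|g x|) K (ex_intro _ x0 Kx0) cK
  (continuous_subspaceT (fun x => continuous_comp (cg x) (@norm_continuous _ _ _))).
exists `|g c| => // x; have [Kx|nKx] := pselect (K x); first by apply: hc; rewrite inE.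
by rewrite g0// normr0.
Qed.

Lemma compact_sub_cube (K : set rV3) : compact K -> exists m, K `<=` cube m.
Proof.
move=> /compact_bounded [M [Mr hM]].
exists (Num.trunc (`|M| + 1)).+1 => x Kx i.
have hx : `|x| <= `|M| + 1 by apply: hM => //; rewrite (le_lt_trans (ler_norm M))// ltrDl.
have hi : `|x 0 i| <= `|x|.
  rewrite [leRHS]/Num.Def.normr /= mx_normrE; apply/bigmax_geP; right => /=; exists (0, i) => //.
have : `|x 0 i| < (Num.trunc (`|M| + 1)).+1%:R.
  by apply: le_lt_trans (truncnS_gt _); exact: le_trans hx.
by rewrite /= in_itv/= ltr_norml => /andP[-> /ltW].
Qed.

Lemma cont_compact_sqint (g : rV3 -> R) (K : set rV3) : compact K -> continuous g ->
  (forall x, ~ K x -> g x = 0) -> sqint leb3 g.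
Proof.
move=> cK cg g0; have [M M0 hM] := cont_compact_bounded cK cg g0.
have [m Km] := compact_sub_cube cK.
have mg := continuous_measurable_rV cg.
split => //; apply: (@intg_le _ _ _ _ (fun x => M ^+ 2 * \1_(cube m) x)).
- exact: measurable_funX.
- apply: intgZ; apply/integrableP; split.
    by apply/measurable_EFinP; apply: measurable_indic; exact: measurable_cube.
  under eq_integral do rewrite gee0_abs ?lee_fin//.
  rewrite integral_indic//; last exact: measurable_cube.
  by rewrite setIT; exact: leb3_cube_lty.
- move=> x; rewrite indicE.
  have [Kx|nKx] := pselect (K x).
    rewrite mem_set ?mulr1; last exact: Km.
    by rewrite ger0_norm ?sqr_ge0// -(real_normK (num_real _)) ler_pXn2r ?nnegrE.
  by rewrite g0// expr0n normr0 mulr_ge0 ?sqr_ge0.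
Qed.

Lemma test_L2 (phi : rV3 -> rV3) : test_field phi -> L2field phi /\ L2field (curl phi).
Proof.
move=> [Cphi cK]; set K := closure _ in cK.
have phi0 x : ~ K x -> phi x = 0.
  move=> nK; apply: contrapT => p0; apply: nK; apply: subset_closure.
  by apply/eqP.
have oK : open (~` K) by rewrite openC; exact: closed_closure.
split; apply/L2fieldP => i.
  apply: (cont_compact_sqint cK); first exact: (Cphi 0%N i).
  by move=> x nK; rewrite phi0// mxE.
have H l j : sqint leb3 (partial l (fun y => phi y 0 j)).
  apply: (cont_compact_sqint cK).
    by have /= [_ /(_ l)[_]] := Cphi 1%N j.
  move=> x nK; rewrite /partial (@near_eq_derive _ _ _ _ (cst 0)) ?derive_cst//.
  have : \forall y \near x, (~` K) y by exact: open_nbhs_nbhs.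
  by apply: filterS => y /phi0 ->; rewrite mxE.
under eq_fun do rewrite mxE -mulN1r.
by apply: sqintD => //; exact: sqintZ.
Qed.

End test_fields.

(** * Time-dependent fields and their finite Laplace transforms *)

Section time_fields.
Context {R : realType}.
Notation rV3 := 'rV[R]_3.
Notation mR := (measurableTypeR R).
Notation leb3 := (@leb3 R).
Notation leb := (@lebesgue_measure R).
Variables (T : R) (T0 : 0 < T).
Implicit Types U : R -> rV3 -> rV3.

Lemma L2_C0_cvg U t : L2_C0 T U -> t \in `[0, T] -> forall e, 0 < e ->
  \forall s \near t, s \in `[0, T] -> nrm (fun x => U s x - U t x) < e.
Proof.
move=> hU tT e e0; have [Lt] := hU t tT.
move=> /fine_cvgP[_] /cvgrPdist_lt /(_ e e0).
rewrite near_withinE => h; near=> s => sT.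
have : s \in `[0, T] -> `|0 - fine (L2norm (fun x => U s x - U t x))| < e by near: s.
move=> /(_ sT).
by rewrite sub0r normrN L2normE//= ?ger0_norm ?nrm_ge0//; apply: L2fieldB => //; have [] := hU s sT.
Unshelve. all: by end_near. Qed.

Lemma ip_continuous U psi : L2_C0 T U -> L2field psi ->
  {within `[0, T]%classic, continuous (fun t => ip (U t) psi)}.
Proof.
move=> hU hpsi; apply/subspace_continuousP => t tT.
apply/cvgrPdist_lt => e e0; have p1 : 0 < nrm psi + 1 by rewrite ltr_wpDl ?nrm_ge0.
have := L2_C0_cvg hU tT (divr_gt0 e0 p1); rewrite /within/=.
apply: filterS => s hs sT; have {}hs := hs sT.
have [Ls _] := hU s sT; have [Lt _] := hU t tT.
rewrite distrC -ipBl//; apply: le_lt_trans (ip_CS (L2fieldB Ls Lt) hpsi) _.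
move: hs; rewrite ltr_pdivlMr// => hs; apply: le_lt_trans hs.
by rewrite ler_wpM2l ?nrm_ge0// lerDl.
Qed.

Lemma nrm_bounded U : L2_C0 T U -> exists2 M, 0 <= M & forall t, t \in `[0, T] -> nrm (U t) <= M.
Proof.
move=> hU.
have cn : {within `[0, T]%classic, continuous (fun t => nrm (U t))}.
  apply/subspace_continuousP => t tT; apply/cvgrPdist_lt => e e0.
  have := L2_C0_cvg hU tT e0; rewrite /within/=; apply: filterS => s hs sT; have {}hs := hs sT.
  have [Ls _] := hU s sT; have [Lt _] := hU t tT.
  apply: le_lt_trans hs.
  have E1 : nrm (U t) <= nrm (fun x => U s x - U t x) + nrm (U s).
    have := nrmD (L2fieldZ (-1) (L2fieldB Ls Lt)) Ls.
    rewrite nrmZ; last exact: L2fieldB.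
    rewrite normrN1 mul1r; under eq_fun do rewrite scaleN1r opprB subrK.
    exact.
  have E2 : nrm (U s) <= nrm (fun x => U s x - U t x) + nrm (U t).
    by have := nrmD (L2fieldB Ls Lt) Lt; under eq_fun do rewrite subrK.
  suff : `|nrm (U t) - nrm (U s)| <= nrm (fun x => U s x - U t x) by [].
  by rewrite ler_norml lerNl opprB !lerBlDr E1 E2.
have [c cT hc] := EVT_max (ltW T0) cn.
by exists (nrm (U c)); [exact: nrm_ge0|exact: hc].
Qed.

(** Pairing with a fixed field turns the derivative in L^2 into a scalar one, by the Cauchy-Schwarz
    inequality. All calculus in time is carried out on such pairings. *)
Lemma ip_derive U U' psi t : L2_C1 T U U' -> L2field psi -> t \in `]0, T[ ->
  is_derive t 1 (fun t => ip (U t) psi) (ip (U' t) psi).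
Proof.
move=> [hU hU' hd] hpsi t0T.
have tT : t \in `[0, T] by apply: subset_itv_oo_cc.
have [Lt _] := hU t tT; have [L't _] := hU' t tT.
have nT : \forall s \near t, s \in `[0, T].
  by have := near_in_itvoo t0T; apply: filterS => s; exact: subset_itv_oo_cc.
suff H : (fun h : R => h^-1 *: (((fun t => ip (U t) psi) \o shift t) (h *: 1) - ip (U t) psi)) @ 0^' --> ip (U' t) psi.
  by apply: DeriveDef; [apply/cvg_ex; exists (ip (U' t) psi)|exact: cvg_lim H].
apply/cvgrPdist_lt => e e0; have p1 : 0 < nrm psi + 1 by rewrite ltr_wpDl ?nrm_ge0.
have e1 := divr_gt0 e0 p1.
have := hd t tT => /fine_cvgP[_] /cvgrPdist_lt /(_ _ e1); rewrite /within/= => hs.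
have {hs} hs : \forall s \near t, s != t -> s \in `[0, T] /\
    nrm (fun x => (s - t)^-1 *: (U s x - U t x) - U' t x) < e / (nrm psi + 1).
  near=> s => st; have sT : s \in `[0, T] by near: s.
  split => //.
  have : (s \in `[0, T] -> `|0 - fine (L2norm (fun x => (s - t)^-1 *: (U s x - U t x) - U' t x))| < e / (nrm psi + 1)).
    by move: st; near: s.
  move=> /(_ sT); have [Ls _] := hU s sT.
  rewrite sub0r normrN L2normE/= ?ger0_norm ?nrm_ge0//.
  by apply: L2fieldB => //; apply: L2fieldZ; exact: L2fieldB.
have : \forall h \near 0^', (h + t != t) -> h + t \in `[0, T] /\
    nrm (fun x => (h + t - t)^-1 *: (U (h + t) x - U t x) - U' t x) < e / (nrm psi + 1).
  have C : (fun h : R => h + t) @ 0^' --> t.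
    rewrite -[X in _ --> X]add0r; apply: cvgD; last exact: cvg_cst.
    exact: cvg_within.
  exact: (C _ hs).
move=> H; near=> h.
have h0 : h != 0 by near: h; exact: nbhs_dnbhs_neq.
have [] : h + t \in `[0, T] /\
    nrm (fun x => (h + t - t)^-1 *: (U (h + t) x - U t x) - U' t x) < e / (nrm psi + 1).
  have : h + t != t -> h + t \in `[0, T] /\
    nrm (fun x => (h + t - t)^-1 *: (U (h + t) x - U t x) - U' t x) < e / (nrm psi + 1) by near: h.
  by apply; rewrite -subr_eq0 addrK.
move=> sT; rewrite addrK => hn; have [Ls _] := hU _ sT.
have -> : ip (U' t) psi - h^-1 *: (((fun t => ip (U t) psi) \o shift t) (h *: 1) - ip (U t) psi) =
    - ip (fun x => h^-1 *: (U (h + t) x - U t x) - U' t x) psi.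
  have LB := L2fieldB Ls Lt.
  rewrite ipBl//; last exact: L2fieldZ.
  by rewrite ipZl// ipBl//= /GRing.scale/= mulr1 opprB.
rewrite normrN; apply: le_lt_trans (ip_CS _ hpsi) _.
  by apply: L2fieldB => //; apply: L2fieldZ; exact: L2fieldB.
move: hn; rewrite ltr_pdivlMr// => hn; apply: le_lt_trans hn.
by rewrite ler_wpM2l ?nrm_ge0// lerDl.
Unshelve. all: by end_near. Qed.

Lemma is_derive_expRM (c t : R) : is_derive t 1 (fun t => expR (c * t)) (c * expR (c * t)).
Proof.
have h := is_derive_affine c 0 t.
have H := @is_derive1_comp _ (@expR R) (fun t => c * t + 0) t _ _ (is_derive_expR _) h.
have E : (@expR R \o (fun t => c * t + 0)) = (fun t => expR (c * t)).
  by apply/funext => s /=; rewrite addr0.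
by rewrite E addr0 in H; rewrite mulrC.
Qed.

Lemma continuous_expRM (c : R) : continuous (fun t => expR (c * t)).
Proof.
move=> t; apply/differentiable_continuous/derivable1_diffP.
by have [] := is_derive_expRM c t.
Qed.

Lemma within_cont_mul (f g : R -> R) : {within `[0, T]%classic, continuous f} ->
  {within `[0, T]%classic, continuous g} ->
  {within `[0, T]%classic, continuous (fun t => f t * g t)}.
Proof. by move=> cf cg x; apply: continuousM; [exact: cf|exact: cg]. Qed.

Lemma within_cont_sub (f g : R -> R) : {within `[0, T]%classic, continuous f} ->
  {within `[0, T]%classic, continuous g} ->
  {within `[0, T]%classic, continuous (fun t => f t - g t)}.
Proof. by move=> cf cg x; apply: continuousB; [exact: cf|exact: cg]. Qed.

Lemma within_cont_cst (c : R) : {within `[0, T]%classic, continuous (fun=> c)}.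
Proof. by apply: continuous_subspaceT => x; exact: cvg_cst. Qed.

Lemma within_integrable (f : R -> R) : {within `[0, T]%classic, continuous f} ->
  leb.-integrable `[0, T]%classic (EFin \o f).
Proof. by apply: continuous_compact_integrable; exact: segment_compact. Qed.

(** The integrand is the derivative of e^{-tau t} <U(t), psi>. The boundary value at t = T is the
    origin of every error term of size e^{-tau T}. *)
Lemma ip_ftc U U' psi tau : L2_C1 T U U' -> L2field psi ->
  \int[leb]_(t in `[0, T]) (expR (- tau * t) * (ip (U' t) psi - tau * ip (U t) psi)) =
  expR (- tau * T) * ip (U T) psi - ip (U 0) psi.
Proof.
move=> h hpsi; have [hU hU' _] := h.
have cU := ip_continuous hU hpsi; have cU' := ip_continuous hU' hpsi.
have ce : {within `[0, T]%classic, continuous (fun t : R => expR (- tau * t))}.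
  by apply: continuous_subspaceT; exact: continuous_expRM.
pose F t := expR (- tau * t) * ip (U t) psi.
have cF : {within `[0, T]%classic, continuous F} by exact: within_cont_mul.
have dF (t : R) : t \in `]0, T[ -> is_derive t 1 F (expR (- tau * t) * (ip (U' t) psi - tau * ip (U t) psi)).
  move=> tT; have := is_deriveM (is_derive_expRM (- tau) t) (ip_derive h hpsi tT).
  move=> H; apply: (is_derive_conv H); rewrite /GRing.scale/=; ring.
rewrite /Rintegral (@continuous_FTC2 _ _ F)//.
- by rewrite /F mulr0 expR0 mul1r.
- apply: within_cont_mul => //; apply: within_cont_sub => //.
  by apply: within_cont_mul => //; exact: within_cont_cst.
- have [_ c0 cT] := (continuous_within_itvP F T0).1 cF.
  by split => // t tT; have [] := dF t tT.
- by move=> t tT; rewrite derive1E; have [_ ->] := dF t tT.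
Qed.

Section laplace_field.
Variables (U : R -> rV3 -> rV3) (tau : R).
Hypotheses (mU : jointly_measurable T U) (cU : L2_C0 T U).

(** Extension by zero in time: joint measurability holds on [0, T] only, and Fubini's theorem is
    applied on the whole product. *)
Let g i (z : mR * rV3) : R := if z.1 \in `[0, T] then U z.1 z.2 0 i else 0.

Let mg i : measurable_fun setT (g i).
Proof.
have m1 : measurable (`[0, T]%classic `*` setT : set (R * rV3)).
  by apply: measurableX => //; exact: measurable_itv.
have h := (measurable_restrictT _ m1).1 (mU i).
have -> : g i = (fun tx : R * rV3 => U tx.1 tx.2 0 i) \_ (`[0, T]%classic `*` setT).
  apply/funext => -[t x]; rewrite /g patchE /=; case: ifPn => tT.
    by rewrite mem_set.
  by rewrite memNset//= => -[tT' _]; rewrite tT' in tT.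
by move=> _ B mB; exact: (h measurableT B mB).
Qed.

Let W i x : R := \int[leb]_t (expR (- tau * t) * g i (t, x)).

Let laplaceTE x i : laplaceT T U tau x 0 i = W i x.
Proof.
rewrite /laplaceT mxE /laplace Rintegral_mkcond; apply: eq_Rintegral => t _.
rewrite patchE /g /=; case: ifPn => tT.
  by rewrite ifT//; move: tT; rewrite inE.
rewrite ifF ?mulr0//; apply/negP => h; move: tT; rewrite notin_setE; exact.
Qed.

Let ebd : R := expR (`|tau| * T).

Let ebdP t : t \in `[0, T] -> expR (- tau * t) <= ebd.
Proof.
rewrite in_itv/= => /andP[t0 tT]; rewrite ler_expR mulNr.
have := ler_norm (- tau); rewrite normrN => h.
apply: (@le_trans _ _ (`|tau| * t)); first by rewrite -mulNr ler_wpM2r.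
by rewrite ler_wpM2l.
Qed.

Let M := sval (cid2 (nrm_bounded cU)).
Let M0 : 0 <= M. Proof. by rewrite /M; case: cid2. Qed.
Let MP t : t \in `[0, T] -> nrm (U t) <= M.
Proof. by rewrite /M; case: cid2 => m m0 hm /=; exact: hm. Qed.

Let g_sq t i : (\int[leb3]_x ((g i (t, x)) ^+ 2)%:E <= (M ^+ 2)%:E * (\1_`[0, T] t)%:E)%E.
Proof.
rewrite indicE; have [tT|tT] := boolP (t \in `[0, T]); last first.
  rewrite integral0_eq; first by rewrite mule_ge0// lee_fin ?sqr_ge0.
  by move=> x _; rewrite /g /= (negbTE tT) expr0n.
rewrite mem_set// mule1 /g /= tT.
have [Lt _] := cU tT; have Lti := (L2fieldP _).1 Lt i.
have /fineK <- := integrable_fin_num measurableT Lti.2.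
rewrite lee_fin; apply: (@le_trans _ _ (ip (U t) (U t))).
  apply: le_Rintegral => //; [exact: Lti.2|exact: L2field_dotv|].
  move=> x _; rewrite dotvE (bigD1 i)//= expr2 lerDl sumr_ge0// => j _.
  by rewrite -expr2 sqr_ge0.
by rewrite -nrm_sqr ler_pXn2r ?nnegrE ?nrm_ge0// MP.
Qed.

Let ind_int : (\int[leb]_t (\1_`[0, T] t)%:E = T%:E)%E.
Proof.
rewrite integral_indic ?setIT//.
change (leb `[0, T]%classic = T%:E).
by rewrite lebesgue_measure_itv /= lte_fin T0 -EFinD subr0.
Qed.

Let intT_lt : (\int[leb]_t ((M ^+ 2)%:E * (\1_`[0, T] t)%:E) < +oo)%E.
Proof.
rewrite ge0_integralZl; [|by []| | |].
- by rewrite ind_int -EFinM; exact: ltry.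
- by apply/measurable_EFinP; apply: measurable_indic; exact: measurable_itv.
- by move=> t _; rewrite lee_fin.
- by rewrite lee_fin sqr_ge0.
Qed.

Let mg2 i : measurable_fun setT (fun z : mR * rV3 => ((g i z) ^+ 2)%:E).
Proof. by apply/measurable_EFinP; exact: measurable_funX. Qed.

Let g2_lty i : (\int[leb3]_x \int[leb]_t ((g i (t, x)) ^+ 2)%:E < +oo)%E.
Proof.
have g20 (z : mR * rV3) : (0 <= ((g i z) ^+ 2)%:E)%E by rewrite lee_fin sqr_ge0.
rewrite -(@fubini_tonelli _ _ _ _ _ leb leb3 (fun z => ((g i z) ^+ 2)%:E) (mg2 i) g20).
apply: le_lt_trans intT_lt; apply: ge0_le_integral => //.
- by move=> t _; apply: integral_ge0 => x _; rewrite lee_fin sqr_ge0.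
- exact: (@measurable_fun_fubini_tonelli_F _ _ _ _ _ leb3 (fun z => ((g i z) ^+ 2)%:E) (mg2 i) g20).
- apply: emeasurable_funM; first exact: measurable_cst.
  by apply/measurable_EFinP; apply: measurable_indic; exact: measurable_itv.
Qed.

Let meg i : measurable_fun setT (fun z : mR * rV3 => expR (- tau * z.1) * g i z).
Proof.
apply: measurable_funM => //.
apply: (measurableT_comp (continuous_measurable_fun (@continuous_expRM (- tau)))).
exact: measurable_fst.
Qed.

Let mW i : measurable_fun setT (W i).
Proof.
rewrite /W /Rintegral; apply: (measurableT_comp (fine_measurable measurableT)).
pose F (z : mR * rV3) := (expR (- tau * z.1) * g i z)%:E.
have mF : measurable_fun setT F by exact/measurable_EFinP.
rewrite (_ : (fun x => _) = (fun x => \int[leb]_t F^\+ (t, x) - \int[leb]_t F^\- (t, x))%E).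
  apply: emeasurable_funB.
    apply: (@measurable_fun_fubini_tonelli_G _ _ _ _ _ leb (F^\+)%E) => //.
    exact: measurable_funepos.
  apply: (@measurable_fun_fubini_tonelli_G _ _ _ _ _ leb (F^\-)%E) => //.
  exact: measurable_funeneg.
apply/funext => x; rewrite integralE; congr (_ - _)%E; apply: eq_integral => t _.
  by rewrite !funeposE.
by rewrite !funenegE.
Qed.

Let indT_intg : leb.-integrable setT (EFin \o (fun t => \1_`[0, T] t)).
Proof.
apply/integrableP; split; first by apply/measurable_EFinP; apply: measurable_indic; exact: measurable_itv.
rewrite (eq_integral (fun t : mR => (\1_`[0, T] t)%:E)).
  by rewrite ind_int ltry.
by move=> t _ /=; rewrite ger0_norm.
Qed.

Let RindT : \int[leb]_t \1_`[0, T] t = T.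
Proof.
by rewrite /Rintegral ind_int.
Qed.

(** The Cauchy-Schwarz inequality on [0, T] at a fixed x. It is stated in the extended reals,
    because the right side may be infinite for exceptional x. *)
Let W_sq i x : (((W i x) ^+ 2)%:E <= (T * ebd ^+ 2)%:E * \int[leb]_t ((g i (t, x)) ^+ 2)%:E)%E.
Proof.
have eb0 : 0 < ebd by exact: expR_gt0.
have C0 : 0 < T * ebd ^+ 2 by rewrite mulr_gt0// exprn_gt0.
have mgx : measurable_fun setT (fun t : mR => g i (t, x)) by exact: measurableT_comp.
have mgx2 : measurable_fun setT (fun t : mR => ((g i (t, x)) ^+ 2)%:E).
  by apply/measurable_EFinP; exact: measurable_funX.
have mh : measurable_fun setT (fun t : mR => expR (- tau * t) * g i (t, x)).
  by apply: measurable_funM => //; exact: (continuous_measurable_fun (@continuous_expRM (- tau))).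
have I0 : (0 <= \int[leb]_t ((g i (t, x)) ^+ 2)%:E)%E.
  by apply: integral_ge0 => t _; rewrite lee_fin sqr_ge0.
have [Ifin|] := ltP (\int[leb]_t ((g i (t, x)) ^+ 2)%:E)%E (+oo)%E; last first.
  rewrite leye_eq => /eqP ->; rewrite gt0_muley ?lte_fin//; exact: leey.
have Ig2 : leb.-integrable setT (EFin \o (fun t => (g i (t, x)) ^+ 2)).
  apply/integrableP; split => //.
  rewrite (eq_integral (fun t => ((g i (t, x)) ^+ 2)%:E))//.
  by move=> t _; rewrite gee0_abs// lee_fin sqr_ge0.
pose h t := expR (- tau * t) * g i (t, x).
have h2 t : h t ^+ 2 <= ebd ^+ 2 * (g i (t, x)) ^+ 2.
  rewrite /h; have [tT|tT] := boolP (t \in `[0, T]); last first.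
    by rewrite /g /= (negbTE tT) mulr0 expr0n mulr0.
  by rewrite exprMn ler_wpM2r ?sqr_ge0// ler_pXn2r ?nnegrE ?expR_ge0 ?(ltW eb0)//; exact: ebdP.
have h0 t : t \notin `[0, T] -> h t = 0 by move=> tT; rewrite /h /g /= (negbTE tT) mulr0.
have Ih2 : leb.-integrable setT (EFin \o (fun t => h t ^+ 2)).
  apply: (@intg_le _ _ _ leb (fun t => ebd ^+ 2 * (g i (t, x)) ^+ 2)).
  - exact: measurable_funX.
  - exact: intgZ.
  - by move=> t; rewrite ger0_norm ?sqr_ge0.
have indE t : \1_`[0, T] t = (t \in `[0, T])%:R :> R.
  rewrite indicE; congr (_%:R); congr nat_of_bool; by apply/idP/idP; rewrite inE.
have Ih : leb.-integrable setT (EFin \o h).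
  apply: (@intg_le _ _ _ leb (fun t => \1_`[0, T] t + h t ^+ 2)) => //.
    by apply: intgD; [exact: indT_intg|exact: Ih2].
  move=> t; rewrite indE; have [tT|/h0 ->] := boolP (t \in `[0, T]); last by rewrite normr0 expr0n addr0.
  rewrite -(real_normK (num_real (h t))); have := normr_ge0 (h t); have := sqr_ge0 (`|h t| - 1).
  by rewrite sqrrB expr1n mulr1 /=; nra.
(* The mean of h over [0, T]; expanding (h - m)^2 >= 0 and integrating over [0, T] gives W^2 <= T
   times the integral of h^2. *)
pose m := W i x / T.
have key : 2 * m * W i x <= \int[leb]_t (h t ^+ 2) + m ^+ 2 * T.
  rewrite -[X in _ * X <= _]/(\int[leb]_t h t) -[X in m ^+ 2 * X]RindT.
  rewrite -!RintegralZl// -RintegralD//; last exact: intgZ.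
  apply: le_Rintegral => //; [exact: intgZ|by apply: intgD => //; exact: intgZ|].
  move=> t _; rewrite indE; have [tT|/h0 ->] := boolP (t \in `[0, T]); last by rewrite !mulr0 expr0n addr0.
  by have := sqr_ge0 (h t - m); rewrite sqrrB mulr1 -mulrA mulr2n mulrC; lra.
have Rg : \int[leb]_t (h t ^+ 2) <= ebd ^+ 2 * \int[leb]_t ((g i (t, x)) ^+ 2).
  by rewrite -RintegralZl//; apply: le_Rintegral => //; exact: intgZ.
have /fineK <- := integrable_fin_num measurableT Ig2.
rewrite -EFinM lee_fin -mulrA.
apply: le_trans (ler_wpM2l (ltW T0) Rg).
rewrite -(ler_pM2r T0) in key; move: key; rewrite [leRHS]mulrDl.
have -> : 2 * m * W i x * T = 2 * W i x ^+ 2 by rewrite /m; field; rewrite gt_eqF.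
have -> : m ^+ 2 * T * T = W i x ^+ 2 by rewrite /m; field; rewrite gt_eqF.
by move: (\int[leb]_t _) => I2; lra.
Qed.

Lemma laplaceT_L2field : L2field (laplaceT T U tau).
Proof.
apply/L2fieldP => i; rewrite (_ : (fun x => _) = W i); last first.
  by apply/funext => x; rewrite laplaceTE.
split => //; apply/integrableP; split.
  by apply/measurable_EFinP; exact: measurable_funX.
have g20 (z : mR * rV3) : (0 <= ((g i z) ^+ 2)%:E)%E by rewrite lee_fin sqr_ge0.
have mG : measurable_fun setT (fun x => \int[leb]_t ((g i (t, x)) ^+ 2)%:E)%E.
  exact: (@measurable_fun_fubini_tonelli_G _ _ _ _ _ leb (fun z => ((g i z) ^+ 2)%:E) (mg2 i) g20).
apply: (@le_lt_trans _ _ (\int[leb3]_x ((T * ebd ^+ 2)%:E * \int[leb]_t ((g i (t, x)) ^+ 2)%:E)))%E.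
  apply: ge0_le_integral => //.
  - apply: measurableT_comp => //; apply/measurable_EFinP; exact: measurable_funX.
  - by apply: emeasurable_funM => //; exact: measurable_cst.
  - by move=> x _ /=; rewrite ger0_norm ?sqr_ge0//; exact: W_sq.
rewrite ge0_integralZl; [|by []|exact: mG| |].
- apply: lte_mul_pinfty; [|by []|exact: g2_lty].
  by rewrite lee_fin mulr_ge0 ?(ltW T0)// exprn_ge0// expR_ge0.
- by move=> x _; apply: integral_ge0 => t _; rewrite lee_fin sqr_ge0.
- by rewrite lee_fin mulr_ge0 ?(ltW T0)// exprn_ge0// expR_ge0.
Qed.

Lemma ip_laplaceT psi : L2field psi ->
  ip (laplaceT T U tau) psi = \int[leb]_(t in `[0, T]) (expR (- tau * t) * ip (U t) psi).
Proof.
move=> hpsi; have /L2fieldP Lp := hpsi.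
have /L2fieldP LW := laplaceT_L2field.
pose F i (z : mR * rV3) := expR (- tau * z.1) * g i z * psi z.2 0 i.
have indE t : \1_`[0, T] t = (t \in `[0, T])%:R :> R.
  rewrite indicE; congr (_%:R); congr nat_of_bool; by apply/idP/idP; rewrite inE.
have mpsi i : measurable_fun setT (fun z : mR * rV3 => psi z.2 0 i).
  by apply: (measurableT_comp (Lp i).1); exact: measurable_snd.
have mind : measurable_fun setT (fun z : mR * rV3 => \1_`[0, T] z.1 : R).
  by apply: (measurableT_comp (measurable_indic _)); [exact: measurable_itv|exact: measurable_fst].
have Ig2 i : (leb \x leb3)%E.-integrable setT (EFin \o (fun z : mR * rV3 => g i z ^+ 2)).
  apply/integrable12ltyP; first exact: mg2.
  apply: le_lt_trans intT_lt; apply: ge0_le_integral => //.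
  + by move=> t _; exact: integral_ge0.
  + apply: (@measurable_fun_fubini_tonelli_F _ _ _ _ _ leb3 (fun z => `|((g i z) ^+ 2)%:E|%E)) => //.
    by apply: measurableT_comp => //; exact: mg2.
  + apply: emeasurable_funM; first exact: measurable_cst.
    by apply/measurable_EFinP; apply: measurable_indic; exact: measurable_itv.
  + move=> t _; apply: le_trans (g_sq t i); rewrite le_eqVlt; apply/orP; left; apply/eqP.
    by apply: eq_integral => x _ /=; rewrite ger0_norm ?sqr_ge0.
have Ip2 i : (leb \x leb3)%E.-integrable setT (EFin \o (fun z : mR * rV3 => \1_`[0, T] z.1 * psi z.2 0 i ^+ 2)).
  have m2 : measurable_fun setT (EFin \o (fun z : mR * rV3 => \1_`[0, T] z.1 * psi z.2 0 i ^+ 2)).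
    by apply/measurable_EFinP; apply: measurable_funM => //; exact: measurable_funX.
  apply/integrable12ltyP => //.
  have /integrableP[_] := intgZ (\int[leb3]_x (psi x 0 i ^+ 2)) indT_intg.
  apply: le_lt_trans; apply: ge0_le_integral => //.
  + by move=> t _; exact: integral_ge0.
  + apply: (@measurable_fun_fubini_tonelli_F _ _ _ _ _ leb3 (fun z => `|(\1_`[0, T] z.1 * psi z.2 0 i ^+ 2)%:E|%E)) => //.
    exact: measurableT_comp.
  + apply: measurableT_comp => //; apply/measurable_EFinP; apply: measurable_funM; first exact: measurable_cst.
    by apply: measurable_indic; exact: measurable_itv.
  + move=> t _ /=.
    have P0 : 0 <= \int[leb3]_x (psi x 0 i ^+ 2) by apply: Rintegral_ge0 => x _; rewrite sqr_ge0.
    rewrite (ger0_norm (mulr_ge0 P0 _))//.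
    rewrite (eq_integral (fun x => (\1_`[0, T] t)%:E * (psi x 0 i ^+ 2)%:E)%E); last first.
      by move=> x _ /=; rewrite -EFinM ger0_norm// mulr_ge0 ?sqr_ge0.
    rewrite integralZl//; last exact: (Lp i).2.
    by rewrite mulrC EFinM /Rintegral fineK//; exact: integrable_fin_num (Lp i).2.
have IF i : (leb \x leb3)%E.-integrable setT (EFin \o F i).
  apply: (@intg_le _ _ _ (leb \x leb3)%E (fun z => ebd * (g i z ^+ 2 + \1_`[0, T] z.1 * psi z.2 0 i ^+ 2))).
  - by apply: measurable_funM.
  - by apply: intgZ; apply: intgD.
  - move=> [t x] /=; rewrite indE /F /=; have [tT|tT] := boolP (t \in `[0, T]); last first.
      rewrite {1}/g /= (negbTE tT) mulr0 mul0r normr0 mul0r addr0.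
      by rewrite mulr_ge0 ?sqr_ge0// expR_ge0.
    rewrite mul1r -mulrA normrM (ger0_norm (expR_ge0 _)).
    apply: ler_pM; rewrite ?expR_ge0 ?ebdP//.
    by rewrite ler_norml; apply/andP; split; nra.
transitivity (\sum_i \int[leb]_t (\int[leb3]_x F i (t, x))).
  rewrite /ip; under eq_Rintegral do rewrite dotvE.
  rewrite Rintegral_sum; last by move=> i; exact: sqint_mul.
  apply: eq_bigr => i _; rewrite -(Rfubini1 (IF i)) Rfubini2//.
  apply: eq_Rintegral => x _; rewrite laplaceTE /W /F /=.
  rewrite mulrC -RintegralZl_measurable//; last first.
    apply: measurable_funM; last exact: measurableT_comp.
    exact: (continuous_measurable_fun (@continuous_expRM (- tau))).
  by apply: eq_Rintegral => t _; rewrite mulrC.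
rewrite -Rintegral_sum; last by move=> i; exact: (intg_fubini1 (IF i)).
rewrite [RHS]Rintegral_mkcond; apply: eq_Rintegral => t _.
rewrite patchE; case: ifPn => tT; last first.
  rewrite big1// => i _; rewrite /Rintegral (eq_integral (cst 0%E)) ?integral0// => x _.
  rewrite /F /g /= ifF ?mulr0 ?mul0r//; apply/negP => h; move: tT; rewrite notin_setE; exact.
have {}tT : t \in `[0, T] by move: tT; rewrite inE.
have [Lt _] := cU tT.
rewrite /ip -RintegralZl//; last exact: L2field_dotv.
under [RHS]eq_Rintegral do rewrite dotvE mulr_sumr.
rewrite Rintegral_sum; last first.
  by move=> i; apply: intgZ; apply: sqint_mul => //; exact: ((L2fieldP _).1 Lt i).
by apply: eq_bigr => i _; apply: eq_Rintegral => x _; rewrite /F /g /= tT mulrA.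
Qed.

End laplace_field.

(** The field equations hold for 0 < t < T only; the two endpoints carry no mass. *)
Lemma eq_Rintegral_itvoo (f g : R -> R) :
  leb.-integrable `[0, T]%classic (EFin \o f) -> leb.-integrable `[0, T]%classic (EFin \o g) ->
  (forall t, t \in `]0, T[ -> f t = g t) ->
  \int[leb]_(t in `[0, T]) f t = \int[leb]_(t in `[0, T]) g t.
Proof.
move=> If Ig fg.
have sub : forall h : R -> R, leb.-integrable `[0, T]%classic (EFin \o h) ->
  \int[leb]_(t in `[0, T]) h t = \int[leb]_(t in `]0, T[) h t.
  move=> h Ih; rewrite -Rintegral_itv_obnd_cbnd; last first.
    by apply: integrableS Ih => //; exact: subset_itv_oc_cc.
  by rewrite -Rintegral_itv_bndo_bndc//; apply: integrableS Ih => //; exact: subset_itv_oo_cc.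
by rewrite !sub//; apply: eq_Rintegral => t; rewrite inE; exact: fg.
Qed.

Lemma ip_mul_move (h : rV3 -> R) u v : ip (fun x => h x *: u x) v = ip u (fun x => h x *: v x).
Proof. by apply: eq_Rintegral => x _; rewrite dotvZl [in RHS]dotvC dotvZl dotvC. Qed.

Lemma ip_ae_eql u v w : L2field u -> L2field v -> L2field w ->
  {ae leb3, forall x, u x = v x} -> ip u w = ip v w.
Proof.
move=> Lu Lv Lw uv; apply: Rintegral_ae_eq.
- exact: intg_measurable (L2field_dotv Lu Lw).
- exact: intg_measurable (L2field_dotv Lv Lw).
- by apply: filterS uv => x ->.
Qed.

(** One statement for both field equations: (a, b) = (eps, sigma) with the source for the curl of H,
    and (a, b) = (-mu, 0) with F0 = 0 for the curl of E. The curl is tested against a fixed field,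
    and the time derivative is removed by [ip_ftc]. *)
Lemma weak_curl_laplace U U' G cG (f : R -> R) (F0 : rV3 -> rV3) (a b : rV3 -> R) (M : R) tau :
  jointly_measurable T U -> jointly_measurable T G ->
  L2_C1 T U U' -> Hcurl_C0 T G cG ->
  measurable_fun setT a -> measurable_fun setT b ->
  (forall x, `|a x| <= M) -> (forall x, `|b x| <= M) ->
  {within `[0, T]%classic, continuous f} -> L2field F0 ->
  {ae leb3, forall x, U 0 x = 0} ->
  (forall t, t \in `]0, T[ -> {ae leb3, forall x,
     cG t x = a x *: U' t x + b x *: U t x - f t *: F0 x}) ->
  weak_curl (laplaceT T G tau) (fun x =>
    (tau * a x + b x) *: laplaceT T U tau x + (expR (- tau * T) * a x) *: U T x
    - laplace T f tau *: F0 x).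
Proof.
move=> jU jG hU [hG hcG wG] ma mb Ma Mb cf LF U0 eqn.
have [cU cU' _] := hU.
have LU := laplaceT_L2field tau jU cU.
have T0' : 0 \in `[0, T] by rewrite in_itv/= lexx ltW.
have TT : T \in `[0, T] by rewrite in_itv/= lexx ltW.
have Lc1 : L2field (fun x => (tau * a x + b x) *: laplaceT T U tau x).
  apply: (@L2field_mul _ _ (`|tau| * M + M)) => //.
    by apply: measurable_funD => //; exact: measurable_funM.
  move=> x; apply: le_trans (ler_normD _ _) _; rewrite normrM lerD//.
  by rewrite ler_wpM2l.
have Lc2 : L2field (fun x => (expR (- tau * T) * a x) *: U T x).
  apply: (@L2field_mul _ _ (expR (- tau * T) * M)).
  - by have [] := cU T TT.
  - exact: measurable_funM.
  - by move=> x; rewrite normrM ger0_norm ?expR_ge0// ler_wpM2l ?expR_ge0.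
have Lc3 : L2field (fun x => laplace T f tau *: F0 x) by exact: L2fieldZ.
split; first exact: laplaceT_L2field.
  by apply: L2fieldB => //; exact: L2fieldD.
move=> phi hphi; have [Lphi Lcphi] := test_L2 hphi.
have Lap : L2field (fun x => a x *: phi x) by exact: L2field_mul Ma.
have Lbp : L2field (fun x => b x *: phi x) by exact: L2field_mul Mb.
rewrite -[LHS]/(ip _ _) -[RHS]/(ip _ phi).
rewrite ip_laplaceT//.
have ce : {within `[0, T]%classic, continuous (fun t : R => expR (- tau * t))}.
  by apply: continuous_subspaceT; exact: continuous_expRM.
transitivity (\int[leb]_(t in `[0, T]) (expR (- tau * t) * (ip (U' t) (fun x => a x *: phi x) - tau * ip (U t) (fun x => a x *: phi x))
   + expR (- tau * t) * ip (U t) (fun x => (tau * a x + b x) *: phi x)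
   - ip F0 phi * (expR (- tau * t) * f t))).
  have Labp : L2field (fun x => (tau * a x + b x) *: phi x).
    apply: (@L2field_mul _ _ (`|tau| * M + M)) => //.
      by apply: measurable_funD => //; exact: measurable_funM.
    move=> x; apply: le_trans (ler_normD _ _) _; rewrite normrM lerD//.
    by rewrite ler_wpM2l.
  apply: eq_Rintegral_itvoo.
  - apply: within_integrable; apply: within_cont_mul => //; exact: ip_continuous.
  - apply: within_integrable; apply: within_cont_sub; last first.
      by apply: within_cont_mul; [exact: within_cont_cst|exact: within_cont_mul].
    have -> : (fun t => expR (- tau * t) * (ip (U' t) (fun x => a x *: phi x) -
       tau * ip (U t) (fun x => a x *: phi x)) +
       expR (- tau * t) * ip (U t) (fun x => (tau * a x + b x) *: phi x)) =
      (fun t => expR (- tau * t) * (ip (U' t) (fun x => a x *: phi x) -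
       tau * ip (U t) (fun x => a x *: phi x)) -
       (-1) * (expR (- tau * t) * ip (U t) (fun x => (tau * a x + b x) *: phi x))).
      by apply/funext => t; rewrite mulN1r opprK.
    apply: within_cont_sub.
      apply: within_cont_mul => //; apply: within_cont_sub; first exact: ip_continuous.
      by apply: within_cont_mul; [exact: within_cont_cst|exact: ip_continuous].
    apply: within_cont_mul; [exact: within_cont_cst|apply: within_cont_mul => //].
    exact: ip_continuous.
  - move=> t tT; have tT' : t \in `[0, T] by apply: subset_itv_oo_cc.
    have [Ut _] := cU t tT'; have [U't _] := cU' t tT'; have [cGt _] := hcG t tT'.
    have LaU : L2field (fun x => a x *: U' t x) by exact: L2field_mul Ma.
    have LbU : L2field (fun x => b x *: U t x) by exact: L2field_mul Mb.
    have Lf : L2field (fun x => f t *: F0 x) by exact: L2fieldZ.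
    have LD : L2field (fun x => a x *: U' t x + b x *: U t x) by exact: L2fieldD.
    have [_ _ /(_ phi hphi)] := wG t tT'; rewrite -[LHS]/(ip _ _) -[RHS]/(ip _ phi) => ->.
    rewrite (ip_ae_eql cGt _ Lphi (eqn t tT)); last exact: L2fieldB.
    rewrite ipBl// ipDl// (ipZl (f t) LF Lphi) !ip_mul_move.
    have -> : ip (U t) (fun x => (tau * a x + b x) *: phi x) =
       tau * ip (U t) (fun x => a x *: phi x) + ip (U t) (fun x => b x *: phi x).
      rewrite -ipZr// -ipDr//; last exact: L2fieldZ.
      by congr (ip _ _); apply/funext => x; rewrite scalerDl scalerA.
    ring.
have Labp : L2field (fun x => (tau * a x + b x) *: phi x).
  apply: (@L2field_mul _ _ (`|tau| * M + M)) => //.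
    by apply: measurable_funD => //; exact: measurable_funM.
  move=> x; apply: le_trans (ler_normD _ _) _; rewrite normrM lerD//.
  by rewrite ler_wpM2l.
have I1 : leb.-integrable `[0, T]%classic (EFin \o (fun t => expR (- tau * t) * (ip (U' t) (fun x => a x *: phi x) - tau * ip (U t) (fun x => a x *: phi x)))).
  apply: within_integrable; apply: within_cont_mul => //; apply: within_cont_sub; first exact: ip_continuous.
  by apply: within_cont_mul; [exact: within_cont_cst|exact: ip_continuous].
have I2 : leb.-integrable `[0, T]%classic (EFin \o (fun t => expR (- tau * t) * ip (U t) (fun x => (tau * a x + b x) *: phi x))).
  by apply: within_integrable; apply: within_cont_mul => //; exact: ip_continuous.
have I3' : leb.-integrable `[0, T]%classic (EFin \o (fun t => expR (- tau * t) * f t)).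
  by apply: within_integrable; exact: within_cont_mul.
have I3 : leb.-integrable `[0, T]%classic (EFin \o (fun t => ip F0 phi * (expR (- tau * t) * f t))).
  by apply: within_integrable; apply: within_cont_mul; [exact: within_cont_cst|exact: within_cont_mul].
have mI : measurable (`[0, T]%classic : set mR) by exact: measurable_itv.
rewrite (RintegralB mI (integrableD mI I1 I2) I3) (RintegralD mI I1 I2) (RintegralZl _ mI I3') (ip_ftc tau hU Lap) -(ip_laplaceT tau jU cU Labp).
have -> : ip (U 0) (fun x => a x *: phi x) = 0.
  have [U00 _] := cU 0 T0'.
  have L0 : L2field (fun=> 0 : rV3).
    by have := L2fieldZ 0 LF; under eq_fun do rewrite scale0r.
  rewrite (ip_ae_eql U00 L0 Lap U0).
  by rewrite /ip; under eq_Rintegral do rewrite dotv0l; rewrite /Rintegral integral0.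
rewrite ipBl//; last exact: L2fieldD.
rewrite ipDl// (ipZl _ LF Lphi) !ip_mul_move -/(laplace T f tau) subr0.
have -> : ip (U T) (fun x => (expR (- tau * T) * a x) *: phi x) =
   expR (- tau * T) * ip (U T) (fun x => a x *: phi x).
  have [UT _] := cU T TT.
  by rewrite -ipZr//; congr (ip _ _); apply/funext => x; rewrite scalerA.
ring.
Qed.

End time_fields.

(** * Integration by parts along lines *)

Section line_calculus.
Context {R : realType}.
Notation rV3 := 'rV[R]_3.
Notation mR := (measurableTypeR R).
Notation leb3 := (@leb3 R).
Notation leb := (@lebesgue_measure R).

Lemma is_derive_ftc (F f : R -> R) a b : a < b -> (forall t : R, is_derive t 1 F (f t)) ->
  continuous f -> (\int[leb]_(t in `[a, b]) (f t)%:E = (F b - F a)%:E)%E.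
Proof.
move=> ab dF cf; rewrite (@continuous_FTC2 _ f F)//.
- exact: continuous_subspaceT.
- have cF : continuous F.
    by move=> t; apply/differentiable_continuous/derivable1_diffP; have [] := dF t.
  split; first by move=> t _; have [] := dF t.
  + exact/cvg_at_right_filter/cF.
  + exact/cvg_at_left_filter/cF.
- by move=> t _; rewrite derive1E; have [_ ->] := dF t.
Qed.

Lemma continuous_itv_intg (f : R -> R) a b : continuous f ->
  leb.-integrable `[a, b]%classic (EFin \o f).
Proof.
move=> cf; apply: continuous_compact_integrable; first exact: segment_compact.
exact: continuous_subspaceT.
Qed.

Lemma integral_is_derive0 (F f : R -> R) N : (forall t : R, is_derive t 1 F (f t)) ->
  continuous f -> (forall t, N < `|t| -> F t = 0 /\ f t = 0) ->
  leb.-integrable setT (EFin \o f) /\ (\int[leb]_t (f t)%:E = 0)%E.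
Proof.
move=> dF cf fN; pose a := `|N| + 1.
have a0 : 0 < a by rewrite ltr_wpDl.
have Na : N < a by rewrite (le_lt_trans (ler_norm N))// ltrDl.
have mI : measurable (`[- a, a]%classic : set mR) by exact: measurable_itv.
have fE : (EFin \o f) \_ `[- a, a] = EFin \o f.
  apply/funext => t; rewrite patchE; case: ifPn => //.
  rewrite notin_setE/= in_itv/= => /negP; rewrite -ler_norml -ltNge => h.
  by rewrite /= (fN t (lt_trans Na h)).2.
split; first by rewrite -fE; apply/(integrable_mkcond _ mI); exact: continuous_itv_intg.
rewrite -[LHS]/(\int[leb]_t (EFin \o f) t)%E -fE -integral_mkcond (@is_derive_ftc F) ?gtrN//.
by rewrite !(fN _ _).1 ?subr0// ?normrN ger0_norm// ltW.
Qed.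

(** The primitive vanishes at both ends but k need not: truncating k to the interval may create
    jumps, yet its integral is still 0. *)
Lemma integral_is_derive_itvoo0 (K k : R -> R) a b : a < b -> (forall t : R, is_derive t 1 K (k t)) ->
  continuous k -> K a = 0 -> K b = 0 ->
  let h := fun t => if t \in `]a, b[ then k t else 0 in
  leb.-integrable setT (EFin \o h) /\ (\int[leb]_t (h t)%:E = 0)%E.
Proof.
move=> ab dK ck Ka Kb h.
have mI : measurable (`]a, b[%classic : set mR) by exact: measurable_itv.
have hE : EFin \o h = (EFin \o k) \_ `]a, b[.
  apply/funext => t; rewrite patchE /h /=; case: ifPn => tI; first by rewrite mem_set.
  by rewrite memNset//=; exact/negP.
have kI : leb.-integrable `]a, b[%classic (EFin \o k).
  by apply: integrableS (continuous_itv_intg a b ck) => //; exact: subset_itv_oo_cc.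
split; first by rewrite hE; apply/(integrable_mkcond _ mI).
rewrite -[LHS]/(\int[leb]_t ((EFin \o h) t))%E hE -integral_mkcond.
have mk : measurable_fun (`]a, b[%classic : set mR) k by have /integrableP[/measurable_EFinP] := kI.
rewrite integral_itv_bndo_bndc; last by apply/measurable_EFinP.
rewrite integral_itv_obnd_cbnd; last first.
  by have /integrableP[] := continuous_itv_intg a b ck => h1 _; apply: measurable_funS h1 => //; exact: subset_itv_oc_cc.
by rewrite (is_derive_ftc ab dK)// Ka Kb subr0.
Qed.

End line_calculus.

Section lines.
Context {R : realType}.
Notation rV3 := 'rV[R]_3.
Notation mR := (measurableTypeR R).
Notation leb3 := (@leb3 R).
Notation leb := (@lebesgue_measure R).
Variable p : rV3.

Definition rad (x : rV3) : R := enorm (x - p).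

(** Smoothness along the lines of direction i that stay off the plane x_{i+1} = p_{i+1}. Such lines
    miss p, where radial functions may be singular, and the lines left out form a null set, as in
    [integral_leb3_lines0]. *)
Definition lineC1 (i : 'I_3) (h d : rV3 -> R) : Prop :=
  forall x : rV3, x 0 (i + 1) <> p 0 (i + 1) -> forall t : R,
    is_derive t 1 (fun t => h (upd i t x)) (d (upd i t x)) /\
    {for t, continuous (fun t => d (upd i t x))}.

Lemma lineC1_eq i h d h' d' : lineC1 i h d -> h = h' -> d = d' -> lineC1 i h' d'.
Proof. by move=> H <- <-. Qed.

Lemma lineC1_cst i c : lineC1 i (fun=> c) (fun=> 0).
Proof. by move=> x _ t; split; [exact: is_derive_cst|exact: cst_continuous]. Qed.

Lemma lineC1_coord i j : lineC1 i (fun x => x 0 j) (fun=> (i == j)%:R).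
Proof.
move=> x _ t; split; last exact: cst_continuous.
have -> : (fun t => upd i t x 0 j) = (if i == j then id else cst (x 0 j)).
  by apply/funext => s; rewrite mxE eq_sym; case: eqP.
by case: eqP => _ /=; [exact: is_derive_id|exact: is_derive_cst].
Qed.

Lemma lineC1_cont i h d (x : rV3) (t : R) : lineC1 i h d -> x 0 (i + 1) <> p 0 (i + 1) ->
  {for t, continuous (fun t => h (upd i t x))}.
Proof.
move=> H /H/(_ t)[dh _].
by apply/differentiable_continuous/derivable1_diffP; have [] := dh.
Qed.

Lemma lineC1D i h1 d1 h2 d2 : lineC1 i h1 d1 -> lineC1 i h2 d2 ->
  lineC1 i (fun x => h1 x + h2 x) (fun x => d1 x + d2 x).
Proof.
move=> H1 H2 x xp t; have [D1 c1] := H1 x xp t; have [D2 c2] := H2 x xp t.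
by split; [exact: is_deriveD|exact: continuousD].
Qed.

Lemma lineC1M i h1 d1 h2 d2 : lineC1 i h1 d1 -> lineC1 i h2 d2 ->
  lineC1 i (fun x => h1 x * h2 x) (fun x => h1 x * d2 x + h2 x * d1 x).
Proof.
move=> H1 H2 x xp t; have [D1 c1] := H1 x xp t; have [D2 c2] := H2 x xp t.
have k1 := lineC1_cont (t := t) H1 xp; have k2 := lineC1_cont (t := t) H2 xp.
split; first exact: (is_deriveM D1 D2).
by apply: continuousD; apply: continuousM.
Qed.

Lemma lineC1Z i c h d : lineC1 i h d -> lineC1 i (fun x => c * h x) (fun x => c * d x).
Proof.
move=> H; have h1 := lineC1M (@lineC1_cst i c) H; apply: (lineC1_eq h1) => //=.
by apply/funext => x; rewrite mulr0 addr0.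
Qed.

Lemma lineC1B i h1 d1 h2 d2 : lineC1 i h1 d1 -> lineC1 i h2 d2 ->
  lineC1 i (fun x => h1 x - h2 x) (fun x => d1 x - d2 x).
Proof.
move=> H1 H2; apply: (lineC1_eq (lineC1D H1 (lineC1Z (-1) H2)));
  by apply/funext => x; rewrite mulN1r.
Qed.

Let rho (i : 'I_3) (x : rV3) : R := (x 0 (i + 1) - p 0 (i + 1)) ^+ 2 + (x 0 (i + 2) - p 0 (i + 2)) ^+ 2.

Lemma rad_sqr x : rad x ^+ 2 = \sum_i (x 0 i - p 0 i) ^+ 2.
Proof. by rewrite enorm_sqr dotvE; apply: eq_bigr => i _; rewrite !mxE expr2. Qed.

Lemma rad_ge0 x : 0 <= rad x. Proof. exact: enorm_ge0. Qed.

Lemma rad_upd i t x : rad (upd i t x) = Num.sqrt ((t - p 0 i) ^+ 2 + rho i x).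
Proof.
rewrite -[LHS]ger0_norm ?rad_ge0// -sqrtr_sqr rad_sqr sum3E; congr Num.sqrt.
by move: i; apply: forall_I3; rewrite /rho !I3E !mxE/=; ring.
Qed.

Let rho_gt0 i (x : rV3) : x 0 (i + 1) <> p 0 (i + 1) -> 0 < rho i x.
Proof.
move=> h; rewrite ltr_pwDl ?sqr_ge0// lt_neqAle sqr_ge0 andbT eq_sym expf_eq0/= subr_eq0.
exact/eqP.
Qed.

Lemma rad_upd_gt0 i t (x : rV3) : x 0 (i + 1) <> p 0 (i + 1) -> 0 < rad (upd i t x).
Proof. by move=> h; rewrite rad_upd sqrtr_gt0 ltr_wpDl ?sqr_ge0 ?rho_gt0. Qed.

(** Writing phi' = r psi absorbs the denominator of the gradient (x_i - p_i) / r of the distance, so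
    successive derivatives keep the same polynomial shape in x - p. *)
Lemma lineC1_rad i (phi psi : R -> R) : (forall r : R, 0 < r -> is_derive r 1 phi (r * psi r)) ->
  (forall r, 0 < r -> {for r, continuous psi}) ->
  lineC1 i (fun x => phi (rad x)) (fun x => (x 0 i - p 0 i) * psi (rad x)).
Proof.
move=> dphi cpsi x xp t.
have r0 := rad_upd_gt0 t xp.
have dr : is_derive t 1 (fun t => rad (upd i t x)) ((t - p 0 i) / rad (upd i t x)).
  have -> : (fun t => rad (upd i t x)) = Num.sqrt \o (fun t => (t - p 0 i) ^+ 2 + rho i x).
    by apply/funext => s; rewrite /= rad_upd.
  have d1 : is_derive t 1 (fun t => t - p 0 i) 1.
    by have := is_derive_affine 1 (- p 0 i) t; under eq_fun do rewrite mul1r.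
  have d2 : is_derive t 1 (fun t => (t - p 0 i) ^+ 2 + rho i x) (2 * (t - p 0 i)).
    have h := is_deriveD (is_deriveM d1 d1) (is_derive_cst (rho i x) t 1).
    under eq_fun do rewrite expr2.
    by apply: (is_derive_conv h); rewrite addr0 /GRing.scale/=; ring.
  have q0 : 0 < (t - p 0 i) ^+ 2 + rho i x by rewrite ltr_wpDl ?sqr_ge0 ?rho_gt0.
  apply: (is_derive_conv (@is_derive1_comp _ Num.sqrt (fun t => (t - p 0 i) ^+ 2 + rho i x) t _ _ (is_derive1_sqrt q0) d2)).
  rewrite rad_upd; field; rewrite gt_eqF//.
  by rewrite sqrtr_gt0.
have cr : {for t, continuous (fun t => rad (upd i t x))}.
  by apply/differentiable_continuous/derivable1_diffP; have [] := dr.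
split.
  apply: (is_derive_conv (@is_derive1_comp _ phi (fun t => rad (upd i t x)) t _ _ (dphi _ r0) dr)).
  by rewrite !mxE eqxx; field; rewrite gt_eqF.
apply: continuousM.
  apply: continuousB; last exact: cst_continuous.
  by have := lineC1_cont (t := t) (@lineC1_coord i i) xp.
exact: (continuous_comp cr (cpsi _ r0)).
Qed.

Lemma upd_upd i s t (x : rV3) : upd i s (upd i t x) = upd i s x.
Proof. by apply/rowP => j; rewrite !mxE; case: eqP. Qed.

Lemma upd_id i (x : rV3) : upd i (x 0 i) x = x.
Proof. by apply/rowP => j; rewrite !mxE; case: eqP => [->|]. Qed.

Lemma upd_continuous i (x : rV3) : continuous (fun t => upd i t x).
Proof.
move=> t; have -> : (fun t => upd i t x) = (fun t => upd i 0 x + t *: delta_mx 0 i).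
  by apply/funext => s; rewrite updE upd_upd mxE eqxx add0r.
apply: (@cvgD _ _ _ (nbhs t) _ (cst (upd i 0 x)) (fun t => t *: delta_mx 0 i)).
  exact: cvg_cst.
exact: (@scalel_continuous R rV3 (delta_mx 0 i) t).
Qed.

Lemma is_derive_upd (g : rV3 -> R) i x (t : R) : derivable g (upd i t x) (delta_mx 0 i) ->
  is_derive t 1 (fun t => g (upd i t x)) (partial i g (upd i t x)).
Proof.
move=> dg; have E : (fun h : R => h^-1 *: ((g \o shift (upd i t x)) (h *: delta_mx 0 i) - g (upd i t x))) =
    (fun h : R => h^-1 *: (((fun t => g (upd i t x)) \o shift t) (h *: 1) - g (upd i t x))).
  apply/funext => h /=; rewrite [h *: delta_mx 0 i + _]addrC updE upd_upd !mxE eqxx.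
  by rewrite /GRing.scale/= mulr1 [t + h]addrC.
by apply: DeriveDef; [move: dg; rewrite /derivable E|rewrite /partial /derive E].
Qed.

Lemma lineC1_Ck g i : Ck 1 g -> lineC1 i g (partial i g).
Proof.
move=> /= [cg dg] x xp t; have [d c] := dg i; split; first exact: is_derive_upd.
by apply: continuous_comp; [exact: upd_continuous|exact: c].
Qed.

(* On a line missing p the inner and the outer formula are both C^1, so the glued integrand is the
   derivative of the outer one plus, on the chord of the ball, the derivative of a function
   vanishing at both ends of the chord. *)
Lemma ibp_glue i (eta N : R) h1 h2 d1 d2 (g : rV3 -> R) : 0 < eta ->
  lineC1 i h1 d1 -> lineC1 i h2 d2 -> (forall x, rad x = eta -> h1 x = h2 x) ->
  Ck 1 g -> (forall x : rV3, N < `|x 0 i| -> g x = 0 /\ partial i g x = 0) ->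
  let h (x : rV3) := if rad x < eta then h2 x else h1 x in
  let d (x : rV3) := if rad x < eta then d2 x else d1 x in
  leb3.-integrable setT (EFin \o (fun x => h x * partial i g x + d x * g x)) ->
  \int[leb3]_x (h x * partial i g x + d x * g x) = 0.
Proof.
move=> eta0 H1 H2 h12 Cg gN h d If.
rewrite /Rintegral (integral_leb3_lines0 (i := i) If (c := p 0 (i + 1)))// => x xp.
have Hg := @lineC1_Ck _ i Cg.
pose F1 t := h1 (upd i t x) * g (upd i t x).
pose f1 t := h1 (upd i t x) * partial i g (upd i t x) + g (upd i t x) * d1 (upd i t x).
have dF1 (t : R) : is_derive t 1 F1 (f1 t) by exact: (lineC1M H1 Hg xp t).1.
have cf1 : continuous f1 by move=> t; exact: (lineC1M H1 Hg xp t).2.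
pose K t := (h2 (upd i t x) - h1 (upd i t x)) * g (upd i t x).
pose k t := (h2 (upd i t x) - h1 (upd i t x)) * partial i g (upd i t x) + g (upd i t x) * (d2 (upd i t x) - d1 (upd i t x)).
have dK (t : R) : is_derive t 1 K (k t) by exact: (lineC1M (lineC1B H2 H1) Hg xp t).1.
have ck : continuous k by move=> t; exact: (lineC1M (lineC1B H2 H1) Hg xp t).2.
have [I1 E1] : leb.-integrable setT (EFin \o f1) /\ (\int[leb]_t (f1 t)%:E = 0)%E.
  apply: (integral_is_derive0 (F := F1) (N := N)) => // t tN.
  have [e1 e2] : g (upd i t x) = 0 /\ partial i g (upd i t x) = 0 by apply: gN; rewrite mxE eqxx.
  by rewrite /F1 /f1 e1 e2 !mulr0 mul0r addr0.
have [e0|e0] := leP (eta ^+ 2) (rho i x).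
  rewrite -[RHS]E1; apply: eq_integral => t _; congr EFin.
  have hr : (rad (upd i t x) < eta) = false.
    apply/negbTE; rewrite -leNgt -(ler_pXn2r (n := 2))// ?nnegrE ?rad_ge0 ?(ltW eta0)//.
    rewrite rad_upd sqr_sqrtr; last by rewrite addr_ge0 ?sqr_ge0// ltW ?rho_gt0.
    by rewrite (le_trans e0)// lerDr sqr_ge0.
  by rewrite /h /d hr /f1; ring.
pose s := Num.sqrt (eta ^+ 2 - rho i x).
have s0 : 0 < s by rewrite sqrtr_gt0 subr_gt0.
have s2 : s ^+ 2 = eta ^+ 2 - rho i x by rewrite sqr_sqrtr// subr_ge0 ltW.
pose a := p 0 i - s; pose b := p 0 i + s.
have radE t : (rad (upd i t x) < eta) = (t \in `]a, b[).
  rewrite -(ltr_pXn2r (n := 2))// ?nnegrE ?rad_ge0 ?(ltW eta0)//.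
  rewrite rad_upd sqr_sqrtr; last by rewrite addr_ge0 ?sqr_ge0// ltW ?rho_gt0.
  rewrite -ltrBrDr -s2 in_itv/= /a /b.
  rewrite -[(t - _) ^+ 2](real_normK (num_real _)) ltr_pXn2r ?nnegrE ?(ltW s0)//.
  by rewrite ltr_distl.
have K0 t : (t - p 0 i) ^+ 2 = s ^+ 2 -> K t = 0.
  move=> ts; rewrite /K h12 ?subrr ?mul0r//.
  by rewrite rad_upd ts s2 subrK sqrtr_sqr ger0_norm// ltW.
have [I2 E2] := @integral_is_derive_itvoo0 _ K k a b (ltac:(rewrite /a /b; lra)) dK ck
  (ltac:(apply: K0; rewrite /a; ring)) (ltac:(apply: K0; rewrite /b; ring)).
rewrite -[RHS](_ : (\int[leb]_t ((f1 t)%:E + (if t \in `]a, b[ then k t else 0)%:E) = 0)%E).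
  apply: eq_integral => t _; rewrite -EFinD; congr EFin.
  by rewrite /h /d radE; case: ifP => _; rewrite /f1 /k; ring.
rewrite (integralD _ I1 I2)//.
by rewrite [X in (X + _)%E]E1 [X in (_ + X)%E]E2 adde0.
Qed.

End lines.

(** * Equality of mixed second derivatives *)

Section schwarz.
Context {R : realType}.
Notation rV3 := 'rV[R]_3.
Implicit Types (g : rV3 -> R) (x : rV3).

Lemma upd_comm (i j : 'I_3) s t x : i != j -> upd i s (upd j t x) = upd j t (upd i s x).
Proof.
move=> ij; apply/rowP => l; rewrite !mxE; case: (eqVneq l i) => // ->.
by rewrite (negbTE ij).
Qed.

Lemma MVT_line g i x h : 0 < h -> (forall y, derivable g y (delta_mx 0 i)) ->
  exists2 s, 0 < s < h & g (upd i (x 0 i + h) x) - g x = h * partial i g (upd i (x 0 i + s) x).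
Proof.
move=> h0 dg; pose F t := g (upd i t x).
have dF (t : R) : is_derive t 1 F (partial i g (upd i t x)) by exact: is_derive_upd.
have ab : x 0 i < x 0 i + h by rewrite ltrDl.
have [|c cI e] := @MVT _ F (fun t => partial i g (upd i t x)) _ _ ab (fun t _ => dF t).
  apply: continuous_subspaceT => t.
  by apply/differentiable_continuous/derivable1_diffP; have [] := dF t.
exists (c - x 0 i).
  by move: cI; rewrite in_itv/= => /andP[? ?]; rewrite subr_gt0 ltrBlDl; apply/andP.
by rewrite [x 0 i + (c - _)]addrC subrK; move: e; rewrite /F upd_id [x 0 i + h]addrC addrK mulrC.
Qed.

Lemma double_difference g i j x h : i != j -> Ck 2 g -> 0 < h ->
  exists s t, [/\ 0 < s < h, 0 < t < h &
    g (upd i (x 0 i + h) (upd j (x 0 j + h) x)) - g (upd i (x 0 i + h) x)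
    - (g (upd j (x 0 j + h) x) - g x) =
    h * (h * partial j (partial i g) (x + s *: delta_mx 0 i + t *: delta_mx 0 j))].
Proof.
move=> ij [_ Cg] h0; have [dgi [_ Cgi]] := Cg i; have [dgij _] := Cgi j.
pose H (y : rV3) := g (upd j (y 0 j + h) y) - g y.
have Hd y : is_derive y (delta_mx 0 i) H (partial i g (upd j (y 0 j + h) y) - partial i g y).
  apply: (@is_derive_line _ _ _ _ (fun t => g (upd i t (upd j (y 0 j + h) y)) - g (upd i t y))).
    move=> t; rewrite /H; congr (g _ - _); rewrite mxE eq_sym (negbTE ij).
    by rewrite upd_comm// eq_sym.
  have e0 : upd j (y 0 j + h) y = upd i (y 0 i) (upd j (y 0 j + h) y).
    by rewrite upd_comm// upd_id.
  have D := is_deriveB (is_derive_upd (dgi (upd i (y 0 i) (upd j (y 0 j + h) y))))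
    (is_derive_upd (dgi (upd i (y 0 i) y))).
  by rewrite -e0 upd_id in D.
have [|s s0 e] := @MVT_line H i x h h0; first by move=> y; have [] := Hd y.
pose y := x + s *: delta_mx 0 i.
have [t t0 e'] := MVT_line y h0 dgij.
exists s, t; split => //.
have yE : y = upd i (x 0 i + s) x by rewrite /y updE.
have xj u : upd i u x 0 j = x 0 j by rewrite mxE eq_sym (negbTE ij).
move: e; rewrite /H xj -[upd j _ (upd i _ x)]upd_comm// => ->; congr (h * _).
have [_ E] := Hd (upd i (x 0 i + s) x); rewrite /partial E -yE.
by rewrite e' updE.
Qed.

(** The second difference over a small rectangle is symmetric in i and j. By [double_difference] it
    equals h^2 times either mixed derivative at some nearby point, and both mixed derivatives are
    continuous. *)
Lemma Ck2_partialC g i j x : Ck 2 g -> partial i (partial j g) x = partial j (partial i g) x.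
Proof.
have aux2 (a b y e : R) : `|b - y| < e / 2 -> `|a - y| < e / 2 -> `|a - b| <= e.
  by rewrite !ltr_distl => /andP[? ?] /andP[? ?]; rewrite ler_norml; lra.
move=> Cg; have [->//|ij] := eqVneq i j.
set A := LHS; set B := RHS.
have cA : continuous (partial i (partial j g)).
  by have [_ /(_ j)[_ [_ /(_ i)[_]]]] := Cg.
have cB : continuous (partial j (partial i g)).
  by have [_ /(_ i)[_ [_ /(_ j)[_]]]] := Cg.
apply/eqP; rewrite -subr_eq0 -normr_eq0; apply/eqP/le_anti; rewrite normr_ge0 andbT.
apply/ler_addgt0Pl => e e0; rewrite addr0.
have e2 : 0 < e / 2 by rewrite divr_gt0.
have := cA x => /cvgrPdist_lt/(_ _ e2); have := cB x => /cvgrPdist_lt/(_ _ e2).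
move=> /nbhs_normP[d1 d10 h1] /nbhs_normP[d2 d20 h2].
pose c := `|delta_mx 0 i : rV3| + `|delta_mx 0 j : rV3| + 1.
have c0 : 0 < c by rewrite ltr_wpDl// addr_ge0.
pose h := Num.min d1 d2 / c.
have h0 : 0 < h by rewrite divr_gt0// lt_min d10.
have near s t : 0 < s < h -> 0 < t < h -> forall (l m : 'I_3) , ((l, m) = (i, j)) \/ ((l, m) = (j, i)) ->
   `|x - (x + s *: delta_mx 0 l + t *: delta_mx 0 m)| < Num.min d1 d2.
  move=> /andP[s0 sh] /andP[t0 th] l m lm.
  rewrite -addrA opprD addNKr opprD.
  apply: le_lt_trans (ler_normB _ _) _; rewrite normrN !normrZ !ger0_norm ?ltW//.
  apply: (@le_lt_trans _ _ (h * (`|delta_mx 0 l : rV3| + `|delta_mx 0 m : rV3|))).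
    by rewrite mulrDr lerD// ler_wpM2r// ltW.
  rewrite (_ : `|delta_mx 0 l : rV3| + `|delta_mx 0 m : rV3| = c - 1); last first.
    by rewrite /c addrK; case: lm => -[-> ->]//; rewrite addrC.
  rewrite /h mulrAC -mulrA gtr_pMr ?lt_min ?d10//.
  by rewrite ltr_pdivrMr// mul1r ltrBlDr ltrDl.
have [s [t [sI tI E1]]] := double_difference x ij Cg h0.
have [s' [t' [sI' tI' E2]]] := double_difference x (negbT (etrans (eq_sym _ _) (negbTE ij))) Cg h0.
have EE : partial j (partial i g) (x + s *: delta_mx 0 i + t *: delta_mx 0 j) =
   partial i (partial j g) (x + s' *: delta_mx 0 j + t' *: delta_mx 0 i).
  apply: (mulfI (negbT (gt_eqF h0))); apply: (mulfI (negbT (gt_eqF h0))).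
  have aux (u v w z : R) : u - v - (w - z) = u - w - (v - z) by ring.
  refine (etrans (esym E1) (etrans _ E2)).
  have -> := upd_comm (x 0 i + h) (x 0 j + h) x ij.
  exact: aux.
have /andP[n1 _] : (`|x - (x + s *: delta_mx 0 i + t *: delta_mx 0 j)| < d1) && (`|x - (x + s *: delta_mx 0 i + t *: delta_mx 0 j)| < d2).
  by rewrite -lt_min; exact: (near s t sI tI i j (or_introl erefl)).
have /andP[_ n2] : (`|x - (x + s' *: delta_mx 0 j + t' *: delta_mx 0 i)| < d1) && (`|x - (x + s' *: delta_mx 0 j + t' *: delta_mx 0 i)| < d2).
  by rewrite -lt_min; exact: (near s' t' sI' tI' j i (or_intror erefl)).
have k1 := h1 _ n1; have k2 := h2 _ n2.
move: k1 k2; rewrite /= EE -/A -/B; move: (partial i _ _) => Y.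
exact: aux2.
Qed.

End schwarz.

(** * The incident field *)

Section radial.
Context {R : realType}.
Implicit Types r : R.

(** [ub], [gb] and [kb] are e^{cr}/r followed by two applications of (1/r) d/dr. For a radial
    function with this triple (u, g, k), the gradient is g (x - p) and the Hessian is g Id + k (x -
    p)(x - p)^T. *)
Definition ub (c r : R) : R := expR (c * r) * r^-1.
Definition gb (c r : R) : R := expR (c * r) * (c * r - 1) * r^-1 ^+ 3.
Definition kb (c r : R) : R := expR (c * r) * (c ^+ 2 * r ^+ 2 - 3 * c * r + 3) * r^-1 ^+ 5.

Lemma radial_laplacian c r : r != 0 -> 3 * gb c r + r ^+ 2 * kb c r = c ^+ 2 * ub c r.
Proof. by move=> r0; rewrite /gb /kb /ub; field. Qed.

Lemma is_derive_mul (f g : R -> R) (x df dg : R) : is_derive x 1 f df -> is_derive x 1 g dg ->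
  is_derive x 1 (fun t => f t * g t) (f x * dg + g x * df).
Proof. exact: is_deriveM. Qed.

Lemma is_derive_inv r : r != 0 -> is_derive r 1 (fun r : R => r^-1) (- (r^-1 ^+ 2)).
Proof.
move=> r0; apply: (is_derive_conv (is_deriveV r0 (is_derive_id r 1))).
by rewrite /GRing.scale/= mulr1 exprVn.
Qed.

Lemma is_derive_ub c r : 0 < r -> is_derive r 1 (ub c) (r * gb c r).
Proof.
move=> r0; have r0' : r != 0 by rewrite gt_eqF.
apply: (is_derive_conv (is_deriveM (is_derive_expRM c r) (is_derive_inv r0'))).
by rewrite /GRing.scale/= /gb; field.
Qed.

Lemma is_derive_gb c r : 0 < r -> is_derive r 1 (gb c) (r * kb c r).
Proof.
move=> r0; have r0' : r != 0 by rewrite gt_eqF.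
have d1 : is_derive r 1 (fun r : R => c * r - 1) c by exact: is_derive_affine.
have i1 := is_derive_inv r0'.
have E : gb c = (fun r => expR (c * r) * (c * r - 1) * (r^-1 * (r^-1 * r^-1))).
  by apply/funext => s; rewrite /gb !exprS expr0 mulr1.
rewrite E.
apply: (is_derive_conv (is_derive_mul (is_derive_mul (is_derive_expRM c r) d1)
  (is_derive_mul i1 (is_derive_mul i1 i1)))).
by rewrite /kb; field.
Qed.

Lemma continuous_inv r : 0 < r -> {for r, continuous (fun r : R => r^-1)}.
Proof. by move=> r0; apply: cvgV; [rewrite gt_eqF|exact: cvg_id]. Qed.

Lemma continuous_kb c r : 0 < r -> {for r, continuous (kb c)}.
Proof.
move=> r0; have ci := continuous_inv r0.
have E : kb c = (fun r => expR (c * r) * (c ^+ 2 * (r * r) - 3 * c * r + 3) *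
    (r^-1 * (r^-1 * (r^-1 * (r^-1 * r^-1))))).
  by apply/funext => s; rewrite /kb; ring.
rewrite E; apply: continuousM; last by do 4 (apply: continuousM => //).
apply: continuousM; first exact: continuous_expRM.
apply: continuousD; last exact: cst_continuous.
apply: continuousB; apply: continuousM => //; try exact: cst_continuous.
  by apply: continuousM => //; exact: cvg_id.
Qed.

Lemma continuous_gb c r : 0 < r -> {for r, continuous (gb c)}.
Proof.
by move=> r0; apply/differentiable_continuous/derivable1_diffP; have [] := is_derive_gb c r0.
Qed.

Lemma expRB_bound (y : R) : 0 <= y -> 0 <= expR y - expR (- y) <= 2 * y * expR y.
Proof.
move=> y0; apply/andP; split; first by rewrite subr_ge0 ler_expR; lra.
have h := expR_ge1Dx (- (2 * y)).
have : expR y * (1 + - (2 * y)) <= expR y * expR (- (2 * y)) by rewrite ler_wpM2l ?expR_ge0.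
rewrite -expRD (_ : y + - (2 * y) = - y); last by ring.
lra.
Qed.

(** With y = k r this is r^3 times [gb k r - gb (- k) r]. It vanishes at 0 and has derivative y (e^y
    - e^{-y}), so it is of order y^3 and compensates the division by r^3 at the centre of the
    ball. *)
Lemma gb_bound (y : R) : 0 <= y ->
  0 <= expR y * (y - 1) + expR (- y) * (y + 1) <= 2 * y ^+ 3 * expR y.
Proof.
rewrite le_eqVlt => /predU1P[<-|y0].
  by rewrite oppr0 expR0 expr0n/= mulr0 mul0r; lra.
pose N (t : R) := expR (1 * t) * (1 * t + -1) + expR (-1 * t) * (1 * t + 1).
have dN (t : R) : is_derive t 1 N (t * (expR t - expR (- t))).
  apply: (is_derive_conv (is_deriveD (is_deriveM (is_derive_expRM 1 t) (is_derive_affine 1 (-1) t))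
    (is_deriveM (is_derive_expRM (-1) t) (is_derive_affine 1 1 t)))).
  rewrite /GRing.scale/= !mul1r mulN1r; ring.
have [|c] := @MVT _ N (fun t => t * (expR t - expR (- t))) _ _ y0 (fun t _ => dN t).
  apply: continuous_subspaceT => t.
  by apply/differentiable_continuous/derivable1_diffP; have [] := dN t.
rewrite in_itv/= => /andP[c0 cy].
rewrite /N !mulr0 expR0 !mul1r mulN1r subr0 => e.
have -> : expR y * (y - 1) + expR (- y) * (y + 1) = c * (expR c - expR (- c)) * y.
  rewrite -e; ring.
have /andP[b1 b2] := expRB_bound (ltW c0).
apply/andP; split.
  apply: mulr_ge0 (ltW y0); apply: mulr_ge0 b1; exact: ltW.
have ec : expR c <= expR y by rewrite ler_expR ltW.
apply: (@le_trans _ _ (c * (2 * c * expR y) * y)).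
  rewrite ler_wpM2r ?(ltW y0)// ler_wpM2l ?(ltW c0)//; apply: le_trans b2 _.
  by rewrite ler_wpM2l// mulr_ge0// ltW.
rewrite (_ : c * (2 * c * expR y) * y = c * c * (2 * expR y * y)); last by ring.
rewrite (_ : 2 * y ^+ 3 * expR y = y * y * (2 * expR y * y)); last by ring.
rewrite ler_wpM2r ?mulr_ge0 ?expR_ge0 ?(ltW y0)//.
by apply: ler_pM; rewrite ?(ltW c0)// ltW.
Qed.

End radial.

Section incident_radial.
Context {R : realType}.
Variables (k eta : R) (k0 : 0 < k) (eta0 : 0 < eta).
Implicit Types r : R.

(* The decaying solution of -Laplacian u + k^2 u = 1_B is 1/k^2 - iA (e^{kr} - e^{-kr})/r in the ball and
   oA e^{-kr}/r outside; the two constants are fixed by matching u and u' at r = eta. *)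
Definition iA : R := (1 + k * eta) * expR (- k * eta) / (2 * k ^+ 3).
Definition oA : R := ((k * eta - 1) * expR (k * eta) + (k * eta + 1) * expR (- k * eta)) / (2 * k ^+ 3).

Definition Ui r := (k ^+ 2)^-1 - iA * (ub k r - ub (- k) r).
Definition Gi r := - iA * (gb k r - gb (- k) r).
Definition Ki r := - iA * (kb k r - kb (- k) r).
Definition Uo r := oA * ub (- k) r.
Definition Go r := oA * gb (- k) r.
Definition Ko r := oA * kb (- k) r.

Lemma expRk : expR (k * eta) * expR (- k * eta) = 1.
Proof. by rewrite -expRD mulNr subrr expR0. Qed.

Lemma match_U : Ui eta = Uo eta.
Proof.
have := expRk; rewrite /Ui /Uo /ub /iA /oA; move: (expR (k * eta)) (expR (- k * eta)) => e e' ee.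
apply/eqP; rewrite -subr_eq0.
have -> : (k ^+ 2)^-1 - (1 + k * eta) * e' / (2 * k ^+ 3) * (e / eta - e' / eta)
   - ((k * eta - 1) * e + (k * eta + 1) * e') / (2 * k ^+ 3) * (e' / eta) =
   (k ^+ 2)^-1 * (1 - e * e') by field; rewrite !gt_eqF.
by rewrite ee subrr mulr0.
Qed.

Lemma match_G : Gi eta = Go eta.
Proof. rewrite /Gi /Go /gb /iA /oA; field; rewrite !gt_eqF//. Qed.

Lemma is_derive_Uo r : 0 < r -> is_derive r 1 Uo (r * Go r).
Proof. by move=> r0; apply: (is_derive_conv (is_deriveZ oA (is_derive_ub (- k) r0))); rewrite /GRing.scale/= mulrCA. Qed.

Lemma is_derive_Go r : 0 < r -> is_derive r 1 Go (r * Ko r).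
Proof. by move=> r0; apply: (is_derive_conv (is_deriveZ oA (is_derive_gb (- k) r0))); rewrite /GRing.scale/= mulrCA. Qed.

Lemma is_derive_Ui r : 0 < r -> is_derive r 1 Ui (r * Gi r).
Proof.
move=> r0; have h := is_deriveB (is_derive_cst ((k ^+ 2)^-1) r 1)
  (is_deriveZ iA (is_deriveB (is_derive_ub k r0) (is_derive_ub (- k) r0))).
by apply: (is_derive_conv h); rewrite /GRing.scale/= /Gi; ring.
Qed.

Lemma is_derive_Gi r : 0 < r -> is_derive r 1 Gi (r * Ki r).
Proof.
move=> r0; have h := is_deriveZ (- iA) (is_deriveB (is_derive_gb k r0) (is_derive_gb (- k) r0)).
by apply: (is_derive_conv h); rewrite /GRing.scale/= /Ki; ring.
Qed.

Lemma continuous_Go r : 0 < r -> {for r, continuous Go}.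
Proof. by move=> r0; apply: continuousM; [exact: cst_continuous|exact: continuous_gb]. Qed.

Lemma continuous_Ko r : 0 < r -> {for r, continuous Ko}.
Proof. by move=> r0; apply: continuousM; [exact: cst_continuous|exact: continuous_kb]. Qed.

Lemma continuous_Gi r : 0 < r -> {for r, continuous Gi}.
Proof.
move=> r0; apply: continuousM; first exact: cst_continuous.
by apply: continuousB; exact: continuous_gb.
Qed.

Lemma continuous_Ki r : 0 < r -> {for r, continuous Ki}.
Proof.
move=> r0; apply: continuousM; first exact: cst_continuous.
by apply: continuousB; exact: continuous_kb.
Qed.

Definition Ur r := if r < eta then Ui r else Uo r.
Definition Gr r := if r < eta then Gi r else Go r.
Definition Kr r := if r < eta then Ki r else Ko r.

Lemma basis0 (c : R) : (ub c 0 = 0) * (gb c 0 = 0) * (kb c 0 = 0).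
Proof. by rewrite /ub /gb /kb invr0 !expr0n/= !mulr0. Qed.

(* Also true at r = 0, where the junk value 0^-1 = 0 gives Ur 0 = k^-2 and Gr 0 = 0. *)
Lemma helmholtz r : 0 <= r -> 3 * Gr r + r ^+ 2 * Kr r = k ^+ 2 * Ur r - (r < eta)%R%:R.
Proof.
rewrite le_eqVlt => /predU1P[<-|r0].
  by rewrite /Gr /Kr /Ur eta0 /Gi /Ki /Ui !basis0 /=; field; rewrite gt_eqF.
have r0' : r != 0 by rewrite gt_eqF.
have h1 := radial_laplacian k r0'; have h2 := radial_laplacian (- k) r0'.
rewrite /Gr /Kr /Ur; case: ifP => _ /=.
  transitivity (- iA * ((3 * gb k r + r ^+ 2 * kb k r) - (3 * gb (- k) r + r ^+ 2 * kb (- k) r))).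
    by rewrite /Gi /Ki; ring.
  by rewrite h1 h2 /Ui; field; rewrite gt_eqF.
transitivity (oA * (3 * gb (- k) r + r ^+ 2 * kb (- k) r)); first by rewrite /Go /Ko; ring.
by rewrite h2 /Uo; ring.
Qed.

Lemma iA_ge0 : 0 <= iA.
Proof. by rewrite /iA !mulr_ge0 ?expR_ge0 ?invr_ge0 ?mulr_ge0 ?exprn_ge0 ?addr_ge0 ?mulr_ge0 ?(ltW k0) ?(ltW eta0). Qed.

(** The constant depends on k: the bound serves to show square integrability at fixed tau. The
    estimates uniform in tau rest on the energy identity and on the exact formulas [incP_sqr] and
    [incQ_sqr]. *)
Lemma radial_bound : exists2 C, 0 <= C & forall r, 0 <= r ->
  [/\ `|Ur r| <= C * expR (- k * r), `|Gr r| <= C * expR (- k * r),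
      r * `|Gr r| <= C * expR (- k * r) & r ^+ 2 * `|Kr r| <= C * expR (- k * r)].
Proof.
(* a common bound for U, G and rG suffices by the Helmholtz relation *)
suff [C C0 HC] : exists2 C, 0 <= C & forall r, 0 <= r ->
    [/\ `|Ur r| <= C * expR (- k * r), `|Gr r| <= C * expR (- k * r),
      r * `|Gr r| <= C * expR (- k * r) & (r < eta)%R%:R <= C * expR (- k * r)].
  exists (3 * C + k ^+ 2 * C + C + C).
    by have := mulr_ge0 (sqr_ge0 k) C0; lra.
  move=> r r0; have [h1 h2 h3 h4] := HC r r0.
  have e0 := expR_ge0 (- k * r); have k20 := sqr_ge0 k.
  have Ce : 0 <= C * expR (- k * r) by rewrite mulr_ge0.
  have kCe : 0 <= k ^+ 2 * (C * expR (- k * r)) by rewrite mulr_ge0.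
  have D : (3 * C + k ^+ 2 * C + C + C) * expR (- k * r) = 3 * (C * expR (- k * r)) +
    k ^+ 2 * (C * expR (- k * r)) + C * expR (- k * r) + C * expR (- k * r) by ring.
  rewrite D; split; try lra.
  have -> : r ^+ 2 * `|Kr r| = `|k ^+ 2 * Ur r - (r < eta)%R%:R - 3 * Gr r|.
    by rewrite -helmholtz// addrAC subrr add0r normrM ger0_norm// sqr_ge0.
  have i1 := ler_normB (k ^+ 2 * Ur r - (r < eta)%R%:R) (3 * Gr r).
  have i2 := ler_normB (k ^+ 2 * Ur r) ((r < eta)%R%:R).
  have := ler_wpM2l k20 h1.
  move: i1 i2; rewrite (normrM (k ^+ 2)) (normrM 3) (ger0_norm k20) (@ger0_norm _ 3)//.
  by rewrite (@ger0_norm _ ((r < eta)%R%:R))//; lra.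
have [e1 e1E] : { c | c = expR (k * eta) } by eexists.
have [Ci CiE] : { c | c = (k ^+ 2)^-1 + iA * (2 * k * e1) + iA * (2 * k ^+ 3 * e1) + eta * (iA * (2 * k ^+ 3 * e1)) + 1 } by eexists.
have [Co CoE] : { c | c = `|oA| * (eta^-1 + (k * eta^-1 ^+ 2 + eta^-1 ^+ 3) + (k * eta^-1 + eta^-1 ^+ 2)) } by eexists.
have A0 := iA_ge0; have e10 : 0 <= e1 by rewrite e1E expR_ge0.
have v0 : 0 <= eta^-1 by rewrite invr_ge0 ltW.
have k20 := sqr_ge0 k; have k30 : 0 <= k ^+ 3 by rewrite exprn_ge0// ltW.
have Co0 : 0 <= Co.
  by rewrite CoE mulr_ge0// !addr_ge0 ?mulr_ge0 ?exprn_ge0 ?(ltW k0).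
have p1 : 0 <= (k ^+ 2)^-1 by rewrite invr_ge0.
have q2' : 0 <= 2 * k * e1 by exact: (mulr_ge0 (mulr_ge0 (ler0n _ 2) (ltW k0)) e10).
have q3' : 0 <= 2 * k ^+ 3 * e1 by exact: (mulr_ge0 (mulr_ge0 (ler0n _ 2) k30) e10).
have p2 : 0 <= iA * (2 * k * e1) by exact: mulr_ge0.
have p3 : 0 <= iA * (2 * k ^+ 3 * e1) by exact: mulr_ge0.
have p4 : 0 <= eta * (iA * (2 * k ^+ 3 * e1)) by rewrite mulr_ge0 ?(ltW eta0).
have Ci0 : 0 <= Ci by rewrite CiE !addr_ge0.
exists (Ci * e1 + Co); first by rewrite addr_ge0 ?mulr_ge0.
move=> r r0; have er := expR_ge0 (- k * r).
have [rlt|rge] := ltP r eta.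
  have eee : 1 <= e1 * expR (- k * r).
    (* In the ball e^{k eta} e^{-k r} >= 1, which turns a constant bound into one that decays with
       r. *)
    rewrite e1E -expRD -expR0 ler_expR mulNr -mulrBr mulr_ge0 ?(ltW k0)// subr_ge0; exact: ltW.
  have kre : expR (k * r) <= e1 by rewrite e1E ler_expR (ler_wpM2l (ltW k0) (ltW rlt)).
  suff [b1 b2 b3] : [/\ `|Ur r| <= Ci, `|Gr r| <= Ci & r * `|Gr r| <= Ci].
    have : Ci <= (Ci * e1 + Co) * expR (- k * r).
      apply: (@le_trans _ _ (Ci * (e1 * expR (- k * r)))); first by rewrite ler_peMr.
      by rewrite mulrA ler_wpM2r// lerDl.
    have : 1 <= Ci by rewrite CiE; lra.
    by move=> ? ?; split => /=; lra.
  have bG : `|Gr r| <= iA * (2 * k ^+ 3 * e1).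
    rewrite /Gr rlt /Gi normrM normrN (ger0_norm A0) ler_wpM2l//.
    move: r0; rewrite le_eqVlt => /predU1P[<-|r0].
      by rewrite !basis0 subrr normr0.
    have y0 : 0 <= k * r by exact: mulr_ge0 (ltW k0) (ltW r0).
    have -> : gb k r - gb (- k) r = (expR (k * r) * (k * r - 1) + expR (- (k * r)) * (k * r + 1)) * r^-1 ^+ 3.
      by rewrite /gb mulNr; ring.
    have /andP[q1 q2] := gb_bound y0.
    have ri : 0 <= r^-1 ^+ 3 by rewrite exprn_ge0// invr_ge0 ltW.
    rewrite (ger0_norm (mulr_ge0 q1 ri)).
    apply: le_trans (ler_wpM2r ri q2) _.
    have -> : 2 * (k * r) ^+ 3 * expR (k * r) * r^-1 ^+ 3 = 2 * k ^+ 3 * expR (k * r).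
      by field; rewrite gt_eqF.
    exact: (ler_wpM2l (mulr_ge0 (ler0n _ 2) k30) kre).
  split.
  - rewrite /Ur rlt /Ui; apply: le_trans (ler_normB _ _) _.
    rewrite (ger0_norm p1) normrM (ger0_norm A0).
    suff : `|ub k r - ub (- k) r| <= 2 * k * e1 by move=> h; have := ler_wpM2l A0 h; rewrite CiE; lra.
    move: r0; rewrite le_eqVlt => /predU1P[<-|r0].
      by rewrite !basis0 subrr normr0.
    have y0 : 0 <= k * r by exact: mulr_ge0 (ltW k0) (ltW r0).
    have -> : ub k r - ub (- k) r = (expR (k * r) - expR (- (k * r))) * r^-1.
      by rewrite /ub mulNr; ring.
    have /andP[q1 q2] := expRB_bound y0.
    have ri : 0 <= r^-1 by rewrite invr_ge0 ltW.
    rewrite (ger0_norm (mulr_ge0 q1 ri)).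
    apply: le_trans (ler_wpM2r ri q2) _.
    have -> : 2 * (k * r) * expR (k * r) * r^-1 = 2 * k * expR (k * r) by field; rewrite gt_eqF.
    exact: (ler_wpM2l (mulr_ge0 (ler0n _ 2) (ltW k0)) kre).
  - by apply: le_trans bG _; rewrite CiE; lra.
  - have : r * `|Gr r| <= eta * (iA * (2 * k ^+ 3 * e1)) by apply: ler_pM => //; exact: ltW.
    by rewrite CiE; lra.
have r1 : 0 < r by rewrite (lt_le_trans eta0).
have riv : r^-1 <= eta^-1 by rewrite lef_pV2.
have ri : 0 <= r^-1 by rewrite invr_ge0 ltW.
have ri2 : r^-1 ^+ 2 <= eta^-1 ^+ 2 by rewrite lerXn2r// nnegrE.
have ri3 : r^-1 ^+ 3 <= eta^-1 ^+ 3 by rewrite lerXn2r// nnegrE.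
have CoC : Co * expR (- k * r) <= (Ci * e1 + Co) * expR (- k * r).
  by rewrite ler_wpM2r// lerDr mulr_ge0.
have o0 := normr_ge0 oA.
have p5 : 0 <= k * eta^-1 ^+ 2 by rewrite mulr_ge0 ?exprn_ge0 ?(ltW k0).
have p6 : 0 <= k * eta^-1 by rewrite mulr_ge0 ?(ltW k0).
have p7 : 0 <= eta^-1 ^+ 2 by rewrite exprn_ge0.
have p8 : 0 <= eta^-1 ^+ 3 by rewrite exprn_ge0.
have red (x y : R) : 0 <= y -> `|x| <= y -> y <= eta^-1 + (k * eta^-1 ^+ 2 + eta^-1 ^+ 3) + (k * eta^-1 + eta^-1 ^+ 2) ->
    `|oA| * (expR (- k * r) * `|x|) <= (Ci * e1 + Co) * expR (- k * r).
  move=> y0 xy yC; apply: le_trans CoC; rewrite CoE -mulrA ler_wpM2l// mulrC ler_wpM2r//.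
  exact: le_trans yC.
have kr : 0 <= k * r by rewrite mulr_ge0 ?(ltW k0).
have nG : `|- k * r - 1| = k * r + 1 by rewrite mulNr -opprD normrN ger0_norm// addr_ge0.
have l5 := ler_wpM2l (ltW k0) ri2; have l6 := ler_wpM2l (ltW k0) riv.
have gE : gb (- k) r = expR (- k * r) * ((- k * r - 1) * r^-1 ^+ 3) by rewrite /gb; ring.
rewrite /Ur /Gr ltNge rge /=; split.
- rewrite /Uo /ub (normrM oA) (normrM (expR _)) (ger0_norm er); apply: (red r^-1 r^-1).
  + by [].
  + by rewrite ger0_norm.
  + by move: p5 p6 p7 p8 riv; move: (eta^-1) (r^-1) => v w *; lra.
- rewrite /Go gE (normrM oA) (normrM (expR _)) (ger0_norm er); apply: (red _ (k * r^-1 ^+ 2 + r^-1 ^+ 3)).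
  + by rewrite addr_ge0 ?mulr_ge0 ?exprn_ge0 ?(ltW k0).
  + rewrite normrM nG (@ger0_norm _ (r^-1 ^+ 3)) ?exprn_ge0//.
    have -> : (k * r + 1) * r^-1 ^+ 3 = k * r^-1 ^+ 2 + r^-1 ^+ 3 by field; rewrite gt_eqF.
    by [].
  + by move: p5 p6 p7 p8 l5 ri3 v0; move: (eta^-1) (r^-1) => v w *; lra.
- have -> : r * `|Go r| = `|oA| * (expR (- k * r) * `|r * ((- k * r - 1) * r^-1 ^+ 3)|).
    by rewrite /Go gE (normrM oA) (normrM (expR _)) (normrM r) (ger0_norm er) (ger0_norm r0); ring.
  apply: (red _ (k * r^-1 + r^-1 ^+ 2)).
  + by rewrite addr_ge0 ?mulr_ge0 ?exprn_ge0 ?(ltW k0).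
  + rewrite (normrM r) normrM nG (ger0_norm r0) (@ger0_norm _ (r^-1 ^+ 3)) ?exprn_ge0//.
    have -> : r * ((k * r + 1) * r^-1 ^+ 3) = k * r^-1 + r^-1 ^+ 2 by field; rewrite gt_eqF.
    by [].
  + by move: p5 p6 p7 p8 l6 ri2 v0; move: (eta^-1) (r^-1) => v w *; lra.
- by rewrite mulr_ge0// addr_ge0 ?mulr_ge0.
Qed.

End incident_radial.

(** * Measurability and integrability of radial exponentials *)

Section exp_rad.
Context {R : realType}.
Notation rV3 := 'rV[R]_3.
Notation mR := (measurableTypeR R).
Notation leb3 := (@leb3 R).
Notation leb := (@lebesgue_measure R).

(** The identity 1/t = t e^{-ln(t^2)} reduces this to known functions; at t = 0 both sides are 0
    because of the default value of the inverse. *)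
Lemma measurable_inv : measurable_fun setT (fun t : mR => t^-1).
Proof.
have -> : (fun t : mR => t^-1) = (fun t : mR => t * expR (- ln (t ^+ 2))).
  apply/funext => t; have [->|t0] := eqVneq t 0; first by rewrite invr0 mul0r.
  rewrite expRN lnK; last by rewrite posrE exprn_even_gt0.
  by rewrite expr2 invfM mulrA mulfV// mul1r.
apply: measurable_funM => //.
apply: (measurableT_comp (continuous_measurable_fun (@continuous_expR R))).
under eq_fun do rewrite -mulN1r.
apply: measurable_funM => //; apply: (measurableT_comp (@measurable_ln R)).
exact: measurable_funX.
Qed.

Lemma measurable_rad (p : rV3) : measurable_fun setT (rad p).
Proof.
have -> : rad p = Num.sqrt \o (fun x => \sum_i (x 0 i - p 0 i) ^+ 2).
  by apply/funext => x; rewrite /= -rad_sqr sqrtr_sqr ger0_norm// rad_ge0.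
apply: (measurableT_comp (continuous_measurable_fun (@sqrt_continuous R))).
under eq_fun do rewrite sum3E.
have m i : measurable_fun setT (fun x : rV3 => (x 0 i - p 0 i) ^+ 2).
  by apply: measurable_funX; apply: measurable_funB => //; exact: measurable_coord.
by apply: measurable_funD => //; apply: measurable_funD.
Qed.

Lemma coord_le_rad (p x : rV3) i : `|x 0 i - p 0 i| <= rad p x.
Proof. by have := coord_le_enorm (x - p) i; rewrite !mxE. Qed.

Lemma integral_expR_abs (c q : R) : 0 < c ->
  (\int[leb]_t (expR (- c * `|t - q|))%:E < +oo)%E.
Proof.
move=> c0.
have mabs (s : R) : measurable_fun setT (fun t : mR => expR (- c * `|t - s|)).
  apply: (measurableT_comp (continuous_measurable_fun (@continuous_expR R))).
  by apply: measurable_funM => //; apply: measurableT_comp => //; exact: measurable_funB.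
have I0 : (\int[leb]_t (expR (- c * `|t|))%:E < +oo)%E.
  rewrite (@ge0_symfun_integralT _ (fun t => expR (- c * `|t|))); last 3 first.
  - by move=> t; exact: expR_ge0.
  - move=> t; apply: (@continuous_comp _ _ _ (fun t => - c * `|t|) (@expR R)); last exact: continuous_expR.
    by apply: continuousM; [exact: cst_continuous|exact: norm_continuous].
  - by move=> t /=; rewrite normrN.
  have mp : measurable ([set x | 0 <= x] : set mR).
    rewrite (_ : [set x | _] = `[0, +oo[%classic); first exact: measurable_itv.
    by apply/seteqP; split => t /=; rewrite in_itv/= andbT.
  have Ip := integrable_exponential_pdf c0.
  rewrite (eq_integral (fun t : mR => (c^-1)%:E * (exponential_pdf c t)%:E)%E); last first.
    move=> t; rewrite inE/= => t0; rewrite exponential_pdfE// ger0_norm// -EFinM.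
    by rewrite mulrA mulVf ?gt_eqF// mul1r.
  have Ip' : leb.-integrable [set x | 0 <= x] (EFin \o exponential_pdf c).
    by apply: integrableS Ip.
  rewrite integralZl//.
  have /fineK <- := integrable_fin_num mp Ip'.
  by rewrite -!EFinM ltry.
apply: (@le_lt_trans _ _ (\int[leb]_t ((expR (c * `|q|))%:E * (expR (- c * `|t|))%:E)))%E.
  apply: ge0_le_integral => //.
  - by apply/measurable_EFinP; exact: mabs.
  - apply: emeasurable_funM => //; apply/measurable_EFinP; have := mabs 0.
    by under eq_fun do rewrite subr0.
  - move=> t _; rewrite -EFinM lee_fin -expRD ler_expR !mulNr.
    have : `|t| <= `|t - q| + `|q| by have := ler_normD (t - q) q; rewrite subrK.
    by move=> /(ler_wpM2l (ltW c0)); rewrite mulrDr; lra.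
rewrite ge0_integralZl//.
- by apply: lte_mul_pinfty => //; rewrite lee_fin expR_ge0.
- by apply/measurable_EFinP; have := mabs 0; under eq_fun do rewrite subr0.
Qed.

Lemma sqint_exp_rad (k : R) (p : rV3) : 0 < k -> sqint leb3 (fun x => expR (- k * rad p x)).
Proof.
move=> k0.
have mE : measurable_fun setT (fun x => expR (- k * rad p x)).
  apply: (measurableT_comp (continuous_measurable_fun (@continuous_expR R))).
  by apply: measurable_funM => //; exact: measurable_rad.
split => //; apply/integrableP; split; first by apply/measurable_EFinP; exact: measurable_funX.
have c0 : 0 < 2 * k / 3 by rewrite divr_gt0 ?mulr_gt0.
(* Each |x_i - p_i| is at most the distance r, so 3 r dominates their sum, and e^{-2kr} is at most a
   product of one-variable exponentials of rate 2k/3. *)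
pose c := 2 * k / 3.
pose g (i : 'I_3) (t : mR) := expR (- c * `|t - p 0 i|).
have mg i : measurable_fun setT (g i).
  apply: (measurableT_comp (continuous_measurable_fun (@continuous_expR R))).
  by apply: measurable_funM => //; apply: measurableT_comp => //; exact: measurable_funB.
apply: (@le_lt_trans _ _ (\int[leb3]_x (g 0%R (x 0%R 0%R) * g 1%R (x 0%R 1%R) * g 2%R (x 0%R 2%R))%:E)%E).
  have mgx i : measurable_fun setT (fun x : rV3 => g i (x 0 i)).
    by apply: (measurableT_comp (mg i)); exact: measurable_coord.
  apply: ge0_le_integral => //.
  - by apply: measurableT_comp => //; apply/measurable_EFinP; exact: measurable_funX.
  - by apply/measurable_EFinP; apply: measurable_funM => //; exact: measurable_funM.
  - move=> x _ /=; rewrite ger0_norm ?sqr_ge0// lee_fin /g -!expRD expr2 -expRD ler_expR.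
    have h0 := coord_le_rad p x 0; have h1 := coord_le_rad p x 1; have h2 := coord_le_rad p x 2.
    have := lerD (lerD h0 h1) h2 => /(ler_wpM2l (ltW c0)); rewrite -/c /c => h.
    have -> : - k * rad p x + - k * rad p x = - (2 * k / 3 * (rad p x + rad p x + rad p x)) by field.
    by move: h; rewrite !mulrDr !mulNr; lra.
rewrite integral_leb3_prod//; last by move=> i t; exact: expR_ge0.
have F i : (\int[leb]_t (g i t)%:E)%E \is a fin_num.
  rewrite ge0_fin_numE; first exact: integral_expR_abs.
  by apply: integral_ge0 => t _; rewrite lee_fin expR_ge0.
by rewrite -(fineK (F 0)) -(fineK (F 1)) -(fineK (F 2)) -!EFinM ltry.
Qed.

End exp_rad.

Section scalar_test.
Context {R : realType}.
Notation rV3 := 'rV[R]_3.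
Notation leb3 := (@leb3 R).
Implicit Types g : rV3 -> R.

Definition stest g := (forall n, Ck n g) /\ compact (closure [set x | g x != 0]).

Lemma stest_out g x : stest g -> ~ closure [set x | g x != 0] x -> forall i, g x = 0 /\ partial i g x = 0.
Proof.
move=> [Cg _] nK i; have oK : open (~` closure [set x | g x != 0]).
  by rewrite openC; exact: closed_closure.
have g0 y : (~` closure [set x | g x != 0]) y -> g y = 0.
  by move=> nKy; apply: contrapT => /eqP gy; apply: nKy; exact: subset_closure.
split; first exact: g0.
rewrite /partial (@near_eq_derive _ _ _ _ (cst 0)) ?derive_cst//.
have : \forall y \near x, (~` closure [set x | g x != 0]) y by exact: open_nbhs_nbhs.
by apply: filterS => y /g0.
Qed.

Lemma stest_partial g i : stest g -> stest (partial i g).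
Proof.
move=> Tg; have [Cg cK] := Tg; split; first by move=> n; have [_ /(_ i)[]] := Cg n.+1.
apply: (subclosed_compact (@closed_closure _ _) cK).
have /closure_id -> : closed (closure [set x | g x != 0]) by exact: closed_closure.
apply: closure_subset => x /eqP h; apply: contrapT => nK; apply: h.
by have [_ ->] := stest_out Tg nK i.
Qed.

Lemma stest_sqint g : stest g -> sqint leb3 g.
Proof.
move=> Tg; have [Cg cK] := Tg; apply: (cont_compact_sqint cK); first exact: (Cg 0%N).
by move=> x /(stest_out Tg)/(_ 0)[].
Qed.

Lemma stest_bounded g : stest g -> exists N, forall i (x : rV3), N < `|x 0 i| -> g x = 0 /\ partial i g x = 0.
Proof.
move=> Tg; have [m Km] := compact_sub_cube Tg.2.
exists m%:R => i x mx; apply: stest_out => // /Km/(_ i) /=; rewrite in_itv/= => /andP[h1 h2].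
by move: mx; rewrite ltNge ler_norml h2 (ltW h1).
Qed.

Lemma test_field_stest (phi : rV3 -> rV3) i : test_field phi -> stest (fun x => phi x 0 i).
Proof.
move=> [Cphi cK]; split; first by move=> n; exact: Cphi.
apply: (subclosed_compact (@closed_closure _ _) cK); apply: closure_subset => x /=.
by apply: contra => /eqP ->; rewrite mxE.
Qed.

End scalar_test.

(** * The incident field solves the background system weakly *)

Section incident_fields.
Context {R : realType}.
Notation rV3 := 'rV[R]_3.
Notation mR := (measurableTypeR R).
Notation leb3 := (@leb3 R).
Variables (k eta : R) (p a : rV3).
Hypotheses (k0 : 0 < k) (eta0 : 0 < eta).

Definition potU (x : rV3) := Ur k eta (rad p x).
Definition gradU (i : 'I_3) (x : rV3) := (x 0 i - p 0 i) * Gr k eta (rad p x).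
Definition hessU (i j : 'I_3) (x : rV3) := (i == j)%:R * Gr k eta (rad p x)
  + (x 0 i - p 0 i) * (x 0 j - p 0 j) * Kr k eta (rad p x).

(* incP = a u - k^-2 grad (a . grad u) and incQ = (grad u) x a = curl incP. *)
Definition incP x : rV3 := \row_i (a 0 i * potU x - (k ^+ 2)^-1 * \sum_j a 0 j * hessU i j x).
Definition incQ x : rV3 := \row_i (gradU (i + 1) x * a 0 (i + 2) - gradU (i + 2) x * a 0 (i + 1)).

Let m_if (f g : R -> R) : measurable_fun setT (f : mR -> R) -> measurable_fun setT (g : mR -> R) ->
  measurable_fun setT (fun x => if rad p x < eta then f (rad p x) else g (rad p x)).
Proof.
move=> mf mg; apply: measurable_fun_ifT.
- by apply: measurable_fun_ltr => //; exact: measurable_rad.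
- by apply: (measurableT_comp mf); exact: measurable_rad.
- by apply: (measurableT_comp mg); exact: measurable_rad.
Qed.

Let m_exp c : measurable_fun setT (fun r : mR => expR (c * r)).
Proof. by apply: continuous_measurable_fun; exact: continuous_expRM. Qed.

Let m_lin c d : measurable_fun setT (fun r : mR => c * r + d).
Proof. by apply: measurable_funD => //; exact: measurable_funM. Qed.

Let m_inv n : measurable_fun setT (fun r : mR => r^-1 ^+ n).
Proof. by apply: measurable_funX; exact: measurable_inv. Qed.

Let m_ub c : measurable_fun setT (ub c : mR -> R).
Proof. by apply: measurable_funM; [exact: m_exp|exact: measurable_inv]. Qed.

Let m_gb c : measurable_fun setT (gb c : mR -> R).
Proof. by apply: measurable_funM; [apply: measurable_funM; [exact: m_exp|exact: m_lin]|exact: m_inv]. Qed.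

Let m_kb c : measurable_fun setT (kb c : mR -> R).
Proof.
apply: measurable_funM; last exact: m_inv.
apply: measurable_funM; first exact: m_exp.
apply: measurable_funD; last exact: measurable_cst.
apply: measurable_funB; last exact: measurable_funM.
by apply: measurable_funM => //; exact: measurable_funX.
Qed.

Let m_comb (f : R -> R -> R) (c d : R) : (forall c, measurable_fun setT (f c : mR -> R)) ->
  measurable_fun setT ((fun r => d * (f k r - f c r)) : mR -> R).
Proof. by move=> mf; apply: measurable_funM => //; apply: measurable_funB; exact: mf. Qed.

Let m_U : measurable_fun setT potU.
Proof.
apply: m_if; first by apply: measurable_funB; [exact: measurable_cst|exact: m_comb].
by apply: measurable_funM; [exact: measurable_cst|exact: m_ub].
Qed.

Let m_G : measurable_fun setT (fun x => Gr k eta (rad p x)).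
Proof.
by apply: m_if; [exact: m_comb|apply: measurable_funM; [exact: measurable_cst|exact: m_gb]].
Qed.

Let m_K : measurable_fun setT (fun x => Kr k eta (rad p x)).
Proof.
by apply: m_if; [exact: m_comb|apply: measurable_funM; [exact: measurable_cst|exact: m_kb]].
Qed.

Let m_z i : measurable_fun setT (fun x : rV3 => x 0 i - p 0 i).
Proof. by apply: measurable_funB => //; exact: measurable_coord. Qed.

Let sqint_radial (f : rV3 -> R) C : measurable_fun setT f -> 0 <= C ->
  (forall x, `|f x| <= C * expR (- k * rad p x)) -> sqint leb3 f.
Proof.
move=> mf C0 hf; apply: sqint_le (sqintZ C (sqint_exp_rad p k0)) _ => // x.
by rewrite (@ger0_norm _ (_ * _))// mulr_ge0// expR_ge0.
Qed.

Lemma sqint_potU : sqint leb3 potU.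
Proof.
have [C C0 HC] := radial_bound k0 eta0; apply: (sqint_radial m_U C0) => x.
by have [] := HC _ (rad_ge0 p x).
Qed.

Lemma sqint_gradU i : sqint leb3 (gradU i).
Proof.
have [C C0 HC] := radial_bound k0 eta0; apply: (sqint_radial _ C0); first exact: measurable_funM.
move=> x; have [_ _ h _] := HC _ (rad_ge0 p x).
by apply: le_trans h; rewrite normrM ler_wpM2r// coord_le_rad.
Qed.

Lemma sqint_hessU i j : sqint leb3 (hessU i j).
Proof.
have [C C0 HC] := radial_bound k0 eta0; apply: sqintD.
  by apply: sqintZ; apply: (sqint_radial m_G C0) => x; have [] := HC _ (rad_ge0 p x).
apply: (sqint_radial _ C0).
  by apply: measurable_funM => //; exact: measurable_funM.
move=> x; have [_ _ _ h] := HC _ (rad_ge0 p x).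
apply: le_trans h; rewrite normrM ler_wpM2r// normrM expr2.
by apply: ler_pM => //; exact: coord_le_rad.
Qed.

Let null (F : rV3 -> R) := leb3.-integrable setT (EFin \o F) /\ \int[leb3]_x F x = 0.

Let null_eq F1 F2 : null F1 -> (forall x, F2 x = F1 x) -> null F2.
Proof. by move=> h e; rewrite (_ : F2 = F1)//; apply/funext. Qed.

Let nullD F1 F2 : null F1 -> null F2 -> null (fun x => F1 x + F2 x).
Proof. by move=> [i1 e1] [i2 e2]; split; [exact: intgD|rewrite RintegralD// e1 e2 addr0]. Qed.

Let nullZ c F : null F -> null (fun x => c * F x).
Proof. by move=> [i1 e1]; split; [exact: intgZ|rewrite RintegralZl// e1 mulr0]. Qed.

Let nullB F1 F2 : null F1 -> null F2 -> null (fun x => F1 x - F2 x).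
Proof. by move=> h1 /(@nullZ (-1)) h2; have := nullD h1 h2; under eq_fun do rewrite mulN1r. Qed.

Let null_sum (F : 'I_3 -> rV3 -> R) : (forall i, null (F i)) -> null (fun x => \sum_i F i x).
Proof. by move=> h; under eq_fun do rewrite sum3E; apply: nullD => //; exact: nullD. Qed.

Lemma ibp_potU i g : stest g -> null (fun x => potU x * partial i g x + gradU i x * g x).
Proof.
move=> Tg; have [N hN] := stest_bounded Tg.
have I : leb3.-integrable setT (EFin \o (fun x => potU x * partial i g x + gradU i x * g x)).
  apply: intgD; apply: sqint_mul; [exact: sqint_potU| |exact: sqint_gradU|exact: stest_sqint].
  by apply: stest_sqint; exact: stest_partial.
split => //.
have L1 : lineC1 p i (fun x => Uo k eta (rad p x)) (fun x => (x 0 i - p 0 i) * Go k eta (rad p x)).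
  by apply: lineC1_rad => r r0; [exact: is_derive_Uo|exact: continuous_Go].
have L2 : lineC1 p i (fun x => Ui k eta (rad p x)) (fun x => (x 0 i - p 0 i) * Gi k eta (rad p x)).
  by apply: lineC1_rad => r r0; [exact: is_derive_Ui|exact: continuous_Gi].
have E (x : rV3) : (if rad p x < eta then (x 0 i - p 0 i) * Gi k eta (rad p x) else (x 0 i - p 0 i) * Go k eta (rad p x)) = gradU i x.
  by rewrite /gradU /Gr; case: ifP.
rewrite -[RHS](@ibp_glue _ p i eta N _ _ _ _ g eta0 L1 L2 _ (Tg.1 1%N) (hN i)) /=.
- by apply: eq_Rintegral => x _; rewrite E.
- by move=> x ->; rewrite match_U.
- by under eq_fun do rewrite E.
Qed.

Lemma ibp_gradU i j g : stest g -> null (fun x => gradU j x * partial i g x + hessU i j x * g x).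
Proof.
move=> Tg; have [N hN] := stest_bounded Tg.
have I : leb3.-integrable setT (EFin \o (fun x => gradU j x * partial i g x + hessU i j x * g x)).
  apply: intgD; apply: sqint_mul; [exact: sqint_gradU| |exact: sqint_hessU|exact: stest_sqint].
  by apply: stest_sqint; exact: stest_partial.
split => //.
have Lz : lineC1 p i (fun x => x 0 j - p 0 j) (fun=> (i == j)%:R).
  apply: (lineC1_eq (lineC1B (@lineC1_coord _ p i j) (@lineC1_cst _ p i (p 0 j)))) => //.
  by apply/funext => x; rewrite subr0.
have L1 : lineC1 p i (fun x => (x 0 j - p 0 j) * Go k eta (rad p x))
    (fun x => (i == j)%:R * Go k eta (rad p x) + (x 0 i - p 0 i) * (x 0 j - p 0 j) * Ko k eta (rad p x)).
  have h : lineC1 p i (fun x => Go k eta (rad p x)) (fun x => (x 0 i - p 0 i) * Ko k eta (rad p x)).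
    by apply: lineC1_rad => r r0; [exact: is_derive_Go|exact: continuous_Ko].
  by apply: (lineC1_eq (lineC1M Lz h)) => //; apply/funext => x; ring.
have L2 : lineC1 p i (fun x => (x 0 j - p 0 j) * Gi k eta (rad p x))
    (fun x => (i == j)%:R * Gi k eta (rad p x) + (x 0 i - p 0 i) * (x 0 j - p 0 j) * Ki k eta (rad p x)).
  have h : lineC1 p i (fun x => Gi k eta (rad p x)) (fun x => (x 0 i - p 0 i) * Ki k eta (rad p x)).
    by apply: lineC1_rad => r r0; [exact: is_derive_Gi|exact: continuous_Ki].
  by apply: (lineC1_eq (lineC1M Lz h)) => //; apply/funext => x; ring.
have E (x : rV3) : (if rad p x < eta then (x 0 j - p 0 j) * Gi k eta (rad p x) else (x 0 j - p 0 j) * Go k eta (rad p x)) = gradU j x.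
  by rewrite /gradU /Gr; case: ifP.
have E2 (x : rV3) : (if rad p x < eta then (i == j)%:R * Gi k eta (rad p x) + (x 0 i - p 0 i) * (x 0 j - p 0 j) * Ki k eta (rad p x)
    else (i == j)%:R * Go k eta (rad p x) + (x 0 i - p 0 i) * (x 0 j - p 0 j) * Ko k eta (rad p x)) = hessU i j x.
  by rewrite /hessU /Gr /Kr; case: ifP.
rewrite -[RHS](@ibp_glue _ p i eta N _ _ _ _ g eta0 L1 L2 _ (Tg.1 1%N) (hN i)) /=.
- by apply: eq_Rintegral => x _; rewrite E E2.
- by move=> x ->; rewrite match_G.
- by under eq_fun do rewrite E E2.
Qed.

Lemma L2field_incP : L2field incP.
Proof.
apply/L2fieldP => i; under eq_fun do rewrite mxE -mulN1r mulrA sum3E.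
apply: sqintD; first by apply: sqintZ; exact: sqint_potU.
by apply: sqintZ; apply: sqintD; [apply: sqintD|]; apply: sqintZ; exact: sqint_hessU.
Qed.

Lemma L2field_incQ : L2field incQ.
Proof.
apply/L2fieldP => i.
have -> : (fun x => incQ x 0 i) = (fun x => a 0 (i + 2) * gradU (i + 1) x + (- a 0 (i + 1)) * gradU (i + 2) x).
  by apply/funext => x; rewrite mxE; ring.
by apply: sqintD; apply: sqintZ; exact: sqint_gradU.
Qed.

Lemma weak_curl_null (u c : rV3 -> rV3) : L2field u -> L2field c ->
  (forall phi, test_field phi -> null (fun x => dotv (u x) (curl phi x) - dotv (c x) (phi x))) ->
  weak_curl u c.
Proof.
move=> Lu Lc h; split => // phi Tphi; have [Lp Lcp] := test_L2 Tphi.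
have [_] := h _ Tphi; rewrite RintegralB//; [|exact: L2field_dotv..].
by move/eqP; rewrite subr_eq0 => /eqP.
Qed.

(** The Hessian may jump across the sphere, so the curl of the gradient part cannot be taken
    directly. The derivative is moved onto the test field instead: the gradient of a . grad u is
    paired with a curl, whose divergence vanishes because mixed derivatives commute. *)
Lemma weak_curl_incP : weak_curl incP incQ.
Proof.
apply: weak_curl_null; [exact: L2field_incP|exact: L2field_incQ|move=> phi Tphi].
have Tc i : stest (fun x => phi x 0 i) by exact: test_field_stest.
pose f i := fun x => phi x 0 i.
have Td l i : stest (partial l (f i)) by apply: stest_partial; exact: Tc.
have Z1 : null (fun x => \sum_i a 0 i * ((potU x * partial (i + 1) (f (i + 2)) x + gradU (i + 1) x * f (i + 2) x)
    - (potU x * partial (i + 2) (f (i + 1)) x + gradU (i + 2) x * f (i + 1) x))).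
  by apply: null_sum => i; apply: nullZ; apply: nullB; apply: ibp_potU; exact: Tc.
have Z2 : null (fun x => \sum_i \sum_j a 0 j *
    ((gradU j x * partial i (partial (i + 1) (f (i + 2))) x + hessU i j x * partial (i + 1) (f (i + 2)) x)
    - (gradU j x * partial i (partial (i + 2) (f (i + 1))) x + hessU i j x * partial (i + 2) (f (i + 1)) x))).
  by apply: null_sum => i; apply: null_sum => j; apply: nullZ; apply: nullB; apply: ibp_gradU; exact: Td.
apply: (null_eq (nullB Z1 (nullZ (k ^+ 2)^-1 Z2))) => x.
have S i j l : partial i (partial j (f l)) x = partial j (partial i (f l)) x.
  by apply: Ck2_partialC; exact: (Tc l).1.
rewrite !dotvE !sum3E !mxE !sum3E !I3E -/(f 0) -/(f 1) -/(f 2).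
rewrite -[phi x 0 0]/(f 0 x) -[phi x 0 1]/(f 1 x) -[phi x 0 2]/(f 2 x).
rewrite (S 1 0) (S 2 0) (S 2 1).
move: (hessU 0 0 x) (hessU 0 1 x) (hessU 0 2 x) (hessU 1 0 x) (hessU 1 1 x) (hessU 1 2 x) (hessU 2 0 x) (hessU 2 1 x) (hessU 2 2 x).
move: (gradU 0 x) (gradU 1 x) (gradU 2 x) (partial 0 (partial 1 (f 2)) x) (partial 0 (partial 2 (f 1)) x) (partial 1 (partial 2 (f 0)) x).
move: (a 0 0) (a 0 1) (a 0 2) ((k ^+ 2)^-1) (potU x).
move: (f 0 x) (f 1 x) (f 2 x) (partial 0 (f 1) x) (partial 0 (f 2) x) (partial 1 (f 0) x) (partial 1 (f 2) x) (partial 2 (f 0) x) (partial 2 (f 1) x).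
move=> f0 f1 f2 d0 d1 d2 d3 d4 d5 c0 c1 c2 c3 c4 g0 g1 g2 g3 g4 g5 h0 h1 h2 h3 h4 h5 h6 h7 h8.
ring.
Qed.

(** The curl of (grad u) x a is grad(a . grad u) - a Laplacian u. By [helmholtz] the Laplacian, the
    trace of the Hessian, equals k^2 u - 1_B; this produces the source and explains the correction
    k^{-2} grad(a . grad u) in [incP]. *)
Lemma weak_curl_incQ :
  weak_curl incQ (fun x => - (k ^+ 2) *: incP x + (\1_(eball p eta) x : R) *: a).
Proof.
have mB : measurable (eball p eta).
  rewrite -[eball p eta]setTI (_ : eball p eta = (rad p) @^-1` `]-oo, eta[%classic).
    by apply: (measurable_rad p); [exact: measurableT|exact: measurable_itv].
  by apply/seteqP; split => x /=; rewrite in_itv.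
have LB : L2field (fun x => (\1_(eball p eta) x : R) *: a).
  apply/L2fieldP => i; under eq_fun do rewrite mxE.
  have m1 : measurable_fun setT (fun x : rV3 => \1_(eball p eta) x : R) by exact: measurable_indic.
  have -> : (fun x => \1_(eball p eta) x * a 0 i) = (fun x : rV3 => a 0 i * \1_(eball p eta) x).
    by apply/funext => x; rewrite mulrC.
  apply: sqintZ; apply: (sqint_radial (C := expR (k * eta)) m1); first exact: expR_ge0.
  move=> x; rewrite indicE; case: (boolP (x \in _)) => [|_]; last by rewrite normr0 mulr_ge0 ?expR_ge0.
  rewrite inE/= => xB; rewrite normr1 -expRD -expR0 ler_expR mulNr -mulrBr.
  by rewrite mulr_ge0 ?(ltW k0)// subr_ge0 ltW.
apply: weak_curl_null; [exact: L2field_incQ| |move=> phi Tphi].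
  by apply: L2fieldD => //; apply: L2fieldZ; exact: L2field_incP.
have Tc i : stest (fun x => phi x 0 i) by exact: test_field_stest.
pose f i := fun x => phi x 0 i.
have E1 i j (m : 'I_3) : null (fun x => gradU j x * partial i (f m) x + hessU i j x * f m x).
  by apply: ibp_gradU; exact: Tc.
have Z1 : null (fun x => \sum_i (
    a 0 (i + 2) * ((gradU (i + 1) x * partial (i + 1) (f (i + 2)) x + hessU (i + 1) (i + 1) x * f (i + 2) x)
      - (gradU (i + 1) x * partial (i + 2) (f (i + 1)) x + hessU (i + 2) (i + 1) x * f (i + 1) x))
  - a 0 (i + 1) * ((gradU (i + 2) x * partial (i + 1) (f (i + 2)) x + hessU (i + 1) (i + 2) x * f (i + 2) x)
      - (gradU (i + 2) x * partial (i + 2) (f (i + 1)) x + hessU (i + 2) (i + 2) x * f (i + 1) x)))).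
  by apply: null_sum => i; apply: nullB; apply: nullZ; apply: nullB; exact: E1.
apply: (null_eq Z1) => x.
have H := helmholtz k0 eta0 (rad_ge0 p x).
have B : \1_(eball p eta) x = (rad p x < eta)%R%:R :> R.
  by rewrite indicE; congr (_%:R); congr nat_of_bool; apply/idP/idP; rewrite inE.
rewrite rad_sqr sum3E in H.
have {}B : \1_(eball p eta) x = k ^+ 2 * potU x - (3 * Gr k eta (rad p x) + ((x 0 0 - p 0 0) ^+ 2 + (x 0 1 - p 0 1) ^+ 2 + (x 0 2 - p 0 2) ^+ 2) * Kr k eta (rad p x)) :> R.
  by rewrite B H /potU; ring.
rewrite !dotvE !sum3E !mxE !sum3E !I3E B -/(f 0) -/(f 1) -/(f 2).
rewrite -[phi x 0 0]/(f 0 x) -[phi x 0 1]/(f 1 x) -[phi x 0 2]/(f 2 x).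
have aux (s t u : R) : - (k ^+ 2) * (s - (k ^+ 2)^-1 * t) + u = - (k ^+ 2) * s + t + u.
  by field; rewrite gt_eqF.
rewrite !aux /hessU !eqxx !I3ne /=.
move: (x 0 0 - p 0 0) (x 0 1 - p 0 1) (x 0 2 - p 0 2).
move: (Gr k eta (rad p x)) (Kr k eta (rad p x)).
move: (gradU 0 x) (gradU 1 x) (gradU 2 x).
move: (a 0 0) (a 0 1) (a 0 2) (k ^+ 2) (potU x).
move: (f 0 x) (f 1 x) (f 2 x) (partial 0 (f 1) x) (partial 0 (f 2) x) (partial 1 (f 0) x) (partial 1 (f 2) x) (partial 2 (f 0) x) (partial 2 (f 1) x).
move=> f0 f1 f2 d0 d1 d2 d3 d4 d5 c0 c1 c2 c3 c4 g0 g1 g2 h0 h1 h2 h3 h4.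
ring.
Qed.

End incident_fields.

Ltac lra_ip := repeat match goal with
  | |- context [ip ?u ?v] => generalize (ip u v); intro
  | |- context [nrm ?u] => generalize (nrm u); intro
  end; lra.

(** * Energy estimates *)

Section arithmetic.
Variable R : realFieldType.
Implicit Types (A B X Y g h L : R).

Lemma sum_le_of_norms A B X Y g h L1 L2 a1 a2 a3 a4 : A + B = - X - Y - g - h ->
  `|X| <= a1 -> `|Y| <= a2 -> `|g| <= a3 -> `|h| <= a4 -> L1 <= A -> L2 <= B ->
  L1 + L2 <= a1 + a2 + a3 + a4.
Proof. by rewrite !ler_norml => E /andP[? ?] /andP[? ?] /andP[? ?] /andP[? ?] ? ?; lra. Qed.

Lemma energy_arith (FW FV b0 m0 bWW gEW mHH gHH VV QQ bWV gEV HQ WV mHQ gHQ i1 i2 : R) :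
  FW = b0 * WV + mHQ + gHQ -> FV = bWV + gEV + m0 * HQ -> FV = b0 * VV + m0 * QQ ->
  FW = bWW + gEW + mHH + gHH ->
  bWW - bWV - i1 + (mHH - mHQ - i2) =
  - (i1 - b0 * (WV - VV)) - (i2 - m0 * (HQ - QQ)) - (gEW - gEV) - (gHH - gHQ).
Proof. by move=> h1 h2 h3 h4; rewrite !mulrBr; lra. Qed.

(** The left side is at least b (r + s)^2 / 2 and the right side at most a constant times r + s;
    then divide by r + s. *)
Lemma quadratic_bound (b K r s v vh g h : R) : 0 < b -> 0 <= K -> 0 <= r -> 0 <= s -> 0 <= v -> 0 <= vh ->
  0 <= g -> 0 <= h ->
  b * r ^+ 2 + b * s ^+ 2 <= K * (r * v) + K * (s * vh) + g * r + h * s ->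
  b * (r + s) <= 2 * (K * (v + vh) + g + h).
Proof.
move=> b0' K0' r0 s0 v0 vh0 g0 h0 tot.
have [->|rs] := eqVneq (r + s) 0.
  by rewrite mulr0 mulr_ge0// !addr_ge0// mulr_ge0// addr_ge0.
have rs0 : 0 < r + s by rewrite lt_neqAle eq_sym rs addr_ge0.
rewrite -(ler_pM2r rs0).
have p1 : b * (r + s) ^+ 2 <= 2 * (b * r ^+ 2 + b * s ^+ 2).
  have := mulr_ge0 (ltW b0') (sqr_ge0 (r - s)); lra.
have p2 : K * (r * v) + K * (s * vh) + g * r + h * s <= (K * (v + vh) + g + h) * (r + s).
  have a1 := mulr_ge0 K0' (mulr_ge0 r0 vh0); have a2 := mulr_ge0 K0' (mulr_ge0 s0 v0).
  have a3 := mulr_ge0 g0 s0; have a4 := mulr_ge0 h0 r0; lra.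
have -> : b * (r + s) * (r + s) = b * (r + s) ^+ 2 by ring.
lra.
Qed.

End arithmetic.

(** * Two solutions of stationary systems with the same source *)

Section hilbert.
Context {R : realType}.
Notation rV3 := 'rV[R]_3.
Notation leb3 := (@leb3 R).

Definition int_eq (f : rV3 -> R) (v : R) := leb3.-integrable setT (EFin \o f) /\ \int[leb3]_x f x = v.

Lemma int_eqD f g v w : int_eq f v -> int_eq g w -> int_eq (fun x => f x + g x) (v + w).
Proof. by move=> [i <-] [j <-]; split; [exact: intgD|rewrite RintegralD]. Qed.

Lemma int_eqB f g v w : int_eq f v -> int_eq g w -> int_eq (fun x => f x - g x) (v - w).
Proof. by move=> [i <-] [j <-]; split; [exact: intgB|rewrite RintegralB]. Qed.

Lemma int_eqZ c f v : int_eq f v -> int_eq (fun x => c * f x) (c * v).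
Proof. by move=> [i <-]; split; [exact: intgZ|rewrite RintegralZl]. Qed.

Lemma int_eq_le f g v w : int_eq f v -> int_eq g w -> (forall x, f x <= g x) -> v <= w.
Proof. by move=> [i <-] [j <-] h; apply: le_Rintegral. Qed.

Lemma int_eq_ip u v : L2field u -> L2field v -> int_eq (fun x => dotv (u x) (v x)) (ip u v).
Proof. by move=> Lu Lv; split; [exact: L2field_dotv|]. Qed.

Variables (beta m : rV3 -> R) (beta0 m0 b M : R) (D : set rV3).
Hypotheses (mbeta : measurable_fun setT beta) (mm : measurable_fun setT m) (mD : measurable D).
Hypotheses (b0 : 0 < b) (bbeta : forall x, b <= beta x <= M) (bm : forall x, b <= m x <= M).
Hypotheses (beta00 : 0 <= beta0) (m00 : 0 <= m0).
Variables (We Wh V Vh gE gH F : rV3 -> rV3).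
Hypotheses (LgE : L2field gE) (LgH : L2field gH) (LF : L2field F).
Hypotheses
  (C1 : weak_curl We (fun x => - m x *: Wh x - gH x))
  (C2 : weak_curl Wh (fun x => beta x *: We x + gE x - F x))
  (C3 : weak_curl V (fun x => - m0 *: Vh x))
  (C4 : weak_curl Vh (fun x => beta0 *: V x - F x)).

Let LWe : L2field We. Proof. by case: C1. Qed.
Let LWh : L2field Wh. Proof. by case: C2. Qed.
Let LV : L2field V. Proof. by case: C3. Qed.
Let LVh : L2field Vh. Proof. by case: C4. Qed.

Let bdd (h : rV3 -> R) x : b <= h x <= M -> `|h x| <= M.
Proof. by move=> /andP[h1 h2]; rewrite ger0_norm// (le_trans (ltW b0)). Qed.

Let Lbeta u : L2field u -> L2field (fun x => beta x *: u x).
Proof. by move=> Lu; apply: (L2field_mul Lu mbeta) => x; exact: (@bdd beta). Qed.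

Let Lm u : L2field u -> L2field (fun x => m x *: u x).
Proof. by move=> Lu; apply: (L2field_mul Lu mm) => x; exact: (@bdd m). Qed.

Notation S := (fun x => Wh x - Vh x).
Notation Rr := (fun x => We x - V x).

Let LR : L2field Rr. Proof. exact: L2fieldB. Qed.
Let LS : L2field S. Proof. exact: L2fieldB. Qed.

Let cWe u : L2field u -> ip (fun x => - m x *: Wh x - gH x) u = - ip (fun x => m x *: Wh x) u - ip gH u.
Proof.
move=> Lu; rewrite ipBl//; last first.
  by have := L2fieldN (Lm LWh); under [X in L2field X -> _]eq_fun do rewrite -scaleNr.
by under [X in ip X u - _]eq_fun do rewrite scaleNr; rewrite ipNl//; exact: Lm.
Qed.

Let cWh u : L2field u -> ip (fun x => beta x *: We x + gE x - F x) u =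
  ip (fun x => beta x *: We x) u + ip gE u - ip F u.
Proof. by move=> Lu; rewrite ipBl// ?ipDl//; [exact: Lbeta|apply: L2fieldD => //; exact: Lbeta]. Qed.

Let cV u : L2field u -> ip (fun x => - m0 *: Vh x) u = - m0 * ip Vh u.
Proof. by move=> Lu; rewrite ipZl. Qed.

Let cVh u : L2field u -> ip (fun x => beta0 *: V x - F x) u = beta0 * ip V u - ip F u.
Proof. by move=> Lu; rewrite ipBl ?ipZl//; exact: L2fieldZ. Qed.

(** The four identities [G1] to [G4] pair each magnetic curl ([C2], [C4]) with each electric curl
    ([C1], [C3]): two energies and two cross terms. All estimates below are linear combinations of
    them. *)
Let G1 : ip F We = ip (fun x => beta x *: We x) We + ip gE We + ip (fun x => m x *: Wh x) Wh + ip gH Wh.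
Proof. by have h := weak_curl_symmetric C2 C1; rewrite cWh// [RHS]ipC cWe// in h; lra. Qed.

Let G2 : ip F V = beta0 * ip V V + m0 * ip Vh Vh.
Proof. by have h := weak_curl_symmetric C4 C3; rewrite cVh// [RHS]ipC cV// in h; lra. Qed.

Let G3 : ip F V = ip (fun x => beta x *: We x) V + ip gE V + m0 * ip Wh Vh.
Proof. by have h := weak_curl_symmetric C2 C3; rewrite cWh// [RHS]ipC cV// (ipC Vh) in h; lra. Qed.

Let G4 : ip F We = beta0 * ip V We + ip (fun x => m x *: Wh x) Vh + ip gH Vh.
Proof. by have h := weak_curl_symmetric C4 C1; rewrite cVh// [RHS]ipC cWe// in h; lra. Qed.

Lemma source_energy : ip F V = beta0 * ip V V + m0 * ip Vh Vh.
Proof. exact: G2. Qed.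

Let err_bound : `|ip gH Vh| + `|ip gE V| + `|ip gE Rr| + `|ip gH S| <=
  nrm gH * (nrm Vh + nrm S) + nrm gE * (nrm V + nrm Rr).
Proof.
have h1 := ip_CS LgH LVh; have h2 := ip_CS LgE LV; have h3 := ip_CS LgE LR; have h4 := ip_CS LgH LS.
rewrite !mulrDr.
apply: (le_trans (lerD (lerD (lerD h1 h2) h3) h4)).
by rewrite -!addrA lerD2l addrA addrC.
Qed.

Let gER : ip gE Rr = ip gE We - ip gE V. Proof. exact: ipBr. Qed.
Let gHS : ip gH S = ip gH Wh - ip gH Vh. Proof. exact: ipBr. Qed.

Let dvv (u v : rV3) : dotv (u - v) (u - v) = dotv u u - 2 * dotv u v + dotv v v.
Proof. by rewrite dotvBl !dotvBr (dotvC v u); ring. Qed.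

(* The E part is the square beta |We - V|^2 plus a remainder, the H part is completed to
   m |Wh - (m0 / m) Vh|^2; lowerI exchanges the two roles. *)
Lemma lowerII (w1 w2 : rV3 -> R) :
  leb3.-integrable setT (EFin \o (fun x => w1 x * dotv (V x) (V x) + w2 x * dotv (Vh x) (Vh x))) ->
  (forall x, w1 x <= beta0 - beta x) -> (forall x, w2 x <= m0 - m0 ^+ 2 / m x) ->
  \int[leb3]_x (w1 x * dotv (V x) (V x) + w2 x * dotv (Vh x) (Vh x))
  - (nrm gH * (nrm Vh + nrm S) + nrm gE * (nrm V + nrm Rr)) <= ip F We - ip F V.
Proof.
move=> Iw hw1 hw2.
have J := int_eqD (int_eqD (int_eqB (int_eq_ip (Lbeta LWe) LWe) (int_eqZ 2 (int_eq_ip (Lbeta LWe) LV)))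
   (int_eqZ beta0 (int_eq_ip LV LV)))
  (int_eqD (int_eqB (int_eq_ip (Lm LWh) LWh) (int_eqZ (2 * m0) (int_eq_ip LWh LVh))) (int_eqZ m0 (int_eq_ip LVh LVh))).
have := int_eq_le (conj Iw erefl) J; set Q := \int[leb3]_x _ => h.
have {}h : Q <= ip (fun x => beta x *: We x) We - 2 * ip (fun x => beta x *: We x) V + beta0 * ip V V +
    (ip (fun x => m x *: Wh x) Wh - 2 * m0 * ip Wh Vh + m0 * ip Vh Vh).
  apply: h => x; rewrite !dotvZl.
  have /andP[bx _] := bbeta x; have /andP[mx _] := bm x.
  have mx0 : 0 < m x by rewrite (lt_le_trans b0).
  have q1 := ler_wpM2r (dotvv_ge0 (V x)) (hw1 x).
  have q2 := ler_wpM2r (dotvv_ge0 (Vh x)) (hw2 x).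
  have q3 := mulr_ge0 (le_trans (ltW b0) bx) (dotvv_ge0 (We x - V x)).
  have q4 := mulr_ge0 (ltW mx0) (dotvv_ge0 (Wh x - (m0 / m x) *: Vh x)).
  have e4 : m x * dotv (Wh x - (m0 / m x) *: Vh x) (Wh x - (m0 / m x) *: Vh x) =
     m x * dotv (Wh x) (Wh x) - 2 * m0 * dotv (Wh x) (Vh x) + m0 ^+ 2 / m x * dotv (Vh x) (Vh x).
    rewrite dvv dotvZl !dotvZr; field; rewrite gt_eqF//.
  rewrite dvv in q3; rewrite e4 in q4.
  move: q1 q2 q3 q4; rewrite !mulrBl mulrDr mulrBr; lra.
have := err_bound; have := ler_norm (- ip gH Vh); have := ler_norm (ip gE V).
have := ler_norm (- ip gE Rr); have := ler_norm (- ip gH S).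
rewrite !normrN gER gHS; move: h; have := G1; have := G2; have := G3; lra_ip.
Qed.

Lemma lowerI (w1 w2 : rV3 -> R) :
  leb3.-integrable setT (EFin \o (fun x => w1 x * dotv (V x) (V x) + w2 x * dotv (Vh x) (Vh x))) ->
  (forall x, w1 x <= beta0 - beta0 ^+ 2 / beta x) -> (forall x, w2 x <= m0 - m x) ->
  \int[leb3]_x (w1 x * dotv (V x) (V x) + w2 x * dotv (Vh x) (Vh x))
  - (nrm gH * (nrm Vh + nrm S) + nrm gE * (nrm V + nrm Rr)) <= - (ip F We - ip F V).
Proof.
move=> Iw hw1 hw2.
have J := int_eqD (int_eqD (int_eqB (int_eq_ip (Lbeta LWe) LWe) (int_eqZ (2 * beta0) (int_eq_ip LWe LV)))
   (int_eqZ beta0 (int_eq_ip LV LV)))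
  (int_eqD (int_eqB (int_eq_ip (Lm LWh) LWh) (int_eqZ 2 (int_eq_ip (Lm LWh) LVh))) (int_eqZ m0 (int_eq_ip LVh LVh))).
have := int_eq_le (conj Iw erefl) J; set Q := \int[leb3]_x _ => h.
have {}h : Q <= ip (fun x => beta x *: We x) We - 2 * beta0 * ip We V + beta0 * ip V V +
    (ip (fun x => m x *: Wh x) Wh - 2 * ip (fun x => m x *: Wh x) Vh + m0 * ip Vh Vh).
  apply: h => x; rewrite !dotvZl.
  have /andP[bx _] := bbeta x; have /andP[mx _] := bm x.
  have bx0 : 0 < beta x by rewrite (lt_le_trans b0).
  have q1 := ler_wpM2r (dotvv_ge0 (V x)) (hw1 x).
  have q2 := ler_wpM2r (dotvv_ge0 (Vh x)) (hw2 x).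
  have q3 := mulr_ge0 (le_trans (ltW b0) mx) (dotvv_ge0 (Wh x - Vh x)).
  have q4 := mulr_ge0 (ltW bx0) (dotvv_ge0 (We x - (beta0 / beta x) *: V x)).
  have e4 : beta x * dotv (We x - (beta0 / beta x) *: V x) (We x - (beta0 / beta x) *: V x) =
     beta x * dotv (We x) (We x) - 2 * beta0 * dotv (We x) (V x) + beta0 ^+ 2 / beta x * dotv (V x) (V x).
    rewrite dvv dotvZl !dotvZr; field; rewrite gt_eqF//.
  rewrite dvv in q3; rewrite e4 in q4.
  move: q1 q2 q3 q4; rewrite !mulrBl mulrDr mulrBr; lra.
have := err_bound; have := ler_norm (ip gH Vh); have := ler_norm (- ip gE V).
have := ler_norm (- ip gE Rr); have := ler_norm (- ip gH S).
rewrite !normrN gER gHS; move: h; have := G1; have := G2; have := G4; rewrite (ipC V We); lra_ip.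
Qed.

Variable K : R.
Hypotheses (K0 : 0 <= K) (Kbeta : forall x, `|beta x - beta0| <= K) (Km : forall x, `|m x - m0| <= K)
  (offD : forall x, ~ D x -> beta x = beta0 /\ m x = m0).

Definition onD (u : rV3 -> rV3) x := (\1_D x : R) *: u x.

Let m1D : measurable_fun setT (fun x => \1_D x : R). Proof. exact: measurable_indic. Qed.

Let n1D x : `|\1_D x : R| <= 1.
Proof. by rewrite indicE; case: (x \in D); rewrite ?normr1 ?normr0. Qed.

Lemma L2field_onD u : L2field u -> L2field (onD u).
Proof. by move=> Lu; exact: (L2field_mul Lu m1D n1D). Qed.

Lemma nrm_onD u : L2field u -> nrm (onD u) <= nrm u.
Proof.
move=> Lu; rewrite ler_sqrt ?ipvv_ge0//.
apply: le_Rintegral => //; [exact: L2field_dotv (L2field_onD Lu) (L2field_onD Lu)|exact: L2field_dotv|].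
move=> x _; rewrite /onD dotvZl dotvZr mulrA indicE.
by case: (x \in D); rewrite ?mulr1 ?mul1r ?mulr0 ?mul0r ?dotvv_ge0.
Qed.

(** The difference of coefficients is supported in D, so both fields may be restricted to D before
    the Cauchy-Schwarz inequality. The exponential smallness of the incident field on D enters
    through this. *)
Let contrast (h : rV3 -> R) h0 u v : measurable_fun setT h -> (forall x, `|h x - h0| <= K) ->
  (forall x, ~ D x -> h x = h0) -> L2field u -> L2field v ->
  `|ip (fun x => h x *: u x) v - h0 * ip u v| <= K * (nrm (onD u) * nrm (onD v)).
Proof.
move=> mh hK hD Lu Lv.
have Lu' := L2field_onD Lu; have Lv' := L2field_onD Lv.
have mhh : measurable_fun setT (fun x => h x - h0) by exact: measurable_funB.
have Lh : L2field (fun x => (h x - h0) *: onD u x) by exact: (L2field_mul Lu' mhh hK).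
have Lhu : L2field (fun x => (h x - h0) *: u x) by exact: (L2field_mul Lu mhh hK).
have -> : ip (fun x => h x *: u x) v - h0 * ip u v = ip (fun x => (h x - h0) *: onD u x) (onD v).
  have -> : ip (fun x => (h x - h0) *: onD u x) (onD v) = ip (fun x => (h x - h0) *: u x) v.
    apply: eq_Rintegral => x _; rewrite !dotvZl dotvZr indicE.
    have [xD|xD] := boolP (x \in D); first by rewrite !mul1r.
    by rewrite hD ?subrr ?mul0r// => h'; move: xD; rewrite notin_setE.
  have e : (fun x => h x *: u x) = (fun x => (h x - h0) *: u x + h0 *: u x).
    by apply/funext => x; rewrite -scalerDl subrK.
  rewrite e ipDl// ?ipZl ?addrK//; exact: L2fieldZ.
apply: le_trans (ip_CS Lh Lv') _; rewrite mulrA ler_wpM2r ?nrm_ge0//.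
have KuL : L2field (fun x => K *: onD u x) by exact: L2fieldZ.
have -> : K * nrm (onD u) = nrm (fun x => K *: onD u x) by rewrite nrmZ// ger0_norm.
rewrite ler_sqrt ?ipvv_ge0//; apply: le_Rintegral => //; [exact: L2field_dotv|exact: L2field_dotv|].
move=> x _; rewrite [leLHS]dotvZl [leLHS]mulrC dotvZr -mulrA [leRHS]dotvZl [leRHS]mulrC dotvZr -mulrA.
rewrite [leLHS]mulrA [leRHS]mulrA [leLHS]mulrAC [leRHS]mulrAC ler_wpM2r ?dotvv_ge0//.
by rewrite -!expr2 -(real_normK (num_real (h x - h0))) lerXn2r// nnegrE.
Qed.

Let EV u : L2field u -> `|ip (fun x => beta x *: u x) V - beta0 * ip u V| <= K * (nrm (onD u) * nrm (onD V)).
Proof. by move=> Lu; apply: contrast => // x /offD[]. Qed.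

Let EVh u : L2field u -> `|ip (fun x => m x *: u x) Vh - m0 * ip u Vh| <= K * (nrm (onD u) * nrm (onD Vh)).
Proof. by move=> Lu; apply: contrast => // x /offD[]. Qed.

(** The energy of the difference equals the two contrast terms plus the errors paired with the
    difference itself (identity [E]). Coercivity with constant b then gives a quadratic inequality
    in the two norms. *)
Lemma energy_bound : b * (nrm Rr + nrm S) <=
  2 * (K * (nrm (onD V) + nrm (onD Vh)) + nrm gE + nrm gH).
Proof.
have e1 : ip (fun x => beta x *: Rr x) Rr = ip (fun x => beta x *: We x) We
    - ip (fun x => beta x *: We x) V - ip (fun x => beta x *: Rr x) V.
  have -> : (fun x => beta x *: Rr x) = (fun x => beta x *: We x - beta x *: V x).
    by apply/funext => x; rewrite scalerBr.
  have a1 := Lbeta LWe; have a2 := Lbeta LV.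
  rewrite ipBl// !ipBr// ipBl//.
  have -> : ip (fun x => beta x *: V x) We = ip (fun x => beta x *: We x) V.
    by rewrite ip_mul_move ipC.
  by ring.
have e2 : ip (fun x => m x *: S x) S = ip (fun x => m x *: Wh x) Wh
    - ip (fun x => m x *: Wh x) Vh - ip (fun x => m x *: S x) Vh.
  have -> : (fun x => m x *: S x) = (fun x => m x *: Wh x - m x *: Vh x).
    by apply/funext => x; rewrite scalerBr.
  have a1 := Lm LWh; have a2 := Lm LVh.
  rewrite ipBl// !ipBr// ipBl//.
  have -> : ip (fun x => m x *: Vh x) Wh = ip (fun x => m x *: Wh x) Vh.
    by rewrite ip_mul_move ipC.
  by ring.
have f1 := EV LR; have f2 := EVh LS.
have q1 : ip Rr V = ip We V - ip V V by exact: ipBl.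
have q2 : ip S Vh = ip Wh Vh - ip Vh Vh by exact: ipBl.
have E : ip (fun x => beta x *: Rr x) Rr + ip (fun x => m x *: S x) S =
   - (ip (fun x => beta x *: Rr x) V - beta0 * ip Rr V) - (ip (fun x => m x *: S x) Vh - m0 * ip S Vh)
   - ip gE Rr - ip gH S.
  rewrite e1 e2 gER gHS q1 q2.
  by have h4 := G4; rewrite (ipC V We) in h4; exact: (energy_arith _ _ h4 G3 G2 G1).
have lb1 : b * nrm Rr ^+ 2 <= ip (fun x => beta x *: Rr x) Rr.
  rewrite nrm_sqr -ipZl//; apply: le_Rintegral => //.
  - by apply: L2field_dotv => //; exact: L2fieldZ.
  - by apply: L2field_dotv => //; exact: Lbeta.
  - by move=> x _; rewrite !dotvZl ler_wpM2r ?dotvv_ge0//; have /andP[] := bbeta x.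
have lb2 : b * nrm S ^+ 2 <= ip (fun x => m x *: S x) S.
  rewrite nrm_sqr -ipZl//; apply: le_Rintegral => //.
  - by apply: L2field_dotv => //; exact: L2fieldZ.
  - by apply: L2field_dotv => //; exact: Lm.
  - by move=> x _; rewrite !dotvZl ler_wpM2r ?dotvv_ge0//; have /andP[] := bm x.
have h3 := ip_CS LgE LR; have h4 := ip_CS LgH LS.
have r0 := nrm_ge0 Rr; have s0 := nrm_ge0 S.
have dR := nrm_onD LR; have dS := nrm_onD LS.
have v0 := nrm_ge0 (onD V); have vh0 := nrm_ge0 (onD Vh); have g0 := nrm_ge0 gE; have gh0 := nrm_ge0 gH.
have f1' : K * (nrm (onD Rr) * nrm (onD V)) <= K * (nrm Rr * nrm (onD V)) by exact: (ler_wpM2l K0 (ler_wpM2r v0 dR)).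
have f2' : K * (nrm (onD S) * nrm (onD Vh)) <= K * (nrm S * nrm (onD Vh)) by exact: (ler_wpM2l K0 (ler_wpM2r vh0 dS)).
have tot := sum_le_of_norms E (le_trans f1 f1') (le_trans f2 f2') h3 h4 lb1 lb2.
exact: (quadratic_bound b0 K0 r0 s0 v0 vh0 g0 gh0 tot).
Qed.

(** Subtracting [G3] from [G4] leaves only contrast terms and errors. In these the norm of the total
    field on D is bounded through that of the incident field and of the difference. *)
Lemma indicator_upper : `|ip F We - ip F V| <=
  K * (nrm (onD V) * (nrm Rr + nrm (onD V)) + nrm (onD Vh) * (nrm S + nrm (onD Vh)))
  + nrm gH * nrm Vh + nrm gE * nrm V.
Proof.
have E : ip F We - ip F V = - (ip (fun x => beta x *: We x) V - beta0 * ip We V)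
   + (ip (fun x => m x *: Wh x) Vh - m0 * ip Wh Vh) + ip gH Vh - ip gE V.
  by have := G3; have := G4; rewrite (ipC V We); lra_ip.
have f1 := EV LWe; have f2 := EVh LWh.
have h1 := ip_CS LgH LVh; have h2 := ip_CS LgE LV.
have tri u v : L2field u -> L2field v -> nrm (onD u) <= nrm (fun x => u x - v x) + nrm (onD v).
  move=> Lu Lv; have Luv := L2fieldB Lu Lv.
  have -> : onD u = (fun x => onD (fun x => u x - v x) x + onD v x).
    by apply/funext => x; rewrite /onD -scalerDr subrK.
  apply: le_trans (nrmD (L2field_onD Luv) (L2field_onD Lv)) _.
  by rewrite lerD2r nrm_onD.
have t1 := tri _ _ LWe LV; have t2 := tri _ _ LWh LVh.
have v0 := nrm_ge0 (onD V); have vh0 := nrm_ge0 (onD Vh).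
have k1 : K * (nrm (onD We) * nrm (onD V)) <= K * (nrm (onD V) * (nrm Rr + nrm (onD V))).
  by rewrite [nrm (onD We) * _]mulrC; exact: (ler_wpM2l K0 (ler_wpM2l v0 t1)).
have k2 : K * (nrm (onD Wh) * nrm (onD Vh)) <= K * (nrm (onD Vh) * (nrm S + nrm (onD Vh))).
  by rewrite [nrm (onD Wh) * _]mulrC; exact: (ler_wpM2l K0 (ler_wpM2l vh0 t2)).
rewrite E mulrDr; apply: le_trans (ler_normB _ _) _; apply: lerD h2.
apply: le_trans (ler_normD _ _) _; apply: lerD h1.
apply: le_trans (ler_normD _ _) _; rewrite normrN.
exact: lerD (le_trans f1 k1) (le_trans f2 k2).
Qed.

End hilbert.

(** * Volume estimates near the nearest points *)

Section cubes.
Context {R : realType}.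
Notation rV3 := 'rV[R]_3.
Notation leb3 := (@leb3 R).

Definition ccube (c : rV3) (h : R) : set rV3 := box (fun i => `[c 0 i - h, c 0 i + h]%classic).

Lemma measurable_ccube c h : measurable (ccube c h).
Proof. by apply: measurable_box => i; exact: measurable_itv. Qed.

Lemma leb3_ccube c h : 0 <= h -> leb3 (ccube c h) = ((2 * h) ^+ 3)%:E.
Proof.
move=> h0; rewrite leb3_box; last by move=> i; exact: measurable_itv.
have e i : lebesgue_measure `[c 0 i - h, c 0 i + h]%classic = (2 * h)%:E.
  rewrite lebesgue_measure_itv /= lte_fin.
  have -> : c 0 i - h < c 0 i + h = (0 < h) by apply/idP/idP => ?; lra.
  case: ifPn => [_|]; first by rewrite -EFinB; congr EFin; ring.
  rewrite -leNgt => h1; have -> : h = 0 by apply/le_anti; rewrite h0 h1.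
  by rewrite mulr0.
by rewrite !e -!EFinM !exprS expr0 mulr1 mulrA.
Qed.

Lemma ccubeP (x c : rV3) h : enorm (x - c) <= h -> ccube c h x.
Proof.
move=> xh i; have := le_trans (coord_le_enorm (x - c) i) xh; rewrite !mxE.
by rewrite /= in_itv/= ler_norml => /andP[? ?]; apply/andP; split; lra.
Qed.

Lemma intg_indic (A : set rV3) : measurable A -> (leb3 A < +oo)%E ->
  leb3.-integrable setT (EFin \o (fun x => \1_A x : R)) /\ \int[leb3]_x (\1_A x : R) = fine (leb3 A).
Proof.
move=> mA fA; have e : (\int[leb3]_x (\1_A x)%:E = leb3 A)%E by rewrite integral_indic ?setIT.
split; last by rewrite /Rintegral e.
apply/integrableP; split; first by apply/measurable_EFinP; exact: measurable_indic.
by under eq_integral do rewrite gee0_abs ?lee_fin//; rewrite e.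
Qed.

Lemma intg_ccube c h : 0 <= h -> leb3.-integrable setT (EFin \o (fun x => \1_(ccube c h) x : R)) /\
  \int[leb3]_x (\1_(ccube c h) x : R) = (2 * h) ^+ 3.
Proof.
move=> h0; have [] := intg_indic (measurable_ccube c h) _; first by rewrite leb3_ccube// ltry.
by rewrite leb3_ccube.
Qed.

(** A geometric series of ratio e^{-2} <= 1/2, since e^2 >= 1 + 2; the induction carries the sharper
    bound 2 - 2^{1-J}. *)
Lemma sum_expR_le2 J : \sum_(j < J) expR (- (2 * j%:R)) <= 2 :> R.
Proof.
have e2 : expR (- 2) <= 2^-1 :> R.
  rewrite expRN lef_pV2 ?posrE ?expR_gt0//; have := @expR_ge1Dx R 2; lra.
suff : \sum_(j < J) expR (- (2 * j%:R)) <= 2 - 2 * 2^-1 ^+ J :> R.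
  have : 0 <= 2^-1 ^+ J :> R by rewrite exprn_ge0.
  lra.
elim: J => [|J ih]; first by rewrite big_ord0 expr0; lra.
rewrite big_ord_recr/=; apply: le_trans (lerD ih _) _; first exact: lexx.
have : expR (- (2 * J%:R)) <= 2^-1 ^+ J :> R.
  by rewrite -mulNr expRM_natr lerXn2r// nnegrE ?expR_ge0.
rewrite exprS; lra.
Qed.

End cubes.

(** * Upper bound for the contribution of the degenerate directions *)

Section cone.
Context {R : realType}.
Notation rV3 := 'rV[R]_3.
Notation leb3 := (@leb3 R).
Variables (D : set rV3) (p a : rV3) (d Rm : R).
Hypotheses (mD : measurable D) (d0 : 0 < d) (dD : forall x, D x -> d <= rad p x)
  (DR : forall x, D x -> rad p x <= Rm) (a1 : enorm a = 1).

(** Outside the ball, |V|^2 and |Vh|^2 both contain this factor. *)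
Definition Phi2 k x : R := ub (- k) (rad p x) ^+ 2.

Lemma Phi2E k x : Phi2 k x = expR (- (2 * k * rad p x)) * (rad p x)^-1 ^+ 2.
Proof.
rewrite /Phi2 /ub exprMn expr2 -expRD; congr (expR _ * _); ring.
Qed.

Lemma Phi2_ge0 k x : 0 <= Phi2 k x. Proof. exact: sqr_ge0. Qed.

Lemma measurable_Phi2 k : measurable_fun setT (Phi2 k).
Proof.
apply: measurable_funX; apply: measurable_funM.
  apply: (measurableT_comp (continuous_measurable_fun (@continuous_expR R))).
  by apply: measurable_funM => //; exact: measurable_rad.
by apply: (measurableT_comp (@measurable_inv R)); exact: measurable_rad.
Qed.

Lemma Phi2_le k x b : 0 <= k -> 0 < b -> b <= rad p x -> Phi2 k x <= b^-1 ^+ 2 * expR (- (2 * k * b)).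
Proof.
move=> k0 b0 br; have r0 := lt_le_trans b0 br.
rewrite Phi2E mulrC; apply: ler_pM; rewrite ?expR_ge0 ?exprn_ge0 ?invr_ge0 ?(ltW r0)//.
  by rewrite lerXn2r// ?nnegrE ?invr_ge0 ?(ltW r0) ?(ltW b0)// lef_pV2.
by rewrite ler_expR lerN2 ler_wpM2l// mulr_ge0.
Qed.

Lemma leb3_D_lty (A : set rV3) : measurable A -> A `<=` D -> (leb3 A < +oo)%E.
Proof.
move=> mA AD; apply: (@le_lt_trans _ _ (leb3 (ccube p `|Rm|))).
  apply: le_measure; rewrite ?inE//; first exact: measurable_ccube.
  move=> x /AD /DR h; apply: ccubeP; exact: le_trans h (ler_norm _).
by rewrite leb3_ccube// ltry.
Qed.

Lemma intg_on_D (A : set rV3) (f : rV3 -> R) C : measurable A -> A `<=` D -> measurable_fun setT f ->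
  (forall x, A x -> `|f x| <= C) -> leb3.-integrable setT (EFin \o (fun x => \1_A x * f x)).
Proof.
move=> mA AD mf fC.
have [i1 _] := intg_indic mA (leb3_D_lty mA AD).
apply: (@intg_le _ _ _ leb3 (fun x => C * \1_A x)).
- by apply: measurable_funM => //; exact: measurable_indic.
- exact: intgZ.
- move=> x; rewrite indicE; have [xA|xA] := boolP (x \in A); last by rewrite mul0r normr0 mulr0.
  by rewrite mul1r mulr1; apply: fC; rewrite inE in xA.
Qed.

Lemma intg_Phi2 k (A : set rV3) : 0 <= k -> measurable A -> A `<=` D ->
  leb3.-integrable setT (EFin \o (fun x => \1_A x * Phi2 k x)).
Proof.
move=> k0 mA AD; apply: (@intg_on_D _ _ (d^-1 ^+ 2 * expR (- (2 * k * d)))) => //; first exact: measurable_Phi2.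
by move=> x /AD/dD dx; rewrite ger0_norm ?Phi2_ge0//; exact: Phi2_le.
Qed.

(* The directions from p, within an angle of order c/k of the line spanned by a, where the leading part of the
   integrand degenerates. *)
Definition cone (c k : R) : set rV3 :=
  [set x | rad p x ^+ 2 - dotv a (x - p) ^+ 2 < (c / k * rad p x) ^+ 2].

Lemma measurable_cone c k : measurable (cone c k).
Proof.
have m1 : measurable_fun setT (fun x : rV3 => rad p x ^+ 2 - dotv a (x - p) ^+ 2).
  apply: measurable_funB; first by apply: measurable_funX; exact: measurable_rad.
  apply: measurable_funX; under eq_fun do rewrite dotvE sum3E !mxE.
  have m i : measurable_fun setT (fun x : rV3 => a 0 i * (x 0 i - p 0 i)).
    by apply: measurable_funM => //; apply: measurable_funB => //; exact: measurable_coord.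
  by apply: measurable_funD => //; apply: measurable_funD.
have m2 : measurable_fun setT (fun x : rV3 => (c / k * rad p x) ^+ 2).
  by apply: measurable_funX; apply: measurable_funM => //; exact: measurable_rad.
have := measurable_fun_ltr m1 m2 => /(_ measurableT [set true]); rewrite setTI.
by apply.
Qed.

Lemma cone_in_cubes c k j (x : rV3) : 0 <= c -> 1 <= k -> D x -> cone c k x ->
  j%:R <= k * (rad p x - d) < j.+1%:R ->
  let h := (Rm * c + (c * Rm) ^+ 2 / d + 1) / k in
  ccube (p + (d + j%:R / k) *: a) h x \/ ccube (p - (d + j%:R / k) *: a) h x.
Proof.
move=> c0 k1 Dx cx /andP[jl ju] h; set r := rad p x in cx jl ju.
have k0 : 0 < k by rewrite (lt_le_trans ltr01).
have dr : d <= r by exact: dD. have rR : r <= Rm by exact: DR.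
have r0 : 0 < r by rewrite (lt_le_trans d0).
set s := dotv a (x - p) in cx.
have aa : dotv a a = 1 by rewrite -enorm_sqr a1 expr1n.
have sr : `|s| <= r by have := dotv_le_enorm a (x - p); rewrite a1 mul1r.
have v0 : 0 <= k^-1 by rewrite invr_ge0 ltW.
have ck0 : 0 <= c / k by rewrite mulr_ge0.
have q1 : enorm (x - p - s *: a) <= Rm * c / k.
  have e : enorm (x - p - s *: a) ^+ 2 = r ^+ 2 - s ^+ 2.
    have e' (u : rV3) : dotv (u - s *: a) (u - s *: a) = dotv u u - 2 * s * dotv a u + s ^+ 2.
      by rewrite dotvBl !dotvBr !dotvZl !dotvZr aa (dotvC u a); ring.
    by rewrite enorm_sqr e' -/s /r /rad enorm_sqr; ring.
  have h2 : enorm (x - p - s *: a) ^+ 2 <= (c / k * r) ^+ 2 by rewrite e ltW.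
  have h3 : enorm (x - p - s *: a) <= c / k * r.
    by move: h2; rewrite ler_pXn2r ?nnegrE ?enorm_ge0 ?mulr_ge0 ?(ltW r0).
  by apply: le_trans h3 _; rewrite mulrC -(mulrA Rm); exact: (ler_wpM2r ck0 rR).
(* The defect is quadratic: (r - |s|)(r + |s|) < (c r / k)^2 with r + |s| >= d, and 1/k^2 <= 1/k
   because k >= 1. *)
have q2 : r - `|s| <= (c * Rm) ^+ 2 / d / k.
  have e : (r - `|s|) * (r + `|s|) <= (c / k * r) ^+ 2.
    rewrite (_ : (r - `|s|) * (r + `|s|) = r ^+ 2 - `|s| ^+ 2); last by ring.
    by rewrite real_normK ?num_real// ltW.
  have e2 : (c / k * r) ^+ 2 <= (c * Rm) ^+ 2 / k.
    rewrite mulrAC exprMn ler_pM ?sqr_ge0//.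
      have crR := ler_wpM2l c0 rR; have cr0 := mulr_ge0 c0 (ltW r0).
      by apply: lerXn2r; rewrite ?nnegrE// (le_trans cr0 crR).
    by rewrite expr2 ler_piMl// invf_le1.
  have e3 : (r - `|s|) * d <= (r - `|s|) * (r + `|s|).
    by rewrite ler_wpM2l ?subr_ge0// (le_trans dr)// lerDl.
  by rewrite mulrAC ler_pdivlMr// (le_trans e3)// (le_trans e).
have q3 : `|r - (d + j%:R / k)| <= 1 / k.
  have -> : r - (d + j%:R / k) = (k * (r - d) - j%:R) / k by field; rewrite gt_eqF.
  rewrite normrM (ger0_norm v0) ler_wpM2r// ger0_norm ?subr_ge0// lerBlDl.
  by rewrite -natr1 addrC in ju; rewrite addrC ltW// addrC.
have hE : h = Rm * c / k + (c * Rm) ^+ 2 / d / k + 1 / k by rewrite /h; ring.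
have tri (u : R) : enorm (x - (p + u *: a)) <= Rm * c / k + `|s - u|.
  have -> : x - (p + u *: a) = (x - p - s *: a) + (s - u) *: a.
    by rewrite scalerBl opprD !addrA subrK.
  by apply: le_trans (enormD _ _) _; rewrite enormZ a1 mulr1 lerD2r.
have [s0|s0] := leP 0 s; [left|right]; apply: ccubeP.
- apply: le_trans (tri _) _; rewrite hE -addrA lerD2l.
  rewrite (ger0_norm s0) in q2.
  have -> : s - (d + j%:R / k) = (r - (d + j%:R / k)) - (r - s) by ring.
  apply: le_trans (ler_normB _ _) _; rewrite addrC lerD// ger0_norm// subr_ge0.
  by rewrite (le_trans (ler_norm s)).
- rewrite -scaleNr; apply: le_trans (tri _) _; rewrite hE -addrA lerD2l.
  rewrite (ltr0_norm s0) opprK in q2.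
  have -> : s - - (d + j%:R / k) = - (r - (d + j%:R / k)) + (r + s) by ring.
  apply: le_trans (ler_normD _ _) _; rewrite normrN addrC lerD// ger0_norm//.
  by move: sr; rewrite ltr0_norm//; lra.
Qed.

(** Shell number j is covered by two cubes of volume (2H/k)^3 and carries the weight d^{-2} e^{-2kd}
    e^{-2j}; the sum over j is at most 2 whatever k is. *)
Lemma cone_upper c : 0 <= c -> exists2 C, 0 <= C & forall k, 1 <= k ->
  \int[leb3]_x (\1_(D `&` cone c k) x * Phi2 k x) <= C * k^-1 ^+ 3 * expR (- (2 * k * d)).
Proof.
move=> c0; pose H := `|Rm| * c + (c * Rm) ^+ 2 / d + 1.
have H0 : 0 <= H.
  by apply: addr_ge0 => //; apply: addr_ge0; [exact: mulr_ge0|apply: mulr_ge0; [exact: sqr_ge0|rewrite invr_ge0 ltW]].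
exists (d^-1 ^+ 2 * (2 * (2 * H) ^+ 3) * 2).
  by rewrite !mulr_ge0 ?exprn_ge0 ?mulr_ge0 ?invr_ge0 ?(ltW d0).
move=> k k1; have k0 : 0 < k by rewrite (lt_le_trans ltr01).
have v0 : 0 <= k^-1 by rewrite invr_ge0 ltW.
pose h := H / k; have h0 : 0 <= h by rewrite mulr_ge0.
pose cp (j : nat) := ccube (p + (d + j%:R / k) *: a) h.
pose cm (j : nat) := ccube (p - (d + j%:R / k) *: a) h.
(* Enough shells to cover D, since k (r - d) <= k |Rm|. *)
pose J := (Num.trunc (k * `|Rm|)).+1.
pose w (j : nat) : R := d^-1 ^+ 2 * expR (- (2 * k * d)) * expR (- (2 * j%:R)).
have w0 j : 0 <= w j by exact: (mulr_ge0 (mulr_ge0 (sqr_ge0 _) (expR_ge0 _)) (expR_ge0 _)).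
pose F x := \sum_(j < J) w j * (\1_(cp j) x + \1_(cm j) x) : R.
have Icp j := intg_ccube (p + (d + j%:R / k) *: a) h0.
have Icm j := intg_ccube (p - (d + j%:R / k) *: a) h0.
have IFj (j : 'I_J) : leb3.-integrable setT (EFin \o (fun x => w j * (\1_(cp j) x + \1_(cm j) x))).
  by apply: intgZ; apply: intgD; [exact: (Icp j).1|exact: (Icm j).1].
apply: (@le_trans _ _ (\int[leb3]_x F x)).
  apply: le_Rintegral => //.
  - apply: intg_Phi2; [exact: ltW| |by move=> x []].
    by apply: measurableI => //; exact: measurable_cone.
  - exact: intg_sum.
  - move=> x _; have F0 : 0 <= F x.
      by apply: sumr_ge0 => j _; rewrite mulr_ge0// addr_ge0// indicE.
    rewrite indicE; have [|] := boolP (x \in _); last by rewrite mul0r.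
    rewrite inE mul1r => -[Dx cx].
    have dr := dD Dx; have rR := DR Dx.
    pose j := Num.trunc (k * (rad p x - d)).
    have y0 : 0 <= k * (rad p x - d) by rewrite mulr_ge0 ?subr_ge0 ?(ltW k0).
    have jP : j%:R <= k * (rad p x - d) < j.+1%:R by exact: truncn_itv.
    have jJ : (j < J)%N.
      rewrite ltnS; apply: le_truncn; rewrite ler_wpM2l ?(ltW k0)//.
      by rewrite (le_trans _ (ler_norm Rm))//; move: dr d0 rR; lra.
    have r0 := lt_le_trans d0 dr.
    have Pw : Phi2 k x <= w j.
      rewrite Phi2E; have -> : w j = expR (- (2 * k * d) - 2 * j%:R) * d^-1 ^+ 2.
        by rewrite expRD /w -mulrA mulrC.
      apply: ler_pM; [exact: expR_ge0|exact: sqr_ge0| |].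
        by rewrite ler_expR; have /andP[jl _] := jP; lra.
      by apply: lerXn2r; rewrite ?nnegrE ?invr_ge0 ?(ltW r0) ?(ltW d0)// lef_pV2.
    have [|] := cone_in_cubes c0 k1 Dx cx jP.
    + move=> xc; have {}xc : cp j x.
        by move=> i; have := xc i; rewrite /h /H (ger0_norm (le_trans (le_trans (ltW d0) dr) rR)).
      rewrite /F (bigD1 (Ordinal jJ))//=; apply: (@le_trans _ _ (w j * (\1_(cp j) x + \1_(cm j) x))); last first.
        by rewrite lerDl; apply: sumr_ge0 => i _; rewrite mulr_ge0// addr_ge0// indicE.
      apply: (@le_trans _ _ (w j)); last by rewrite ler_peMr// !indicE mem_set//= lerDl.
      exact: Pw.
    + move=> xc; have {}xc : cm j x.
        by move=> i; have := xc i; rewrite /h /H (ger0_norm (le_trans (le_trans (ltW d0) dr) rR)).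
      rewrite /F (bigD1 (Ordinal jJ))//=; apply: (@le_trans _ _ (w j * (\1_(cp j) x + \1_(cm j) x))); last first.
        by rewrite lerDl; apply: sumr_ge0 => i _; rewrite mulr_ge0// addr_ge0// indicE.
      apply: (@le_trans _ _ (w j)); last by rewrite ler_peMr// !indicE [in X in _ + X]mem_set//= lerDr.
      exact: Pw.
rewrite /F Rintegral_sum//.
have E (j : 'I_J) : \int[leb3]_x (w j * (\1_(cp j) x + \1_(cm j) x)) = w j * (2 * (2 * h) ^+ 3).
  rewrite RintegralZl//; last by apply: intgD; [exact: (Icp j).1|exact: (Icm j).1].
  rewrite RintegralD//; [|exact: (Icp j).1|exact: (Icm j).1].
  by rewrite (Icp j).2 (Icm j).2; ring.
rewrite (eq_bigr _ (fun j _ => E j)) -mulr_suml /w -mulr_sumr.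
have -> : (2 * h) ^+ 3 = (2 * H) ^+ 3 * k^-1 ^+ 3 by rewrite /h mulrA exprMn.
have := @sum_expR_le2 R J; set S := \sum_(j < J) _ => S2.
rewrite (_ : d^-1 ^+ 2 * expR (- (2 * k * d)) * S * (2 * ((2 * H) ^+ 3 * k^-1 ^+ 3)) =
  d^-1 ^+ 2 * (2 * (2 * H) ^+ 3) * k^-1 ^+ 3 * expR (- (2 * k * d)) * S); last by ring.
rewrite (_ : d^-1 ^+ 2 * (2 * (2 * H) ^+ 3) * 2 * k^-1 ^+ 3 * expR (- (2 * k * d)) =
  d^-1 ^+ 2 * (2 * (2 * H) ^+ 3) * k^-1 ^+ 3 * expR (- (2 * k * d)) * 2); last by ring.
apply: ler_wpM2l S2.
have d2 : 0 <= d^-1 ^+ 2 by exact: sqr_ge0.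
have h3 : 0 <= (2 * H) ^+ 3 by rewrite exprn_ge0// mulr_ge0.
have k3 : 0 <= k^-1 ^+ 3 by rewrite exprn_ge0.
exact: (mulr_ge0 (mulr_ge0 (mulr_ge0 d2 (mulr_ge0 (ler0n _ 2) h3)) k3) (expR_ge0 _)).
Qed.

End cone.

(** * First-order expansion at a boundary point *)

Section first_order.
Context {R : realType}.

(** The intermediate point is parametrised by a fraction s of t, so that t may have either sign. *)
Lemma MVT_dir n (g : 'rV[R]_n -> R) y v t : (forall z, derivable g z v) ->
  exists2 s, 0 < s < 1 & g (y + t *: v) - g y = t * 'D_v g (y + (s * t) *: v).
Proof.
move=> dg; pose G (u : R) := g (y + u *: v).
have dG (u : R) : is_derive u 1 G ('D_v g (y + u *: v)).
  have E : (fun h : R => h^-1 *: ((g \o shift (y + u *: v)) (h *: v) - g (y + u *: v))) =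
      (fun h : R => h^-1 *: ((G \o shift u) (h *: 1) - G u)).
    apply/funext => h /=; rewrite /G addrCA -scalerDl; congr (_ *: (g (_ + _ *: _) - _)).
    by rewrite /GRing.scale/= mulr1.
  by apply: DeriveDef; [have := dg (y + u *: v); rewrite /derivable E|rewrite /derive E].
pose F (s : R) := G (t * s + 0).
have dF (s : R) : is_derive s 1 F (t * 'D_v g (y + (s * t) *: v)).
  have h := @is_derive1_comp _ G (fun s => t * s + 0) s _ _ (dG (t * s + 0)) (is_derive_affine t 0 s).
  by apply: (is_derive_conv h); rewrite addr0 mulrC (mulrC t s).
have [|s sI e] := @MVT _ F (fun s => t * 'D_v g (y + (s * t) *: v)) 0 1 ltr01 (fun s _ => dF s).
  apply: continuous_subspaceT => s.
  by apply/differentiable_continuous/derivable1_diffP; have [] := dF s.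
exists s; first by move: sI; rewrite in_itv.
by move: e; rewrite /F /G !addr0 mulr0 mulr1 scale0r addr0 subr0 mulr1.
Qed.

Lemma Ck1_first_order (g : 'rV[R]_2 -> R) y e : Ck 1 g -> 0 < e -> exists2 del, 0 < del &
  forall h : 'rV[R]_2, `|h 0 0| < del -> `|h 0 1| < del ->
  `|g (y + h) - g y - (partial 0 g y * h 0 0 + partial 1 g y * h 0 1)| <= e * (`|h 0 0| + `|h 0 1|).
Proof.
move=> [_ Cg] e0; have [d0 c0] := Cg 0; have [d1 c1] := Cg 1.
have := c0 y => /cvgrPdist_lt/(_ _ e0); have := c1 y => /cvgrPdist_lt/(_ _ e0).
move=> /nbhs_normP[r1 r10 h1] /nbhs_normP[r0 r00 h0].
pose c := `|delta_mx 0 0 : 'rV[R]_2| + `|delta_mx 0 1 : 'rV[R]_2| + 1.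
have cp : 0 < c by rewrite ltr_wpDl// addr_ge0.
have m0 : 0 < Num.min r1 r0 by rewrite lt_min; apply/andP.
exists (Num.min r1 r0 / c); first by rewrite divr_gt0.
move=> h; set del := _ / c => hh0 hh1.
have hE : h = h 0 0 *: delta_mx 0 0 + h 0 1 *: delta_mx 0 1.
  apply/rowP => i; rewrite !mxE; case: i => -[|[|//]] i /=; rewrite ?mulr1 ?mulr0 ?addr0 ?add0r;
    congr (h _ _); exact: val_inj.
have [s0 /andP[s00 s01] E0] := MVT_dir y (h 0 0) d0.
have [s1 /andP[s10 s11] E1] := MVT_dir (y + h 0 0 *: delta_mx 0 0) (h 0 1) d1.
have small s t : `|s| <= 1 -> `|t| <= 1 ->
    `|y - (y + (s * h 0 0) *: delta_mx 0 0 + (t * h 0 1) *: delta_mx 0 1)| < Num.min r1 r0.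
  move=> s1' t1'; rewrite -addrA opprD addNKr opprD.
  apply: le_lt_trans (ler_normB _ _) _; rewrite normrN !normrZ.
  have a0 : `|s * h 0 0| <= del by rewrite normrM (le_trans _ (ltW hh0))// ler_piMl.
  have a1 : `|t * h 0 1| <= del by rewrite normrM (le_trans _ (ltW hh1))// ler_piMl.
  apply: (@le_lt_trans _ _ (del * (`|delta_mx 0 0 : 'rV[R]_2| + `|delta_mx 0 1 : 'rV[R]_2|))).
    by rewrite mulrDr; apply: lerD; apply: ler_wpM2r => //; rewrite -normrM.
  rewrite (_ : _ + _ = c - 1); last by rewrite /c addrK.
  rewrite /del mulrAC -mulrA gtr_pMr// ltr_pdivrMr// mul1r ltrBlDr ltrDl//.
have n01 : `|s0| <= 1 by rewrite ger0_norm ?(ltW s00)// ltW.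
have n11 : `|s1| <= 1 by rewrite ger0_norm ?(ltW s10)// ltW.
have z0 : `|0 : R| <= 1 by rewrite normr0.
have o1 : `|1 : R| <= 1 by rewrite normr1.
have b0 : `|partial 0 g y - 'D_(delta_mx 0 0) g (y + (s0 * h 0 0) *: delta_mx 0 0)| < e.
  apply: h0 => /=; have := small s0 0 n01 z0; rewrite mul0r scale0r addr0 lt_min => /andP[_ ?] //.
have b1 : `|partial 1 g y - 'D_(delta_mx 0 1) g (y + h 0 0 *: delta_mx 0 0 + (s1 * h 0 1) *: delta_mx 0 1)| < e.
  apply: h1 => /=; have := small 1 s1 o1 n11; rewrite mul1r lt_min => /andP[? _] //.
have E : g (y + h) - g y = h 0 0 * 'D_(delta_mx 0 0) g (y + (s0 * h 0 0) *: delta_mx 0 0) +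
    h 0 1 * 'D_(delta_mx 0 1) g (y + h 0 0 *: delta_mx 0 0 + (s1 * h 0 1) *: delta_mx 0 1).
  by rewrite -E0 -E1 {1}hE addrA; move: (g _) (g _) (g _) => u v w; ring.
rewrite E; move: b0 b1; set D0 := 'D_(delta_mx 0 0) g _; set D1 := 'D_(delta_mx 0 1) g _; move: D0 D1 (partial 0 g y) (partial 1 g y) => {E} D0 D1 p0 p1 b0 b1.
rewrite (_ : _ - _ = - (h 0 0 * (p0 - D0)) - h 0 1 * (p1 - D1)); last by ring.
apply: le_trans (ler_normB _ _) _; rewrite normrN !normrM mulrDr lerD// mulrC ler_wpM2r//; exact: ltW.
Qed.

End first_order.

Section blowup.
Context {R : realType}.
Notation rV3 := 'rV[R]_3.
Implicit Types D : set rV3.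

Lemma dotv_mulmx n (u v : 'rV[R]_n) (Q : 'M[R]_n) : dotv u (v *m Q) = dotv (u *m Q^T) v.
Proof. by rewrite /dotv trmx_mul mulmxA. Qed.

Lemma enorm_mulmx n (u : 'rV[R]_n) (Q : 'M[R]_n) : Q *m Q^T = 1%:M -> enorm (u *m Q) = enorm u.
Proof. by move=> QQ; rewrite /enorm dotv_mulmx -mulmxA QQ mulmx1. Qed.

(** Neighbourhoods are those of the max norm; a max-norm ball of radius r/2 fits because 3 (r/2)^2 <
    r^2. *)
Lemma eball_nbhs (q : rV3) r : 0 < r -> nbhs q (eball q r).
Proof.
move=> r0; apply/(@nbhs_normP R rV3 q); exists (r / 2); first by rewrite /= divr_gt0.
move=> x /= xq; rewrite /eball/=.
have h i : `|(x - q) 0 i| < r / 2.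
  apply: le_lt_trans xq; rewrite distrC [leRHS]/Num.Def.normr /= mx_normrE.
  by apply/bigmax_geP; right => /=; exists (0, i).
have r2 : (enorm (x - q)) ^+ 2 < r ^+ 2.
  rewrite enorm_sqr dotvE sum3E -!expr2 -!(real_normK (num_real ((x - q) 0 _))).
  have q2 i : `|(x - q) 0 i| ^+ 2 <= (r / 2) ^+ 2.
    by apply: lerXn2r; rewrite ?nnegrE ?(ltW (h i))// ltW// divr_gt0.
  apply: (@le_lt_trans _ _ ((r / 2) ^+ 2 + (r / 2) ^+ 2 + (r / 2) ^+ 2)); first by rewrite !lerD.
  have -> : (r / 2) ^+ 2 = r ^+ 2 / 4 by field.
  by have : 0 < r ^+ 2; [rewrite exprn_gt0|lra].
by rewrite -(ltr_pXn2r (n := 2))// ?nnegrE ?enorm_ge0// ltW.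
Qed.

(* First-order blow-up: D contains a cone-shaped neighbourhood of each direction that
   points strictly into the tangent half-space. *)
Lemma boundary_blowup D q : C2_boundary D -> bdry D q -> exists n xi : rV3,
  [/\ dotv n xi = -1, enorm xi = 1 & forall e, 0 < e -> exists2 del, 0 < del &
    forall h, enorm h < del -> dotv n h < - (e * enorm h) -> D (q + h)].
Proof.
move=> C2 bq; have [rho [r0 [Q [g [Dr0 QQ Cg rhoE Dr]]]]] := C2 q bq.
pose lft (x : rV3) : 'rV[R]_2 := lsubmx (x *m Q : 'rV[R]_(2 + 1)).
pose rgt (x : rV3) : R := rsubmx (x *m Q : 'rV[R]_(2 + 1)) 0 0.
have rhoE' x : rho x = rgt x - g (lft x) by rewrite rhoE.
(* In the rotated coordinates [v] is the gradient of the defining function at q. Rotated back it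
   becomes [n], and xi is the downward vertical direction, along which the defining function has
   slope -1. *)
pose p0 := partial 0 g (lft q); pose p1 := partial 1 g (lft q).
pose v : rV3 := \row_(i < 3) [:: - p0; - p1; 1]`_i.
pose e3 : rV3 := \row_(i < 3) [:: 0; 0; 1]`_i.
have lft0 x : lft x 0 0 = (x *m Q) 0 0 by rewrite mxE; congr (fun_of_matrix _ _ _); exact: val_inj.
have lft1 x : lft x 0 1 = (x *m Q) 0 1 by rewrite mxE; congr (fun_of_matrix _ _ _); exact: val_inj.
have rgt2 x : rgt x = (x *m Q) 0 2 by rewrite /rgt mxE; congr (fun_of_matrix _ _ _); exact: val_inj.
have QQ' : Q^T *m Q = 1%:M by exact: mulmx1C.
pose n := v *m Q^T.
have nE h : dotv n h = - (p0 * lft h 0 0 + p1 * lft h 0 1) + rgt h.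
  rewrite -dotv_mulmx dotvE sum3E !(mxE _ (fun _ i => nth _ _ _)) -lft0 -lft1 -rgt2 /=; ring.
have lftD x h : lft (x + h) = lft x + lft h.
  by apply/rowP => i; rewrite /lft mulmxDl !mxE.
have rgtD x h : rgt (x + h) = rgt x + rgt h by rewrite /rgt mulmxDl !mxE.
have lft_le h i : `|lft h 0 i| <= enorm h.
  by rewrite -(enorm_mulmx h QQ) /lft mxE; exact: coord_le_enorm.
have expansion e : 0 < e -> exists2 del, 0 < del & forall h, enorm h < del ->
    `|rho (q + h) - rho q - dotv n h| <= e * enorm h.
  move=> e0; have e2 : 0 < e / 2 by rewrite divr_gt0.
  have [del del0 hd] := Ck1_first_order (lft q) (conj Cg.1 (fun i => conj (Cg.2 i).1 (Cg.2 i).2.1)) e2.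
  exists del => // h hdel.
  have l0 := lft_le h 0; have l1 := lft_le h 1.
  have := hd (lft h) (le_lt_trans l0 hdel) (le_lt_trans l1 hdel).
  rewrite !rhoE' lftD rgtD nE -/p0 -/p1; move: (g _) (g _) => g1 g0 H.
  rewrite (_ : _ - (- _ + _) = - (g0 - g1 - (p0 * lft h 0 0 + p1 * lft h 0 1))); last by ring.
  rewrite normrN; apply: le_trans H _.
  rewrite -mulrA ler_wpM2l ?(ltW e0)// mulrC ler_pdivrMr// mulr_natr mulr2n lerD//.
(* The point q is a limit of points of D, where rho < 0, and the expansion shows that rho is
   continuous at q. This one-sided sign suffices below. *)
have rho0 : rho q <= 0.
  apply/ler_addgt0Pl => e e0; rewrite addr0.
  have [del del0 hd] := expansion 1 ltr01.
  pose c := enorm n + 1; have c0 : 0 < c by rewrite ltr_wpDl// enorm_ge0.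
  pose s := Num.min r0 (Num.min del (e / c)).
  have s0 : 0 < s by rewrite !lt_min Dr0 del0 divr_gt0.
  have [x [Dx xs]] := bq.1 _ (eball_nbhs q s0).
  move: xs; rewrite /eball/= !lt_min => /and3P[x1 x2 x3].
  have rx : rho x < 0.
    have : (D `&` eball q r0) x by [].
    by rewrite Dr => -[].
  have := hd (x - q) x2; rewrite [q + _]addrC subrK mul1r.
  have := dotv_le_enorm n (x - q); move: x3; rewrite ltr_pdivlMr// /c mulrDr mulr1.
  rewrite !ler_norml mulrC => x3 /andP[? ?] /andP[? ?]; lra.
exists n, (- (e3 *m Q^T)); split.
- rewrite dotvNr /n -dotv_mulmx -mulmxA QQ' mulmx1 /v /e3 dotvE sum3E !mxE /=; ring.
- rewrite enormN enorm_mulmx ?trmxK//.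
  rewrite /enorm dotvE sum3E !mxE /= !mulr0 !add0r mulr1 sqrtr1//.
- move=> e e0; have [del del0 hd] := expansion e e0.
  exists (Num.min del r0); first by rewrite lt_min del0.
  move=> h; rewrite lt_min => /andP[h1 h2] hn.
  have : ([set x | rho x < 0] `&` eball q r0) (q + h).
    split; last by rewrite /eball/= addrC addKr.
    have := hd h h1; rewrite ler_norml => /andP[_] /=; lra.
  by rewrite -Dr => -[].
Qed.

End blowup.

(** * Lower bound for the weighted volume near a nearest point *)

Section lower_volume.
Context {R : realType}.
Notation rV3 := 'rV[R]_3.
Notation leb3 := (@leb3 R).
Variables (D : set rV3) (p q : rV3) (d Rm : R).
Hypotheses (mD : measurable D) (d0 : 0 < d) (dD : forall x, D x -> d <= rad p x)
  (DR : forall x, D x -> rad p x <= Rm) (qd : rad p q = d) (bq : bdry D q) (C2 : C2_boundary D).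

(** Applied with w = q - p it gives a direction tangent to the sphere at q; the sign is chosen so
    that it does not point out of D to first order. *)
Lemma exists_orthogonal (n w : rV3) : w != 0 ->
  exists e : rV3, [/\ enorm e = 1, dotv e w = 0 & dotv n e <= 0].
Proof.
move=> w0.
have [e [e1 ew]] : exists e : rV3, enorm e = 1 /\ dotv e w = 0.
  pose u : rV3 := \row_(i < 3) [:: - w 0 1; w 0 0; 0]`_i.
  have [u0|u0] := eqVneq u 0.
    have w1 : w 0 1 = 0 by have := congr1 (fun x : rV3 => x 0 0) u0; rewrite !mxE/= => /eqP; rewrite oppr_eq0 => /eqP.
    have w2 : w 0 0 = 0 by have := congr1 (fun x : rV3 => x 0 1) u0; rewrite !mxE/=.
    exists (\row_(i < 3) [:: 1; 0; 0]`_i); split.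
      by rewrite /enorm dotvE sum3E !mxE/= !mulr0 !addr0 mulr1 sqrtr1.
    by rewrite dotvE sum3E !mxE/= w1 w2; ring.
  have un : enorm u != 0 by apply: contra u0 => /eqP/enorm_eq0 ->.
  exists ((enorm u)^-1 *: u); split.
    by rewrite enormZ ger0_norm ?invr_ge0 ?enorm_ge0// mulVf.
  by rewrite dotvZl dotvE sum3E !mxE/=; ring.
have [h|h] := leP (dotv n e) 0; first by exists e.
by exists (- e); split; rewrite ?enormN// ?dotvNl ?ew ?oppr0// dotvNr oppr_le0 ltW.
Qed.

(** One coordinate l along which e is not small is enough to separate the translated cubes. *)
Lemma unit_large_coord (e : rV3) : enorm e = 1 -> exists l, 1 / 2 <= `|e 0 l|.
Proof.
move=> e1; apply: contrapT => h.
have hl l : (e 0 l) ^+ 2 <= 4^-1.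
  rewrite -(real_normK (num_real _)).
  have : `|e 0 l| < 1 / 2 by rewrite ltNge; apply/negP => ?; apply: h; exists l.
  have := normr_ge0 (e 0 l); move: `|e 0 l| => y y0 y1; nra.
have : enorm e ^+ 2 <= 4^-1 + 4^-1 + 4^-1 by rewrite enorm_sqr dotvE sum3E -!expr2 !lerD.
by rewrite e1 expr1n; lra.
Qed.

Lemma ccube_enorm (c x : rV3) h : ccube c h x -> enorm (x - c) <= 2 * h.
Proof.
move=> xc; have h0 : 0 <= h by have := xc 0; rewrite /= in_itv/= => /andP[? ?]; lra.
rewrite -(ler_pXn2r (n := 2))// ?nnegrE ?enorm_ge0 ?mulr_ge0//.
rewrite enorm_sqr dotvE sum3E !mxE -!expr2.
have hi i : (x 0 i - c 0 i) ^+ 2 <= h ^+ 2.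
  rewrite -(real_normK (num_real _)); apply: lerXn2r; rewrite ?nnegrE//.
  have := xc i; rewrite /= in_itv/= => /andP[? ?]; rewrite ler_norml; apply/andP; split; lra.
have := hi 0; have := hi 1; have := hi 2; have := sqr_ge0 h; rewrite exprMn; lra.
Qed.

(* The cubes have side of order 1/k and are lined up along a direction tangent to the sphere at q, so that they
   stay in D at distance at most d + O(1/k) from p. *)
Lemma volume_lower (N : R) : exists2 k0, 1 <= k0 & forall k, k0 <= k ->
  N * k^-1 ^+ 3 * expR (- (2 * k * d)) <= \int[leb3]_x (\1_D x * Phi2 p k x).
Proof.
have [n [xi [nxi xi1 blow]]] := boundary_blowup C2 bq.
have qp : q - p != 0.
  by apply/eqP => h; move: d0; rewrite -qd /rad h /enorm dotv0l sqrtr0 ltxx.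
have [e [e1 eqp ne]] := exists_orthogonal n qp.
have [l el] := unit_large_coord e1.
(* Points of a cube differ from its centre by z/k with |z| <= 2 dl. This value gives |n . z| <= 1/2,
   so that the inward shift by xi, with n . xi = -1, prevails. *)
pose dl := (4 * (enorm n + 1))^-1.
have n0 := enorm_ge0 n.
have dl0 : 0 < dl by rewrite invr_gt0 mulr_gt0// ltr_wpDl.
have dl4 : dl * (4 * (enorm n + 1)) = 1 by rewrite mulVf// gt_eqF// mulr_gt0// ltr_wpDl.
have dlq : dl <= 4^-1.
  by rewrite lef_pV2 ?posrE ?mulr_gt0 ?ltr_wpDl//; lra.
(* Along coordinate l two distinct centres are at least L/(2k) = 4 dl/k apart, more than the side 2
   dl/k, so the cubes are disjoint. *)
pose L := 8 * dl.
have L0 : 0 <= L by rewrite mulr_ge0// ltW.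
(* The contribution of one cube divided by k^{-3} e^{-2kd}: its volume is (2 dl/k)^3, and on it r <=
   d + 4/k, which accounts for e^{-8}. The number J of cubes is chosen so that J times this constant
   exceeds N. *)
pose cst := (2 * dl) ^+ 3 * (expR (- 8) * (d + 4)^-1 ^+ 2).
have cst0 : 0 < cst.
  have dl2 : 0 < 2 * dl by rewrite mulr_gt0.
  have d4 : 0 < (d + 4)^-1 by rewrite invr_gt0 addr_gt0.
  exact: (mulr_gt0 (exprn_gt0 _ dl2) (mulr_gt0 (expR_gt0 _) (exprn_gt0 _ d4))).
pose J := (Num.trunc (`|N| / cst)).+1.
have NJ : N <= J%:R * cst.
  rewrite -ler_pdivrMr//; apply: le_trans (ltW (truncnS_gt _)).
  by rewrite ler_wpM2r ?invr_ge0 ?(ltW cst0)// ler_norm.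
(* A bound for k |x - q| over all the cubes. With e = 1/(4 rho) the allowed error in the blow-up is
   1/4, below the margin 1/2 left by the choice of [dl]. *)
pose rho := 2 + J%:R * L.
have rho0 : 0 < rho by rewrite ltr_pwDl// mulr_ge0.
have [del del0 hdel] := blow (4 * rho)^-1 (ltac:(by rewrite invr_gt0 mulr_gt0)).
(* The first term brings the cubes within del of q. The second makes the squared tangential shift at
   most 2d/k, so that by Pythagoras it increases the distance to p by at most 1/k. *)
pose k1 := rho / del + (J%:R * L) ^+ 2 / (2 * d) + 1.
have t1 : 0 <= rho / del by rewrite divr_ge0 ?ltW.
have t2 : 0 <= (J%:R * L) ^+ 2 / (2 * d) by rewrite divr_ge0 ?sqr_ge0// mulr_ge0 ?(ltW d0).
exists (k1 + 1); first by rewrite /k1; lra.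
move=> k k1k.
have k10 : 1 <= k by move: k1k; rewrite /k1; lra.
have k0 : 0 < k by rewrite (lt_le_trans ltr01).
have v0 : 0 < k^-1 by rewrite invr_gt0.
have kv : k * k^-1 = 1 by rewrite mulfV// gt_eqF.
pose c (j : nat) : rV3 := q + k^-1 *: (xi + (j%:R * L) *: e).
pose C j := ccube (c j) (dl / k).
have dk0 : 0 <= dl / k by rewrite mulr_ge0 ?ltW.
have jL (j : 'I_J) : 0 <= j%:R * L <= J%:R * L.
  by rewrite mulr_ge0//= ler_wpM2r// ler_nat ltnW.
have CE (j : 'I_J) x : C j x -> exists2 z : rV3, enorm z <= 2 * dl &
    x = q + k^-1 *: (xi + (j%:R * L) *: e + z).
  move=> /ccube_enorm h; exists (k *: (x - c j)).
    by rewrite enormZ ger0_norm ?(ltW k0)// -(ler_pM2r v0) mulrAC kv mul1r -mulrA.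
  by rewrite scalerDr scalerA mulVf ?gt_eqF// scale1r addrA addrCA subrr addr0.
have CD (j : 'I_J) x : C j x -> D x.
  move=> /CE[z zdl ->]; have /andP[j1 j2] := jL j.
  have nz : `|dotv n z| <= 1 / 2.
    have := dotv_le_enorm n z; have := ler_wpM2l n0 zdl.
    have : enorm n * (2 * dl) <= 1 / 2 by have := dl4; have := dl0; lra.
    lra.
  have hz : enorm (xi + (j%:R * L) *: e + z) <= rho.
    apply: le_trans (enormD _ _) _; apply: le_trans (lerD (enormD _ _) (lexx _)) _.
    rewrite xi1 enormZ e1 mulr1 ger0_norm// /rho; move: zdl dlq; lra.
  apply: hdel.
    rewrite enormZ ger0_norm ?(ltW v0)// mulrC ltr_pdivrMr//.
    apply: le_lt_trans hz _.
    by rewrite -ltr_pdivrMl// mulrC; move: k1k; rewrite /k1; lra.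
  rewrite dotvZr enormZ (ger0_norm (ltW v0)) (mulrCA (4 * rho)^-1) -mulrN (ltr_pM2l v0).
  rewrite !dotvDr nxi dotvZr.
  have h1 : (4 * rho)^-1 * enorm (xi + (j%:R * L) *: e + z) <= 4^-1.
    have -> : 4^-1 = (4 * rho)^-1 * rho by field; rewrite gt_eqF.
    by apply: ler_wpM2l hz; rewrite invr_ge0 mulr_ge0// ltW.
  have h2 : j%:R * L * dotv n e <= 0 by rewrite mulr_ge0_le0.
  by move: nz; rewrite ler_norml => /andP[? ?]; lra.
have Cr (j : 'I_J) x : C j x -> rad p x <= d + 4 / k.
  move=> /CE[z zdl ->]; have /andP[j1 j2] := jL j.
  pose u := j%:R * L / k.
  have u0 : 0 <= u by rewrite mulr_ge0 ?(ltW v0).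
  have -> : q + k^-1 *: (xi + (j%:R * L) *: e + z) = p + ((q - p) + u *: e) + k^-1 *: (xi + z).
    rewrite addrA [p + _]addrC subrK -[X in _ = X]addrA; congr (q + _).
    have -> : u *: e = k^-1 *: ((j%:R * L) *: e) by rewrite scalerA [k^-1 * _]mulrC.
    by rewrite -scalerDr -addrA addrCA.
  rewrite /rad -[p + _ + _]addrA [p + _]addrC addrK.
  apply: le_trans (enormD _ _) _.
  have a1 : enorm (q - p + u *: e) <= d + 1 / k.
    rewrite -(ler_pXn2r (n := 2))// ?nnegrE ?enorm_ge0 ?addr_ge0 ?mulr_ge0 ?(ltW d0) ?(ltW v0)//.
    have -> : enorm (q - p + u *: e) ^+ 2 = d ^+ 2 + u ^+ 2.
      have pyth (w : rV3) : dotv e w = 0 -> enorm (w + u *: e) ^+ 2 = enorm w ^+ 2 + u ^+ 2.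
        move=> ew; rewrite enorm_sqr dotvDl !dotvDr !dotvZl !dotvZr ew (dotvC w e) ew -!enorm_sqr e1; ring.
      by rewrite pyth// -/(rad p q) qd.
    have u2 : u ^+ 2 <= 2 * d * k^-1.
      rewrite /u exprMn [k^-1 ^+ 2]expr2 mulrA ler_wpM2r ?(ltW v0)// ler_pdivrMr//.
      apply: (@le_trans _ _ ((J%:R * L) ^+ 2)); first by apply: lerXn2r; rewrite ?nnegrE// mulr_ge0.
      by rewrite [leRHS]mulrC -ler_pdivrMr ?mulr_gt0//; move: k1k; rewrite /k1; lra.
    have := sqr_ge0 (k^-1); rewrite mul1r sqrrD -mulr_natr; move: u2; lra.
  have a2 : enorm (k^-1 *: (xi + z)) <= 3 / k.
    rewrite enormZ ger0_norm ?(ltW v0)// mulrC ler_wpM2r ?(ltW v0)//.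
    by apply: le_trans (enormD _ _) _; rewrite xi1; move: zdl dlq; lra.
  by move: a1 a2; rewrite mul1r; lra.
have Cdisj (i j : 'I_J) x : C i x -> C j x -> i = j.
  move=> xi' xj; apply/eqP; apply: contraT => ij; exfalso.
  have := xi' l; have := xj l; rewrite /= !in_itv/= !mxE => /andP[a1 a2] /andP[b1 b2].
  have key : `|(i%:R - j%:R) * L * e 0 l| * k^-1 <= 2 * dl / k.
    rewrite -[k^-1 in X in X <= _]ger0_norm ?(ltW v0)// -normrM ler_norml; apply/andP.
    by split; move: a1 a2 b1 b2; lra.
  have ij1 : 1 <= `|i%:R - j%:R : R|.
    have : (i : nat) != j by [].
    rewrite neq_ltn => /orP[h|h].
      rewrite ler0_norm ?subr_le0 ?ler_nat 1?ltnW// opprB lerBrDl natr1 ler_nat//.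
    rewrite ger0_norm ?subr_ge0 ?ler_nat 1?ltnW// lerBrDl natr1 ler_nat//.
  rewrite ler_pM2r// in key.
  rewrite (normrM ((i%:R - j%:R) * L)) (normrM (i%:R - j%:R)) (ger0_norm L0) in key.
  have hf : 0 <= 1 / 2 :> R by rewrite divr_ge0.
  have B := ler_pM (mulr_ge0 ler01 L0) hf (ler_wpM2r L0 ij1) el.
  have := le_trans B key; rewrite /L; move: dl0; lra.
pose m := expR (- 8) * (d + 4)^-1 ^+ 2 * expR (- (2 * k * d)).
have m0 : 0 <= m by exact: (mulr_ge0 (mulr_ge0 (expR_ge0 _) (sqr_ge0 _)) (expR_ge0 _)).
have IC (j : 'I_J) := intg_ccube (c j) dk0.
have Im (j : 'I_J) : leb3.-integrable setT (EFin \o (fun x => m * \1_(C j) x)).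
  by apply: intgZ; exact: (IC j).1.
apply: (@le_trans _ _ (\int[leb3]_x (\sum_(j < J) m * \1_(C j) x))); last first.
  apply: le_Rintegral => //; [exact: intg_sum|exact: (intg_Phi2 d0 dD DR (ltW k0) mD)|].
  move=> x _; have [[j Cjx]|nC] := pselect (exists j : 'I_J, C j x); last first.
    rewrite big1; first by rewrite mulr_ge0 ?Phi2_ge0// indicE.
    by move=> j _; rewrite indicE memNset ?mulr0// => h; apply: nC; exists j.
  rewrite (bigD1 j)//= big1 ?addr0; last first.
    by move=> i ij; rewrite indicE memNset ?mulr0// => /Cdisj/(_ Cjx) h; rewrite h eqxx in ij.
  have Dx := CD j x Cjx; rewrite !indicE !mem_set// mulr1 mul1r Phi2E.
  have rd := dD Dx; have rC := Cr j x Cjx; have rp := lt_le_trans d0 rd.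
  rewrite /m mulrAC -expRD; apply: ler_pM.
  - exact: expR_ge0.
  - by rewrite exprn_ge0// invr_ge0 addr_ge0// ltW.
  - rewrite ler_expR -opprD lerN2.
    have -> : 8 + 2 * k * d = 2 * k * (d + 4 / k) by field; rewrite gt_eqF.
    by rewrite ler_wpM2l// mulr_ge0// ltW.
  - apply: lerXn2r; rewrite ?nnegrE ?invr_ge0 ?(ltW rp) ?addr_ge0 ?(ltW d0)//.
    rewrite lef_pV2 ?posrE ?addr_gt0//; apply: le_trans rC _.
    by rewrite lerD2l ler_pdivrMr// ler_peMr.
rewrite Rintegral_sum//.
have E (j : 'I_J) : \int[leb3]_x (m * \1_(C j) x) = m * (2 * (dl / k)) ^+ 3.
  by rewrite RintegralZl//; [rewrite (IC j).2|exact: (IC j).1].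
rewrite (eq_bigr _ (fun j _ => E j)) sumr_const card_ord.
have -> : m * (2 * (dl / k)) ^+ 3 *+ J = J%:R * cst * k^-1 ^+ 3 * expR (- (2 * k * d)).
  by rewrite -[LHS]mulr_natl /m /cst; ring.
by rewrite ler_wpM2r ?expR_ge0// ler_wpM2r ?exprn_ge0 ?(ltW v0).
Qed.

End lower_volume.

(** * The nearest point of D and the distance from D to the ball *)

Section nearest.
Context {R : realType}.
Notation rV3 := 'rV[R]_3.
Variables (D : set rV3) (p : rV3) (eta : R).
Hypotheses (D0 : D !=set0) (Db : bounded_set D) (Do : open D) (eta0 : 0 < eta)
  (disj : closure (eball p eta) `&` closure D = set0).

Lemma rad_continuous : continuous (rad p).
Proof.
move=> x.
have -> : rad p = Num.sqrt \o (fun x : rV3 => (x 0 0 - p 0 0) ^+ 2 + (x 0 1 - p 0 1) ^+ 2 + (x 0 2 - p 0 2) ^+ 2).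
  by apply/funext => y; have e := rad_sqr p y; rewrite sum3E in e; rewrite /= -e sqrtr_sqr ger0_norm// rad_ge0.
have c i : {for x, continuous (fun x : rV3 => (x 0 i - p 0 i) ^+ 2)}.
  have h : {for x, continuous (fun x : rV3 => x 0 i - p 0 i)}.
    by apply: (@continuousB _ _ _ (fun x : rV3 => x 0 i) (cst (p 0 i)) x); [exact: coord_cont|exact: cst_continuous].
  by under [X in {for _, continuous X}]eq_fun do rewrite expr2; exact: (@continuousM _ _ _ _ x h h).
apply: continuous_comp; last exact: sqrt_continuous.
apply: (@continuousD _ _ _ (fun x : rV3 => (x 0 0 - p 0 0) ^+ 2 + (x 0 1 - p 0 1) ^+ 2) (fun x : rV3 => (x 0 2 - p 0 2) ^+ 2) x) => //.
exact: (@continuousD _ _ _ (fun x : rV3 => (x 0 0 - p 0 0) ^+ 2) (fun x : rV3 => (x 0 1 - p 0 1) ^+ 2) x).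
Qed.

Lemma closure_compact : compact (closure D).
Proof.
apply: bounded_closed_compact; last exact: closed_closure.
case: Db => M [Mr hM]; exists M; split => // r Mr' x cx.
have cl : closed [set y : rV3 | `|y| <= r].
  apply: (closed_comp (f := fun y : rV3 => `|y|) (D := [set s | s <= r])).
    by move=> y _; exact: norm_continuous.
  exact: closed_le.
have : closure [set y : rV3 | `|y| <= r] x.
  by apply: closure_subset cx => y /hM; exact.
by move/closure_id : cl => <-.
Qed.

Lemma nearest_point : exists q d Rm,
  [/\ eta < d, rad p q = d, bdry D q, (forall x, D x -> d <= rad p x) &
   (forall x, D x -> rad p x <= Rm)] /\ setdist D (eball p eta) = d - eta.
Proof.
have cD0 : closure D !=set0 by case: D0 => x Dx; exists x; exact: subset_closure.
have crad : {within closure D, continuous (rad p)} by apply: continuous_subspaceT; exact: rad_continuous.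
have [q qD qmin] := EVT_min_rV cD0 closure_compact crad.
have [s sD smax] := EVT_max_rV cD0 closure_compact crad.
have {}qmin x : closure D x -> rad p q <= rad p x by move=> h; apply: qmin; rewrite inE.
have {}smax x : closure D x -> rad p x <= rad p s by move=> h; apply: smax; rewrite inE.
rewrite inE in qD.
(* If |q - p| <= eta, the points of the segment from q towards p lie in the open ball and tend to q,
   which then belongs to both closures. *)
have etad : eta < rad p q.
  rewrite ltNge; apply/negP => h.
  suff : (closure (eball p eta) `&` closure D) q by rewrite disj.
  split => // U /nbhs_normP[r /= r0 hU].
  pose t := Num.min 1 (r / (2 * (`|q - p| + 1))).
  have n1 : 0 < `|q - p| + 1 by rewrite ltr_wpDl.
  have t0 : 0 < t by rewrite lt_min ltr01 divr_gt0// mulr_gt0.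
  have t1 : t <= 1 by rewrite ge_min lexx.
  exists (q - t *: (q - p)); split.
    rewrite /eball/= addrAC -{1}(scale1r (q - p)) -scalerBl enormZ ger0_norm ?subr_ge0//.
    apply: le_lt_trans (_ : (1 - t) * eta < _); first by rewrite ler_wpM2l ?subr_ge0.
    by rewrite mulrBl mul1r ltrBlDr ltrDl mulr_gt0.
  apply: hU => /=; rewrite opprB addrCA subrr addr0 normrZ ger0_norm ?(ltW t0)//.
  have tr : t <= r / (2 * (`|q - p| + 1)) by rewrite ge_min lexx orbT.
  apply: le_lt_trans (ler_wpM2r (normr_ge0 _) tr) _.
  rewrite mulrAC ltr_pdivrMr ?mulr_gt0// ltr_pM2l//; have := normr_ge0 (q - p); lra.
have d0 : 0 < rad p q by rewrite (lt_trans eta0).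
exists q, (rad p q), (rad p s); split; first split => //.
(* At an interior point of D one could still move towards p and decrease the minimal distance. *)
- split => //; rewrite /interior => /nbhs_normP[r /= r0 hD].
  have n1 : 0 < `|q - p| + 1 by rewrite ltr_wpDl.
  pose t := Num.min 1 (r / (2 * (`|q - p| + 1))).
  have t0 : 0 < t by rewrite lt_min ltr01 divr_gt0// mulr_gt0.
  have t1 : t <= 1 by rewrite ge_min lexx.
  have Dx : D (q - t *: (q - p)).
    apply: hD => /=; rewrite opprB addrCA subrr addr0 normrZ ger0_norm ?(ltW t0)//.
    have tr : t <= r / (2 * (`|q - p| + 1)) by rewrite ge_min lexx orbT.
    apply: le_lt_trans (ler_wpM2r (normr_ge0 _) tr) _.
    rewrite mulrAC ltr_pdivrMr ?mulr_gt0// ltr_pM2l//; have := normr_ge0 (q - p); lra.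
  have := qmin _ (subset_closure Dx); apply/negP; rewrite -ltNge /rad.
  rewrite addrAC -{1}(scale1r (q - p)) -scalerBl enormZ ger0_norm ?subr_ge0//.
  by rewrite mulrBl mul1r ltrBlDr ltrDl mulr_gt0.
- by move=> x Dx; apply: qmin; exact: subset_closure.
- by move=> x Dx; apply: smax; exact: subset_closure.
set S := [set enorm (x - y) | x in D & y in eball p eta].
have lb : lbound S (rad p q - eta).
  move=> _ [x Dx] [y By] <-.
  have := qmin _ (subset_closure Dx); have := enormD (x - y) (y - p).
  rewrite addrA subrK -/(rad p x); move: By; rewrite /eball/=; lra.
apply/le_anti/andP; split; last first.
  apply: lb_le_inf => //; case: D0 => x Dx.
  exists (enorm (x - p)); exists x => //; exists p => //.
  by rewrite /eball/= subrr /enorm dotv0l sqrtr0.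
apply/ler_addgt0Pr => e e0.
have e2 : 0 < e / 2 by rewrite divr_gt0.
have [x [Dx xq]] := qD _ (eball_nbhs q e2).
have rx : rad p x <= e / 2 + rad p q.
  have := enormD (x - q) (q - p); rewrite addrA subrK -/(rad p x) -/(rad p q).
  by move: xq; rewrite /eball/=; lra.
have dx := qmin _ (subset_closure Dx).
have x0 : 0 < rad p x by rewrite (lt_le_trans d0).
(* The competitor in the ball is the point of the segment from p to x at distance eta - e' from p:
   strictly inside, within e/2 of the sphere, and at a nonnegative distance since e' <= eta/2. *)
pose e' := Num.min (e / 2) (eta / 2).
have e'1 : e' <= e / 2 by rewrite ge_min lexx.
have e'2 : e' <= eta / 2 by rewrite ge_min lexx orbT.
have e'0 : 0 < e' by rewrite lt_min e2 divr_gt0.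
pose t := (eta - e') / rad p x.
have t0 : 0 <= t by rewrite divr_ge0 ?rad_ge0//; lra.
have tr : t * rad p x = eta - e' by rewrite /t divfK// gt_eqF.
have t1 : t <= 1 by rewrite /t ler_pdivrMr// mul1r; lra.
apply: (@le_trans _ _ (enorm (x - (p + t *: (x - p))))).
  apply: ge_inf; first by exists (rad p q - eta).
  exists x => //; exists (p + t *: (x - p)) => //.
  by rewrite /eball/= addrC addKr enormZ ger0_norm// -/(rad p x) tr; lra.
have -> : x - (p + t *: (x - p)) = (1 - t) *: (x - p).
  by rewrite scalerBl scale1r opprD addrA.
by rewrite enormZ ger0_norm ?subr_ge0// mulrBl mul1r -/(rad p x) tr; lra.
Qed.

End nearest.

Ltac pos := first [ assumption | exact: ltW | exact: ler0n | exact: ltr0n | exact: ler01 | exact: ltr01 |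
  lazymatch goal with
  | |- is_true (0 <= _ ^+ 2)%R => exact: sqr_ge0
  | |- is_true (0 <= _ ^+ _)%R => apply: exprn_ge0; pos
  | |- is_true (0 < _ ^+ _)%R => apply: exprn_gt0; pos
  | |- is_true (0 <= _ + _)%R => apply: addr_ge0; pos
  | |- is_true (0 < _ + _)%R => first [apply: addr_gt0; pos | apply: ltr_wpDl; pos | apply: ltr_pwDl; pos]
  | |- is_true (0 <= _ * _)%R => apply: mulr_ge0; pos
  | |- is_true (0 < _ * _)%R => apply: mulr_gt0; pos
  | |- is_true (0 <= _^-1)%R => rewrite invr_ge0; pos
  | |- is_true (0 < _^-1)%R => rewrite invr_gt0; pos
  | |- is_true (0 <= expR _)%R => exact: expR_ge0
  | |- is_true (0 < expR _)%R => exact: expR_gt0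
  | |- is_true (0 <= `|_|)%R => exact: normr_ge0
  end ].

(** * Size of the incident field on D *)

Section sizes.
Context {R : realType}.
Notation rV3 := 'rV[R]_3.
Variables (k eta : R) (p a : rV3).
Hypotheses (k0 : 0 < k) (eta0 : 0 < eta) (a1 : enorm a = 1).

(** The squared cosine of the angle between a and x - p. *)
Definition cos2 x : R := dotv a (x - p) ^+ 2 / rad p x ^+ 2.
(** With t = [cos2], the angular profile of a dipole field: a transverse part with sin^2 and a
    radial part with 4 cos^2, two orders lower in k. [Qw] is the magnetic profile, which is purely
    transverse. *)
Definition Pw (r t : R) : R := (k ^+ 2 + (k / r + r^-1 ^+ 2)) ^+ 2 * (1 - t) + 4 * t * (k / r + r^-1 ^+ 2) ^+ 2.
Definition Qw (r t : R) : R := (k + r^-1) ^+ 2 * (1 - t).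

Lemma cos2_bound x : 0 < rad p x -> 0 <= cos2 x <= 1.
Proof.
move=> r0; rewrite divr_ge0 ?sqr_ge0//= ler_pdivrMr ?exprn_gt0// mul1r.
by have := dotv_CS a (x - p); rewrite -!enorm_sqr a1 expr1n mul1r.
Qed.

Let aa : dotv a a = 1. Proof. by rewrite -enorm_sqr a1 expr1n. Qed.

Lemma incP_sqr x : eta <= rad p x ->
  dotv (incP k eta p a x) (incP k eta p a x) =
  (oA k eta / k ^+ 2) ^+ 2 * (Phi2 p k x * Pw (rad p x) (cos2 x)).
Proof.
move=> er; have r0 : 0 < rad p x by rewrite (lt_le_trans eta0).
have rlt : rad p x < eta = false by apply/negbTE; rewrite -leNgt.
set s := dotv a (x - p).
pose A := Uo k eta (rad p x) - (k ^+ 2)^-1 * Go k eta (rad p x).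
pose B := (k ^+ 2)^-1 * Ko k eta (rad p x) * s.
have -> : incP k eta p a x = A *: a - B *: (x - p).
  apply/rowP => i; rewrite !mxE /hessU /potU /Ur /Gr /Kr rlt.
  have -> : \sum_j a 0 j * ((i == j)%:R * Go k eta (rad p x) + (x 0 i - p 0 i) * (x 0 j - p 0 j) * Ko k eta (rad p x))
     = a 0 i * Go k eta (rad p x) + (x 0 i - p 0 i) * s * Ko k eta (rad p x).
    rewrite /s dotvE; have -> : a 0 i = \sum_j a 0 j * (i == j)%:R.
      by rewrite (bigD1 i)//= eqxx mulr1 big1 ?addr0// => j ij; rewrite eq_sym (negbTE ij) mulr0.
    rewrite mulr_sumr !mulr_suml -big_split/=; apply: eq_bigr => j _; rewrite !mxE; ring.
  by rewrite /A /B; ring.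
have dd (u v : rV3) : dotv (A *: u - B *: v) (A *: u - B *: v) = A ^+ 2 * dotv u u - 2 * A * B * dotv u v + B ^+ 2 * dotv v v.
  by rewrite dotvBl !dotvBr !dotvZl !dotvZr (dotvC v u); ring.
rewrite dd aa -/s -[dotv (x - p) (x - p)]enorm_sqr -/(rad p x).
rewrite /Pw /cos2 -/s /B /A /Uo /Go /Ko /Phi2 /ub /gb /kb.
move: (expR _) (oA k eta) => e o; field; rewrite !gt_eqF//.
Qed.

Lemma incQ_sqr x : eta <= rad p x ->
  dotv (incQ k eta p a x) (incQ k eta p a x) =
  oA k eta ^+ 2 * (Phi2 p k x * Qw (rad p x) (cos2 x)).
Proof.
move=> er; have r0 : 0 < rad p x by rewrite (lt_le_trans eta0).
have rlt : rad p x < eta = false by apply/negbTE; rewrite -leNgt.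
set s := dotv a (x - p).
have -> : dotv (incQ k eta p a x) (incQ k eta p a x) = Go k eta (rad p x) ^+ 2 * (dotv a a * dotv (x - p) (x - p) - s ^+ 2).
  by rewrite /s !dotvE !sum3E !mxE /gradU /Gr rlt !I3E; ring.
rewrite aa -[dotv (x - p) (x - p)]enorm_sqr -/(rad p x).
rewrite /Qw /cos2 -/s /Go /Phi2 /ub /gb.
move: (expR _) (oA k eta) => e o; field; rewrite !gt_eqF//.
Qed.

Lemma oA_lower : 2 <= k * eta -> expR (k * eta) / (2 * k ^+ 3) <= oA k eta.
Proof.
move=> y2; rewrite /oA mulNr ler_wpM2r//; first by pos.
have := ler_wpM2r (expR_ge0 (k * eta)) (_ : 1 <= k * eta - 1); rewrite mul1r => /(_ ltac:(lra)).
have : 0 <= (k * eta + 1) * expR (- (k * eta)) by have : 0 <= k * eta; [lra|move=> ?; pos].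
lra.
Qed.

Lemma oA_upper : `|oA k eta| <= (k * eta + 1) * expR (k * eta) / k ^+ 3.
Proof.
have y0 : 0 <= k * eta by pos.
have ee : expR (- (k * eta)) <= expR (k * eta) by rewrite ler_expR; lra.
have k3 : 0 < 2 * k ^+ 3 by pos.
rewrite /oA mulNr normrM [`|(2 * k ^+ 3)^-1|]ger0_norm; last by pos.
have -> : (k * eta + 1) * expR (k * eta) / k ^+ 3 = 2 * ((k * eta + 1) * expR (k * eta)) / (2 * k ^+ 3).
  by field; rewrite gt_eqF.
rewrite ler_wpM2r//; first by pos.
apply: le_trans (ler_normD _ _) _; rewrite !normrM !(ger0_norm (expR_ge0 _)) (ger0_norm (addr_ge0 y0 ler01)).
have h : `|k * eta - 1| <= k * eta + 1 by rewrite ler_norml; apply/andP; split; lra.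
have := ler_wpM2r (expR_ge0 (k * eta)) h; have := ler_wpM2l (addr_ge0 y0 ler01) ee; lra.
Qed.

End sizes.

(** * Behaviour of the angular weights for large tau *)

Section weights.
Variable R : realType.
Variables (eps0 mu0 sigma0 d : R).
Hypotheses (eps00 : 0 < eps0) (mu00 : 0 < mu0) (sigma00 : 0 <= sigma0) (d0 : 0 < d).

Definition beta0 tau : R := tau * eps0 + sigma0.
Definition wnum tau : R := Num.sqrt (mu0 * tau * beta0 tau).
Definition kmax : R := Num.sqrt (mu0 * (eps0 + sigma0)).

Lemma beta0_gt0 tau : 0 < tau -> 0 < beta0 tau.
Proof. by move=> t0; rewrite ltr_pwDl// mulr_gt0. Qed.

Lemma wnum_sqr tau : 0 < tau -> wnum tau ^+ 2 = mu0 * tau * beta0 tau.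
Proof. by move=> t0; rewrite sqr_sqrtr// mulr_ge0 ?mulr_ge0 ?ltW// beta0_gt0. Qed.

Lemma wnum_gt0 tau : 0 < tau -> 0 < wnum tau.
Proof. by move=> t0; rewrite sqrtr_gt0 !mulr_gt0// beta0_gt0. Qed.

Lemma wnum_ge tau : 0 < tau -> Num.sqrt (mu0 * eps0) * tau <= wnum tau.
Proof.
move=> t0; rewrite -[X in _ * X](ger0_norm (ltW t0)) -sqrtr_sqr -sqrtrM; last by pos.
have b0 := beta0_gt0 t0.
rewrite ler_sqrt; last by pos.
have -> : mu0 * eps0 * tau ^+ 2 = mu0 * tau * (tau * eps0) by ring.
by apply: ler_wpM2l; [pos|rewrite lerDl].
Qed.

Lemma wnum_le tau : 1 <= tau -> wnum tau <= kmax * tau.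
Proof.
move=> t1; have t0 : 0 < tau by rewrite (lt_le_trans ltr01).
rewrite -[X in _ * X](ger0_norm (ltW t0)) -sqrtr_sqr -sqrtrM; last by pos.
rewrite ler_sqrt; last by pos.
have -> : mu0 * (eps0 + sigma0) * tau ^+ 2 = mu0 * tau * (tau * eps0 + sigma0 * tau) by ring.
by apply: ler_wpM2l; [pos|rewrite lerD2l ler_peMr].
Qed.

(* k <= c0 tau + C with the exact leading coefficient, needed for the sharp exponential rate *)
Lemma wnum_le_affine tau : 0 < tau ->
  wnum tau <= Num.sqrt (mu0 * eps0) * tau + mu0 * sigma0 / (2 * Num.sqrt (mu0 * eps0)).
Proof.
move=> t0; set c := Num.sqrt _; have c0 : 0 < c by rewrite sqrtr_gt0 mulr_gt0.
have cc : c ^+ 2 = mu0 * eps0 by rewrite sqr_sqrtr// mulr_ge0 ?ltW.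
have B0 : 0 <= mu0 * sigma0 / (2 * c) by pos.
have A0 : 0 <= c * tau by rewrite mulr_ge0 ?ltW.
rewrite -(ler_pXn2r (n := 2))// ?nnegrE ?addr_ge0// ?(ltW (wnum_gt0 t0))//.
rewrite wnum_sqr// sqrrD exprMn cc /beta0.
have -> : c * tau * (mu0 * sigma0 / (2 * c)) *+ 2 = mu0 * tau * sigma0 by field; rewrite gt_eqF.
have := sqr_ge0 (mu0 * sigma0 / (2 * c)); lra.
Qed.

Let C1 := kmax.
Let C3 := (C1 / d + d^-1 ^+ 2) / eps0.
Let C4 := mu0 * sigma0 + 2 * (C1 / d) + d^-1 ^+ 2.

Let v0 : 0 <= d^-1. Proof. by rewrite invr_ge0 ltW. Qed.
Let C10 : 0 <= C1. Proof. exact: sqrtr_ge0. Qed.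
Let C30 : 0 <= C3. Proof. by rewrite divr_ge0 ?(ltW eps00)// addr_ge0 ?mulr_ge0 ?exprn_ge0. Qed.
Let C40 : 0 <= C4. Proof. by rewrite !addr_ge0 ?mulr_ge0 ?exprn_ge0 ?mulr_ge0 ?(ltW mu00). Qed.

(** Division by [beta0] makes the leading term exact, since k^2 / beta0 = mu0 tau; the remainder th
    = (k/r + r^{-2}) / beta0 is bounded uniformly in tau. *)
Let Pw_norm tau r t : 1 <= tau -> d <= r -> exists2 th, 0 <= th <= C3 &
  Pw (wnum tau) r t / beta0 tau ^+ 2 = (mu0 * tau + th) ^+ 2 * (1 - t) + 4 * t * th ^+ 2.
Proof.
move=> t1 dr; have t0 : 0 < tau by rewrite (lt_le_trans ltr01).
have b0 := beta0_gt0 t0; have r0 := lt_le_trans d0 dr.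
exists ((wnum tau / r + r^-1 ^+ 2) / beta0 tau); last first.
  rewrite /Pw wnum_sqr//; move: (wnum tau) b0 => w b0; move: (beta0 tau) b0 => b b0.
  by field; rewrite !gt_eqF.
have ri : 0 <= r^-1 by rewrite invr_ge0 ltW.
have rv : r^-1 <= d^-1 by rewrite lef_pV2.
have k0 := ltW (wnum_gt0 t0).
apply/andP; split; first by rewrite divr_ge0 ?(ltW b0)// addr_ge0 ?mulr_ge0 ?exprn_ge0.
rewrite ler_pdivrMr// /C3.
have h1 : wnum tau / r <= C1 * tau * d^-1 by apply: ler_pM => //; exact: wnum_le.
have h2 : r^-1 ^+ 2 <= d^-1 ^+ 2 by apply: lerXn2r; rewrite ?nnegrE.
have h3 : d^-1 ^+ 2 <= d^-1 ^+ 2 * tau by rewrite ler_peMr// sqr_ge0.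
apply: (@le_trans _ _ ((C1 / d + d^-1 ^+ 2) * tau)); first by rewrite mulrDl mulrAC; lra.
have -> : (C1 / d + d^-1 ^+ 2) / eps0 * beta0 tau = (C1 / d + d^-1 ^+ 2) * (beta0 tau / eps0) by ring.
rewrite ler_wpM2l ?addr_ge0 ?mulr_ge0 ?exprn_ge0//.
by rewrite ler_pdivlMr// /beta0 lerDl.
Qed.

Let Qw_norm tau r t : 1 <= tau -> d <= r -> exists2 e, 0 <= e <= C4 * tau &
  Qw (wnum tau) r t = (mu0 * eps0 * tau ^+ 2 + e) * (1 - t).
Proof.
move=> t1 dr; have t0 : 0 < tau by rewrite (lt_le_trans ltr01).
have r0 := lt_le_trans d0 dr.
exists (mu0 * sigma0 * tau + 2 * (wnum tau / r) + r^-1 ^+ 2); last first.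
  rewrite /Qw sqrrD wnum_sqr// /beta0; ring.
have ri : 0 <= r^-1 by rewrite invr_ge0 ltW.
have rv : r^-1 <= d^-1 by rewrite lef_pV2.
have k0 := ltW (wnum_gt0 t0).
have h1 : wnum tau / r <= C1 * tau * d^-1 by apply: ler_pM => //; exact: wnum_le.
have h2 : r^-1 ^+ 2 <= d^-1 ^+ 2 by apply: lerXn2r; rewrite ?nnegrE.
have h3 : d^-1 ^+ 2 <= d^-1 ^+ 2 * tau by rewrite ler_peMr// sqr_ge0.
apply/andP; split.
  by rewrite !addr_ge0 ?mulr_ge0 ?exprn_ge0 ?mulr_ge0 ?(ltW mu00) ?(ltW t0).
by rewrite /C4 !mulrDl; have := mulrA 2 C1 d^-1; lra.
Qed.

Lemma weights_upper : exists2 C, 0 <= C & forall tau r t, 1 <= tau -> d <= r -> 0 <= t <= 1 ->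
  Pw (wnum tau) r t / beta0 tau ^+ 2 <= C * tau ^+ 2 /\ Qw (wnum tau) r t <= C * tau ^+ 2.
Proof.
exists ((mu0 + C3) ^+ 2 + 4 * C3 ^+ 2 + (mu0 * eps0 + C4)).
  by pos.
move=> tau r t t1 dr /andP[tt0 tt1]; have t0 : 0 < tau by rewrite (lt_le_trans ltr01).
have tau2 : tau <= tau ^+ 2 by rewrite expr2 ler_peMl// ltW.
have one2 : 1 <= tau ^+ 2 by rewrite (le_trans t1).
have m1 : 0 <= (mu0 + C3) ^+ 2 * tau ^+ 2 by rewrite mulr_ge0 ?sqr_ge0.
have m2 : 0 <= C3 ^+ 2 * tau ^+ 2 by rewrite mulr_ge0 ?sqr_ge0.
have m3 : 0 <= (mu0 * eps0 + C4) * tau ^+ 2.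
  by rewrite mulr_ge0 ?sqr_ge0// addr_ge0 ?mulr_ge0 ?(ltW mu00) ?(ltW eps00).
rewrite (_ : _ * tau ^+ 2 = (mu0 + C3) ^+ 2 * tau ^+ 2 + 4 * (C3 ^+ 2 * tau ^+ 2) + (mu0 * eps0 + C4) * tau ^+ 2); last by ring.
split.
  have [th /andP[th0 th1] ->] := Pw_norm t t1 dr.
  have q1 : (mu0 * tau + th) ^+ 2 <= (mu0 + C3) ^+ 2 * tau ^+ 2.
    rewrite -exprMn; apply: lerXn2r; rewrite ?nnegrE ?addr_ge0 ?mulr_ge0 ?(ltW mu00) ?(ltW t0) ?addr_ge0 ?(ltW mu00)//.
    by rewrite mulrDl lerD2l (le_trans th1)// ler_peMr.
  have q2 : th ^+ 2 <= C3 ^+ 2 * tau ^+ 2.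
    apply: (@le_trans _ _ (C3 ^+ 2)); first by apply: lerXn2r; rewrite ?nnegrE.
    by rewrite ler_peMr ?sqr_ge0.
  have q3 : (mu0 * tau + th) ^+ 2 * (1 - t) <= (mu0 * tau + th) ^+ 2.
    by rewrite ler_piMr ?sqr_ge0//; lra.
  have q4 : t * th ^+ 2 <= th ^+ 2 by rewrite ler_piMl ?sqr_ge0.
  rewrite -(mulrA 4 t); lra.
have [e /andP[e0 e1] ->] := Qw_norm t t1 dr.
have E0 : 0 <= mu0 * eps0 * tau ^+ 2 + e.
  by pos.
have q1 : (mu0 * eps0 * tau ^+ 2 + e) * (1 - t) <= mu0 * eps0 * tau ^+ 2 + e by rewrite ler_piMr//; lra.
have q2 : C4 * tau <= C4 * tau ^+ 2 by rewrite ler_wpM2l.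
have m3E : (mu0 * eps0 + C4) * tau ^+ 2 = mu0 * eps0 * tau ^+ 2 + C4 * tau ^+ 2 by ring.
lra.
Qed.

(** The leading term is tau^3 (1 - t) (A1 mu0^2 + A2 mu0 eps0), that is mu0^2 eps0 (A1/eps0 +
    A2/mu0) times tau^3 (1 - t): A1 and A2 may have any sign, but this sum is at least c. Terms of
    order tau^2 (1 - t) take at most half of it for large tau; the radial part, which does not
    vanish with 1 - t, leaves -C' tau. *)
Lemma weights_lower M c : 0 <= M -> 0 < c -> exists c' C' tau1,
  [/\ 0 < c', 0 <= C', 1 <= tau1 & forall tau r t A1 A2,
    tau1 <= tau -> d <= r -> 0 <= t <= 1 -> `|A1| <= M -> `|A2| <= M -> c <= A1 / eps0 + A2 / mu0 ->
    c' * tau ^+ 3 * (1 - t) - C' * tau <=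
    (tau * A1 - M) * (Pw (wnum tau) r t / beta0 tau ^+ 2) + tau * A2 * Qw (wnum tau) r t].
Proof.
move=> M0 c0.
(* The sum of the coefficients of tau^2 (1 - t) in the remainders; the threshold 2 K1 / c1 is where
   they drop below half of the leading term. *)
pose K1 := 2 * M * (2 * mu0 * C3 + C3 ^+ 2) + M * mu0 ^+ 2 + M * C4.
pose c1 := mu0 ^+ 2 * eps0 * c.
have c10 : 0 < c1 by rewrite !mulr_gt0// exprn_gt0.
have K10 : 0 <= K1 by rewrite /K1; pos.
exists (c1 / 2), (8 * M * C3 ^+ 2), (2 * K1 / c1 + 1); split.
- by rewrite divr_gt0.
- by pos.
- by rewrite lerDr; pos.
move=> tau r t A1 A2 tau1 dr /andP[tt0 tt1] A1M A2M cA.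
have q0 : 0 <= 2 * K1 / c1 by pos.
have t1 : 1 <= tau by lra.
have t0 : 0 < tau by rewrite (lt_le_trans ltr01).
have tK : 2 * K1 <= c1 * tau.
  by rewrite [leRHS]mulrC -ler_pdivrMr//; lra.
have [th /andP[th0 th1] ->] := Pw_norm t t1 dr.
have [e /andP[e0 e1] ->] := Qw_norm t t1 dr.
have u0 : 0 <= 1 - t by lra.
set u := 1 - t in u0 *.
have cA' : c1 <= A1 * mu0 ^+ 2 + A2 * mu0 * eps0.
  have -> : A1 * mu0 ^+ 2 + A2 * mu0 * eps0 = mu0 ^+ 2 * eps0 * (A1 / eps0 + A2 / mu0) by field; rewrite !gt_eqF.
  by rewrite ler_wpM2l// mulr_ge0 ?sqr_ge0 ?(ltW eps00).
(* What remains of the electric weight after removal of its leading part (mu0 tau)^2 (1 - t). *)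
pose X1 := (2 * mu0 * tau * th + th ^+ 2) * u + 4 * t * th ^+ 2.
have th2 : th ^+ 2 <= C3 ^+ 2 by apply: lerXn2r; rewrite ?nnegrE.
have X10 : 0 <= X1.
  have w1 : 0 <= 2 * mu0 * tau * th by rewrite !mulr_ge0 ?(ltW mu00) ?(ltW t0).
  have w2 := sqr_ge0 th.
  exact: (addr_ge0 (mulr_ge0 (addr_ge0 w1 w2) u0) (mulr_ge0 (mulr_ge0 (ler0n _ 4) tt0) w2)).
have X1b : X1 <= (2 * mu0 * C3 + C3 ^+ 2) * tau * u + 4 * C3 ^+ 2.
  have w1 : 2 * mu0 * tau * th <= 2 * mu0 * C3 * tau.
    have := ler_wpM2l (mulr_ge0 (mulr_ge0 (ler0n _ 2) (ltW mu00)) (ltW t0)) th1; lra.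
  have w2 : th ^+ 2 <= C3 ^+ 2 * tau by rewrite (le_trans th2)// ler_peMr// sqr_ge0.
  have w3 : (2 * mu0 * tau * th + th ^+ 2) * u <= (2 * mu0 * C3 + C3 ^+ 2) * tau * u.
    apply: ler_wpM2r => //; have -> : (2 * mu0 * C3 + C3 ^+ 2) * tau = 2 * mu0 * C3 * tau + C3 ^+ 2 * tau by ring.
    exact: lerD.
  have w4 : t * th ^+ 2 <= C3 ^+ 2 by rewrite (le_trans _ th2)// ler_piMl// sqr_ge0.
  rewrite /X1 -(mulrA 4 t); lra.
have E1 : (tau * A1 - M) * ((mu0 * tau + th) ^+ 2 * u + 4 * t * th ^+ 2) + tau * A2 * ((mu0 * eps0 * tau ^+ 2 + e) * u)
  = tau ^+ 3 * u * (A1 * mu0 ^+ 2 + A2 * mu0 * eps0) + (tau * A1 - M) * X1 - M * mu0 ^+ 2 * tau ^+ 2 * u + tau * A2 * e * u.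
  by rewrite /X1; ring.
rewrite E1.
have f1 : tau ^+ 3 * u * c1 <= tau ^+ 3 * u * (A1 * mu0 ^+ 2 + A2 * mu0 * eps0).
  by rewrite ler_wpM2l// mulr_ge0// exprn_ge0// ltW.
have f2 : - (2 * M * tau * ((2 * mu0 * C3 + C3 ^+ 2) * tau * u + 4 * C3 ^+ 2)) <= (tau * A1 - M) * X1.
  have g1 : `|tau * A1 - M| <= 2 * M * tau.
    apply: le_trans (ler_normB _ _) _; rewrite normrM (ger0_norm (ltW t0)) (ger0_norm M0).
    have := ler_wpM2l (ltW t0) A1M; have := ler_peMr M0 t1; lra.
  have : `|(tau * A1 - M) * X1| <= 2 * M * tau * ((2 * mu0 * C3 + C3 ^+ 2) * tau * u + 4 * C3 ^+ 2).
    by rewrite normrM (ger0_norm X10); apply: ler_pM.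
  by rewrite ler_norml => /andP[].
have f3 : - (M * C4 * tau ^+ 2 * u) <= tau * A2 * e * u.
  have : `|tau * A2 * e * u| <= M * C4 * tau ^+ 2 * u.
    rewrite normrM (ger0_norm u0) ler_wpM2r// normrM (ger0_norm e0) normrM (ger0_norm (ltW t0)).
    have -> : M * C4 * tau ^+ 2 = tau * M * (C4 * tau) by ring.
    apply: ler_pM => //; first by rewrite mulr_ge0 ?(ltW t0).
    by rewrite ler_wpM2l ?(ltW t0).
  by rewrite ler_norml => /andP[].
have f4 : 2 * K1 * (tau ^+ 2 * u) <= c1 * tau * (tau ^+ 2 * u).
  by rewrite ler_wpM2r// mulr_ge0 ?sqr_ge0.
have f4E : c1 * tau * (tau ^+ 2 * u) = c1 * tau ^+ 3 * u by ring.
rewrite f4E in f4.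
have -> : c1 / 2 * tau ^+ 3 * u = c1 * tau ^+ 3 * u / 2 by ring.
have K1E : K1 * (tau ^+ 2 * u) = 2 * M * (2 * mu0 * C3 + C3 ^+ 2) * (tau ^+ 2 * u) + M * mu0 ^+ 2 * (tau ^+ 2 * u) + M * C4 * (tau ^+ 2 * u).
  by rewrite /K1; ring.
have f2E : 2 * M * tau * ((2 * mu0 * C3 + C3 ^+ 2) * tau * u + 4 * C3 ^+ 2) =
  2 * M * (2 * mu0 * C3 + C3 ^+ 2) * (tau ^+ 2 * u) + 8 * M * C3 ^+ 2 * tau by ring.
have f3E : M * C4 * tau ^+ 2 * u = M * C4 * (tau ^+ 2 * u) by ring.
have f5E : M * mu0 ^+ 2 * tau ^+ 2 * u = M * mu0 ^+ 2 * (tau ^+ 2 * u) by ring.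
have f1E : tau ^+ 3 * u * c1 = c1 * tau ^+ 3 * u by ring.
rewrite f2E in f2; rewrite f3E in f3; rewrite f5E; rewrite f1E in f1.
rewrite -mulrA K1E in f4.
move: f1 f2 f3 f4; clear; lra.
Qed.

End weights.

(** * The Maxwell system after the finite Laplace transform *)

Section transformed.
Context {R : realType}.
Notation rV3 := 'rV[R]_3.
Notation leb3 := (@leb3 R).
Notation leb := (@lebesgue_measure R).

Lemma weak_curl_scale s (u c : rV3 -> rV3) : weak_curl u c -> weak_curl (fun x => s *: u x) (fun x => s *: c x).
Proof.
move=> [Lu Lc h]; split; [exact: L2fieldZ|exact: L2fieldZ|move=> phi Tphi].
have [Lp Lcp] := test_L2 Tphi; rewrite -[LHS]/(ip _ _) -[RHS]/(ip _ _) !ipZl//; congr (_ * _).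
exact: h.
Qed.

Lemma weak_curl_eqr (u c c' : rV3 -> rV3) : weak_curl u c -> (forall x, c x = c' x) -> weak_curl u c'.
Proof. by move=> h e; rewrite (_ : c' = c)//; apply/funext => x. Qed.

Lemma measurable_eball (p : rV3) eta : measurable (eball p eta).
Proof.
rewrite -[eball p eta]setTI (_ : eball p eta = (rad p) @^-1` `]-oo, eta[%classic).
  by apply: (measurable_rad p); [exact: measurableT|exact: measurable_itv].
by apply/seteqP; split => x /=; rewrite in_itv.
Qed.

Lemma L2field_eball (p a : rV3) eta : 0 < eta -> L2field (fun x => (\1_(eball p eta) x : R) *: a).
Proof.
move=> eta0; apply/L2fieldP => i; under eq_fun do rewrite mxE.
have m1 : measurable_fun setT (fun x : rV3 => \1_(eball p eta) x : R).
  by apply: measurable_indic; exact: measurable_eball.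
apply: (sqint_le (g := fun x => (a 0 i * \1_(ccube p eta) x))).
- exact: measurable_funM.
- apply: sqintZ; split; first by apply: measurable_indic; exact: measurable_ccube.
  have [h _] := intg_ccube p (ltW eta0).
  rewrite (_ : (fun x => \1_(ccube p eta) x ^+ 2) = (fun x => \1_(ccube p eta) x : R))//.
  by apply/funext => x; rewrite indicE; case: (x \in _); rewrite ?expr1n ?expr0n.
- move=> x; rewrite !indicE; have [xB|_] := boolP (x \in eball p eta); last by rewrite mul0r normr0.
  rewrite mem_set ?mul1r ?mulr1//; apply: ccubeP; rewrite inE in xB; exact: ltW.
Qed.

Variables (T : R) (T0 : 0 < T) (f : R -> R) (cf : {within `[0, T]%classic, continuous f}).
Variables (eps mu sigma : rV3 -> R) (M : R).
Hypotheses (meps : measurable_fun setT eps) (mmu : measurable_fun setT mu) (msigma : measurable_fun setT sigma)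
  (beps : forall x, `|eps x| <= M) (bmu : forall x, `|mu x| <= M) (bsigma : forall x, `|sigma x| <= M).
Variables (p a : rV3) (eta : R) (eta0 : 0 < eta).
Variables (E H : R -> rV3 -> rV3).
Hypothesis sol : maxwell_solution T eps mu sigma (source f (eball p eta) a) E H.
Variable tau : R.

Definition sourceF x : rV3 := (laplace T f tau * \1_(eball p eta) x) *: a.
(** [endE] and [endH] are the boundary terms at t = T, left because the observation time is
    finite. *)
Definition endE x : rV3 := (expR (- tau * T) * eps x) *: E T x.
Definition endH x : rV3 := (expR (- tau * T) * mu x) *: H T x.

Lemma L2field_sourceF : L2field sourceF.
Proof.
have := L2fieldZ (laplace T f tau) (L2field_eball p a eta0).
by under [X in L2field X -> _]eq_fun do rewrite scalerA.
Qed.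

Lemma laplace_maxwell :
  [/\ weak_curl (laplaceT T E tau) (fun x => - (tau * mu x) *: laplaceT T H tau x - endH x),
      weak_curl (laplaceT T H tau) (fun x => (tau * eps x + sigma x) *: laplaceT T E tau x + endE x - sourceF x),
      L2field (E T) & L2field (H T)].
Proof.
have [jE [jH [E' [H' [cE [cH [hE hH hcE hcH [e1 e2 E0 H0]]]]]]]] := sol.
have TT : T \in `[0, T] by rewrite in_itv/= lexx ltW.
split.
- have c0 : {within `[0, T]%classic, continuous (fun=> 0 : R)} by exact: within_cont_cst.
  have L0 : L2field (fun=> 0 : rV3).
    by have := L2fieldZ 0 (L2field_eball p a eta0); under eq_fun do rewrite scale0r.
  have mN : measurable_fun setT (fun x => - mu x) by exact: measurableT_comp.
  have bN x : `|- mu x| <= M by rewrite normrN.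
  have b0 (x : rV3) : `|0 : R| <= M by rewrite normr0 (le_trans _ (bmu x)).
  apply: (weak_curl_eqr (weak_curl_laplace T0 tau jH jE hH hcE mN (@measurable_cst _ _ _ _ setT (0 : R)) bN b0 c0 L0 H0 _)).
    move=> t tT; apply: filterS (e2 t tT) => x /eqP; rewrite addrC addr_eq0 => /eqP ->.
    by rewrite scale0r addr0 scaler0 subr0 scaleNr.
  by move=> x; rewrite scaler0 subr0 /cst addr0 mulrN /endH mulrN [X in _ + X]scaleNr.
- apply: (weak_curl_eqr (weak_curl_laplace T0 tau jE jH hE hcH meps msigma beps bsigma cf (L2field_eball p a eta0) E0 _)).
    move=> t tT; apply: filterS (e1 t tT) => x /eqP; rewrite subr_eq => /eqP h.
    rewrite h /source scalerA; move: (sigma x *: E t x) (_ *: a) (cH t x) => s j c.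
    by rewrite [X in X - _]addrAC [- s + j + s]addrAC addNr add0r [j + c]addrC addrK.
  by move=> x; rewrite /endE /sourceF scalerA.
- by have [h _ _] := hE; have [] := h T TT.
- by have [h _ _] := hH; have [] := h T TT.
Qed.

Lemma nrm_endE : L2field (E T) -> nrm endE = expR (- tau * T) * nrm (fun x => eps x *: E T x).
Proof.
move=> LE; have L : L2field (fun x => eps x *: E T x) by exact: L2field_mul beps.
have -> : endE = (fun x => expR (- tau * T) *: (eps x *: E T x)) by apply/funext => x; rewrite scalerA.
by rewrite nrmZ// ger0_norm// expR_ge0.
Qed.

Lemma nrm_endH : L2field (H T) -> nrm endH = expR (- tau * T) * nrm (fun x => mu x *: H T x).
Proof.
move=> LH; have L : L2field (fun x => mu x *: H T x) by exact: L2field_mul bmu.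
have -> : endH = (fun x => expR (- tau * T) *: (mu x *: H T x)) by apply/funext => x; rewrite scalerA.
by rewrite nrmZ// ger0_norm// expR_ge0.
Qed.

Lemma L2field_end : L2field (E T) -> L2field (H T) -> L2field endE /\ L2field endH.
Proof.
move=> LE LH.
have L1 : L2field (fun x => eps x *: E T x) by exact: L2field_mul beps.
have L2 : L2field (fun x => mu x *: H T x) by exact: L2field_mul bmu.
split; [have := L2fieldZ (expR (- tau * T)) L1|have := L2fieldZ (expR (- tau * T)) L2];
  by under [X in L2field X -> _]eq_fun do rewrite scalerA.
Qed.

Lemma nrm_sourceF : nrm sourceF = `|laplace T f tau| * nrm (fun x => (\1_(eball p eta) x : R) *: a).
Proof. by rewrite -nrmZ; [congr nrm; apply/funext => x; rewrite scalerA|exact: L2field_eball]. Qed.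

End transformed.

Section laplace_bound.
Context {R : realType}.
Notation leb := (@lebesgue_measure R).

Lemma laplace_bound (T : R) (f : R -> R) : 0 < T -> {within `[0, T]%classic, continuous f} ->
  exists2 C, 0 <= C & forall tau, 0 < tau -> `|laplace T f tau| <= C / tau.
Proof.
move=> T0 cf.
have cn : {within `[0, T]%classic, continuous (fun t => `|f t|)}.
  apply/subspace_continuousP => x xT; have /subspace_continuousP/(_ x xT) h := cf.
  exact: (cvg_norm h).
have [c cT hc] := EVT_max (ltW T0) cn.
exists `|f c| => // tau tau0; rewrite /laplace.
have ce (s : R) : {within `[0, T]%classic, continuous (fun t : R => expR (s * t))}.
  by apply: continuous_subspaceT; exact: continuous_expRM.
have I1 : leb.-integrable `[0, T]%classic (EFin \o (fun t => expR (- tau * t) * f t)).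
  by apply: within_integrable; exact: within_cont_mul.
have I2 : leb.-integrable `[0, T]%classic (EFin \o (fun t => `|expR (- tau * t) * f t|)).
  exact: (integrable_abse I1).
have I3 : leb.-integrable `[0, T]%classic (EFin \o (fun t => `|f c| * expR (- tau * t))).
  by apply: within_integrable; apply: within_cont_mul => //; exact: within_cont_cst.
apply: le_trans (le_normr_Rintegral _ I1) _; first exact: measurable_itv.
apply: (@le_trans _ _ (\int[leb]_(t in `[0, T]) (`|f c| * expR (- tau * t)))).
  apply: le_Rintegral => // t; rewrite /= => tT.
  by rewrite normrM ger0_norm ?expR_ge0// mulrC ler_wpM2r ?expR_ge0//; exact: hc.
pose F (t : R) := - (`|f c| / tau) * expR (- tau * t).
have dF (t : R) : is_derive t 1 F (`|f c| * expR (- tau * t)).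
  apply: (is_derive_conv (is_deriveZ (- (`|f c| / tau)) (is_derive_expRM (- tau) t))).
  by rewrite /GRing.scale/=; field; rewrite gt_eqF.
rewrite /Rintegral (is_derive_ftc T0 dF); last first.
  by move=> t; apply: (@continuousM _ _ (cst `|f c|) (fun t => expR (- tau * t))); [exact: cst_continuous|exact: continuous_expRM].
rewrite /F /= mulr0 expR0 mulr1 opprK mulNr addrC lerBlDr lerDl.
by rewrite mulr_ge0 ?expR_ge0// divr_ge0// ltW.
Qed.

End laplace_bound.

Section incident.
Context {R : realType}.
Notation rV3 := 'rV[R]_3.
Notation leb3 := (@leb3 R).
Variables (eps0 mu0 sigma0 T : R) (f : R -> R) (p a : rV3) (eta d Rm : R) (D : set rV3).
Hypotheses (eps00 : 0 < eps0) (mu00 : 0 < mu0) (sigma00 : 0 <= sigma0) (T0 : 0 < T)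
  (cf : {within `[0, T]%classic, continuous f}) (a1 : enorm a = 1) (eta0 : 0 < eta) (etad : eta < d)
  (mD : measurable D) (dD : forall x, D x -> d <= rad p x) (DR : forall x, D x -> rad p x <= Rm).

Notation k := (wnum eps0 mu0 sigma0).
Notation b0 := (beta0 eps0 sigma0).
Notation ft := (laplace T f).
Notation F := (sourceF T f p a eta).

(** [incP] solves curl curl P + k^2 P = 1_B a; the factors are those for which [incV] and [incH]
    solve the first-order background system with the transformed source. *)
Definition incV tau x : rV3 := (tau * mu0 * ft tau) *: incP (k tau) eta p a x.
Definition incH tau x : rV3 := (- ft tau) *: incQ (k tau) eta p a x.
(** Since d - eta is the distance from D to the ball, the square of this quantity carries the
    expected exponential rate of the indicator. *)
Definition decay tau : R := expR (- (Num.sqrt (mu0 * eps0) * (d - eta)) * tau).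

Lemma weak_curl_incV tau : 0 < tau -> weak_curl (incV tau) (fun x => - (tau * mu0) *: incH tau x).
Proof.
move=> t0; have k0 := wnum_gt0 eps00 mu00 sigma00 t0.
apply: (weak_curl_eqr (weak_curl_scale (tau * mu0 * ft tau) (weak_curl_incP p a k0 eta0))) => x.
by rewrite /incH scalerA; congr (_ *: _); ring.
Qed.

Lemma weak_curl_incH tau : 0 < tau -> weak_curl (incH tau) (fun x => b0 tau *: incV tau x - F tau x).
Proof.
move=> t0; have k0 := wnum_gt0 eps00 mu00 sigma00 t0.
apply: (weak_curl_eqr (weak_curl_scale (- ft tau) (weak_curl_incQ p a k0 eta0))) => x.
rewrite scalerDr scalerA /incV /sourceF !scalerA -[- (_ *: a)]scaleNr mulNr.
congr (_ *: _ + _ *: _); last by rewrite mulNr.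
by rewrite (wnum_sqr eps00 mu00 sigma00 t0); ring.
Qed.

(** The energy identity bounds tau eps0 |V|^2 + tau mu0 |Vh|^2 by |F| |V|, and |F| = O(1/tau). The
    power tau^{-2} matters: it makes the error e^{-tau T} |V| negligible even after multiplication
    by e^{tau T}. *)
Lemma incident_small : exists2 C, 0 <= C & forall tau, 1 <= tau ->
  nrm (incV tau) <= C / tau ^+ 2 /\ nrm (incH tau) <= C / tau ^+ 2.
Proof.
have [Cf Cf0 hf] := laplace_bound T0 cf.
pose CB := nrm (fun x => (\1_(eball p eta) x : R) *: a).
have CB0 : 0 <= CB by exact: nrm_ge0.
pose c := Num.sqrt (mu0 * eps0); have c0 : 0 < c by rewrite sqrtr_gt0; pos.
have cc : c ^+ 2 = mu0 * eps0 by rewrite sqr_sqrtr//; pos.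
exists (Cf * CB / eps0 + Cf * CB / c); first by pos.
move=> tau t1; have t0 : 0 < tau by rewrite (lt_le_trans ltr01).
have W1 := weak_curl_incV t0; have W2 := weak_curl_incH t0.
have LF := L2field_sourceF T f p a eta0 tau.
have SE := source_energy LF W1 W2.
have LV : L2field (incV tau) by case: W1.
have CS := le_trans (ler_norm _) (ip_CS LF LV).
rewrite SE -!nrm_sqr in CS.
have phi : nrm (F tau) <= Cf * CB / tau.
  by rewrite nrm_sourceF// mulrAC ler_wpM2r// hf.
move: CS phi (nrm_ge0 (incV tau)) (nrm_ge0 (incH tau)) (nrm_ge0 (F tau)).
move: (nrm (incV tau)) (nrm (incH tau)) (nrm (F tau)) => v h F0 CS phi v0 h0 F00.
have bt : tau * eps0 <= b0 tau by rewrite lerDl.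
have m0 : 0 < tau * mu0 by pos.
have te0 : 0 < tau * eps0 by pos.
have hv : v <= F0 / (tau * eps0).
  rewrite ler_pdivlMr//; move: v0; rewrite le_eqVlt => /predU1P[<-|v0]; first by rewrite mul0r.
  rewrite -(ler_pM2r v0); have := ler_wpM2r (sqr_ge0 v) bt; have := mulr_ge0 (ltW m0) (sqr_ge0 h); move: CS; lra.
have hh : h <= F0 / (tau * c).
  rewrite -(ler_pXn2r (n := 2))// ?nnegrE//; last by pos.
  have e1 : tau * mu0 * h ^+ 2 <= F0 * v.
    have b00 := beta0_gt0 eps00 sigma00 t0.
    have := mulr_ge0 (ltW b00) (sqr_ge0 v); move: CS; lra.
  have e2 : F0 * v <= F0 * (F0 / (tau * eps0)) by rewrite ler_wpM2l.
  have -> : (F0 / (tau * c)) ^+ 2 = F0 * (F0 / (tau * eps0)) / (tau * mu0).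
    have cE : c ^+ 2 = mu0 * eps0 by [].
    rewrite exprMn exprVn exprMn cE; field; rewrite !gt_eqF//.
  by rewrite ler_pdivlMr// mulrC; exact: le_trans e2.
have q1 : F0 / (tau * eps0) <= Cf * CB / eps0 / tau ^+ 2.
  have -> : Cf * CB / eps0 / tau ^+ 2 = Cf * CB / tau / (tau * eps0) by field; rewrite !gt_eqF.
  by rewrite ler_wpM2r//; pos.
have q2 : F0 / (tau * c) <= Cf * CB / c / tau ^+ 2.
  have -> : Cf * CB / c / tau ^+ 2 = Cf * CB / tau / (tau * c) by field; rewrite !gt_eqF.
  by rewrite ler_wpM2r//; pos.
have r1 : 0 <= Cf * CB / eps0 / tau ^+ 2 by pos.
have r2 : 0 <= Cf * CB / c / tau ^+ 2 by pos.
by rewrite mulrDl; split; [apply: le_trans (le_trans hv q1) _; rewrite lerDl|apply: le_trans (le_trans hh q2) _; rewrite lerDr].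
Qed.

Lemma incV_sqr tau x : 0 < tau -> eta <= rad p x -> dotv (incV tau x) (incV tau x) =
  ft tau ^+ 2 * oA (k tau) eta ^+ 2 * (Phi2 p (k tau) x * (Pw (k tau) (rad p x) (cos2 p a x) / b0 tau ^+ 2)).
Proof.
move=> t0 er; have k0 := wnum_gt0 eps00 mu00 sigma00 t0.
have b00 := beta0_gt0 eps00 sigma00 t0.
rewrite dotvZl dotvZr (incP_sqr k0 eta0 a1 er).
have -> : (oA (k tau) eta / k tau ^+ 2) ^+ 2 = oA (k tau) eta ^+ 2 / (mu0 * tau * b0 tau) ^+ 2.
  by rewrite exprMn exprVn (wnum_sqr eps00 mu00 sigma00 t0).
by field; rewrite !gt_eqF.
Qed.

Lemma incH_sqr tau x : 0 < tau -> eta <= rad p x -> dotv (incH tau x) (incH tau x) =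
  ft tau ^+ 2 * oA (k tau) eta ^+ 2 * (Phi2 p (k tau) x * Qw (k tau) (rad p x) (cos2 p a x)).
Proof.
move=> t0 er; have k0 := wnum_gt0 eps00 mu00 sigma00 t0.
rewrite dotvZl dotvZr incQ_sqr//; ring.
Qed.

Let d0 : 0 < d. Proof. exact: lt_trans etad. Qed.

Lemma decay_sqr tau : decay tau ^+ 2 = expR (- (2 * (Num.sqrt (mu0 * eps0) * tau) * (d - eta))).
Proof. by rewrite expr2 -expRD; congr expR; ring. Qed.

(** The growth e^{k eta} of [oA] combines with the decay e^{-kd} on D, and k >= sqrt(mu0 eps0) tau.
    No power of tau survives: the weights are O(tau^2), while the squared transform of f is
    O(tau^{-2}). *)
Lemma incident_onD : exists2 C, 0 <= C & forall tau, 1 <= tau ->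
  nrm (onD D (incV tau)) <= C * decay tau /\ nrm (onD D (incH tau)) <= C * decay tau.
Proof.
have [Cf Cf0 hf] := laplace_bound T0 cf.
have [Cw Cw0 hw] := weights_upper eps00 mu00 sigma00 d0.
pose c := Num.sqrt (mu0 * eps0); have c0 : 0 < c by rewrite sqrtr_gt0; pos.
pose CA := eta / c ^+ 2 + (c ^+ 3)^-1.
have CA0 : 0 <= CA by rewrite /CA; pos.
pose vD := \int[leb3]_x (\1_D x : R).
have vD0 : 0 <= vD by apply: Rintegral_ge0 => x _; rewrite indicE.
have [iD _] := intg_indic mD (leb3_D_lty DR mD (fun x h => h)).
pose K2 := Cf ^+ 2 * CA ^+ 2 * (d^-1 ^+ 2 * Cw) * vD.
have K20 : 0 <= K2 by rewrite /K2; have := d0; move=> ?; pos.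
have dv0 : 0 <= d^-1 by rewrite invr_ge0 ltW.
exists (Num.sqrt K2); first exact: sqrtr_ge0.
move=> tau t1; have t0 : 0 < tau by rewrite (lt_le_trans ltr01).
have k0 := wnum_gt0 eps00 mu00 sigma00 t0.
have kc := wnum_ge eps00 mu00 sigma00 t0.
have kc1 : c <= k tau by apply: le_trans kc; rewrite ler_peMr// ltW.
have oAb : oA (k tau) eta ^+ 2 <= CA ^+ 2 * expR (2 * (k tau * eta)).
  have -> : expR (2 * (k tau * eta)) = expR (k tau * eta) ^+ 2 by rewrite expr2 -expRD; congr expR; ring.
  rewrite -exprMn -(real_normK (num_real (oA _ _))); apply: lerXn2r; rewrite ?nnegrE//; first by pos.
  apply: le_trans (oA_upper k0 eta0) _.
  rewrite mulrAC ler_wpM2r ?expR_ge0//.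
  have -> : (k tau * eta + 1) / k tau ^+ 3 = eta / k tau ^+ 2 + (k tau ^+ 3)^-1 by field; rewrite gt_eqF.
  have i2 : (k tau ^+ 2)^-1 <= (c ^+ 2)^-1.
    by rewrite lef_pV2 ?posrE ?exprn_gt0//; apply: lerXn2r; rewrite ?nnegrE ?(ltW c0) ?(ltW k0).
  have i3 : (k tau ^+ 3)^-1 <= (c ^+ 3)^-1.
    by rewrite lef_pV2 ?posrE ?exprn_gt0//; apply: lerXn2r; rewrite ?nnegrE ?(ltW c0) ?(ltW k0).
  by apply: lerD => //; rewrite ler_wpM2l// ltW.
have ftb : ft tau ^+ 2 * tau ^+ 2 <= Cf ^+ 2.
  rewrite -exprMn -(real_normK (num_real (ft tau * tau))); apply: lerXn2r; rewrite ?nnegrE//.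
  by rewrite normrM (ger0_norm (ltW t0)) -ler_pdivlMr// hf.
have main (u : rV3 -> rV3) (w : rV3 -> R) : L2field u -> (forall x, D x -> dotv (u x) (u x) =
     ft tau ^+ 2 * oA (k tau) eta ^+ 2 * (Phi2 p (k tau) x * w x)) ->
     (forall x, D x -> w x <= Cw * tau ^+ 2) -> nrm (onD D u) <= Num.sqrt K2 * decay tau.
  move=> Lu uE wb.
  have f2 : 0 <= ft tau ^+ 2 by exact: sqr_ge0.
  have o2 : 0 <= oA (k tau) eta ^+ 2 by exact: sqr_ge0.
  pose Bd := ft tau ^+ 2 * oA (k tau) eta ^+ 2 * (d^-1 ^+ 2 * expR (- (2 * k tau * d)) * (Cw * tau ^+ 2)).
  have h1 : ip (onD D u) (onD D u) <= Bd * vD.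
    rewrite /vD -RintegralZl//; apply: le_Rintegral => //.
    - by apply: L2field_dotv; exact: L2field_onD.
    - exact: intgZ.
    - move=> x _; rewrite /onD dotvZl dotvZr indicE; have [xD|xD] := boolP (x \in D); last by rewrite !mul0r mulr0.
      rewrite inE in xD; rewrite !mul1r mulr1 uE// /Bd; apply: ler_wpM2l; first by pos.
      apply: le_trans (ler_wpM2l (Phi2_ge0 _ _ _) (wb x xD)) _.
      by apply: ler_wpM2r; [pos|apply: Phi2_le => //; [exact: ltW|exact: dD]].
  have h2 : Bd <= Cf ^+ 2 * CA ^+ 2 * (d^-1 ^+ 2 * Cw) * decay tau ^+ 2.
    have -> : Bd = (ft tau ^+ 2 * tau ^+ 2) * (oA (k tau) eta ^+ 2 * expR (- (2 * k tau * d))) * (d^-1 ^+ 2 * Cw).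
      by rewrite /Bd; ring.
    have -> : Cf ^+ 2 * CA ^+ 2 * (d^-1 ^+ 2 * Cw) * decay tau ^+ 2 = Cf ^+ 2 * (CA ^+ 2 * decay tau ^+ 2) * (d^-1 ^+ 2 * Cw) by ring.
    apply: ler_wpM2r; first by pos.
    apply: ler_pM => //; [pos|pos|].
    apply: le_trans (ler_wpM2r (expR_ge0 _) oAb) _.
    rewrite -(mulrA (CA ^+ 2)) -expRD; apply: ler_wpM2l; first by pos.
    rewrite decay_sqr ler_expR.
    have : 0 <= (k tau - c * tau) * (d - eta) by apply: mulr_ge0; rewrite subr_ge0// ltW.
    rewrite -/c; lra.
  rewrite -(ler_pXn2r (n := 2))// ?nnegrE ?nrm_ge0//; last by rewrite mulr_ge0 ?sqrtr_ge0// expR_ge0.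
  rewrite nrm_sqr exprMn (sqr_sqrtr K20); apply: le_trans h1 _.
  by apply: le_trans (ler_wpM2r vD0 h2) _; rewrite /K2 mulrAC.
have tb x : D x -> 0 <= cos2 p a x <= 1.
  by move=> Dx; apply: cos2_bound => //; exact: lt_le_trans (dD Dx).
have eD x : D x -> eta <= rad p x by move=> Dx; rewrite (le_trans (ltW etad))// dD.
split.
  apply: (main _ (fun x => Pw (k tau) (rad p x) (cos2 p a x) / b0 tau ^+ 2)).
  - by case: (weak_curl_incV t0).
  - by move=> x Dx; apply: incV_sqr => //; exact: eD.
  - by move=> x Dx; have [] := hw tau (rad p x) (cos2 p a x) t1 (dD Dx) (tb x Dx).
apply: (main _ (fun x => Qw (k tau) (rad p x) (cos2 p a x))).
- by case: (weak_curl_incH t0).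
- by move=> x Dx; apply: incH_sqr => //; exact: eD.
- by move=> x Dx; have [] := hw tau (rad p x) (cos2 p a x) t1 (dD Dx) (tb x Dx).
Qed.

Variables (q : rV3).
Hypotheses (qd : rad p q = d) (bq : bdry D q) (C2 : C2_boundary D).

(** The power tau^{-8} is the product of tau from the weights, k^{-6} from the square of [oA], and
    k^{-3} from the volume of D within 1/k of a nearest point. *)
Lemma incident_lower (A1 A2 : rV3 -> R) M c : 0 <= M -> 0 < c ->
  measurable_fun setT A1 -> measurable_fun setT A2 ->
  (forall x, `|A1 x| <= M) -> (forall x, `|A2 x| <= M) ->
  {ae leb3, forall x, D x -> c <= A1 x / eps0 + A2 x / mu0} ->
  exists cq tq, [/\ 0 < cq, 1 <= tq & forall tau, tq <= tau ->
    let g x := \1_D x * (tau * A1 x - M) * dotv (incV tau x) (incV tau x) +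
               \1_D x * (tau * A2 x) * dotv (incH tau x) (incH tau x) in
    leb3.-integrable setT (EFin \o g) /\
    cq * ft tau ^+ 2 * tau ^- 8 * decay tau ^+ 2 <= \int[leb3]_x g x].
Proof.
move=> M0 c0 mA1 mA2 bA1 bA2 jump.
have [c' [C' [tau1 [c'0 C'0 tau11 hw]]]] := weights_lower eps00 mu00 sigma00 d0 M0 c0.
pose km := kmax eps0 mu0 sigma0.
have km0 : 0 < km by rewrite /km /kmax sqrtr_gt0; pos.
(* As k <= km tau, outside the cone of this opening 1 - cos^2 >= (C' + 1)/(c' tau^2). The lower
   bound c' tau^3 (1 - cos^2) - C' tau of the weight is then at least tau. *)
pose cc := km * Num.sqrt ((C' + 1) / c').
have cc0 : 0 <= cc by rewrite /cc mulr_ge0 ?sqrtr_ge0// ltW.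
have [Cc Cc0 hcone] := cone_upper mD d0 dD DR a1 cc0.
(* The multiple is chosen to absorb C' + 1 times the contribution of the cone and to leave one full
   unit k^{-3} e^{-2kd}. *)
have [k1 k11 hvol] := volume_lower mD d0 dD DR qd bq C2 ((C' + 1) * Cc + 1).
pose s0 := Num.sqrt (mu0 * eps0); have s00 : 0 < s0 by rewrite sqrtr_gt0; pos.
pose kc := mu0 * sigma0 / (2 * s0).
(* The factor 4 k^6 comes from the lower bound of the squared [oA] and k^3 from the volume, with k
   <= km tau; the exponential pays for the bounded excess kc of k over sqrt(mu0 eps0) tau. *)
pose cq := (4 * km ^+ 9)^-1 * expR (- (2 * kc * (d - eta))).
(* The three terms ensure the range of [weights_lower], then k >= k1 for the volume bound and k eta
   >= 2 for [oA_lower], both through k >= s0 tau. *)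
exists cq, (tau1 + k1 / s0 + 2 / (s0 * eta)); split.
- by rewrite /cq; pos.
- have h1 : 0 <= k1 / s0 by apply: divr_ge0; [lra|exact: ltW].
  have h2 : 0 <= 2 / (s0 * eta) by pos.
  lra.
move=> tau tt g.
have h1 : 0 <= k1 / s0 by apply: divr_ge0; [lra|exact: ltW].
have h2 : 0 <= 2 / (s0 * eta) by pos.
have t1t : tau1 <= tau by move: tt h1 h2; lra.
have t1 : 1 <= tau by exact: le_trans t1t.
have t0 : 0 < tau by exact: lt_le_trans t1.
have k0 := wnum_gt0 eps00 mu00 sigma00 t0.
have kge := wnum_ge eps00 mu00 sigma00 t0; rewrite -/s0 in kge.
have kle := wnum_le eps00 mu00 sigma00 t1; rewrite -/km in kle.
have kk1 : k1 <= k tau.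
  apply: le_trans kge; rewrite mulrC -ler_pdivrMr//; move: tt tau11 h2; lra.
have kk : 1 <= k tau by exact: le_trans kk1.
have keta : 2 <= k tau * eta.
  apply: (@le_trans _ _ (s0 * tau * eta)); last by rewrite ler_wpM2r// ltW.
  have : 2 / (s0 * eta) <= tau by move: tt tau11 h1; lra.
  rewrite ler_pdivrMr; last by pos.
  by move=> h; rewrite mulrAC mulrC.
have LV : L2field (incV tau) by case: (weak_curl_incV t0).
have LH : L2field (incH tau) by case: (weak_curl_incH t0).
have Ig : leb3.-integrable setT (EFin \o g).
  have n1D (x : rV3) : `|\1_D x : R| <= 1 by rewrite indicE; case: (x \in D); rewrite ?normr1 ?normr0.
  have m1D : measurable_fun setT (fun x : rV3 => \1_D x : R) by exact: measurable_indic.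
  apply: intgD.
    apply: (@intg_bounded_mul _ _ _ _ _ (fun x => \1_D x * (tau * A1 x - M)) (1 * (tau * M + M))); first exact: L2field_dotv.
      by apply: measurable_funM => //; apply: measurable_funB => //; exact: measurable_funM.
    move=> x; rewrite normrM; apply: ler_pM => //; apply: le_trans (ler_normB _ _) _.
    by rewrite normrM (ger0_norm (ltW t0)) (ger0_norm M0) lerD2r ler_wpM2l ?(ltW t0).
  apply: (@intg_bounded_mul _ _ _ _ _ (fun x => \1_D x * (tau * A2 x)) (1 * (tau * M))); first exact: L2field_dotv.
    by apply: measurable_funM => //; exact: measurable_funM.
  move=> x; rewrite normrM; apply: ler_pM => //.
  by rewrite normrM (ger0_norm (ltW t0)) ler_wpM2l ?(ltW t0).
split => //.
pose S := ft tau ^+ 2 * oA (k tau) eta ^+ 2.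
have S0 : 0 <= S by rewrite /S; pos.
pose ph x := \1_D x * Phi2 p (k tau) x.
pose pc x := \1_(D `&` cone p a cc (k tau)) x * Phi2 p (k tau) x.
have Iph : leb3.-integrable setT (EFin \o ph) by exact: (intg_Phi2 d0 dD DR (ltW k0) mD).
have Ipc : leb3.-integrable setT (EFin \o pc).
  apply: (intg_Phi2 d0 dD DR (ltW k0)); last by move=> x [].
  by apply: measurableI => //; exact: measurable_cone.
(* After removal of the factor S Phi2, the integrand is at least tau on D off the cone and at least
   -C' tau on the cone, where 1 - (C' + 1) = -C'. *)
have low : \int[leb3]_x (S * tau * (ph x - (C' + 1) * pc x)) <= \int[leb3]_x g x.
  apply: le_Rintegral_ae => //; first by apply: intgZ; apply: intgB => //; exact: intgZ.
  apply: filterS jump => x cA; rewrite /ph /pc /g !indicE.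
  have [xD|xD] := boolP (x \in D); last first.
    have -> : (x \in D `&` cone p a cc (k tau)) = false.
      by apply/negbTE; apply: contra xD; rewrite !inE => -[].
    by rewrite !mul0r mulr0 subr0 mulr0 addr0.
  rewrite inE in xD; rewrite !mul1r.
  have dr := dD xD; have r0 : 0 < rad p x by exact: lt_le_trans dr.
  have er : eta <= rad p x by rewrite (le_trans (ltW etad)).
  have tb := cos2_bound a1 r0.
  have := hw tau (rad p x) (cos2 p a x) (A1 x) (A2 x) t1t dr tb (bA1 x) (bA2 x) (cA xD).
  rewrite (incV_sqr t0 er) (incH_sqr t0 er) -/S.
  have P0 := Phi2_ge0 p (k tau) x.
  have SP : 0 <= S * Phi2 p (k tau) x by pos.
  move=> /(ler_wpM2l SP) H.
  have -> : (tau * A1 x - M) * (S * (Phi2 p (k tau) x * (Pw (k tau) (rad p x) (cos2 p a x) / b0 tau ^+ 2))) +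
     tau * A2 x * (S * (Phi2 p (k tau) x * Qw (k tau) (rad p x) (cos2 p a x))) =
     S * Phi2 p (k tau) x * ((tau * A1 x - M) * (Pw (k tau) (rad p x) (cos2 p a x) / b0 tau ^+ 2) +
     tau * A2 x * Qw (k tau) (rad p x) (cos2 p a x)) by ring.
  apply: le_trans H.
  have u0 : 0 <= 1 - cos2 p a x by rewrite subr_ge0; case/andP: tb.
  have [xc|xc] := boolP (x \in D `&` cone p a cc (k tau)).
    rewrite mul1r.
    have -> : S * tau * (Phi2 p (k tau) x - (C' + 1) * Phi2 p (k tau) x) = S * Phi2 p (k tau) x * (- (C' * tau)) by ring.
    apply: ler_wpM2l => //; rewrite -subr_ge0 opprK subrK; pos.
  rewrite mul0r mulr0 subr0.
  have -> : S * tau * Phi2 p (k tau) x = S * Phi2 p (k tau) x * tau by ring.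
  apply: ler_wpM2l => //.
  have nc : (cc / k tau * rad p x) ^+ 2 <= rad p x ^+ 2 - dotv a (x - p) ^+ 2.
    by rewrite leNgt; apply/negP => h; move: xc; rewrite mem_set.
  have uE : (1 - cos2 p a x) * rad p x ^+ 2 = rad p x ^+ 2 - dotv a (x - p) ^+ 2.
    by rewrite /cos2; field; rewrite gt_eqF.
  have r2 : 0 < rad p x ^+ 2 by pos.
  have u1 : (cc / k tau) ^+ 2 <= 1 - cos2 p a x.
    by rewrite -(ler_pM2r r2) uE -exprMn.
  have u2 : (C' + 1) / c' / tau ^+ 2 <= (cc / k tau) ^+ 2.
    have -> : (cc / k tau) ^+ 2 = (C' + 1) / c' * (km ^+ 2 / k tau ^+ 2).
      have <- : Num.sqrt ((C' + 1) / c') ^+ 2 = (C' + 1) / c' by rewrite sqr_sqrtr//; pos.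
      by rewrite /cc; field; rewrite gt_eqF.
    apply: ler_wpM2l; first by pos.
    rewrite ler_pdivlMr ?exprn_gt0// mulrC ler_pdivrMr ?exprn_gt0// -exprMn.
    by apply: lerXn2r; rewrite ?nnegrE ?(ltW k0)//; pos.
  have u3 := le_trans u2 u1.
  have ct : 0 < c' * tau ^+ 3 by pos.
  have := ler_wpM2l (ltW ct) u3.
  have -> : c' * tau ^+ 3 * ((C' + 1) / c' / tau ^+ 2) = (C' + 1) * tau by field; rewrite !gt_eqF.
  lra.
apply: le_trans low.
have Icp : leb3.-integrable setT (EFin \o (fun x => (C' + 1) * pc x)) by exact: intgZ.
rewrite RintegralZl//; last exact: intgB.
rewrite RintegralB// RintegralZl//.
have v1 := hvol (k tau) kk1; have v2 := hcone (k tau) kk.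
rewrite -/(ph) in v1; rewrite -/(pc) in v2.
have X0 : 0 <= (k tau)^-1 ^+ 3 * expR (- (2 * k tau * d)) by have := k0; move=> ?; pos.
have v3 : (k tau)^-1 ^+ 3 * expR (- (2 * k tau * d)) <= \int[leb3]_x ph x - (C' + 1) * \int[leb3]_x pc x.
  have C'1 : 0 <= C' + 1 by pos.
  have := ler_wpM2l C'1 v2; move: v1; rewrite -!(mulrA _ ((k tau)^-1 ^+ 3)).
  move: (\int[leb3]_x ph x) (\int[leb3]_x pc x) ((k tau)^-1 ^+ 3 * _) => P Q X.
  by rewrite mulrDl mul1r -(mulrA _ Cc); lra.
have St : 0 <= S * tau by pos.
apply: le_trans (ler_wpM2l St v3).
have oAl := oA_lower k0 keta.
have oA2 : (expR (k tau * eta) / (2 * k tau ^+ 3)) ^+ 2 <= oA (k tau) eta ^+ 2.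
  have h : 0 <= expR (k tau * eta) / (2 * k tau ^+ 3) by have := k0; move=> ?; pos.
  by apply: lerXn2r; rewrite ?nnegrE// (le_trans h).
have f2 : 0 <= ft tau ^+ 2 by exact: sqr_ge0.
have de0 : 0 < d - eta by rewrite subr_gt0.
have kaff := wnum_le_affine eps00 mu00 sigma00 t0; rewrite -/s0 -/kc in kaff.
have e1 : expR (- (2 * kc * (d - eta))) * decay tau ^+ 2 <= expR (- (2 * k tau * (d - eta))).
  rewrite decay_sqr -expRD ler_expR -/s0.
  have := ler_wpM2r (ltW de0) kaff; lra.
have e2 : (km ^+ 9 * tau ^+ 9)^-1 <= (k tau ^+ 9)^-1.
  rewrite -exprMn lef_pV2 ?posrE ?exprn_gt0//; last by pos.
  by apply: lerXn2r; rewrite ?nnegrE ?(ltW k0)//; pos.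
apply: (@le_trans _ _ (ft tau ^+ 2 * tau * ((km ^+ 9 * tau ^+ 9)^-1 / 4) * (expR (- (2 * kc * (d - eta))) * decay tau ^+ 2))).
  rewrite le_eqVlt; apply/orP; left; apply/eqP; rewrite /cq; field; rewrite !gt_eqF//.
apply: (@le_trans _ _ (ft tau ^+ 2 * tau * ((k tau ^+ 9)^-1 / 4) * expR (- (2 * k tau * (d - eta))))).
  apply: ler_pM => //.
  - by have k9 : 0 < km ^+ 9 * tau ^+ 9; pos.
  - by pos.
  - by apply: ler_wpM2l; [pos|apply: ler_wpM2r => //; pos].
have -> : ft tau ^+ 2 * tau * ((k tau ^+ 9)^-1 / 4) * expR (- (2 * k tau * (d - eta))) =
   ft tau ^+ 2 * (expR (k tau * eta) / (2 * k tau ^+ 3)) ^+ 2 * tau * ((k tau)^-1 ^+ 3 * expR (- (2 * k tau * d))).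
  have -> : expR (- (2 * k tau * (d - eta))) = expR (k tau * eta) ^+ 2 * expR (- (2 * k tau * d)).
    by rewrite expr2 -!expRD; congr expR; ring.
  by field; rewrite gt_eqF.
apply: ler_wpM2r => //; apply: ler_wpM2r; first exact: ltW.
by rewrite /S; apply: ler_wpM2l.
Qed.

End incident.

(** * Bounds for a single solution *)

Section contrast_arithmetic.
Variable R : realFieldType.
Implicit Types (t e M B G X : R).

Lemma field_arith t e M B G X c nv nh : 1 <= t -> 0 < e -> 0 <= M -> 0 <= B -> 0 <= G -> 0 <= c ->
  nv <= B -> nh <= B -> t * e * X <= 2 * (2 * M * t * (nv + nh) + G * c) ->
  X <= (8 * M + 2 * c) / e * (B + G).
Proof.
move=> t1 e0 M0 B0 G0 c0 vB hB.
have t0 : 0 < t by lra.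
have te0 : 0 < t * e by pos.
move=> h; rewrite -(ler_pM2l te0); apply: (le_trans h).
have -> : t * e * ((8 * M + 2 * c) / e * (B + G)) = t * (8 * M + 2 * c) * (B + G) by field; rewrite gt_eqF.
have h1 : 2 * M * t * (nv + nh) <= 2 * M * t * (2 * B) by apply: ler_wpM2l; [pos|lra].
have h2 : G * c <= t * (G * c) by rewrite ler_peMl//; pos.
have h3 : 0 <= t * c * B by pos.
have h4 : 0 <= t * M * G by pos.
lra.
Qed.

Lemma indicator_arith t M B G C r s nv nh cE cH v h Cv I0 : 0 <= t -> 0 <= M -> 0 <= B -> 0 <= G -> 0 <= r -> 0 <= s ->
  0 <= nv -> 0 <= nh -> 0 <= cE -> 0 <= cH -> 0 <= C -> 0 <= Cv ->
  nv <= B -> nh <= B -> r + s <= C * (B + G) -> v <= Cv -> h <= Cv ->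
  I0 <= 2 * M * t * (nv * (r + nv) + nh * (s + nh)) + G * cH * h + G * cE * v ->
  I0 <= 2 * M * (C + 2) * (t * (B * (B + G))) + (cE + cH) * (G * Cv).
Proof.
move=> t0 M0 B0 G0 r0 s0 nv0 nh0 cE0 cH0 C0 Cv0 vB hB rs vC hC hI; apply: (le_trans hI).
have a1 : nv * (r + nv) <= B * (r + B) by apply: ler_pM; lra.
have a2 : nh * (s + nh) <= B * (s + B) by apply: ler_pM; lra.
have a3 : B * (r + s) <= B * (C * (B + G)) by exact: ler_wpM2l.
have a4 : G * cH * h <= G * cH * Cv by apply: ler_wpM2l => //; pos.
have a5 : G * cE * v <= G * cE * Cv by apply: ler_wpM2l => //; pos.
have a6 : nv * (r + nv) + nh * (s + nh) <= (C + 2) * (B * (B + G)).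
  have : 0 <= B * G by pos.
  lra.
have tM : 0 <= 2 * M * t by pos.
have := ler_wpM2l tM a6; lra.
Qed.

Lemma dist_bounded x y M : 0 <= x -> x <= M -> 0 <= y -> y <= M -> `|x - y| <= M.
Proof. by move=> x0 xM y0 yM; rewrite ler_norml; apply/andP; split; lra. Qed.

Lemma decay_arith t C D X G Y : 0 <= t -> 0 <= C -> 0 <= D -> 0 <= X -> 0 <= G -> 0 <= Y ->
  C * (t * (D * X * (D * X + G)) + Y) <= C * (D + 1) * (D + 1) * (t * (X * (X + G)) + Y).
Proof.
move=> t0 C0 D0 X0 G0 Y0; rewrite -!(mulrA C); apply: ler_wpM2l => //.
have h1 : 0 <= t * (X * X) by pos.
have h2 : 0 <= t * (X * G) by pos.
have h3 : 0 <= D * (t * (X * X)) by pos.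
have h4 : 0 <= D * (t * (X * G)) by pos.
have h5 : 0 <= D * (D * (t * (X * G))) by pos.
have h6 : 0 <= D * Y by pos.
have h7 : 0 <= D * (D * Y) by pos.
lra.
Qed.

Lemma decay_arith1 C D X G : 0 <= C -> 0 <= D -> 0 <= X -> 0 <= G ->
  C * (D * X + G) <= C * (D + 1) * (D + 1) * (X + G).
Proof.
move=> C0 D0 X0 G0; rewrite -!(mulrA C); apply: ler_wpM2l => //.
have h1 : 0 <= D * X by pos.
have h2 : 0 <= D * G by pos.
have h3 : 0 <= D * (D * X) by pos.
have h4 : 0 <= D * (D * G) by pos.
lra.
Qed.

End contrast_arithmetic.

Section solution.
Context {R : realType}.
Notation rV3 := 'rV[R]_3.
Notation leb3 := (@leb3 R).
Variables (eps0 mu0 sigma0 T : R) (f : R -> R) (p a : rV3) (eta : R) (D : set rV3).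
Hypotheses (eps00 : 0 < eps0) (mu00 : 0 < mu0) (sigma00 : 0 <= sigma0) (T0 : 0 < T)
  (cf : {within `[0, T]%classic, continuous f}) (eta0 : 0 < eta) (mD : measurable D).
Variables (eps mu sigma : rV3 -> R) (e M : R).
Hypotheses (meps : measurable_fun setT eps) (mmu : measurable_fun setT mu) (msigma : measurable_fun setT sigma)
  (e0 : 0 < e) (beps : forall x, e <= eps x <= M) (bmu : forall x, e <= mu x <= M)
  (bsigma : forall x, 0 <= sigma x <= M)
  (eps0M : eps0 <= M) (mu0M : mu0 <= M) (sigma0M : sigma0 <= M)
  (offD : forall x, ~ D x -> [/\ eps x = eps0, mu x = mu0 & sigma x = sigma0]).
Variables (E H : R -> rV3 -> rV3).
Hypothesis sol : maxwell_solution T eps mu sigma (source f (eball p eta) a) E H.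

Notation V := (incV eps0 mu0 sigma0 T f p a eta).
Notation Vh := (incH eps0 mu0 sigma0 T f p a eta).
Notation F := (sourceF T f p a eta).
Notation We := (laplaceT T E).
Notation Wh := (laplaceT T H).
Notation gE := (endE T eps E).
Notation gH := (endH T mu H).
Notation G tau := (expR (- tau * T)).

(** The indicator function with the transform of the background solution replaced by the explicit
    incident field. *)
Definition pairing tau := ip (F tau) (We tau) - ip (F tau) (V tau).

Let M0 : 0 <= M. Proof. exact: le_trans sigma0M. Qed.
Let neps x : `|eps x| <= M.
Proof. by have /andP[h1 h2] := beps x; rewrite ger0_norm// (le_trans (ltW e0)). Qed.
Let nmu x : `|mu x| <= M.
Proof. by have /andP[h1 h2] := bmu x; rewrite ger0_norm// (le_trans (ltW e0)). Qed.
Let nsigma x : `|sigma x| <= M.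
Proof. by have /andP[h1 h2] := bsigma x; rewrite ger0_norm. Qed.

Let beta tau x := tau * eps x + sigma x.
Let m tau x := tau * mu x.
Let Mt tau := tau * M + M.

Let mbeta tau : measurable_fun setT (beta tau).
Proof. by apply: measurable_funD => //; exact: measurable_funM. Qed.
Let mm tau : measurable_fun setT (m tau).
Proof. exact: measurable_funM. Qed.

Let bbeta tau : 0 < tau -> forall x, tau * e <= beta tau x <= Mt tau.
Proof.
move=> t0 x; have /andP[h1 h2] := beps x; have /andP[h3 h4] := bsigma x.
by rewrite /beta /Mt -[tau * e]addr0 !lerD// ler_wpM2l// ltW.
Qed.

Let bm tau : 0 < tau -> forall x, tau * e <= m tau x <= Mt tau.
Proof.
move=> t0 x; have /andP[h1 h2] := bmu x.
rewrite /m /Mt ler_wpM2l ?(ltW t0)//=.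
by apply: le_trans (ler_wpM2l (ltW t0) h2) _; rewrite lerDl.
Qed.

Let LM := laplace_maxwell T0 cf meps mmu msigma neps nmu nsigma eta0 sol.

Let cE := nrm (fun x => eps x *: E T x).
Let cH := nrm (fun x => mu x *: H T x).
Let cE0 : 0 <= cE. Proof. exact: nrm_ge0. Qed.
Let cH0 : 0 <= cH. Proof. exact: nrm_ge0. Qed.

(** The size B of the incident field on D is left abstract, so that the lemma applies both to the
    obstacle, with exponential decay, and to the background solution, with D empty and B = 0. *)
Lemma pairing_bound (B : R -> R) :
  (forall tau, 1 <= tau -> nrm (onD D (V tau)) <= B tau /\ nrm (onD D (Vh tau)) <= B tau) ->
  exists2 C, 0 <= C & forall tau, 1 <= tau ->
    nrm (fun x => We tau x - V tau x) + nrm (fun x => Wh tau x - Vh tau x) <= C * (B tau + G tau) /\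
    `|pairing tau| <= C * (tau * (B tau * (B tau + G tau)) + G tau / tau ^+ 2).
Proof.
move=> hB.
have [Cv Cv0 hv] := incident_small p a eps00 mu00 sigma00 T0 cf eta0.
pose CX := (8 * M + 2 * (cE + cH)) / e.
have CX0 : 0 <= CX by rewrite /CX; pos.
exists (CX + 2 * M * (CX + 2) + (cE + cH) * Cv); first by pos.
move=> tau t1; have t0 : 0 < tau by lra.
have [C1 C2 LE LH] := LM tau.
have C3 := weak_curl_incV T f p a eps00 mu00 sigma00 eta0 t0.
have C4 := weak_curl_incH T f p a eps00 mu00 sigma00 eta0 t0.
have [LgE LgH] := L2field_end meps mmu neps nmu tau LE LH.
have LF := L2field_sourceF T f p a eta0 tau.
have K0 : 0 <= 2 * M * tau by pos.
have Kb x : `|beta tau x - beta0 eps0 sigma0 tau| <= 2 * M * tau.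
  have -> : beta tau x - beta0 eps0 sigma0 tau = tau * (eps x - eps0) + (sigma x - sigma0) by rewrite /beta /beta0; ring.
  apply: le_trans (ler_normD _ _) _; rewrite normrM (gtr0_norm t0).
  have h1 : `|eps x - eps0| <= M.
    by have /andP[h1 h2] := beps x; apply: dist_bounded => //; [exact: le_trans (ltW e0) h1|exact: ltW].
  have h2 : `|sigma x - sigma0| <= M.
    by have /andP[h3 h2] := bsigma x; exact: dist_bounded.
  have := ler_wpM2l (ltW t0) h1; have := ler_wpM2r M0 t1; lra.
have Km x : `|m tau x - tau * mu0| <= 2 * M * tau.
  rewrite -mulrBr normrM (gtr0_norm t0).
  have h1 : `|mu x - mu0| <= M.
    by have /andP[h1 h2] := bmu x; apply: dist_bounded => //; [exact: le_trans (ltW e0) h1|exact: ltW].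
  have := ler_wpM2l (ltW t0) h1; have := mulr_ge0 M0 (ltW t0); lra.
have oD x : ~ D x -> beta tau x = beta0 eps0 sigma0 tau /\ m tau x = tau * mu0.
  by move=> /offD[h1 h2 h3]; rewrite /beta /m h1 h2 h3.
have te0 : 0 < tau * e by pos.
have EB := energy_bound (@mbeta tau) (@mm tau) mD te0 (bbeta t0) (bm t0) LgE LgH LF C1 C2 C3 C4 K0 Kb Km oD.
have IU := indicator_upper (@mbeta tau) (@mm tau) mD te0 (bbeta t0) (bm t0) LgE LgH LF C1 C2 C3 C4 K0 Kb Km oD.
have [hB1 hB2] := hB tau t1; have [hv1 hv2] := hv tau t1.
rewrite -/(pairing tau) in IU.
rewrite (nrm_endE meps neps tau LE) (nrm_endH mmu nmu tau LH) -/cE -/cH in EB IU.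
have nV0 := nrm_ge0 (onD D (V tau)); have nH0 := nrm_ge0 (onD D (Vh tau)).
have r0 := nrm_ge0 (fun x => We tau x - V tau x); have s0 := nrm_ge0 (fun x => Wh tau x - Vh tau x).
move: EB IU hB1 hB2 hv1 hv2 nV0 nH0 r0 s0.
move: (nrm (onD D (V tau))) (nrm (onD D (Vh tau))) (nrm (V tau)) (nrm (Vh tau)) => nv nh v h.
move: (nrm (fun x => We tau x - V tau x)) (nrm (fun x => Wh tau x - Vh tau x)) `|pairing tau| => r s I0.
move=> EB IU hB1 hB2 hv1 hv2 nV0 nH0 r0 s0.
have B0 := le_trans nV0 hB1.
have G0 := expR_ge0 (- tau * T).
have c0 : 0 <= cE + cH by pos.
rewrite -addrA -mulrDr in EB.
have X := field_arith t1 e0 M0 B0 G0 c0 hB1 hB2 EB; rewrite -/CX in X.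
have Ct0 : 0 <= Cv / tau ^+ 2 by pos.
have I1 := indicator_arith (ltW t0) M0 B0 G0 r0 s0 nV0 nH0 cE0 cH0 CX0 Ct0 hB1 hB2 X hv1 hv2 IU.
split.
  apply: le_trans X _; apply: ler_wpM2r; first by pos.
  have : 0 <= 2 * M * (CX + 2) + (cE + cH) * Cv by pos.
  lra.
apply: le_trans I1 _.
have q1 : 0 <= tau * (B tau * (B tau + G tau)) by have := ltW t0 => ?; pos.
have q2 : 0 <= G tau / tau ^+ 2 by pos.
have -> : (cE + cH) * (G tau * (Cv / tau ^+ 2)) = (cE + cH) * Cv * (G tau / tau ^+ 2) by ring.
have p1 : 0 <= CX * (tau * (B tau * (B tau + G tau)) + G tau / tau ^+ 2) by pos.
have p2 : 0 <= 2 * M * (CX + 2) * (G tau / tau ^+ 2) by pos.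
have p3 : 0 <= (cE + cH) * Cv * (tau * (B tau * (B tau + G tau))) by pos.
move: (tau * (B tau * (B tau + G tau))) (G tau / tau ^+ 2) q1 q2 p1 p2 p3 => x y.
move: ((cE + cH) * Cv) (2 * M * (CX + 2)) => u w.
lra.
Qed.

Variables (d Rm : R) (q : rV3).
Hypotheses (a1 : enorm a = 1) (etad : eta < d) (dD : forall x, D x -> d <= rad p x) (DR : forall x, D x -> rad p x <= Rm)
  (qd : rad p q = d) (bq : bdry D q) (C2bd : C2_boundary D).

Notation dk := (decay eps0 mu0 eta d).

Lemma decay_le1 tau : 0 <= tau -> dk tau <= 1.
Proof.
move=> t0; rewrite /decay -expR0 ler_expR mulNr oppr_le0; apply: mulr_ge0 => //.
by apply: mulr_ge0; rewrite ?sqrtr_ge0// subr_ge0 ltW.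
Qed.

Lemma pairing_upper : exists2 C, 0 <= C & forall tau, 1 <= tau ->
  nrm (fun x => We tau x - V tau x) + nrm (fun x => Wh tau x - Vh tau x) <= C * (dk tau + G tau) /\
  `|pairing tau| <= C * (tau * (dk tau * (dk tau + G tau)) + G tau / tau ^+ 2).
Proof.
have [Cd Cd0 hd] := incident_onD eps00 mu00 sigma00 T0 cf a1 eta0 etad mD dD DR.
have [C C0 hC] := pairing_bound hd.
exists (C * (Cd + 1) * (Cd + 1)); first by pos.
move=> tau t1; have [h1 h2] := hC tau t1.
have D0 : 0 <= dk tau by exact: expR_ge0.
have G0 : 0 <= G tau by exact: expR_ge0.
have t0 : 0 < tau by exact: lt_le_trans t1.
split; first by apply: le_trans h1 _; exact: decay_arith1.
by apply: le_trans h2 _; apply: decay_arith => //; pos.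
Qed.

(** Crude bounds suffice here: above the threshold any constant times e^{-tau T} is dominated by the
    main term of the lower estimates. *)
Let error_bound : exists2 C, 0 <= C & forall tau, 1 <= tau ->
  nrm (gH tau) * (nrm (Vh tau) + nrm (fun x => Wh tau x - Vh tau x)) +
  nrm (gE tau) * (nrm (V tau) + nrm (fun x => We tau x - V tau x)) <= C * G tau.
Proof.
have [C C0 hC] := pairing_upper.
have [Cv Cv0 hv] := incident_small p a eps00 mu00 sigma00 T0 cf eta0.
exists ((cE + cH) * (Cv + C * 2)); first by pos.
move=> tau t1; have [h1 _] := hC tau t1; have [hv1 hv2] := hv tau t1.
have t0 : 0 < tau by exact: lt_le_trans t1.
have [_ _ LE LH] := LM tau.
rewrite (nrm_endE meps neps tau LE) (nrm_endH mmu nmu tau LH) -/cE -/cH.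
have D1 := decay_le1 (ltW t0).
have G1 : G tau <= 1 by rewrite -expR0 ler_expR mulNr oppr_le0; pos.
have G0 := expR_ge0 (- tau * T).
have cv : Cv / tau ^+ 2 <= Cv by rewrite ler_pdivrMr ?exprn_gt0// ler_peMr// exprn_ege1.
have X : nrm (fun x => We tau x - V tau x) + nrm (fun x => Wh tau x - Vh tau x) <= C * 2.
  by apply: le_trans h1 _; apply: ler_wpM2l => //; rewrite -[2]/(1 + 1) lerD.
have r0 := nrm_ge0 (fun x => We tau x - V tau x); have s0 := nrm_ge0 (fun x => Wh tau x - Vh tau x).
move: X (le_trans hv1 cv) (le_trans hv2 cv) r0 s0.
move: (nrm (fun x => We tau x - V tau x)) (nrm (fun x => Wh tau x - Vh tau x)) (nrm (V tau)) (nrm (Vh tau)) => r s v h.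
move=> X v1 h0 r0 s0.
have gE0 : 0 <= G tau * cE by exact: mulr_ge0.
have gH0 : 0 <= G tau * cH by exact: mulr_ge0.
have -> : (cE + cH) * (Cv + C * 2) * G tau = G tau * cH * (Cv + C * 2) + G tau * cE * (Cv + C * 2) by ring.
by apply: lerD; apply: ler_wpM2l => //; apply: lerD => //; apply: le_trans X; rewrite ?lerDl ?lerDr.
Qed.

Let ind_bound (b c : R) x : (D x -> b <= c) -> (~ D x -> 0 <= c) -> \1_D x * b <= c.
Proof.
move=> h1 h2; rewrite indicE; have [|] := boolP (x \in D); first by rewrite inE mul1r => /h1.
by move=> /negP; rewrite inE mul0r => /h2.
Qed.

(** One constant for both contrasts A1 and A2 and for the terms of order one in tau created by the
    conductivity; the last summand serves the case of condition (A.I). *)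
Let M' := M + M ^+ 2 / e + 3 * M ^+ 2 / e.

Let quot_bound c x : 0 <= c -> c <= M -> e <= x -> 0 <= c ^+ 2 / x <= M ^+ 2 / e.
Proof.
move=> c0 cM ex; have x0 : 0 < x by exact: lt_le_trans ex.
apply/andP; split; first by pos.
by apply: ler_pM => //; [pos|pos|apply: lerXn2r|rewrite lef_pV2].
Qed.

Let diff_bound c y : 0 <= c -> c <= M -> 0 <= y -> y <= M \/ y <= M ^+ 2 / e -> `|c - y| <= M'.
Proof.
move=> c0 cM y0 yM; have h : 0 <= M ^+ 2 / e by pos.
rewrite /M' -mulrA; move: (M ^+ 2 / e) yM h => w yM h.
by rewrite ler_norml; apply/andP; split; case: yM; lra.
Qed.

Let M'0 : 0 <= M'. Proof. by rewrite /M'; pos. Qed.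

Let M'M : M <= M'. Proof. by rewrite /M' -addrA lerDl; pos. Qed.

(** With A1 = eps0 - eps and A2 = mu0 - mu0^2/mu, the sum A1/eps0 + A2/mu0 is exactly the left side
    of the jump condition. The conductivity contributes sigma0 - sigma, which M' absorbs. *)
Lemma pairing_lowerII : jumpII eps0 mu0 eps mu D ->
  exists cq tq C, [/\ 0 < cq, 1 <= tq, 0 <= C & forall tau, tq <= tau ->
    cq * laplace T f tau ^+ 2 / tau ^+ 8 * dk tau ^+ 2 - C * G tau <= pairing tau].
Proof.
move=> [c c0 jump].
have [C C0 hC] := error_bound.
pose A1 (x : rV3) := eps0 - eps x; pose A2 (x : rV3) := mu0 - mu0 ^+ 2 / mu x.
have mA1 : measurable_fun setT A1 by exact: measurable_funB.
have mA2 : measurable_fun setT A2.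
  by apply: measurable_funB => //; apply: measurable_funM => //; exact: (measurableT_comp measurable_inv mmu).
have qmu x : 0 <= mu0 ^+ 2 / mu x <= M ^+ 2 / e.
  by apply: quot_bound => //; [exact: ltW|have /andP[] := bmu x].
have nA1 x : `|A1 x| <= M'.
  have /andP[h1 h2] := beps x; apply: diff_bound => //; [exact: ltW|exact: le_trans (ltW e0) h1|by left].
have nA2 x : `|A2 x| <= M'.
  have /andP[h1 h2] := qmu x; apply: diff_bound => //; [exact: ltW|by right].
have jA : {ae leb3, forall x, D x -> c <= A1 x / eps0 + A2 x / mu0}.
  apply: filterS jump => x h Dx; apply: le_trans (h Dx) _; rewrite le_eqVlt; apply/orP; left; apply/eqP.
  have /andP[mx _] := bmu x; have mx0 := lt_le_trans e0 mx.
  by rewrite /A1 /A2; field; rewrite !gt_eqF.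
have [cq [tq [cq0 tq1 hq]]] := incident_lower T f eps00 mu00 sigma00 a1 eta0 etad mD dD DR qd bq C2bd M'0 c0 mA1 mA2 nA1 nA2 jA.
exists cq, tq, C; split => // tau tt.
have t1 : 1 <= tau by exact: le_trans tt.
have t0 : 0 < tau by exact: lt_le_trans t1.
have [Ig lg] := hq tau tt.
have [C1 C2 LE LH] := LM tau.
have C3 := weak_curl_incV T f p a eps00 mu00 sigma00 eta0 t0.
have C4 := weak_curl_incH T f p a eps00 mu00 sigma00 eta0 t0.
have [LgE LgH] := L2field_end meps mmu neps nmu tau LE LH.
have LF := L2field_sourceF T f p a eta0 tau.
have te0 : 0 < tau * e by pos.
have w1 x : \1_D x * (tau * A1 x - M') <= beta0 eps0 sigma0 tau - beta tau x.
  apply: ind_bound => [_|nD]; rewrite /beta0 /beta; last by have [-> _ ->] := offD nD; rewrite subrr.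
  have /andP[h1 h2] := bsigma x; rewrite /A1; have := sigma00; move: (M') (le_trans h2 M'M) => N NM; lra.
have w2 x : \1_D x * (tau * A2 x) <= tau * mu0 - (tau * mu0) ^+ 2 / m tau x.
  have /andP[mx _] := bmu x; have mx0 := lt_le_trans e0 mx.
  have -> : tau * mu0 - (tau * mu0) ^+ 2 / m tau x = tau * A2 x by rewrite /m /A2; field; rewrite !gt_eqF.
  apply: ind_bound => // nD; have [_ h _] := offD nD.
  by rewrite /A2 h expr2 mulfK ?gt_eqF// subrr mulr0.
have LB := lowerII (@mbeta tau) (@mm tau) te0 (bbeta t0) (bm t0) LgE LgH LF C1 C2 C3 C4 Ig w1 w2.
apply: le_trans LB; apply: lerB => //; exact: hC.
Qed.

(** The completed square now lies on the electric side, so A1 = eps0 - eps0^2/eps and A2 = mu0 - mu.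
    The conductivity enters the quotient beta0^2/beta, which has to be expanded in tau. *)
Lemma pairing_lowerI : jumpI eps0 mu0 eps mu D ->
  exists cq tq C, [/\ 0 < cq, 1 <= tq, 0 <= C & forall tau, tq <= tau ->
    cq * laplace T f tau ^+ 2 / tau ^+ 8 * dk tau ^+ 2 - C * G tau <= - pairing tau].
Proof.
move=> [c c0 jump].
have [C C0 hC] := error_bound.
pose A1 (x : rV3) := eps0 - eps0 ^+ 2 / eps x; pose A2 (x : rV3) := mu0 - mu x.
have mA2 : measurable_fun setT A2 by exact: measurable_funB.
have mA1 : measurable_fun setT A1.
  by apply: measurable_funB => //; apply: measurable_funM => //; exact: (measurableT_comp measurable_inv meps).
have qeps x : 0 <= eps0 ^+ 2 / eps x <= M ^+ 2 / e.
  by apply: quot_bound => //; [exact: ltW|have /andP[] := beps x].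
have nA2 x : `|A2 x| <= M'.
  have /andP[h1 h2] := bmu x; apply: diff_bound => //; [exact: ltW|exact: le_trans (ltW e0) h1|by left].
have nA1 x : `|A1 x| <= M'.
  have /andP[h1 h2] := qeps x; apply: diff_bound => //; [exact: ltW|by right].
have jA : {ae leb3, forall x, D x -> c <= A1 x / eps0 + A2 x / mu0}.
  apply: filterS jump => x h Dx; apply: le_trans (h Dx) _; rewrite le_eqVlt; apply/orP; left; apply/eqP.
  have /andP[mx _] := beps x; have mx0 := lt_le_trans e0 mx.
  by rewrite /A1 /A2; field; rewrite !gt_eqF.
have [cq [tq [cq0 tq1 hq]]] := incident_lower T f eps00 mu00 sigma00 a1 eta0 etad mD dD DR qd bq C2bd M'0 c0 mA1 mA2 nA1 nA2 jA.
exists cq, tq, C; split => // tau tt.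
have t1 : 1 <= tau by exact: le_trans tt.
have t0 : 0 < tau by exact: lt_le_trans t1.
have [Ig lg] := hq tau tt.
have [C1 C2 LE LH] := LM tau.
have C3 := weak_curl_incV T f p a eps00 mu00 sigma00 eta0 t0.
have C4 := weak_curl_incH T f p a eps00 mu00 sigma00 eta0 t0.
have [LgE LgH] := L2field_end meps mmu neps nmu tau LE LH.
have LF := L2field_sourceF T f p a eta0 tau.
have te0 : 0 < tau * e by pos.
have w1 x : \1_D x * (tau * A1 x - M') <= beta0 eps0 sigma0 tau - beta0 eps0 sigma0 tau ^+ 2 / beta tau x.
  have /andP[mx _] := beps x; have mx0 := lt_le_trans e0 mx.
  have /andP[s0 _] := bsigma x; have b00 := beta0_gt0 eps00 sigma00 t0.
  apply: ind_bound => [_|nD]; last first.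
    have -> : beta tau x = beta0 eps0 sigma0 tau by rewrite /beta0 /beta; have [-> _ ->] := offD nD.
    by rewrite expr2 mulfK ?gt_eqF// subrr.
  have tx0 : 0 < tau * eps x by pos.
  have txb : tau * eps x <= beta tau x by rewrite lerDl.
  (* Dropping sigma >= 0 from the denominator leaves tau eps0^2/eps plus a remainder bounded by 3
     M^2 / e. *)
  have h1 : beta0 eps0 sigma0 tau ^+ 2 / beta tau x <= beta0 eps0 sigma0 tau ^+ 2 / (tau * eps x).
    by apply: ler_wpM2l; [pos|rewrite lef_pV2 ?posrE// (lt_le_trans tx0)].
  have h2 : beta0 eps0 sigma0 tau ^+ 2 / (tau * eps x) =
      tau * (eps0 ^+ 2 / eps x) + (2 * eps0 * sigma0 + sigma0 ^+ 2 / tau) / eps x.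
    by rewrite /beta0; field; rewrite !gt_eqF.
  have h3 : (2 * eps0 * sigma0 + sigma0 ^+ 2 / tau) / eps x <= 3 * M ^+ 2 / e.
    apply: ler_pM; [pos|pos| |by rewrite lef_pV2].
    have e1 : eps0 * sigma0 <= M * M by apply: ler_pM => //; exact: ltW.
    have e2 : sigma0 ^+ 2 / tau <= M * M.
      rewrite ler_pdivrMr//; apply: le_trans (_ : M * M <= _); first by rewrite expr2 ler_pM.
      by rewrite ler_peMr//; pos.
    rewrite -(mulrA 2) (expr2 M); move: (eps0 * sigma0) (sigma0 ^+ 2 / tau) (M * M) e1 e2 => u v w; lra.
  have h4 : beta0 eps0 sigma0 tau = tau * eps0 + sigma0 by [].
  have h5 : 3 * M ^+ 2 / e <= M' by rewrite /M' lerDr; pos.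
  move: h1; rewrite h2 h4 /A1; move: h3 h5; move: (M') (3 * M ^+ 2 / e) ((2 * _ * _ + _) / _) ((_ + _) ^+ 2 / _) (eps0 ^+ 2 / eps x) => u v w y z.
  rewrite mulrBr; move: (tau * eps0) (tau * z) => r s; have := sigma00; lra.
have w2 x : \1_D x * (tau * A2 x) <= tau * mu0 - m tau x.
  rewrite -mulrBr; apply: ind_bound => // nD; have [_ h _] := offD nD.
  by rewrite h subrr mulr0.
have LB := lowerI (@mbeta tau) (@mm tau) te0 (bbeta t0) (bm t0) LgE LgH LF C1 C2 C3 C4 Ig w1 w2.
apply: le_trans LB; apply: lerB => //; exact: hC.
Qed.

End solution.

(** * Limits as tau tends to infinity *)

Section asymptotics.
Context {R : realType}.
Implicit Types (I J h : R -> R) (s T C c : R).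

(** With k = a/(n + 1), e^{at} = (e^{kt})^{n+1} >= (kt)^{n+1}, so the product is at most a constant
    over t. *)
Lemma poly_exp_small n (a b : R) : 0 < a -> 0 < b ->
  exists2 t1 : R, 1 <= t1 & forall t, t1 <= t -> t ^+ n * expR (- a * t) <= b.
Proof.
move=> a0 b0.
pose k := a / n.+1%:R; have k0 : 0 < k by rewrite divr_gt0.
exists (1 + (k ^+ n.+1)^-1 / b); first by rewrite lerDl; pos.
move=> t tt.
have t0 : 0 < t by apply: lt_le_trans tt; rewrite ltr_wpDr//; pos.
have e1 : expR (- a * t) = (expR (k * t) ^+ n.+1)^-1.
  rewrite -expRM_natl -expRN; congr expR; rewrite /k -mulr_natl; field.
  by rewrite addrC natr1 pnatr_eq0.
have e2 : (k * t) ^+ n.+1 <= expR (k * t) ^+ n.+1.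
  apply: lerXn2r; rewrite ?nnegrE ?expR_ge0//; first by pos.
  by apply: le_trans (expR_ge1Dx _); rewrite lerDr.
have kt0 : 0 < (k * t) ^+ n.+1 by pos.
apply: (@le_trans _ _ (t ^+ n / (k * t) ^+ n.+1)).
  rewrite e1; apply: ler_wpM2l; first by pos.
  by rewrite lef_pV2 ?posrE// exprn_gt0// expR_gt0.
have -> : t ^+ n / (k * t) ^+ n.+1 = (k ^+ n.+1)^-1 / t.
  by rewrite exprMn (exprS t); field; rewrite !expf_neq0// ?gt_eqF.
rewrite ler_pdivrMr// -ler_pdivrMl//.
by apply: le_trans tt; rewrite mulrC lerDr.
Qed.

Lemma near_pinfty t1 (P : R -> Prop) : (forall t, t1 <= t -> P t) -> \forall t \near +oo, P t.
Proof. by move=> h; exists t1; split => [|t /ltW/h//]; rewrite num_real. Qed.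

(** Multiplied by e^{tT}, the bound becomes C times the sum of t e^{-(2s - T)t}, t e^{-st} and
    t^{-2}; each is made at most e / (3 (C + 1)). *)
Lemma indicator_cvg0 I s T C : 0 < s -> 0 < T -> T < 2 * s -> 0 <= C ->
  (forall t, 1 <= t -> `|I t| <= C * (t * (expR (- s * t) * (expR (- s * t) + expR (- t * T))) + expR (- t * T) / t ^+ 2)) ->
  (fun t => expR (t * T) * I t) @ +oo --> (0 : R).
Proof.
move=> s0 T0 Ts C0 hI; apply/cvgrPdist_le => e e0.
have e'0 : 0 < e / (3 * (C + 1)) by pos.
have ts0 : 0 < 2 * s - T by rewrite subr_gt0.
have [t1 t11 h1] := poly_exp_small 1 ts0 e'0.
have [t2 t21 h2] := poly_exp_small 1 s0 e'0.
apply: (@near_pinfty (t1 + t2 + (e / (3 * (C + 1)))^-1)) => t tt.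
have i0 : 0 < (e / (3 * (C + 1)))^-1 by rewrite invr_gt0.
have {}h1 := h1 t ltac:(lra); have {}h2 := h2 t ltac:(lra).
have t0 : 0 < t by lra.
have tl1 : 1 <= t by lra.
have h3 : (t ^+ 2)^-1 <= e / (3 * (C + 1)).
  apply: (@le_trans _ _ t^-1); first by rewrite lef_pV2 ?posrE//; [rewrite expr2 ler_peMr// ltW|pos].
  by rewrite -[leRHS]invrK lef_pV2 ?posrE//; lra.
rewrite sub0r normrN normrM (ger0_norm (expR_ge0 _)).
apply: le_trans (ler_wpM2l (expR_ge0 _) (hI t tl1)) _.
have E1 : expR (t * T) * expR (- t * T) = 1 by rewrite -expRD mulNr addrN expR0.
have E2 : expR (t * T) * (expR (- s * t) * expR (- s * t)) = expR (- (2 * s - T) * t).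
  by rewrite -!expRD; congr expR; ring.
move: h1 h2 h3 E1 E2; rewrite expr1.
move: (expR (t * T)) (expR (- t * T)) (expR (- s * t)) (expR (- (2 * s - T) * t)) (t ^+ 2)^-1 => x y z w v h1 h2 h3 E1 E2.
have -> : x * (C * (t * (z * (z + y)) + y * v)) = C * (t * (x * (z * z)) + (x * y) * (t * z) + (x * y) * v) by ring.
rewrite E1 E2 !mul1r.
apply: (@le_trans _ _ (C * (e / (3 * (C + 1)) + e / (3 * (C + 1)) + e / (3 * (C + 1))))).
  by apply: ler_wpM2l => //; apply: lerD => //; exact: lerD.
have -> : C * (e / (3 * (C + 1)) + e / (3 * (C + 1)) + e / (3 * (C + 1))) = e * (C / (C + 1)).
  by field; rewrite gt_eqF//; lra.
by rewrite ler_piMr ?(ltW e0)// ler_pdivrMr; lra.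
Qed.

(** A positive lower limit is a positive infimum on some half-line. The real exponent g is replaced
    by a natural number above it, which only weakens the bound for t >= 1. *)
Lemma liminf_poly (g : R) (h : R -> R) :
  (0 < limf_einf (fun t : R => (t `^ g * `|h t|)%:E) (pinfty_nbhs R))%E ->
  exists (c : R) n t1, [/\ 0 < c, 1 <= t1 & forall t, t1 <= t -> c / t ^+ n <= h t ^+ 2 / t ^+ 8].
Proof.
rewrite limf_einfE => /ereal_sup_gt[_ [V [t1 [_ hV]] <-] Vpos].
have [c c0 hc] : exists2 c : R, 0 < c & forall t, V t -> c <= t `^ g * `|h t|.
  move: Vpos; case: (ereal_inf _) (@ereal_inf_lbound R [set (t `^ g * `|h t|)%:E | t in V]) => [r| |] lb //.
    by rewrite lte_fin => r0; exists r => // t Vt; rewrite -lee_fin; apply: lb; exists t.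
  move=> _; exists 1 => // t Vt; have : (+oo <= (t `^ g * `|h t|)%:E)%E by apply: lb; exists t.
  by rewrite leye_eq.
have [n gn] : exists n : nat, g <= n%:R.
  exists (Num.Def.trunc `|g|).+1; apply: le_trans (ler_norm g) _; apply/ltW.
  by have /andP[] := truncn_itv (normr_ge0 g).
exists (c ^+ 2), (n * 2 + 8)%N, (`|t1| + 1); split; [pos|by rewrite lerDr|].
move=> t tt.
have n0 := normr_ge0 t1; have t1n := ler_norm t1.
have t1t : t1 < t by lra.
have tl1 : 1 <= t by lra.
have t0 : 0 < t by lra.
have h1 : c <= t ^+ n * `|h t|.
  apply: le_trans (hc t (hV t t1t)) _; apply: ler_wpM2r => //.
  by rewrite -(powR_mulrn n (ltW t0)); apply: ler_powR.
have h2 : c ^+ 2 <= t ^+ (n * 2) * h t ^+ 2.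
  have -> : t ^+ (n * 2) * h t ^+ 2 = (t ^+ n * `|h t|) ^+ 2 by rewrite exprMn real_normK ?num_real// exprM.
  by apply: lerXn2r => //; rewrite nnegrE; pos.
rewrite exprD invfM mulrA; apply: ler_wpM2r; first by pos.
by rewrite ler_pdivrMr ?exprn_gt0// mulrC.
Qed.

(** The error is e^{-2st} times C e^{-(T - 2s)t}, which beats any power of t and so takes at most
    half of the main term. *)
Lemma lower_exp J h s T C cq c n t1 t2 : 0 < cq -> 0 < c -> 1 <= t1 -> 1 <= t2 -> 0 <= C -> 2 * s < T ->
  (forall t, t1 <= t -> c / t ^+ n <= h t ^+ 2 / t ^+ 8) ->
  (forall t, t2 <= t -> cq * h t ^+ 2 / t ^+ 8 * expR (- s * t) ^+ 2 - C * expR (- t * T) <= J t) ->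
  exists c' t3, [/\ 0 < c', 1 <= t3 & forall t, t3 <= t -> c' / t ^+ n * expR (- s * t) ^+ 2 <= J t].
Proof.
move=> cq0 c0 t11 t21 C0 sT hh hJ.
have d0 : 0 < T - 2 * s by rewrite subr_gt0.
have b0 : 0 < cq * c / 2 / (C + 1) by pos.
have [t4 t41 h4] := poly_exp_small n d0 b0.
exists (cq * c / 2), (t1 + t2 + t4); split; [pos|lra|].
move=> t tt; apply: le_trans (hJ t ltac:(lra)).
have {}hh := hh t ltac:(lra); have {}h4 := h4 t ltac:(lra).
have t0 : 0 < t by lra.
have tn0 : 0 < t ^+ n by exact: exprn_gt0.
have E : expR (- t * T) = expR (- s * t) ^+ 2 * expR (- (T - 2 * s) * t).
  by rewrite expr2 -!expRD; congr expR; ring.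
rewrite E; have x0 : 0 <= expR (- s * t) ^+ 2 by exact: sqr_ge0.
move: (expR (- s * t) ^+ 2) (expR (- (T - 2 * s) * t)) h4 (expR_ge0 (- (T - 2 * s) * t)) x0 => x y h4 y0 x0.
have q1 : cq * (c / t ^+ n) <= cq * (h t ^+ 2 / t ^+ 8) by apply: ler_wpM2l => //; exact: ltW.
have q2 : C * y <= cq * c / 2 / t ^+ n.
  rewrite ler_pdivlMr//; apply: (@le_trans _ _ ((C + 1) * (t ^+ n * y))).
    rewrite -mulrA (mulrC y); apply: ler_wpM2r; [pos|lra].
  apply: le_trans (ler_wpM2l _ h4) _; first by lra.
  by rewrite mulrCA mulfV ?mulr1// gt_eqF//; lra.
have q3 : cq * c / 2 / t ^+ n <= cq * (h t ^+ 2 / t ^+ 8) - C * y.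
  apply: le_trans (lerB q1 q2); rewrite le_eqVlt; apply/orP; left; apply/eqP; field.
  by rewrite expf_neq0// gt_eqF.
have := ler_wpM2r x0 q3.
have -> : cq * h t ^+ 2 / t ^+ 8 = cq * (h t ^+ 2 / t ^+ 8) by rewrite -mulrA.
by rewrite mulrBl (mulrC x y) -(mulrA C).
Qed.

Lemma blowup J s T c n t1 : 0 < c -> 1 <= t1 -> 2 * s < T ->
  (forall t, t1 <= t -> c / t ^+ n * expR (- s * t) ^+ 2 <= J t) ->
  (fun t => expR (t * T) * J t) @ +oo --> +oo.
Proof.
move=> c0 t11 sT hJ; apply/cvgryPge => A.
have d0 : 0 < T - 2 * s by rewrite subr_gt0.
have A0 : 0 < `|A| + 1 by rewrite ltr_wpDl.
have b0 : 0 < c / (`|A| + 1) by pos.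
have [t2 t21 h2] := poly_exp_small n d0 b0.
apply: (@near_pinfty (t1 + t2)) => t tt.
have {}h2 := h2 t ltac:(lra); have t0 : 0 < t by lra.
apply: le_trans (ler_wpM2l (expR_ge0 _) (hJ t ltac:(lra))).
have -> : expR (t * T) * (c / t ^+ n * expR (- s * t) ^+ 2) = c / (t ^+ n * expR (- (T - 2 * s) * t)).
  have -> : expR (- (T - 2 * s) * t) = (expR (t * T) * expR (- s * t) ^+ 2)^-1.
    by rewrite expr2 -!expRD -expRN; congr expR; ring.
  by field; rewrite !expf_neq0 ?gt_eqF ?expR_gt0.
apply: (@le_trans _ _ (`|A| + 1)); first by rewrite (le_trans (ler_norm A))// lerDl.
rewrite ler_pdivlMr; last by rewrite mulr_gt0 ?expR_gt0// exprn_gt0.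
apply: le_trans (ler_wpM2l (ltW A0) h2) _; by rewrite mulrCA mulfV ?mulr1// gt_eqF.
Qed.

(** For every e > 0, powers of t are absorbed by e^{et}, so |I| lies between e^{-(2s + e)t} and
    e^{-(2s - e)t} for large t. In particular I is nonzero and the logarithm is meaningful. *)
Lemma log_asymptotics I J s T C c n t1 : 0 < s -> 2 * s < T -> 0 <= C -> 0 < c -> 1 <= t1 ->
  (forall t, 1 <= t -> `|I t| <= C * (t * (expR (- s * t) * (expR (- s * t) + expR (- t * T))) + expR (- t * T) / t ^+ 2)) ->
  (forall t, J t <= `|I t|) ->
  (forall t, t1 <= t -> c / t ^+ n * expR (- s * t) ^+ 2 <= J t) ->
  (fun t => t^-1 * ln `|I t|) @ +oo --> - (2 * s).
Proof.
move=> s0 sT C0 c0 t11 hI JI hJ; apply/cvgrPdist_le => e e0.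
have b0 : 0 < (3 * (C + 1))^-1 by pos.
have [t2 t21 h2] := poly_exp_small 1 e0 b0.
have [t3 t31 h3] := poly_exp_small n e0 c0.
apply: (@near_pinfty (t1 + t2 + t3)) => t tt.
have {}h2 := h2 t ltac:(lra); have {}h3 := h3 t ltac:(lra).
have {}hJ := le_trans (hJ t ltac:(lra)) (JI t); have {}hI := hI t ltac:(lra).
have t0 : 0 < t by lra.
have tl1 : 1 <= t by lra.
have tn0 : 0 < t ^+ n by exact: exprn_gt0.
pose x := expR (- s * t) ^+ 2; have x0 : 0 < x by rewrite exprn_gt0// expR_gt0.
have xE : x = expR (- (2 * s) * t) by rewrite /x expr2 -expRD; congr expR; ring.
have lo : expR (- (2 * s + e) * t) <= `|I t|.
  apply: le_trans hJ; rewrite -/x.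
  have -> : expR (- (2 * s + e) * t) = expR (- e * t) * x by rewrite xE -expRD; congr expR; ring.
  by apply: ler_wpM2r; [exact: ltW|rewrite ler_pdivlMr// mulrC].
have up : `|I t| <= expR (- (2 * s - e) * t).
  apply: le_trans hI _.
  have y1 : expR (- t * T) <= x by rewrite xE ler_expR !mulNr lerN2 mulrC; apply: ler_wpM2l; exact: ltW.
  have y2 : expR (- s * t) * (expR (- s * t) + expR (- t * T)) <= 2 * x.
    have z1 : expR (- s * t) <= 1 by rewrite -expR0 ler_expR mulNr oppr_le0; pos.
    have := ler_pM (expR_ge0 _) (expR_ge0 _) z1 y1; rewrite mul1r mulrDr -expr2 -/x; lra.
  have y3 : expR (- t * T) / t ^+ 2 <= t * x.
    apply: (@le_trans _ _ x); last by rewrite ler_peMl// ltW.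
    by rewrite ler_pdivrMr ?exprn_gt0//; apply: le_trans y1 _; rewrite ler_peMr ?(ltW x0)// exprn_ege1.
  have -> : expR (- (2 * s - e) * t) = x / expR (- e * t).
    by rewrite xE -expRN -expRD; congr expR; ring.
  rewrite ler_pdivlMr ?expR_gt0//.
  have y4 : t * (expR (- s * t) * (expR (- s * t) + expR (- t * T))) + expR (- t * T) / t ^+ 2 <= 3 * (t * x).
    have := ler_wpM2l (ltW t0) y2; move: y3; lra.
  apply: (@le_trans _ _ (C * (3 * (t * x)) * expR (- e * t))).
    by apply: ler_wpM2r; [exact: expR_ge0|exact: ler_wpM2l].
  have -> : C * (3 * (t * x)) * expR (- e * t) = 3 * C * (t ^+ 1 * expR (- e * t)) * x by ring.
  rewrite ler_piMl ?(ltW x0)//.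
  have C3 : 0 <= 3 * C by pos.
  apply: le_trans (ler_wpM2l C3 h2) _.
  by rewrite ler_pdivrMr; lra.
have I0 : 0 < `|I t| by exact: lt_le_trans (expR_gt0 _) lo.
move: lo up; rewrite -{1 2}(lnK I0) !ler_expR => lo up.
rewrite ler_norml; move: (ln `|I t|) lo up => l lo up.
have lE : l = t * (t^-1 * l) by rewrite mulrA mulfV ?mul1r// gt_eqF.
move: (t^-1 * l) lE => w lE; rewrite lE !(mulrC _ t) !(ler_pM2l t0) in lo up.
by apply/andP; split; lra.
Qed.

End asymptotics.

(** * Coefficients bounded everywhere, and the theorem *)

Section modification.
Context {R : realType}.
Notation rV3 := 'rV[R]_3.
Notation leb3 := (@leb3 R).

Lemma ess_sup_bound (g : rV3 -> R) : (ess_sup leb3 (fun x => (g x)%:E) < +oo)%E ->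
  exists M : R, {ae leb3, forall x, g x <= M}.
Proof.
have := ess_sup_ge leb3 (fun x => (g x)%:E).
case: (ess_sup _ _) => [M| |]// h _; first by exists M; apply: filterS h => x; rewrite lee_fin.
by exists 0; apply: filterS h => x; rewrite leeNy_eq.
Qed.

Lemma ess_inf_bound (g : rV3 -> R) : (0 < ess_inf leb3 (fun x => (g x)%:E))%E ->
  exists2 e : R, 0 < e & {ae leb3, forall x, e <= g x}.
Proof.
have := ess_inf_le leb3 (fun x => (g x)%:E).
case: (ess_inf _ _) => [e| |]// h e0; first by exists e; [rewrite lte_fin in e0|apply: filterS h => x; rewrite lee_fin].
by exists 1 => //; apply: filterS h => x; rewrite leye_eq.
Qed.

(** The coefficients are reset to their background values on one null set outside of which all the
    almost-everywhere bounds hold. The estimates can then use bounds valid at every point, and the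
    field equations, stated almost everywhere, are unchanged. *)
Lemma nice_coefficients (eps0 mu0 sigma0 : R) (eps mu sigma : rV3 -> R) (D : set rV3) :
  0 < eps0 -> 0 < mu0 -> 0 <= sigma0 ->
  measurable_fun setT eps -> measurable_fun setT mu -> measurable_fun setT sigma ->
  (ess_sup leb3 (fun x => `|eps x|%:E) < +oo)%E ->
  (ess_sup leb3 (fun x => `|mu x|%:E) < +oo)%E ->
  (ess_sup leb3 (fun x => `|sigma x|%:E) < +oo)%E ->
  (0 < ess_inf leb3 (fun x => (eps x)%:E))%E ->
  (0 < ess_inf leb3 (fun x => (mu x)%:E))%E ->
  {ae leb3, forall x, 0 <= sigma x} ->
  {ae leb3, forall x, ~ D x -> [/\ eps x = eps0, mu x = mu0 & sigma x = sigma0]} ->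
  exists (eps' mu' sigma' : rV3 -> R) (e M : R),
  [/\ [/\ measurable_fun setT eps', measurable_fun setT mu', measurable_fun setT sigma' & 0 < e],
      [/\ forall x, e <= eps' x <= M, forall x, e <= mu' x <= M, forall x, 0 <= sigma' x <= M &
          forall x, ~ D x -> [/\ eps' x = eps0, mu' x = mu0 & sigma' x = sigma0]],
      [/\ eps0 <= M, mu0 <= M & sigma0 <= M] &
      {ae leb3, forall x, [/\ eps' x = eps x, mu' x = mu x & sigma' x = sigma x]}].
Proof.
move=> eps00 mu00 sigma00 meps mmu msigma /ess_sup_bound[M1 h1] /ess_sup_bound[M2 h2] /ess_sup_bound[M3 h3]
  /ess_inf_bound[e1 e10 l1] /ess_inf_bound[e2 e20 l2] l3 bg.
have := filterI (filterI (filterI h1 h2) (filterI h3 l1)) (filterI (filterI l2 l3) bg).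
move=> [N [mN N0 sub]].
pose w c (h : rV3 -> R) (x : rV3) := \1_N x * c + (1 - \1_N x) * h x.
have mw c h : measurable_fun setT h -> measurable_fun setT (w c h).
  move=> mh; have m1 : measurable_fun setT (fun x : rV3 => \1_N x : R) by exact: measurable_indic.
  by apply: measurable_funD; apply: measurable_funM => //; exact: measurable_funB.
have wE c h x : w c h x = if x \in N then c else h x.
  by rewrite /w indicE; case: (x \in N); rewrite ?mul1r ?subrr ?mul0r ?addr0// subr0 mul1r add0r.
pose M := `|M1| + `|M2| + `|M3| + eps0 + mu0 + sigma0.
pose e := Num.min (Num.min e1 e2) (Num.min eps0 mu0).
have [n1 n2 n3] : [/\ M1 <= `|M1|, M2 <= `|M2| & M3 <= `|M3|] by split; exact: ler_norm.
have [p1 p2 p3] : [/\ 0 <= `|M1|, 0 <= `|M2| & 0 <= `|M3|] by split; exact: normr_ge0.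
have [b1 b2 b3] : [/\ eps0 <= M, mu0 <= M & sigma0 <= M] by rewrite /M; split; lra.
have [b4 b5 b6] : [/\ M1 <= M, M2 <= M & M3 <= M] by rewrite /M; split; lra.
have good x : x \notin N -> [/\ eps x <= M /\ e1 <= eps x, mu x <= M /\ e2 <= mu x, 0 <= sigma x /\ sigma x <= M &
    ~ D x -> [/\ eps x = eps0, mu x = mu0 & sigma x = sigma0]].
  move=> xN; have : ~ (~` [set x | ((`|eps x| <= M1 /\ `|mu x| <= M2) /\ `|sigma x| <= M3 /\ e1 <= eps x) /\
     (e2 <= mu x /\ 0 <= sigma x) /\ (~ D x -> [/\ eps x = eps0, mu x = mu0 & sigma x = sigma0])]) x.
    by move=> h; move: xN; rewrite notin_setE; apply; exact: sub.
  move=> /contrapT[[[q1 q2] [q3 q4]] [[q5 q6] q7]].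
  by split => //; split => //; apply: le_trans (ler_norm _) _; [apply: le_trans b4|apply: le_trans b5|apply: le_trans b6].
exists (w eps0 eps), (w mu0 mu), (w sigma0 sigma), e, M; split.
- by split; [exact: mw|exact: mw|exact: mw|rewrite !lt_min e10 e20 eps00 mu00].
- split => x; rewrite ?wE; case: (boolP (x \in N)) => xN.
  + by rewrite b1 !ge_min lexx !orbT.
  + by have [[-> q] _ _ _] := good x xN; rewrite !ge_min q.
  + by rewrite b2 !ge_min lexx !orbT.
  + by have [_ [-> q] _ _] := good x xN; rewrite !ge_min q !orbT.
  + by rewrite sigma00.
  + by have [_ _ [-> ->] _] := good x xN.
  + by [].
  + by have [_ _ _] := good x xN.
- by split.
- exists N; split => // x; apply: contra_notP => xN /=; rewrite !wE.
  by rewrite (negbTE (_ : x \notin N))// notin_setE.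
Qed.

Lemma maxwell_solution_ae T (eps mu sigma eps' mu' sigma' : rV3 -> R) J E H :
  {ae leb3, forall x, [/\ eps' x = eps x, mu' x = mu x & sigma' x = sigma x]} ->
  maxwell_solution T eps mu sigma J E H -> maxwell_solution T eps' mu' sigma' J E H.
Proof.
move=> hN [jE [jH [E' [H' [cE [cH [hE hH hcE hcH [e1 e2 E0 H0]]]]]]]].
split => //; split => //; exists E', H', cE, cH; split => //; split => // t tT.
- by apply: filterS2 hN (e1 t tT) => x [-> _ ->].
- by apply: filterS2 hN (e2 t tT) => x [_ -> _].
Qed.

End modification.

(** * From the pairings to the indicator function *)

Section indicator.
Context {R : realType}.
Notation rV3 := 'rV[R]_3.
Notation leb3 := (@leb3 R).
Variables (eps0 mu0 sigma0 T : R) (f : R -> R) (p a : rV3) (eta : R) (D : set rV3).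
Hypotheses (eps00 : 0 < eps0) (mu00 : 0 < mu0) (sigma00 : 0 <= sigma0) (T0 : 0 < T)
  (cf : {within `[0, T]%classic, continuous f}) (eta0 : 0 < eta) (mD : measurable D).
Variables (E0 H0 : R -> rV3 -> rV3).
Hypothesis sol0 : maxwell_solution T (fun=> eps0) (fun=> mu0) (fun=> sigma0) (source f (eball p eta) a) E0 H0.

(** With no obstacle there is no contrast term, and the gap between the transform of E0 and the
    explicit field comes from the boundary terms at t = T alone. *)
Lemma background_pairing : exists2 C, 0 <= C & forall tau, 1 <= tau ->
  `|pairing eps0 mu0 sigma0 T f p a eta E0 tau| <= C * (expR (- tau * T) / tau ^+ 2).
Proof.
pose M := eps0 + mu0 + sigma0; pose e := Num.min eps0 mu0.
have e0 : 0 < e by rewrite lt_min eps00.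
have b1 : eps0 <= M by rewrite /M -addrA lerDl addr_ge0// ltW.
have b2 : mu0 <= M by rewrite /M addrAC lerDr addr_ge0// ltW.
have b3 : sigma0 <= M by rewrite /M lerDr addr_ge0// ltW.
have h0 tau : 1 <= tau -> nrm (onD set0 (incV eps0 mu0 sigma0 T f p a eta tau)) <= 0 /\
    nrm (onD set0 (incH eps0 mu0 sigma0 T f p a eta tau)) <= 0.
  move=> _; have z u : nrm (onD (@set0 rV3) u) <= 0.
    rewrite /nrm /ip; have -> : (fun x => dotv (onD (@set0 rV3) u x) (onD set0 u x)) = cst 0.
      by apply/funext => x; rewrite /onD indicE in_set0 dotvZl mul0r.
    by rewrite Rintegral_cst// mul0r sqrtr0.
  by split.
have ce (x : rV3) : e <= eps0 <= M /\ e <= mu0 <= M /\ 0 <= sigma0 <= M by rewrite !ge_min !lexx b1 b2 b3 sigma00 !orbT.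
have [C C0 hC] := pairing_bound eps00 mu00 sigma00 T0 cf eta0 measurable0
   (measurable_cst eps0) (measurable_cst mu0) (measurable_cst sigma0) e0 (fun x => (ce x).1) (fun x => (ce x).2.1)
   (fun x => (ce x).2.2) b1 b2 b3 (fun _ _ => And3 erefl erefl erefl) sol0 h0.
exists C => // tau t1; have [_ h] := hC tau t1.
by move: h; rewrite mul0r mulr0 add0r.
Qed.

Variables (eps mu sigma : rV3 -> R) (e M : R).
Hypotheses (meps : measurable_fun setT eps) (mmu : measurable_fun setT mu) (msigma : measurable_fun setT sigma)
  (e0 : 0 < e) (beps : forall x, e <= eps x <= M) (bmu : forall x, e <= mu x <= M)
  (bsigma : forall x, 0 <= sigma x <= M)
  (eps0M : eps0 <= M) (mu0M : mu0 <= M) (sigma0M : sigma0 <= M)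
  (offD : forall x, ~ D x -> [/\ eps x = eps0, mu x = mu0 & sigma x = sigma0]).
Variables (E H : R -> rV3 -> rV3).
Hypothesis sol : maxwell_solution T eps mu sigma (source f (eball p eta) a) E H.

Notation I := (indicator_fun T f (eball p eta) a E E0).

Lemma indicator_pairing tau : I tau =
  pairing eps0 mu0 sigma0 T f p a eta E tau - pairing eps0 mu0 sigma0 T f p a eta E0 tau.
Proof.
have nb (h : rV3 -> R) x : e <= h x <= M -> `|h x| <= M.
  by move=> /andP[h1 h2]; rewrite ger0_norm// (le_trans (ltW e0)).
have ns x : `|sigma x| <= M by have /andP[h1 h2] := bsigma x; rewrite ger0_norm.
have [[LE _ _] _ _ _] := laplace_maxwell T0 cf meps mmu msigma (fun x => nb _ x (beps x)) (fun x => nb _ x (bmu x)) ns eta0 sol tau.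
have c0 (x : R) : 0 <= x -> x <= M -> rV3 -> `|x| <= M by move=> x0 xM _; rewrite ger0_norm.
have [[LE0 _ _] _ _ _] := laplace_maxwell T0 cf (measurable_cst eps0) (measurable_cst mu0) (measurable_cst sigma0)
  (c0 _ (ltW eps00) eps0M) (c0 _ (ltW mu00) mu0M) (c0 _ sigma00 sigma0M) eta0 sol0 tau.
rewrite -[LHS]/(ip (sourceF T f p a eta tau) _) ipBr//; last exact: L2field_sourceF.
by rewrite /pairing opprB addrA subrK.
Qed.

Variables (d Rm : R) (q : rV3).
Hypotheses (a1 : enorm a = 1) (etad : eta < d) (dD : forall x, D x -> d <= rad p x) (DR : forall x, D x -> rad p x <= Rm)
  (qd : rad p q = d) (bq : bdry D q).

Let s := Num.sqrt (mu0 * eps0) * (d - eta).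
Let s0 : 0 < s. Proof. by rewrite /s mulr_gt0 ?subr_gt0// sqrtr_gt0 mulr_gt0. Qed.

Lemma indicator_bound : exists2 C, 0 <= C & forall t, 1 <= t ->
  `|I t| <= C * (t * (expR (- s * t) * (expR (- s * t) + expR (- t * T))) + expR (- t * T) / t ^+ 2).
Proof.
have [C C0 hC] := pairing_upper eps00 mu00 sigma00 T0 cf eta0 mD meps mmu msigma e0 beps bmu bsigma eps0M mu0M sigma0M
  offD sol a1 etad dD DR.
have [C' C'0 hC'] := background_pairing.
exists (C + C'); first by rewrite addr_ge0.
move=> t t1; have [_ h] := hC t t1; have h' := hC' t t1.
rewrite indicator_pairing; apply: le_trans (ler_normB _ _) _.
rewrite mulrDl; apply: lerD => //; apply: le_trans h' _; apply: ler_wpM2l => //.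
by rewrite lerDr; apply: mulr_ge0; [exact: le_trans t1|apply: mulr_ge0; rewrite ?addr_ge0 ?expR_ge0].
Qed.

Let lower (J : R -> R) : (exists cq tq C, [/\ 0 < cq, 1 <= tq, 0 <= C & forall tau, tq <= tau ->
    cq * laplace T f tau ^+ 2 / tau ^+ 8 * decay eps0 mu0 eta d tau ^+ 2 - C * expR (- tau * T) <= J tau]) ->
  exists cq tq C, [/\ 0 < cq, 1 <= tq, 0 <= C & forall t, tq <= t ->
    cq * laplace T f t ^+ 2 / t ^+ 8 * expR (- s * t) ^+ 2 - C * expR (- t * T) <=
    J t - `|pairing eps0 mu0 sigma0 T f p a eta E0 t|].
Proof.
move=> [cq [tq [C [cq0 tq1 C0 h]]]].
have [C' C'0 hC'] := background_pairing.
exists cq, tq, (C + C'); split => //; first by rewrite addr_ge0.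
move=> t tt; have t1 := le_trans tq1 tt; rewrite mulrDl opprD addrA; apply: lerB; first exact: h.
apply: le_trans (hC' t t1) _; apply: ler_wpM2l => //.
by rewrite ler_pdivrMr ?exprn_gt0 ?(lt_le_trans ltr01)// ler_peMr ?expR_ge0// exprn_ege1.
Qed.

Lemma indicator_lowerII : C2_boundary D -> jumpII eps0 mu0 eps mu D ->
  exists cq tq C, [/\ 0 < cq, 1 <= tq, 0 <= C & forall t, tq <= t ->
    cq * laplace T f t ^+ 2 / t ^+ 8 * expR (- s * t) ^+ 2 - C * expR (- t * T) <= I t].
Proof.
move=> C2 jump.
have [cq [tq [C [cq0 tq1 C0 h]]]] := lower (pairing_lowerII eps00 mu00 sigma00 T0 cf eta0 mD meps mmu msigma e0 beps bmu bsigma eps0M mu0M sigma0M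
  offD sol a1 etad dD DR qd bq C2 jump).
exists cq, tq, C; split => // t tt; apply: le_trans (h t tt) _.
by rewrite indicator_pairing lerD2l lerN2 ler_norm.
Qed.

Lemma indicator_lowerI : C2_boundary D -> jumpI eps0 mu0 eps mu D ->
  exists cq tq C, [/\ 0 < cq, 1 <= tq, 0 <= C & forall t, tq <= t ->
    cq * laplace T f t ^+ 2 / t ^+ 8 * expR (- s * t) ^+ 2 - C * expR (- t * T) <= - I t].
Proof.
move=> C2 jump.
have [cq [tq [C [cq0 tq1 C0 h]]]] := lower (pairing_lowerI eps00 mu00 sigma00 T0 cf eta0 mD meps mmu msigma e0 beps bmu bsigma eps0M mu0M sigma0M
  offD sol a1 etad dD DR qd bq C2 jump).
exists cq, tq, C; split => // t tt; apply: le_trans (h t tt) _.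
rewrite indicator_pairing; move: (pairing _ _ _ _ _ _ _ _ E t) (pairing _ _ _ _ _ _ _ _ E0 t) => x y.
by rewrite opprB [leRHS]addrC lerD2l lerNl -normrN ler_norm.
Qed.

End indicator.

Theorem theorem1p2 (R : realType)
  (eps0 mu0 sigma0 : R) (eps mu sigma : 'rV[R]_3 -> R) (D : set 'rV[R]_3)
  (p a : 'rV[R]_3) (eta T : R) (f : R -> R)
  (E H E0 H0 : R -> 'rV[R]_3 -> 'rV[R]_3)
  (eps0_gt0 : 0 < eps0) (mu0_gt0 : 0 < mu0) (sigma0_ge0 : 0 <= sigma0)
  (eps_meas : measurable_fun setT eps)
  (mu_meas : measurable_fun setT mu)
  (sigma_meas : measurable_fun setT sigma)
  (eps_bnd : (ess_sup leb3 (fun x => `|eps x|%:E) < +oo)%E)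
  (mu_bnd : (ess_sup leb3 (fun x => `|mu x|%:E) < +oo)%E)
  (sigma_bnd : (ess_sup leb3 (fun x => `|sigma x|%:E) < +oo)%E)
  (eps_pos : (0 < ess_inf leb3 (fun x => (eps x)%:E))%E)
  (mu_pos : (0 < ess_inf leb3 (fun x => (mu x)%:E))%E)
  (sigma_ge0 : {ae leb3, forall x, 0 <= sigma x})
  (D_neq0 : D !=set0) (D_bnd : bounded_set D) (D_open : open D)
  (DC_conn : connected (~` closure D))
  (background : {ae leb3, forall x, ~ D x ->
     [/\ eps x = eps0, mu x = mu0 & sigma x = sigma0]})
  (eta_gt0 : 0 < eta)
  (BD_disj : closure (eball p eta) `&` closure D = set0)
  (a_unit : enorm a = 1)
  (T_gt0 : 0 < T)
  (f_H1 : H1_interval T f) (f_0 : f 0 = 0)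
  (EH_sol : maxwell_solution T eps mu sigma (source f (eball p eta) a) E H)
  (EH0_sol : maxwell_solution T (fun=> eps0) (fun=> mu0) (fun=> sigma0)
     (source f (eball p eta) a) E0 H0) :
  let B := eball p eta in
  let I := indicator_fun T f B a E E0 in
  let T0 := 2 * Num.sqrt (mu0 * eps0) * setdist D B in
  (T < T0 -> (fun tau => expR (tau * T) * I tau) @ +oo --> (0 : R))
  /\
  ((exists gamma : R, (0 < limf_einf
      (fun tau : R => (tau `^ gamma * `|laplace T f tau|)%:E) (pinfty_nbhs R))%E) ->
   C2_boundary D ->
   geomI p D \/ geomII p D \/ geomIII p a D ->
   [/\ T0 < T -> jumpI eps0 mu0 eps mu D ->
         (fun tau => expR (tau * T) * I tau) @ +oo --> -oo,
       T0 < T -> jumpII eps0 mu0 eps mu D ->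
         (fun tau => expR (tau * T) * I tau) @ +oo --> +oo &
       jumpI eps0 mu0 eps mu D \/ jumpII eps0 mu0 eps mu D ->
         T0 < T ->
         (fun tau => tau^-1 * ln `|I tau|) @ +oo --> - T0]).
Proof.
have cf : {within `[0, T]%classic, continuous f} by case: f_H1.
have [q [d [Rm [[etad qd bq dD DR] distE]]]] := nearest_point D_neq0 D_bnd eta_gt0 BD_disj.
have mD : measurable D by exact: open_measurable_rV.
have [eps' [mu' [sigma' [e [M [[meps mmu msigma e0] [beps bmu bsigma offD] [eps0M mu0M sigma0M] hN]]]]]] :=
  nice_coefficients eps0_gt0 mu0_gt0 sigma0_ge0 eps_meas mu_meas sigma_meas eps_bnd mu_bnd sigma_bnd eps_pos mu_pos
    sigma_ge0 background.
have sol := maxwell_solution_ae hN EH_sol.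
move=> B I T0; pose s := Num.sqrt (mu0 * eps0) * (d - eta).
have T0E : T0 = 2 * s by rewrite /T0 distE /s mulrA.
have s0 : 0 < s by rewrite /s mulr_gt0 ?subr_gt0// sqrtr_gt0 mulr_gt0.
have [C C0 hC] := indicator_bound eps0_gt0 mu0_gt0 sigma0_ge0 T_gt0 cf eta_gt0 mD EH0_sol meps mmu msigma e0 beps bmu bsigma
  eps0M mu0M sigma0M offD sol a_unit etad dD DR.
split; first by rewrite T0E => TT0; exact: (indicator_cvg0 s0 T_gt0 TT0 C0 hC).
move=> [gamma /liminf_poly[c [n [t1 [c0 t11 hf]]]]] C2 _.
have lowI : T0 < T -> jumpI eps0 mu0 eps mu D -> exists c' t3, [/\ 0 < c', 1 <= t3 & forall t, t3 <= t ->
    c' / t ^+ n * expR (- s * t) ^+ 2 <= - I t].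
  rewrite T0E => TT0 [K K0 jump].
  have jump' : jumpI eps0 mu0 eps' mu' D.
    by exists K => //; apply: filterS2 hN jump => x [-> -> _].
  have [cq [tq [C' [cq0 tq1 C'0 hL]]]] := indicator_lowerI eps0_gt0 mu0_gt0 sigma0_ge0 T_gt0 cf eta_gt0 mD EH0_sol meps mmu msigma
    e0 beps bmu bsigma eps0M mu0M sigma0M offD sol a_unit etad dD DR qd bq C2 jump'.
  exact: (lower_exp (J := fun t => - I t) cq0 c0 t11 tq1 C'0 TT0 hf hL).
have lowII : T0 < T -> jumpII eps0 mu0 eps mu D -> exists c' t3, [/\ 0 < c', 1 <= t3 & forall t, t3 <= t ->
    c' / t ^+ n * expR (- s * t) ^+ 2 <= I t].
  rewrite T0E => TT0 [K K0 jump].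
  have jump' : jumpII eps0 mu0 eps' mu' D.
    by exists K => //; apply: filterS2 hN jump => x [-> -> _].
  have [cq [tq [C' [cq0 tq1 C'0 hL]]]] := indicator_lowerII eps0_gt0 mu0_gt0 sigma0_ge0 T_gt0 cf eta_gt0 mD EH0_sol meps mmu msigma
    e0 beps bmu bsigma eps0M mu0M sigma0M offD sol a_unit etad dD DR qd bq C2 jump'.
  exact: (lower_exp (J := I) cq0 c0 t11 tq1 C'0 TT0 hf hL).
split.
- move=> TT0 /(lowI TT0)[c' [t3 [c'0 t31 h]]]; rewrite T0E in TT0.
  have := blowup c'0 t31 TT0 h => /cvgryPge hy; apply/cvgrNyPle => A.
  by apply: filterS (hy (- A)) => t; rewrite mulrN lerN2.
- move=> TT0 /(lowII TT0)[c' [t3 [c'0 t31 h]]]; rewrite T0E in TT0; exact: (blowup c'0 t31 TT0 h).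
- move=> jump TT0.
  have [c' [t3 [c'0 t31 h]]] : exists c' t3, [/\ 0 < c', 1 <= t3 & forall t, t3 <= t ->
      c' / t ^+ n * expR (- s * t) ^+ 2 <= `|I t|].
    case: jump => [/(lowI TT0)|/(lowII TT0)] [c' [t3 [c'0 t31 h]]]; exists c', t3; split => // t tt;
      apply: le_trans (h t tt) _; rewrite ?ler_norm// -normrN; exact: ler_norm.
  rewrite T0E in TT0 *; exact: (log_asymptotics s0 TT0 C0 c'0 t31 hC (fun t => lexx _) h).
Qed.
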